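(* Let $s>0$ and let $(z,y)\in\mathbb{R}_{+}\times\mathbb{R}$ be an initial position. There exists a hedge $(\hat\pi,\hat\sigma)\in \mathcal A(T,s,z,y)$ (not necessarily unique) such that $$\mathcal R(T,s,\hat\pi,\hat\sigma)=R(T,s,z,y).$$
   Context: Fix a complete probability space $(\Omega,\mathcal F,\mathbb P)$ carrying a standard one-dimensional Brownian motion $W$, with filtration $\mathcal F_t=\sigma\{W_u:u\le t\}$ completed by null sets. Constants: $T>0$, volatility $\kappa>0$, drift $\vartheta\in\mathbb R$. For $s>0$ the stock price is $S^{(s)}_t=s\exp(\kappa W_t+(\vartheta-\kappa^2/2)t)$; the savings account is $\equiv 1$. Transaction cost constants $\delta>0$, $0<\mu<1$: buying or selling $\beta$ shares at price $S$ costs $g(\beta,S)=\max(\delta,\mu|\beta|S)$ if $\beta\neq 0$ and $g(0,S)=0$. $C[0,T]$ is the space of continuous functions on $[0,T]$ with sup norm $\|\cdot\|$. $F,G:C[0,T]\to C[0,T]$ are continuous and non-anticipative (if $x|_{[0,t]}=y|_{[0,t]}$ then $F(x)|_{[0,t]}=F(y)|_{[0,t]}$ and $G(x)|_{[0,t]}=G(y)|_{[0,t]}$), $F\le G$, and there are $C,p>0$ with $\|F(x)\|+\|G(x)\|\le C(1+\|x\|^p)$. The game option payoffs are $Y^{(s)}_t=F(S^{(s)})(t)\le X^{(s)}_t=G(S^{(s)})(t)$. A trading strategy with initial position $(z,y)\in\mathbb R_+\times\mathbb R$ is a triple $\pi=(z,y,\gamma)$ where $\gamma=(\gamma_t)_{t\in[0,T]}$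 is an adapted, left-continuous, pure-jump process with a.s. finitely many jumps and $\gamma_0=y$. Its value is $V^{\pi}_t=z+\int_{0}^t \gamma_u\, dS^{(s)}_u+g(y,s)-g(\gamma_t,S^{(s)}_t)-\sum_{u\in [0,t)}g(\gamma_{u+}-\gamma_u, S^{(s)}_u)$. $\pi$ is admissible if $V^\pi_t\ge 0$ for all $t$. A hedge is a pair $(\pi,\sigma)$ with $\pi$ admissible and $\sigma\le T$ a stopping time; $\mathcal A(T,s,z,y)$ denotes the set of hedges with initial position $(z,y)$, and $\mathcal T_T$ the set of stopping times $\le T$. The shortfall risk of a hedge is $\mathcal R(T,s,\pi,\sigma)=\sup_{\tau\in\mathcal T_T}\mathbb E_{\mathbb P}\big(X^{(s)}_\sigma\mathbb I_{\sigma<\tau}+Y^{(s)}_\tau\mathbb I_{\tau\le\sigma}-V^\pi_{\sigma\wedge\tau}\big)^+$, and $R(T,s,z,y)=\inf_{(\pi,\sigma)\in\mathcal A(T,s,z,y)}\mathcal R(T,s,\pi,\sigma)$. *)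

(* Defs.v *)
From HB Require Import structures.
From mathcomp Require Import all_boot all_order all_algebra.
From mathcomp Require Import all_classical all_reals all_analysis.

Set Implicit Arguments.
Unset Strict Implicit.
Unset Printing Implicit Defensive.

Import Order.TTheory GRing.Theory Num.Theory.
Import numFieldNormedType.Exports.

Local Open Scope classical_set_scope.
Local Open Scope ring_scope.

Section GameOptionDefs.
Context {R : realType} {d : measure_display} {Omega : measurableType d}.

Definition standard_BM (P : probability Omega R) (W : R -> Omega -> R) : Prop :=
  (forall w, W 0 w = 0) /\
  (forall w, {within `[0, +oo[, continuous (fun t => W t w)}) /\
  (forall t, 0 <= t -> measurable_fun setT (W t)) /\
  (forall u t, 0 <= u -> u < t -> forall B : set R, measurable B ->
      P ((fun w => W t w - W u w) @^-1` B) = normal_prob 0 (Num.sqrt (t - u)) B) /\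
  (forall (n : nat) (tt : nat -> R), 0 <= tt 0%N ->
      (forall i, (i < n)%N -> tt i < tt i.+1) ->
      forall B : nat -> set R, (forall i, measurable (B i)) ->
      P (\bigcap_(i < n) ((fun w => W (tt i.+1) w - W (tt i) w) @^-1` B i)) =
      (\prod_(i < n) P ((fun w => (W (tt i.+1) w - W (tt i) w)%R) @^-1` B i))%E).

Definition sigmaW (W : R -> Omega -> R) (t : R) : set (set Omega) :=
  <<s [set A | exists u (B : set R),
        [/\ 0 <= u, u <= t, measurable B & A = W u @^-1` B]] >>.

(* F_t = sigma{ W_u : u <= t } completed by the P-null sets *)
Definition FW (P : probability Omega R) (W : R -> Omega -> R) (t : R)
    (A : set Omega) : Prop :=
  exists G N : set Omega, [/\ sigmaW W t G, measurable N, P N = 0%E &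
                             (A `\` G) `|` (G `\` A) `<=` N].

Definition adapted (P : probability Omega R) (W : R -> Omega -> R) (T : R)
    (X : R -> Omega -> R) : Prop :=
  forall t, 0 <= t -> t <= T ->
    forall B : set R, measurable B -> FW P W t (X t @^-1` B).

Definition stopping_time (P : probability Omega R) (W : R -> Omega -> R) (T : R)
    (tau : Omega -> R) : Prop :=
  (forall w, 0 <= tau w <= T) /\
  (forall t, 0 <= t -> t <= T -> FW P W t [set w | tau w <= t]).

End GameOptionDefs.

Section Market.
Context {R : realType}.

Definition stock {Omega : Type} (s kappa theta : R) (W : R -> Omega -> R)
    (t : R) (w : Omega) : R :=
  s * expR (kappa * W t w + (theta - kappa ^+ 2 / 2) * t).

Definition tcost (delta mu beta S : R) : R :=
  if beta == 0 then 0 else Num.max delta (mu * `|beta| * S).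

(* A left-continuous pure-jump path with finitely many jumps on [0,T]:
   data (n, tau, c) with 0 = tau_0 < tau_1 < ... < tau_n = T and
   f u = c_k for u in (tau_k, tau_{k+1}]  (f 0 is the initial value). *)
Definition step_data (T : R) (f : R -> R) (D : nat * (nat -> R) * (nat -> R)) : Prop :=
  let: (n, tau, c) := D in
  [/\ tau 0%N = 0, tau n = T,
      (forall k, (k < n)%N -> tau k < tau k.+1) &
      (forall k u, (k < n)%N -> tau k < u -> u <= tau k.+1 -> f u = c k)].

Definition step_path (T : R) (f : R -> R) : Prop := exists D, step_data T f D.

Definition step_integral (T : R) (f S : R -> R) (t : R) : R :=
  match pselect (step_path T f) with
  | left h => let: (n, tau, c) := proj1_sig (cid h) in
      \sum_(k < n) c k * (S (Num.min (tau k.+1) t) - S (Num.min (tau k) t))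
  | right _ => 0
  end.

(* sum_{u in [0,t)} g(f_{u+} - f_u, S_u) for a step path f
   (the jumps of f can only occur at the tau_k, k < n, where f_{u+} = c_k) *)
Definition step_costs (T delta mu : R) (f S : R -> R) (t : R) : R :=
  match pselect (step_path T f) with
  | left h => let: (n, tau, c) := proj1_sig (cid h) in
      \sum_(k < n | tau k < t) tcost delta mu (c k - f (tau k)) (S (tau k))
  | right _ => 0
  end.

Definition value (T delta mu s z y : R) (S : R -> R) (gam : R -> R) (t : R) : R :=
  z + step_integral T gam S t + tcost delta mu y s
    - tcost delta mu (gam t) (S t) - step_costs T delta mu gam S t.

Definition supnorm (T : R) (x : R -> R) : R := sup [set `|x u| | u in `[0, T]].

Definition Cspace (T : R) (x : R -> R) : Prop := {within `[0, T], continuous x}.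

Definition payoff_functional (T : R) (F : (R -> R) -> (R -> R)) : Prop :=
  (forall x, Cspace T x -> Cspace T (F x)) /\
  (forall x, Cspace T x -> forall e, 0 < e -> exists2 eta, 0 < eta &
     forall y, Cspace T y -> supnorm T (fun u => x u - y u) < eta ->
       supnorm T (fun u => F x u - F y u) < e) /\
  (forall t x y, 0 <= t -> t <= T -> Cspace T x -> Cspace T y ->
     (forall u, 0 <= u -> u <= t -> x u = y u) ->
     forall u, 0 <= u -> u <= t -> F x u = F y u).

Definition game_payoffs (T : R) (F G : (R -> R) -> (R -> R)) : Prop :=
  payoff_functional T F /\ payoff_functional T G /\
  (forall x, Cspace T x -> forall t, 0 <= t -> t <= T -> F x t <= G x t) /\
  (exists C p : R, [/\ 0 < C, 0 < p &
     forall x, Cspace T x ->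
       supnorm T (F x) + supnorm T (G x) <= C * (1 + supnorm T x `^ p)]).

End Market.

Section Hedging.
Context {R : realType} {d : measure_display} {Omega : measurableType d}.
Variables (P : probability Omega R) (W : R -> Omega -> R).
Variables (T kappa theta delta mu : R) (F G : (R -> R) -> (R -> R)).
Variables (s z y : R).

Let S (w : Omega) : R -> R := fun t => stock s kappa theta W t w.

Definition trading_strategy (gam : R -> Omega -> R) : Prop :=
  [/\ adapted P W T gam,
      (forall w, gam 0 w = y) &
      {ae P, forall w, step_path T (fun u => gam u w)}].

Definition V (gam : R -> Omega -> R) (t : R) (w : Omega) : R :=
  value T delta mu s z y (S w) (fun u => gam u w) t.

Definition admissible (gam : R -> Omega -> R) : Prop :=
  {ae P, forall w, forall t, 0 <= t -> t <= T -> 0 <= V gam t w}.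

Definition hedges : set ((R -> Omega -> R) * (Omega -> R)) :=
  [set h | [/\ trading_strategy h.1, admissible h.1 & stopping_time P W T h.2]].

Definition Ypay (t : R) (w : Omega) : R := F (S w) t.
Definition Xpay (t : R) (w : Omega) : R := G (S w) t.

Definition shortfall_given (h : (R -> Omega -> R) * (Omega -> R)) (tau : Omega -> R)
    : \bar R :=
  (\int[P]_w (Num.max ((if h.2 w < tau w then Xpay (h.2 w) w else Ypay (tau w) w)
                       - V h.1 (Num.min (h.2 w) (tau w)) w) 0)%:E)%E.

Definition shortfall_risk (h : (R -> Omega -> R) * (Omega -> R)) : \bar R :=
  ereal_sup [set shortfall_given h tau | tau in stopping_time P W T].

Definition min_risk : \bar R := ereal_inf [set shortfall_risk h | h in hedges].

End Hedging.

(* Main.v *)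
(* A strategy is described by its cash [K] and its shares [B]; every action costs at
   least [delta], and the liquidation value is an upper semicontinuous function of the
   state. The price is a martingale under an equivalent measure, so the liquidation value
   is a supermartingale there: wealth is bounded in probability and the number of actions
   is finite. Proportional costs dominate price oscillations over short time windows, so
   several nearby trades can be merged, and a strategy can be grafted onto a slightly
   different initial state at an arbitrarily small loss.
   At a node (a stopping time with a state), nearly optimal plans are glued along a time
   grid, by backward induction. Among them, the latest first action times are nearly
   optimal stopping rules; they decrease to a stopping time, because the Brownian filtration
   is right-continuous, and the limiting trade there loses nothing. Iterating this step
   gives a chain of actions which ends after finitely many, since each one costs at least
   [delta], and the resulting hedge attains the infimum. *)

Require Import Defs.
From HB Require Import structures.
From mathcomp Require Import all_boot all_order all_algebra.
From mathcomp Require Import all_classical all_reals all_analysis.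
From mathcomp Require Import measurable_realfun.
From mathcomp Require Import ring lra.
Set Implicit Arguments.
Unset Strict Implicit.
Unset Printing Implicit Defensive.
Import Order.TTheory GRing.Theory Num.Theory.
Import numFieldNormedType.Exports.
Local Open Scope classical_set_scope.
Local Open Scope ring_scope.

Local Notation salg := (sigma_algebra setT).
Local Notation mfun := (measurable_fun setT).
Local Notation "f <=w g" := (forall w, f w <= g w) (at level 70).

(** Two features shape the argument. First, minimizing sequences of strategies have no evident
    compactness, so only the first action is passed to the limit: its time, its kind (stop or trade)
    and the position it leads to. For this, a plan has to be nearly optimal at every stopping time
    up to its first action and on every event known there; in this strong form near-optimality
    survives pasting, taking the later of two action times, and infinitely many repetitions with
    summable errors. Second, the estimates are pathwise, with constants that depend on the path. All
    costs lie between 0 and one integrable variable [Z], so an event on which the constants are bad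
    may be given up for at most the expectation of [Z] on it. The model is also relaxed: cash may be
    thrown away, and an action that moves no shares still costs [delta]. Actions are then closed
    under merging and under limits, and the conversion at the end shows that the minimal risk is
    unchanged. The optimization uses only the properties collected in [market]; Brownian motion
    enters afterwards, to provide them. *)

Lemma min_leL (R : realType) (x y : R) : Num.min x y <= x. Proof. by rewrite ge_min lexx. Qed.

Lemma min_leR (R : realType) (x y : R) : Num.min x y <= y.
Proof. by rewrite ge_min lexx orbT. Qed.

Lemma le_maxL (R : realType) (x y : R) : x <= Num.max x y. Proof. by rewrite le_max lexx. Qed.

Lemma le_maxR (R : realType) (x y : R) : y <= Num.max x y.
Proof. by rewrite le_max lexx orbT. Qed.

(** * Paths of cash and shares, and the merging of nearby trades *)

Section TradingPaths.
Context {R : realType}.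
Variables (T delta mu : R).
Hypotheses (delta0 : 0 < delta) (mu0 : 0 < mu) (mu1 : mu < 1).
Implicit Types (S K B : R -> R) (t u v s k b p eta eps : R).

(** Unlike [tcost], it does not vanish at [b = 0]: an action always costs at least [delta]. The jump
    of [tcost] at zero would spoil limits of trades whose sizes tend to zero; this cost is
    continuous, and it is subadditive in [b] ([action_costD]), so that trades at one instant
    merge. *)
Definition action_cost b p := Num.max delta (mu * `|b| * p).

Definition liq k b p := k + b * p - tcost delta mu b p.

(** An inequality for the cash: money may be discarded. Approximation errors are absorbed by
    lowering the cash after a trade ([trade_le]). *)
Definition trade k b k' b' p :=
  k' <= k - (b' - b) * p - action_cost (b' - b) p.

(** [K] and [B] are left-continuous step paths on []t, T]]: at an action time [s] they still show
    the state before the trade. The number [n] bounds the actions, several of which may fall on one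
    instant. Nothing is said at [t] itself, where the state is [(k, b)]. *)
Inductive legal S : nat -> R -> R -> R -> (R -> R) -> (R -> R) -> Prop :=
| legal_hold n t k b K B :
    (forall u, t < u -> u <= T -> K u = k /\ B u = b) -> legal S n t k b K B
| legal_jump n t k b s k' b' K B : t <= s -> s < T ->
    (forall u, t < u -> u <= s -> K u = k /\ B u = b) ->
    trade k b k' b' (S s) -> legal S n s k' b' K B -> legal S n.+1 t k b K B.

Inductive trades S : R -> R -> R -> R -> R -> R -> Prop :=
| trades_nil t k b v : t <= v -> trades S t k b v k b
| trades_cons t k b s k1 b1 v k' b' : t <= s -> s <= v ->
    trade k b k1 b1 (S s) -> trades S s k1 b1 v k' b' -> trades S t k b v k' b'.

Lemma action_costP b p c :
  (c <= - action_cost b p) = (c <= - delta) && (c <= - (mu * `|b| * p)).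
Proof. by rewrite /action_cost lerNr ge_max lerNr [in X in _ && X]lerNr. Qed.

Lemma action_cost_le b p c :
  (action_cost b p <= c) = (delta <= c) && (mu * `|b| * p <= c).
Proof. by rewrite /action_cost ge_max. Qed.

Lemma action_cost_delta b p : delta <= action_cost b p.
Proof. by rewrite /action_cost le_maxL. Qed.

Lemma action_cost_prop b p : mu * `|b| * p <= action_cost b p.
Proof. by rewrite /action_cost le_maxR. Qed.

Lemma action_costN b p : action_cost (- b) p = action_cost b p.
Proof. by rewrite /action_cost normrN. Qed.

Lemma mu_normD (b c : R) p : 0 <= p -> mu * `|b + c| * p <= mu * `|b| * p + mu * `|c| * p.
Proof.
move=> p0; rewrite -!mulrA -mulrDr -mulrDl ler_pM2l //.
by rewrite ler_wpM2r // ler_normD.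
Qed.

Lemma action_costD b c p : 0 <= p ->
  action_cost (b + c) p <= action_cost b p + action_cost c p.
Proof.
move=> p0; rewrite action_cost_le.
have := action_cost_delta b p; have := action_cost_prop b p.
have := action_cost_delta c p; have := action_cost_prop c p.
have := mu_normD b c p0; move: delta0.
set x := mu * `|b + c| * p; set y := mu * `|b| * p; set z := mu * `|c| * p.
by move=> *; apply/andP; split; lra.
Qed.

Lemma tcost_ge0 b p : 0 <= tcost delta mu b p.
Proof.
rewrite /tcost; case: ifP => // _.
by rewrite le_max ltW.
Qed.

Lemma tcost0 p : tcost delta mu 0 p = 0.
Proof. by rewrite /tcost eqxx. Qed.

Lemma tcost_neq0 b p : b != 0 -> tcost delta mu b p = action_cost b p.
Proof. by rewrite /tcost /action_cost => /negbTE ->. Qed.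

Lemma tcost_le b p : tcost delta mu b p <= action_cost b p.
Proof.
case: (eqVneq b 0) => [->|/tcost_neq0 -> //].
by rewrite tcost0 (le_trans (ltW delta0)) // action_cost_delta.
Qed.

Lemma tcost_prop b p : mu * `|b| * p <= tcost delta mu b p.
Proof.
case: (eqVneq b 0) => [->|/tcost_neq0 ->]; last exact: action_cost_prop.
by rewrite tcost0 normr0 mulr0 mul0r.
Qed.

Lemma tcost_tri b c p : 0 <= p ->
  tcost delta mu (b + c) p <= action_cost b p + tcost delta mu c p.
Proof.
move=> p0; case: (eqVneq c 0) => [->|c0].
  by rewrite addr0 tcost0 addr0 tcost_le.
by rewrite (tcost_neq0 _ c0) (le_trans (tcost_le _ _)) // action_costD.
Qed.

Lemma liq_trade k b k' b' p : 0 <= p -> trade k b k' b' p ->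
  liq k' b' p <= liq k b p.
Proof.
rewrite /trade /liq => p0 tr.
have := @tcost_tri (b - b') b' p p0; rewrite subrK -action_costN opprB.
set x := action_cost _ _ in tr *; set y := tcost _ _ b _; set z := tcost _ _ b' _.
by move: tr; rewrite mulrBl; lra.
Qed.

Lemma liq_wealth_ge0 k b p : 0 <= p -> 0 <= liq k b p -> mu * `|b| * p <= k + b * p.
Proof.
by move=> p0; rewrite /liq; have := tcost_prop b p; lra.
Qed.

Lemma trade_liquidate k b k' p : b != 0 -> k' <= liq k b p -> trade k b k' 0 p.
Proof.
move=> b0; rewrite /trade /liq (tcost_neq0 _ b0) sub0r action_costN mulNr.
by rewrite opprK.
Qed.

Lemma trade_trans k b k1 b1 k2 b2 p : 0 <= p ->
  trade k b k1 b1 p -> trade k1 b1 k2 b2 p -> trade k b k2 b2 p.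
Proof.
rewrite /trade => p0 h1 h2.
have := @action_costD (b2 - b1) (b1 - b) p p0; rewrite addrA subrK.
set x := action_cost (b2 - b) p.
set y := action_cost (b2 - b1) p in h2 *; set z := action_cost (b1 - b) p in h1 *.
by move: h1 h2; rewrite !mulrBl; lra.
Qed.

Lemma tradeB eta k b k' b' p : trade k b k' b' p -> trade (k - eta) b (k' - eta) b' p.
Proof. by rewrite /trade; lra. Qed.

Lemma trade_le k1 k b k' k'1 b' p : k <= k1 -> k'1 <= k' -> trade k b k' b' p -> trade k1 b k'1 b' p.
Proof. by rewrite /trade; lra. Qed.

Lemma trades_same S t k b v k' b' : 0 <= S t -> trades S t k b v k' b' -> v <= t ->
  (k' = k /\ b' = b) \/ trade k b k' b' (S t).
Proof.
move=> St trs; elim: trs St => {t k b v k' b'}; first by left.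
move=> t k b s k1 b1 v k' b' ts sv tr trs IH St vt.
have est : s = t by apply: le_anti; rewrite ts (le_trans sv vt).
subst s; right; have [[-> ->]//|] := IH St vt.
exact: trade_trans.
Qed.

(** Valued at a reference price [p], a trade made at [q] loses its cost, which is at least the
    proportional cost at [(1 - eps) p], and gains at most the price difference times the number of
    shares moved. *)
Lemma trade_window k b k1 b1 p q eps : trade k b k1 b1 q -> 0 < p -> 0 <= eps -> eps <= 1 ->
  `|q - p| <= eps * p ->
  k1 + b1 * p <= k + b * p - Num.max delta (mu * (1 - eps) * p * `|b1 - b|) + eps * p * `|b1 - b|.
Proof.
move=> tr p0 e0 e1 Ss; set c := `|b1 - b|.
have c0 : 0 <= c by exact: normr_ge0.
have h2 : (b1 - b) * (p - q) <= eps * p * c.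
  rewrite (le_trans (ler_norm _)) // normrM mulrC distrC.
  by rewrite ler_wpM2r.
have h3 : Num.max delta (mu * (1 - eps) * p * c) <= action_cost (b1 - b) q.
  rewrite ge_max action_cost_delta /=.
  apply: le_trans (action_cost_prop _ _); rewrite -/c -!mulrA ler_pM2l //.
  rewrite [leRHS]mulrC mulrA ler_wpM2r //.
  by move: Ss; rewrite ler_norml => /andP[]; lra.
by move: tr h2; rewrite /trade !mulrBl mulrBr; lra.
Qed.

(** [L] is the total number of shares moved. The costs of the single trades add up to at least the
    cost of one trade of size [L], because [Num.max delta] is subadditive in the size. *)
Lemma trades_window S t k b v k' b' p eps : trades S t k b v k' b' ->
  0 < p -> 0 <= eps -> eps <= 1 ->
  (forall u, t <= u -> u <= v -> `|S u - p| <= eps * p) ->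
  (k' = k /\ b' = b) \/ exists L : R, [/\ `|b' - b| <= L, 0 <= L &
    k' + b' * p <= k + b * p - Num.max delta (mu * (1 - eps) * p * L) + eps * p * L].
Proof.
move=> trs p0 e0 e1; elim: trs => {t k b v k' b'}; first by left.
move=> t k b s k1 b1 v k' b' ts sv tr trs IH Sp; right.
have h1 := trade_window tr p0 e0 e1 (Sp s ts sv).
have [|[-> ->]|[L [bL L0 hL]]] := IH.
- by move=> u su; apply: Sp; apply: le_trans su.
- by exists `|b1 - b|.
set c := `|b1 - b| in h1 *; exists (c + L); split.
- by rewrite (le_trans (ler_distD b1 _ _)) // addrC lerD.
- by rewrite addr_ge0 // /c.
have : Num.max delta (mu * (1 - eps) * p * (c + L)) <=
  Num.max delta (mu * (1 - eps) * p * c) + Num.max delta (mu * (1 - eps) * p * L).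
  rewrite ge_max; apply/andP; split.
    rewrite -[leLHS]addr0 lerD // le_max ?lexx //.
    by rewrite ltW.
  by rewrite mulrDr lerD // le_maxR.
move: hL h1; rewrite [eps * p * (c + L)]mulrDr.
set m1 := Num.max _ _; set m2 := Num.max _ _; set m3 := Num.max _ _.
by lra.
Qed.

(* Proportional costs dominate small price oscillations, so several trades in a
   short window can be merged into a single one at a cost of order [eps]. *)
Lemma trades_merge S t k b v k' b' p eps : trades S t k b v k' b' ->
  0 < p -> 0 <= eps -> eps <= mu / 4 ->
  (forall u, t <= u -> u <= v -> `|S u - p| <= eps * p) ->
  0 <= k' + b' * p ->
  (k' = k /\ b' = b) \/
  (trade k b (k' - 4 * eps * (k + b * p) / mu) b' p /\ k' + b' * p <= k + b * p - delta / 2).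
Proof.
move=> trs p0 e0 e1 Sp k'0.
have e2 : eps <= 1 by move: mu1 e1; lra.
have [|[L [bL L0 hL]]] := trades_window trs p0 e0 e2 Sp; first by left.
right; set q := p * L.
have q0 : 0 <= q by rewrite /q mulr_ge0 // ltW.
have hm1 : mu * (1 - eps) * q <= Num.max delta (mu * (1 - eps) * p * L).
  by rewrite /q mulrA le_maxR.
have hm2 : delta <= Num.max delta (mu * (1 - eps) * p * L).
  by rewrite le_maxL.
move: hL; rewrite -[eps * p * L]mulrA -/q => hL.
have emu : eps * mu * q <= eps * q.
  by rewrite ler_wpM2r // ler_piMr // ltW.
have heq : eps * q <= mu / 4 * q by rewrite ler_wpM2r.
(* The final wealth is nonnegative, and since [eps <= mu / 4] half of the proportional cost survives
   the price errors. So the turnover [q] is at most twice the initial wealth over [mu], and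
   [2 * eps * q] is at most the cash given up in the statement. *)
have hq : mu * q <= 2 * (k + b * p).
  have : mu * (1 - eps) * q - eps * q <= k + b * p by lra.
  by lra.
have h4 : 2 * eps * q <= 4 * eps * (k + b * p) / mu.
  by rewrite ler_pdivlMr //; have := ler_wpM2l e0 hq; lra.
have hb : mu * `|b' - b| * p <= mu * q.
  by rewrite -mulrA ler_pM2l // /q mulrC ler_pM2l.
have eq0 : 0 <= eps * q by rewrite mulr_ge0.
split; last by lra.
rewrite /trade mulrBl -lerBlDl opprB; set e4 := 4 * _ * _ / _ in h4 *.
rewrite addrC action_costP; apply/andP; split; first by lra.
by lra.
Qed.

(** Because a trade really takes place at [t], the merged trades cannot lead back to the initial
    state: the cost of that trade exceeds the price error, so the wealth at the price [p] has
    strictly dropped. *)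
Lemma trades_merge1 S t k b k1 b1 v k' b' p eps : t <= v -> trade k b k1 b1 (S t) ->
  trades S t k1 b1 v k' b' -> 0 < p -> 0 <= eps -> eps <= mu / 4 ->
  (forall u, t <= u -> u <= v -> `|S u - p| <= eps * p) ->
  0 <= k' + b' * p ->
  trade k b (k' - 4 * eps * (k + b * p) / mu) b' p.
Proof.
move=> tv tr trs p0 e0 e1 Sp k'0.
have trs' : trades S t k b v k' b' by exact: trades_cons tr trs.
have [[ek eb]|[]//] := trades_merge trs' p0 e0 e1 Sp k'0.
have e2 : eps <= 1 by move: mu1 e1; lra.
have h1 := trade_window tr p0 e0 e2 (Sp t (lexx t) tv).
have h2 : k' + b' * p <= k1 + b1 * p.
  have [[-> ->]//|[_ h]] := trades_merge trs p0 e0 e1 Sp k'0.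
  by move: h delta0; lra.
exfalso; move: h1 h2; rewrite ek eb; set c := `|b1 - b|; set q := p * c.
have q0 : 0 <= q by rewrite /q mulr_ge0 ?(ltW p0) // /c.
have hm1 : mu * (1 - eps) * q <= Num.max delta (mu * (1 - eps) * p * c).
  by rewrite /q mulrA le_maxR.
have hm2 : delta <= Num.max delta (mu * (1 - eps) * p * c) by rewrite le_maxL.
rewrite -[eps * p * c]mulrA -/q.
have emu : eps * mu * q <= eps * q by rewrite ler_wpM2r // ler_piMr // ltW.
have heq : eps * q <= mu / 4 * q by rewrite ler_wpM2r.
have hd := delta0; move: hm1 hm2; set m := Num.max _ _ => hm1 hm2; lra.
Qed.

Lemma trades_merge_liq S t k b v k' b' p eps : trades S t k b v k' b' ->
  0 < p -> 0 <= eps -> eps <= mu / 4 ->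
  (forall u, t <= u -> u <= v -> `|S u - p| <= eps * p) ->
  0 <= k' + b' * p -> 0 <= k + b * p ->
  liq k' b' p <= liq k b p + 4 * eps * (k + b * p) / mu.
Proof.
move=> trs p0 e0 e1 Sp k'0 kb0.
have h0 : 0 <= 4 * eps * (k + b * p) / mu.
  by rewrite divr_ge0 // ?(ltW mu0) // mulr_ge0 // mulr_ge0.
have [[-> ->]|[+ _]] := trades_merge trs p0 e0 e1 Sp k'0; first by rewrite lerDl.
move/(liq_trade (ltW p0)); rewrite /liq; lra.
Qed.

Lemma legal_left S n t k b K B v : legal S n t k b K B -> t < v -> v <= T ->
  trades S t k b v (K v) (B v).
Proof.
move=> leg; elim: leg v => {n t k b K B}.
  by move=> n t k b K B hc v tv vT; have [-> ->] := hc _ tv vT; apply/trades_nil/ltW.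
move=> n t k b s k' b' K B ts sT hc tr leg IH v tv vT.
have [vs|sv] := leP v s.
  by have [-> ->] := hc _ tv vs; apply/trades_nil/ltW.
by apply: trades_cons ts (ltW sv) tr _; exact: IH.
Qed.

(** [(k', b')] is the right limit of the path at [v], after all trades up to and including [v]. The
    bound on the remaining actions does not increase, so it can serve for inductions. *)
Lemma legal_split S n t k b K B v : legal S n t k b K B -> t <= v -> v < T ->
  exists m k' b', [/\ (m <= n)%N, legal S m v k' b' K B, trades S t k b v k' b' &
    exists2 e, 0 < e & forall u, v < u -> u < v + e -> u <= T -> K u = k' /\ B u = b'].
Proof.
move=> leg; elim: leg v => {n t k b K B}.
  move=> n t k b K B hc v tv vT; exists n, k, b; split=> //.
  - by apply: legal_hold => u vu uT; apply: hc => //; apply: le_lt_trans tv vu.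
  - exact: trades_nil.
  - by exists 1 => // u vu _ uT; apply: hc => //; apply: le_lt_trans tv vu.
move=> n t k b s k' b' K B ts sT hc tr leg IH v tv vT.
have [sv|vs] := leP s v.
  have [m [k1 [b1 [mn leg1 trs1 e1]]]] := IH v sv vT.
  exists m, k1, b1; split=> //; first exact: leq_trans mn _.
  exact: trades_cons ts sv tr trs1.
exists n.+1, k, b; split => //.
- apply: legal_jump (ltW vs) sT _ tr leg => u vu us.
  by apply: hc => //; apply: le_lt_trans tv vu.
- exact: trades_nil.
- exists (s - v); rewrite ?subr_gt0 // => u vu; rewrite addrC subrK => us _.
  by apply: hc (ltW us); apply: le_lt_trans tv vu.
Qed.

Lemma legal_at S n t k b K B v : legal S n t k b K B -> t < v -> v <= T ->
  exists m, legal S m v (K v) (B v) K B.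
Proof.
move=> leg; elim: leg v => {n t k b K B}.
  move=> n t k b K B hc v tv vT; exists 0; have [-> ->] := hc _ tv vT.
  by apply: legal_hold => u vu uT; apply: hc => //; apply: lt_trans vu.
move=> n t k b s k' b' K B ts sT hc tr leg IH v tv vT.
have [vs|sv] := leP v s; last exact: IH.
exists n.+1; have [-> ->] := hc _ tv vs.
apply: legal_jump vs sT _ tr leg => u vu us.
by apply: hc => //; apply: lt_trans vu.
Qed.

(** All trades at the first action time are merged into one by [trade_trans], so that the state
    after it is the right limit of the path. *)
Lemma legal_first S n t k b K B : (forall u, 0 <= S u) -> legal S n t k b K B ->
  (forall u, t < u -> u <= T -> K u = k /\ B u = b) \/
  exists m s k' b', [/\ (m < n)%N, t <= s, s < T &
   [/\ forall u, t < u -> u <= s -> K u = k /\ B u = b,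
      trade k b k' b' (S s), legal S m s k' b' K B &
    exists2 e, 0 < e & forall u, s < u -> u < s + e -> u <= T -> K u = k' /\ B u = b']].
Proof.
move=> S0; case=> {n t k b K B}; first by left.
move=> n t k b s k' b' K B ts sT hc tr leg; right.
have [m [k1 [b1 [mn leg1 trs1 e1]]]] := legal_split leg (lexx s) sT.
exists m, s, k1, b1; split=> //; split=> //.
have [[-> ->]//|] := trades_same (S0 s) trs1 (lexx s).
exact: trade_trans.
Qed.

Lemma legal_shift eta S n t k b K B : legal S n t k b K B ->
  legal S n t (k - eta) b (fun u => K u - eta) B.
Proof.
elim=> {n t k b K B}.
  by move=> n t k b K B hc; apply: legal_hold => u tu uT; have [-> ->] := hc _ tu uT.
move=> n t k b s k' b' K B ts sT hc tr leg IH.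
apply: legal_jump ts sT _ (tradeB eta tr) IH => u tu us.
by have [-> ->] := hc _ tu us.
Qed.

Lemma legal_extend S n t v k b K B : legal S n v k b K B -> t <= v ->
  (forall u, t < u -> u <= v -> K u = k /\ B u = b) -> legal S n t k b K B.
Proof.
case=> {n v k b K B}.
  move=> n v k b K B hc tv hc'; apply: legal_hold => u tu uT.
  by have [uv|vu] := leP u v; [exact: hc'|exact: hc].
move=> n v k b s k' b' K B vs sT hc tr leg tv hc'.
apply: legal_jump (le_trans tv vs) sT _ tr leg => u tu us.
by have [uv|vu] := leP u v; [exact: hc'|exact: hc].
Qed.

Lemma legal_ext S n t k b K B K' B' : legal S n t k b K B ->
  (forall u, t < u -> u <= T -> K' u = K u /\ B' u = B u) -> legal S n t k b K' B'.
Proof.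
move=> leg; elim: leg K' B' => {n t k b K B}.
  move=> n t k b K B hc K' B' h; apply: legal_hold => u tu uT.
  by have [-> ->] := h _ tu uT; exact: hc.
move=> n t k b s k' b' K B ts sT hc tr leg IH K' B' h.
apply: (legal_jump ts sT _ tr) => [u tu us|].
  by have [-> ->] := h _ tu (le_trans us (ltW sT)); exact: hc.
by apply: IH => u su uT; apply: h => //; apply: le_lt_trans su.
Qed.

Lemma legal_lconst S n t k b K B u : legal S n t k b K B -> t < u -> u <= T ->
  exists2 e, 0 < e & forall v, t < v -> u - e < v -> v <= u -> K v = K u /\ B v = B u.
Proof.
move=> leg; elim: leg u => {n t k b K B}.
  move=> n t k b K B hc u tu uT; exists 1 => // v tv _ vu.
  by have [-> ->] := hc _ tu uT; apply: hc => //; apply: le_trans uT.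
move=> n t k b s k' b' K B ts sT hc tr leg IH u tu uT.
have [us|su] := leP u s.
  exists 1 => // v tv _ vu; have [-> ->] := hc _ tu us.
  by apply: hc => //; apply: le_trans us.
have [e e0 h] := IH u su uT.
exists (Num.min e (u - s)); first by rewrite lt_min e0 subr_gt0.
move=> v tv uv vu; apply: h => //.
  by move: uv; rewrite ltrBlDr -ltrBlDl lt_min => /andP[_]; lra.
by move: uv; rewrite ltrBlDr -ltrBlDl lt_min => /andP[]; lra.
Qed.

(* From time [beta] on: give everything up by a trade, or do nothing when no trade is affordable. *)
Definition frozen k b := if (b == 0) && (k < delta) then k else 0.

Lemma frozen_ge0 k b p : 0 <= liq k b p -> 0 <= frozen k b.
Proof.
rewrite /frozen; case: eqP => //= ->; case: ifP => // _.
by rewrite /liq tcost0 mul0r addr0 subr0.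
Qed.

Lemma frozen_trade k b p : 0 <= liq k b p -> (b = 0 /\ frozen k b = k) \/ trade k b (frozen k b) 0 p.
Proof.
move=> l0; rewrite /frozen; case: eqP => /= [b0|/eqP b0]; last by right; exact: trade_liquidate.
rewrite b0; case: ltP => kd; first by left.
right; rewrite /trade subrr mul0r subr0 /action_cost normr0 mulr0 mul0r.
by rewrite (max_idPl (ltW delta0)) subr_ge0.
Qed.

(** At [beta = t] the values [K t] and [B t] are not controlled by [legal]; the state to be frozen
    is then the initial one. *)
Lemma legal_freeze S n t k b K B beta k0 b0 : legal S n t k b K B ->
  t <= beta -> beta < T ->
  (k0, b0) = (if t < beta then (K beta, B beta) else (k, b)) ->
  0 <= liq k0 b0 (S beta) ->
  exists m, legal S m t k b
   (fun u => if u <= beta then K u else frozen k0 b0)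
   (fun u => if u <= beta then B u else 0).
Proof.
have base t' k' b' K' B' beta' : t' <= beta' -> beta' < T -> 0 <= liq k' b' (S beta') ->
    (forall u, t' < u -> u <= beta' -> K' u = k' /\ B' u = b') ->
    exists m, legal S m t' k' b' (fun u => if u <= beta' then K' u else frozen k' b')
      (fun u => if u <= beta' then B' u else 0).
  move=> tb bT l0 hc; have [[b0' fk]|tr] := frozen_trade l0.
    exists 0; apply: legal_hold => u tu uT; case: ifP => ub; last by rewrite fk b0'.
    exact: hc.
  exists 1; apply: (@legal_jump _ _ _ _ _ beta' _ 0 _ _ tb bT _ tr).
    by move=> u tu ub; rewrite ub; exact: hc.
  by apply: legal_hold => u bu uT; rewrite leNgt bu.
move=> leg; elim: leg beta => {n t k b K B}.
- move=> n t k b K B hc beta tb bT e0 l0.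
  have {e0}[ek eb] : k0 = k /\ b0 = b.
    by move: e0; case: ifP => [tb' [-> ->]|_ [-> ->] //]; apply: hc => //; exact: ltW.
  subst k0 b0; apply: base => // u tu ub.
  by apply: hc => //; apply: le_trans (ltW bT).
- move=> n t k b s k' b' K B ts sT hc tr leg IH beta tb bT e0 l0.
  have [bs|sb] := leP beta s; last first.
    have [|m legm] := IH beta (ltW sb) bT _ l0.
      by rewrite sb e0 (le_lt_trans ts sb).
    exists m.+1; apply: legal_jump ts sT _ tr legm => u tu us.
    by rewrite (le_trans us (ltW sb)); exact: hc.
  have {e0}[ek eb] : k0 = k /\ b0 = b.
    by move: e0; case: ifP => [tb' [-> ->]|_ [-> ->] //]; apply: hc => //.
  subst k0 b0; apply: base => // u tu ub.
  by apply: hc => //; apply: le_trans bs.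
Qed.

(** As long as the shares stay at [c], further actions are round trips at one instant and only cost
    money. The best case is a single trade at [t], charged with [tcost], which is zero when no
    shares move. *)
Lemma legal_cash_le S n t k b K B u c : (forall v, 0 <= S v) -> legal S n t k b K B ->
  t < u -> u <= T -> (forall v, t < v -> v <= u -> B v = c) ->
  K u <= k - (c - b) * S t - tcost delta mu (c - b) (S t).
Proof.
move=> S0 leg; elim: leg u => {n t k b K B}.
  move=> n t k b K B hc u tu uT Bc; have [-> Bu] := hc _ tu uT.
  have -> : c = b by rewrite -Bu Bc.
  by rewrite subrr mul0r tcost0 !subr0.
move=> n t k b s k' b' K B ts sT hc tr leg IH u tu uT Bc.
have [us|su] := leP u s.
  have [-> Bu] := hc _ tu us; have -> : c = b by rewrite -Bu Bc.
  by rewrite subrr mul0r tcost0 !subr0.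
have {IH} := IH _ su uT (fun v sv => Bc v (le_lt_trans ts sv)).
have := @tcost_tri (b' - b) (c - b') (S s) (S0 s); rewrite [b' - b + _]addrC addrA subrK.
move: tr; rewrite /trade.
have [tsl|st] := ltP t s; last first.
  have -> : s = t by apply: le_anti; rewrite ts st.
  set x := action_cost _ _; set z := tcost _ _ _ _; set z' := tcost _ _ _ _.
  by rewrite !mulrBl; lra.
have [Ks Bs] := hc _ tsl (lexx s).
have -> : c = b by rewrite -Bs (Bc _ tsl (ltW su)).
rewrite subrr mul0r !tcost0 !subr0.
have := action_cost_delta (b' - b) (S s); have := tcost_ge0 (b - b') (S s).
set x := action_cost _ _; set z := tcost _ _ _ _.
by move: delta0; rewrite !mulrBl; lra.
Qed.

(** The proportional cost is Lipschitz in the price with constant [mu * |b|], which is at most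
    [|b|]; the shares themselves give the other [|b|]. *)
Lemma liq_cont (k b p q : R) : 0 < p -> 0 < q -> `|liq k b p - liq k b q| <= 2 * `|b| * `|p - q|.
Proof.
move=> p0 q0; rewrite /liq.
have h : `|tcost delta mu b p - tcost delta mu b q| <= `|b| * `|p - q|.
  case: (eqVneq b 0) => [->|b0]; first by rewrite !tcost0 subrr normr0 mul0r.
  rewrite !(tcost_neq0 _ b0) /action_cost.
  have hp : forall x y : R, `|Num.max delta x - Num.max delta y| <= `|x - y|.
    move=> x y; have := ler_norm (x - y); have := ler_norm (y - x).
    rewrite [`|y - x|]distrC => h1 h2.
    rewrite !maxEle; case: ifPn => h3; case: ifPn => h4;
      rewrite -?ltNge in h3 h4; rewrite ler_norml; apply/andP; split; lra.
  apply: le_trans (hp _ _) _; rewrite -mulrBr normrM normrM normr_id.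
  rewrite [`|mu|]gtr0_norm // ler_wpM2r //.
  by rewrite ger_pMl ?normr_gt0 // ltW.
have -> : k + b * p - tcost delta mu b p - (k + b * q - tcost delta mu b q) =
  b * (p - q) - (tcost delta mu b p - tcost delta mu b q) by ring.
rewrite (le_trans (ler_normB _ _)) // normrM -mulrA mulrDl !mul1r.
by rewrite lerD.
Qed.

End TradingPaths.

(** * Real-valued expectations *)

Section Expectation.
Context {R : realType} {d : measure_display} {Omega : measurableType d}.
Variable P : probability Omega R.
Implicit Types (f g Z : Omega -> R) (A : set Omega).

Definition Ib f := P.-integrable setT (EFin \o f).

Definition Ex f : R := \int[P]_w f w.

Lemma Ib_measurable f : Ib f -> mfun f.
Proof. by move/measurable_int/measurable_EFinP. Qed.

Lemma Ib_le f g : mfun f -> Ib g -> (forall w, `|f w| <= g w) -> Ib f.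
Proof.
move=> mf Ig fg; apply: le_integrable Ig => //; first exact/measurable_EFinP.
by move=> w _ /=; rewrite lee_fin (le_trans (fg w)) // ler_norm.
Qed.

Lemma IbD f g : Ib f -> Ib g -> Ib (fun w => f w + g w).
Proof.
move=> If Ig; have := integrableD measurableT If Ig.
by apply: eq_integrable => // w _ /=; rewrite EFinD.
Qed.

Lemma IbB f g : Ib f -> Ib g -> Ib (fun w => f w - g w).
Proof.
move=> If Ig; have := integrableB measurableT If Ig.
by apply: eq_integrable => // w _ /=; rewrite EFinB.
Qed.

Lemma IbZ c f : Ib f -> Ib (fun w => c * f w).
Proof.
move=> If; have := integrableZl measurableT c If.
by apply: eq_integrable => // w _ /=; rewrite EFinM.
Qed.

Lemma Ib_cst c : Ib (fun=> c).
Proof. exact: finite_measure_integrable_cst. Qed.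

Lemma Ib_indic A f : measurable A -> Ib f -> Ib (fun w => \1_A w * f w).
Proof.
move=> mA If; apply: (@Ib_le _ (fun w => `|f w|)).
- apply: measurable_funM; last exact: Ib_measurable.
  exact: measurable_indic.
- exact: integrable_norm.
- move=> w; rewrite normrM indicE; case: (w \in A) => /=.
    by rewrite normr1 mul1r.
  by rewrite normr0 mul0r.
Qed.

Lemma Ex_le f g : Ib f -> Ib g -> f <=w g -> Ex f <= Ex g.
Proof. by move=> If Ig fg; apply: le_Rintegral. Qed.

Lemma ExD f g : Ib f -> Ib g -> Ex (fun w => f w + g w) = Ex f + Ex g.
Proof. by move=> If Ig; rewrite /Ex RintegralD. Qed.

Lemma ExB f g : Ib f -> Ib g -> Ex (fun w => f w - g w) = Ex f - Ex g.
Proof. by move=> If Ig; rewrite /Ex RintegralB. Qed.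

Lemma ExZ c f : Ib f -> Ex (fun w => c * f w) = c * Ex f.
Proof. by move=> If; rewrite /Ex RintegralZl. Qed.

Lemma Ex_cst c : Ex (fun=> c) = c.
Proof. rewrite /Ex Rintegral_cst // -[RHS]mulr1; congr (_ * _).
by have := probability_setT P => /(congr1 fine). Qed.

Lemma Ex_ge0 f : (forall w, 0 <= f w) -> 0 <= Ex f.
Proof. by move=> f0; apply: Rintegral_ge0. Qed.

Lemma eq_Ex f g : (forall w, f w = g w) -> Ex f = Ex g.
Proof. by move=> /funext ->. Qed.

Lemma Ex_dct (F : nat -> Omega -> R) f Z : (forall n, mfun (F n)) ->
  Ib Z -> (forall n w, `|F n w| <= Z w) -> (forall w, F ^~ w @ \oo --> f w) ->
  Ib f /\ (fun n => Ex (F n)) @ \oo --> Ex f.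
Proof.
move=> mF IZ FZ Ff.
have mf : mfun f.
  by apply: (@measurable_fun_cvg _ _ _ setT F) => // w _; exact: Ff.
have FZ' w : forall n : nat, [set: Omega] w -> (`|(EFin \o F n) w| <= (EFin \o Z) w)%E.
  by move=> n _; rewrite lee_fin.
have Ff' w : (EFin \o F n) w @[n --> \oo] --> (EFin \o f) w.
  by apply: cvg_EFin; [exact: nearW|exact: Ff].
have [If _ cvg] := @dominated_convergence _ _ _ P setT measurableT
  (fun n => EFin \o F n) (EFin \o f) (EFin \o Z)
  (fun n => (measurable_EFinP _ _).2 (mF n)) ((measurable_EFinP _ _).2 mf)
  (aeW _ (fun w _ => Ff' w))
  IZ (aeW _ FZ').
split=> //.
by apply: fine_cvg; rewrite fineK // integrable_fin_num.
Qed.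

(** Dominated convergence to zero. Applied with the common bound [Z] of all costs, it makes events
    that every path eventually leaves negligible for the risk. *)
Lemma Ex_tail (A : nat -> set Omega) Z : (forall n, measurable (A n)) -> Ib Z ->
  (forall w, exists N, forall n, (N <= n)%N -> ~ A n w) ->
  forall e, 0 < e -> exists N, forall n, (N <= n)%N -> Ex (fun w => \1_(A n) w * Z w) < e.
Proof.
move=> mA IZ hA e e0.
have [||||_] := @Ex_dct (fun n w => \1_(A n) w * Z w) (fun=> 0) (fun w => `|Z w|).
- by move=> n; apply: Ib_measurable; exact: Ib_indic.
- exact: integrable_norm.
- move=> n w; rewrite normrM indicE; case: (w \in A n) => /=.
    by rewrite normr1 mul1r.
  by rewrite normr0 mul0r.
- move=> w; have [N hN] := hA w; apply: cvg_near_cst.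
  by exists N => // n /= Nn; rewrite indicE memNset ?mul0r //; exact: hN.
rewrite Ex_cst => /cvgrPdist_lt /(_ e e0) [N _ hN]; exists N => n Nn.
by have := hN n Nn; rewrite sub0r normrN; apply: le_lt_trans; exact: ler_norm.
Qed.

End Expectation.

(** * Measurability with respect to a sub-sigma-algebra *)

Section SubSigmaAlgebra.
Context {R : realType} {d : measure_display} {Omega : measurableType d}.
Implicit Types (G : set (set Omega)) (A B : set Omega) (f g : Omega -> R).

(** The wrapper keeps two measurable structures on one set apart: the type [g_sigma_algebraType G]
    is convertible to [Omega]. *)
Variant mG G (f : Omega -> R) : Prop :=
  MG of measurable_fun [set: g_sigma_algebraType G] (f : g_sigma_algebraType G -> R).

Lemma mGP G f : salg G ->
  (mG G f <-> forall B : set R, measurable B -> G (f @^-1` B)).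
Proof.
move=> sG; split=> [[mf] B mB|h]; last (split=> _ B mB).
  by have := mf measurableT B mB; rewrite setTI /measurable /= sigma_algebra_id.
rewrite setTI; have := h B mB; rewrite /measurable /= sigma_algebra_id //.
Qed.

Lemma sigma_setT G : salg G -> G setT.
Proof. by case=> G0 GC _; rewrite -(setD0 setT); exact: GC. Qed.

Lemma sigma_setC G A : salg G -> G A -> G (~` A).
Proof. by case=> _ GC _ GA; rewrite -setTD; exact: GC. Qed.

Lemma sigma_bigcup G (F : nat -> set Omega) : salg G ->
  (forall n, G (F n)) -> G (\bigcup_n F n).
Proof. by case=> _ _; apply. Qed.

Lemma sigma_setU G A B : salg G -> G A -> G B -> G (A `|` B).
Proof.
move=> sG GA GB; rewrite -bigcup2E; apply: sigma_bigcup => // -[|[|n]] //=.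
by case: sG.
Qed.

Lemma sigma_setI G A B : salg G -> G A -> G B -> G (A `&` B).
Proof.
move=> sG GA GB; rewrite -[A `&` B]setCK setCI.
by apply: sigma_setC => //; apply: sigma_setU => //; exact: sigma_setC.
Qed.

Lemma sigma_setD G A B : salg G -> G A -> G B -> G (A `\` B).
Proof. by move=> sG GA GB; rewrite setDE; apply: sigma_setI => //; exact: sigma_setC. Qed.

Lemma sigma_bigcap G (F : nat -> set Omega) : salg G ->
  (forall n, G (F n)) -> G (\bigcap_n F n).
Proof.
move=> sG GF; rewrite -[\bigcap_n _]setCK setC_bigcap.
by apply: sigma_setC => //; apply: sigma_bigcup => // n; exact: sigma_setC.
Qed.

Lemma sigma_bigcup_count G (T : countType) (F : T -> set Omega) : salg G ->
  (forall n, G (F n)) -> G (\bigcup_n F n).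
Proof.
move=> sG GF; have -> : \bigcup_n F n =
    \bigcup_n (if choice.unpickle n is Some x then F x else set0).
  apply/seteqP; split=> [w [x _ Fx]|w [n _]].
    by exists (choice.pickle x) => //; rewrite choice.pickleK.
  by case: choice.unpickle => // x Fx; exists x.
by apply: sigma_bigcup => // n; case: choice.unpickle => //; case: sG.
Qed.

Lemma sigma_bigcap_count G (T : countType) (F : T -> set Omega) : salg G ->
  (forall n, G (F n)) -> G (\bigcap_n F n).
Proof.
move=> sG GF; rewrite -[\bigcap_n _]setCK setC_bigcap.
by apply: sigma_setC => //; apply: sigma_bigcup_count => // n; exact: sigma_setC.
Qed.

Lemma sigma_measurable G A : salg G -> G A ->
  measurable (A : set (g_sigma_algebraType G)).
Proof. by move=> sG GA; rewrite /measurable /= sigma_algebra_id. Qed.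

Lemma measurable_sigma G A : salg G ->
  measurable (A : set (g_sigma_algebraType G)) -> G A.
Proof. by move=> sG; rewrite /measurable /= sigma_algebra_id. Qed.

Lemma mG_sub G H f : salg G -> salg H -> G `<=` H ->
  mG G f -> mG H f.
Proof. by move=> sG sH GH /(mGP _ sG) mf; apply/(mGP _ sH) => B mB; apply/GH/mf. Qed.

Lemma mG_measurable G f : salg G -> G `<=` measurable ->
  mG G f -> mfun f.
Proof. by move=> sG Gm /(mGP _ sG) mf _ B mB; rewrite setTI; apply/Gm/mf. Qed.

Lemma mG_lt G f g : salg G -> mG G f -> mG G g -> G [set w | f w < g w].
Proof.
move=> sG [mf] [mg]; apply: measurable_sigma => //.
have := measurable_fun_ltr mf mg; move=> /(_ measurableT [set true] I).
by rewrite setTI.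
Qed.

Lemma mG_le G f g : salg G -> mG G f -> mG G g -> G [set w | f w <= g w].
Proof.
move=> sG [mf] [mg]; apply: measurable_sigma => //.
have := measurable_fun_ler mf mg; move=> /(_ measurableT [set true] I).
by rewrite setTI.
Qed.

Lemma mG_eq G f g : salg G -> mG G f -> mG G g -> G [set w | f w = g w].
Proof.
move=> sG mf mg; have -> : [set w | f w = g w] = [set w | f w <= g w] `&` [set w | g w <= f w].
  apply/seteqP; split=> w /=; first by move=> ->.
  by case=> h1 h2; apply: le_anti; rewrite h1 h2.
by apply: sigma_setI => //; exact: mG_le.
Qed.

Lemma mG_cst G (c : R) : mG G (fun=> c).
Proof. by split; exact: measurable_cst. Qed.

Lemma mG_if G A f g : salg G -> G A -> mG G f -> mG G g ->
  mG G (fun w => if w \in A then f w else g w).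
Proof.
move=> sG GA /(mGP _ sG) mf /(mGP _ sG) mg; apply/(mGP _ sG) => B mB.
have -> : (fun w => if w \in A then f w else g w) @^-1` B =
  (A `&` f @^-1` B) `|` (g @^-1` B `\` A).
  apply/seteqP; split=> w /=.
    case: ifPn => [/set_mem|/negP h]; first by left.
    by right; split=> // Aw; apply: h; exact: mem_set.
  by case=> -[h1 h2]; [rewrite mem_set|rewrite memNset].
by apply: sigma_setU => //; [apply: sigma_setI|apply: sigma_setD] => //; [exact: mf|exact: mg].
Qed.

Lemma mG_lim G (F : nat -> Omega -> R) f : (forall n, mG G (F n)) ->
  (forall w, F ^~ w @ \oo --> f w) -> mG G f.
Proof. by move=> mF h; split; apply: (@measurable_fun_cvg _ (g_sigma_algebraType G) _ setT F) => [n|w _]; [by case: (mF n)|exact: h]. Qed.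

Lemma mGD G f g : mG G f -> mG G g -> mG G (fun w => f w + g w).
Proof. by move=> [mf] [mg]; split; exact: measurable_funD. Qed.

Lemma mGB G f g : mG G f -> mG G g -> mG G (fun w => f w - g w).
Proof. by move=> [mf] [mg]; split; exact: measurable_funB. Qed.

Lemma mGM G f g : mG G f -> mG G g -> mG G (fun w => f w * g w).
Proof. by move=> [mf] [mg]; split; exact: measurable_funM. Qed.

Lemma mG_max G f g : mG G f -> mG G g -> mG G (fun w => Num.max (f w) (g w)).
Proof. by move=> [mf] [mg]; split; exact: measurable_maxr. Qed.

Lemma mG_min G f g : mG G f -> mG G g -> mG G (fun w => Num.min (f w) (g w)).
Proof. by move=> [mf] [mg]; split; exact: measurable_minr. Qed.

Lemma mG_comp G (f : R -> R) g : mfun f -> mG G g -> mG G (fun w => f (g w)).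
Proof. by move=> mf [mg]; split; exact: measurableT_comp. Qed.

Lemma mG_norm G f : mG G f -> mG G (fun w => `|f w|).
Proof. by apply: mG_comp; exact: normr_measurable. Qed.

End SubSigmaAlgebra.

(** * Stopping times of a right-continuous filtration *)

Section StoppingTimes.
Context {R : realType} {d : measure_display} {Omega : measurableType d}.
Variables (T : R) (Fi : R -> set (set Omega)).
Hypotheses (T0 : 0 < T) (Fs : forall t, salg (Fi t)).
Hypothesis (Fm : forall s t, s <= t -> Fi s `<=` Fi t).
Hypothesis (Frc : forall t A, (forall u, t < u -> Fi u A) -> Fi t A).
Implicit Types (tau sig : Omega -> R) (A B : set Omega) (f g : Omega -> R) (t u : R).

Definition stopt tau :=
  (forall w, 0 <= tau w <= T) /\ (forall t, Fi t [set w | tau w <= t]).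

Definition Fat tau : set (set Omega) :=
  [set A | forall t, Fi t (A `&` [set w | tau w <= t])].

Lemma mG_ray G f : salg G -> (forall c, G [set w | f w <= c]) -> mG G f.
Proof.
move=> sG h; split; apply: (measurability _ (RGenOInfty.measurableE R)) => //.
move=> _ [_ [x ->] <-]; rewrite setTI; apply: sigma_measurable => //.
have -> : f @^-1` `]x, +oo[%classic = ~` [set w | f w <= x].
  apply/seteqP; split=> w /=; rewrite in_itv /= andbT.
    by move=> h1 h2; move: h1; rewrite ltNge h2.
  by move=> /negP; rewrite -ltNge.
exact: sigma_setC.
Qed.

Lemma mG_count G (C : countType) (idx : Omega -> C) (H : C -> Omega -> R) :
  salg G -> (forall z, G [set w | idx w = z]) -> (forall z, mG G (H z)) ->
  mG G (fun w => H (idx w) w).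
Proof.
move=> sG hi hH; apply/(mGP _ sG) => B mB.
have -> : (fun w => H (idx w) w) @^-1` B =
  \bigcup_z ([set w | idx w = z] `&` H z @^-1` B).
  apply/seteqP; split=> w /=; first by move=> h; exists (idx w).
  by case=> z _ [/= -> ].
apply: sigma_bigcup_count => // z; apply: sigma_setI => //.
by move/(mGP _ sG): (hH z); apply.
Qed.

Lemma sigma_cond G A (b : bool) : salg G -> (b -> G A) -> G [set w | b /\ A w].
Proof.
move=> sG; case: b => [h|_].
  have -> : [set w | true /\ A w] = A by apply/seteqP; split=> w //= [].
  exact: h.
have -> : [set w | false /\ A w] = set0 by apply/seteqP; split=> w //= [].
by case: sG.
Qed.

Lemma stopt_ge0 tau w : stopt tau -> 0 <= tau w. Proof. by case=> /(_ w)/andP[]. Qed.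

Lemma stopt_leT tau w : stopt tau -> tau w <= T. Proof. by case=> /(_ w)/andP[]. Qed.

Lemma stopt_lt tau u : stopt tau -> Fi u [set w | tau w < u].
Proof.
case=> _ h; have -> : [set w | tau w < u] = \bigcup_n [set w | tau w <= u - n.+1%:R^-1].
  apply/seteqP; split=> w /=.
    rewrite -subr_gt0 => h1; have [n hn] := ltr_add_invr (y:=0) (x:=u - tau w) h1.
    by exists n => //=; rewrite lerBrDl -lerBrDr ltW // -[_^-1]add0r.
  move=> [n _ /=]; have : 0 < n.+1%:R^-1 :> R by rewrite invr_gt0.
  by set x := n.+1%:R^-1; lra.
apply: sigma_bigcup => // n; apply: Fm (h _).
by rewrite gerBl invr_ge0.
Qed.

Lemma stopt_rc tau : (forall w, 0 <= tau w <= T) ->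
  (forall u, Fi u [set w | tau w < u]) -> stopt tau.
Proof.
move=> h0 h; split=> // t; apply: Frc => u tu.
have [N hN] : exists N, t + N.+1%:R^-1 < u.
  by have [n hn] := ltr_add_invr tu; exists n.
have -> : [set w | tau w <= t] = \bigcap_n [set w | tau w < t + (N + n).+1%:R^-1].
  apply/seteqP; split=> w /=.
    move=> h1 n _ /=; apply: le_lt_trans h1 _; by rewrite ltrDl invr_gt0.
  move=> h1; rewrite leNgt; apply/negP => h2.
  have [n hn] := ltr_add_invr h2.
  have /= := h1 n I; rewrite ltNge => /negP; apply.
  apply: le_trans (ltW hn); rewrite lerD2l lef_pV2 ?posrE ?ltr0n // ler_nat ltnS.
  exact: leq_addl.
apply: sigma_bigcap => // n; apply: Fm (h _).
apply: le_trans (ltW hN); rewrite lerD2l lef_pV2 ?posrE ?ltr0n // ler_nat ltnS.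
exact: leq_addr.
Qed.

Lemma stopt_cst c : 0 <= c <= T -> stopt (fun=> c).
Proof.
move=> hc; split=> // t; case: (leP c t) => h.
  have -> : [set w : Omega | true] = setT by apply/seteqP.
  exact: sigma_setT.
have -> : [set w : Omega | false] = set0 by apply/seteqP; split.
by case: (Fs t).
Qed.

Lemma stopt_if A tau sig : (forall u, Fi u (A `&` [set w | tau w <= u])) ->
  (forall u, Fi u (~` A `&` [set w | sig w <= u])) ->
  (forall w, 0 <= tau w <= T) -> (forall w, 0 <= sig w <= T) ->
  stopt (fun w => if w \in A then tau w else sig w).
Proof.
move=> h1 h2 ht hs; split=> [w|t]; first by case: ifP.
have -> : [set w | (if w \in A then tau w else sig w) <= t] =
  (A `&` [set w | tau w <= t]) `|` (~` A `&` [set w | sig w <= t]).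
  apply/seteqP; split=> w /=.
    by case: ifPn => [/set_mem|/negP h]; [left|right; split=> // Aw; apply: h; exact: mem_set].
  by case=> -[h h']; [rewrite mem_set|rewrite memNset].
exact: sigma_setU.
Qed.

Lemma stopt_minC tau u : stopt tau -> mG (Fi u) (fun w => Num.min (tau w) u).
Proof.
case=> h0 h; apply: mG_ray => // c; case: (leP u c) => uc.
  have -> : [set w | Num.min (tau w) u <= c] = setT.
    by apply/seteqP; split=> // w _ /=; rewrite ge_min uc orbT.
  exact: sigma_setT.
have -> : [set w | Num.min (tau w) u <= c] = [set w | tau w <= c].
  by apply/seteqP; split=> w /=; rewrite ge_min [u <= c]leNgt uc orbF.
by apply: Fm (h c); exact: ltW.
Qed.

Lemma Fat_sigma tau : stopt tau -> salg (Fat tau).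
Proof.
move=> [h0 h]; split=> [t|A hA t|F hF t].
- by rewrite set0I; case: (Fs t).
- have -> : ([set: Omega] `\` A) `&` [set w | tau w <= t] =
    [set w | tau w <= t] `\` (A `&` [set w | tau w <= t]).
    apply/seteqP; split=> w /=; first by case=> -[_ nA] ht; split=> // -[].
    by case=> ht nA; split=> //; split=> // Aw; apply: nA.
  exact: sigma_setD.
- rewrite setI_bigcupl; apply: sigma_bigcup => // n; exact: hF.
Qed.

Lemma Fat_rc tau A : stopt tau -> (forall u, Fi u (A `&` [set w | tau w < u])) -> Fat tau A.
Proof.
move=> [h0 h] hA t; apply: Frc => u tu.
have -> : A `&` [set w | tau w <= t] = (A `&` [set w | tau w < u]) `&` [set w | tau w <= t].
  apply/seteqP; split=> w /=; last by case=> -[].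
  by case=> Aw ht; split=> //; split=> //; exact: le_lt_trans ht tu.
by apply: sigma_setI => //; apply: Fm (h t); exact: ltW.
Qed.

Lemma Fat_lt tau A u : stopt tau -> Fat tau A -> Fi u (A `&` [set w | tau w < u]).
Proof.
move=> st hA; have -> : A `&` [set w | tau w < u] =
  (A `&` [set w | tau w <= u]) `&` [set w | tau w < u].
  apply/seteqP; split=> w /=; last by case=> -[].
  by case=> Aw ht; split=> //; split=> //; exact: ltW.
by apply: sigma_setI => //; exact: stopt_lt.
Qed.

Lemma Fat_mon tau sig : stopt tau -> stopt sig -> tau <=w sig ->
  Fat tau `<=` Fat sig.
Proof.
move=> ht [h0 hs] le A hA t.
have -> : A `&` [set w | sig w <= t] =
  (A `&` [set w | tau w <= t]) `&` [set w | sig w <= t].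
  apply/seteqP; split=> w /=; last by case=> -[].
  by case=> Aw h; split=> //; split=> //; exact: le_trans (le w) h.
exact: sigma_setI.
Qed.

Lemma Fat_setT tau A : stopt tau -> Fat tau A -> Fi T A.
Proof.
move=> st /(_ T); have -> : [set w | tau w <= T] = setT.
  by apply/seteqP; split=> // w _ /=; exact: stopt_leT.
by rewrite setIT.
Qed.

(** Only values seen strictly after [tau] have to be measurable; right-continuity of the filtration
    supplies the instant [tau] itself. *)
Lemma mG_FatP tau f : stopt tau -> (forall u, mG (Fi u) (fun w => if tau w < u then f w else 0)) ->
  mG (Fat tau) f.
Proof.
move=> st h; apply/(mGP _ (Fat_sigma st)) => B mB; apply: Fat_rc => // u.
have -> : f @^-1` B `&` [set w | tau w < u] =
  ((fun w => if tau w < u then f w else 0) @^-1` B) `&` [set w | tau w < u].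
  by apply/seteqP; split=> w /= [h1 h2]; split=> //; rewrite h2 // in h1 *.
apply: sigma_setI => //; last exact: stopt_lt.
by move/(mGP _ (Fs u)): (h u); apply.
Qed.

Lemma mG_Fat_le tau f u : stopt tau -> mG (Fat tau) f ->
  mG (Fi u) (fun w => if tau w <= u then f w else 0).
Proof.
move=> st /(mGP _ (Fat_sigma st)) mf; apply/(mGP _ (Fs u)) => B mB.
have -> : (fun w => if tau w <= u then f w else 0) @^-1` B =
  (f @^-1` B `&` [set w | tau w <= u]) `|`
  [set w | (0 \in B) /\ (~` [set w | tau w <= u]) w].
  apply/seteqP; split=> w /=.
    case: ifPn => h1 h2; first by left.
    by right; split; [exact: mem_set|exact/negP].
  by case=> [[h1 ->]//|[/set_mem h1 /negP/negbTE -> //]].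
apply: sigma_setU => //; first exact: mf.
by apply: sigma_cond => // _; apply: sigma_setC => //; case: st.
Qed.

Lemma Fat_le tau sig : stopt tau -> stopt sig -> Fat tau [set w | tau w <= sig w].
Proof.
move=> st ss t.
have -> : [set w | tau w <= sig w] `&` [set w | tau w <= t] =
  [set w | Num.min (tau w) t <= Num.min (sig w) t] `&` [set w | tau w <= t].
  apply/seteqP; split=> w /= [h1 h2]; split=> //; move: h1;
    rewrite (min_idPl h2) le_min h2 andbT //.
by apply: sigma_setI => //; [apply: mG_le => //; exact: stopt_minC|case: st].
Qed.

Lemma Fat_ler tau sig : stopt tau -> stopt sig -> Fat sig [set w | tau w <= sig w].
Proof.
move=> st ss t.
have -> : [set w | tau w <= sig w] `&` [set w | sig w <= t] =
  [set w | Num.min (tau w) t <= Num.min (sig w) t] `&`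
  ([set w | sig w <= t] `&` [set w | tau w <= t]).
  apply/seteqP; split=> w /=.
    case=> h1 h2; have h3 := le_trans h1 h2.
    by rewrite (min_idPl h2) (min_idPl h3).
  by case=> h1 [h2 h3]; split=> //; move: h1; rewrite (min_idPl h2) (min_idPl h3).
by apply: sigma_setI => //; [apply: mG_le => //; exact: stopt_minC|
  apply: sigma_setI => //; [case: ss|case: st]].
Qed.

Lemma Fat_ltl tau sig : stopt tau -> stopt sig -> Fat tau [set w | tau w < sig w].
Proof.
move=> st ss; have -> : [set w | tau w < sig w] = ~` [set w | sig w <= tau w].
  by apply/seteqP; split=> w /=; rewrite ltNge => /negP.
by apply: (sigma_setC (Fat_sigma st)); exact: Fat_ler.
Qed.

Lemma Fat_ltr tau sig : stopt tau -> stopt sig -> Fat sig [set w | tau w < sig w].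
Proof.
move=> st ss; have -> : [set w | tau w < sig w] = ~` [set w | sig w <= tau w].
  by apply/seteqP; split=> w /=; rewrite ltNge => /negP.
by apply: (sigma_setC (Fat_sigma ss)); exact: Fat_le.
Qed.

Lemma stopt_min tau sig : stopt tau -> stopt sig -> stopt (fun w => Num.min (tau w) (sig w)).
Proof.
move=> st ss; split=> [w|t].
  by rewrite ge_min le_min !stopt_ge0 // stopt_leT.
have -> : [set w | Num.min (tau w) (sig w) <= t] =
  [set w | tau w <= t] `|` [set w | sig w <= t].
  by apply/seteqP; split=> w /=; rewrite ge_min => /orP.
by apply: sigma_setU => //; [case: st|case: ss].
Qed.

Lemma stopt_max tau sig : stopt tau -> stopt sig -> stopt (fun w => Num.max (tau w) (sig w)).
Proof.
move=> st ss; split=> [w|t].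
  by rewrite ge_max le_max !stopt_ge0 // !stopt_leT.
have -> : [set w | Num.max (tau w) (sig w) <= t] =
  [set w | tau w <= t] `&` [set w | sig w <= t].
  by apply/seteqP; split=> w /=; rewrite ge_max => /andP.
by apply: sigma_setI => //; [case: st|case: ss].
Qed.

Lemma stopt_mG tau : stopt tau -> mG (Fat tau) tau.
Proof.
move=> st; apply: mG_ray; first exact: Fat_sigma.
move=> c t; have -> : [set w | tau w <= c] `&` [set w | tau w <= t] =
  [set w | tau w <= Num.min c t].
  by apply/seteqP; split=> w /=; rewrite le_min => /andP.
by apply: Fm (proj2 st _); rewrite min_leR.
Qed.

(** Approximation by multiples of [1 / (n + 1)], strictly from the left; [rap] works strictly from
    the right. Strictness matters for [rap], because a right limit is not determined by the value at
    the point. *)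
Definition lap (n : nat) (x : R) : R := (Num.ceil (x * n.+1%:R) - 1)%:~R / n.+1%:R.

Definition rap (n : nat) (x : R) : R := (Num.floor (x * n.+1%:R) + 1)%:~R / n.+1%:R.

Lemma lap_lt n x : lap n x < x.
Proof. by rewrite /lap ltr_pdivrMr ?ltr0n //; case/andP: (ceil_itv (x * n.+1%:R)). Qed.

Lemma lap_ge n x : x - n.+1%:R^-1 <= lap n x.
Proof.
rewrite /lap ler_pdivlMr ?ltr0n // mulrBl mulVf ?pnatr_eq0 // intrD lerB //.
by case/andP: (ceil_itv (x * n.+1%:R)).
Qed.

Lemma rap_gt n x : x < rap n x.
Proof. by rewrite /rap ltr_pdivlMr ?ltr0n //; case/andP: (floor_itv (x * n.+1%:R)). Qed.

Lemma rap_le n x : rap n x <= x + n.+1%:R^-1.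
Proof.
rewrite /rap ler_pdivrMr ?ltr0n // mulrDl mulVf ?pnatr_eq0 // intrD lerD //.
by case/andP: (floor_itv (x * n.+1%:R)).
Qed.

Lemma inv_lt (e : R) : 0 < e -> exists N, forall n, (N <= n)%N -> n.+1%:R^-1 < e.
Proof.
move=> e0; have [N hN] := ltr_add_invr (y:=0) (x:=e) e0; exists N => n Nn.
rewrite add0r in hN; apply: le_lt_trans hN.
by rewrite lef_pV2 ?posrE ?ltr0n // ler_nat ltnS.
Qed.

Definition lcont (t : R) (g : R -> R) := forall u, t < u -> u <= T -> forall e, 0 < e ->
  exists2 h, 0 < h & forall v, t < v -> u - h < v -> v <= u -> `|g v - g u| < e.

Lemma mG_ceil G f n z : salg G -> mG G f ->
  G [set w | Num.ceil (f w * n.+1%:R) = z].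
Proof.
move=> sG mf.
have -> : [set w | Num.ceil (f w * n.+1%:R) = z] =
  [set w | (z - 1)%:~R / n.+1%:R < f w] `&` [set w | f w <= z%:~R / n.+1%:R].
  apply/seteqP; split=> w /=.
    move/eqP; rewrite ceil_eq => /andP[h1 h2].
    by rewrite ltr_pdivrMr ?ltr0n // ler_pdivlMr ?ltr0n.
  rewrite ltr_pdivrMr ?ltr0n // ler_pdivlMr ?ltr0n // => -[h1 h2].
  by apply/eqP; rewrite ceil_eq h1 h2.
by apply: sigma_setI => //; [apply: mG_lt|apply: mG_le] => //; exact: mG_cst.
Qed.

Lemma mG_floor G f n z : salg G -> mG G f ->
  G [set w | Num.floor (f w * n.+1%:R) = z].
Proof.
move=> sG mf.
have -> : [set w | Num.floor (f w * n.+1%:R) = z] =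
  [set w | z%:~R / n.+1%:R <= f w] `&` [set w | f w < (z + 1)%:~R / n.+1%:R].
  apply/seteqP; split=> w /=.
    move/eqP; rewrite floor_eq => /andP[h1 h2].
    by rewrite ler_pdivrMr ?ltr0n // ltr_pdivlMr ?ltr0n.
  rewrite ler_pdivrMr ?ltr0n // ltr_pdivlMr ?ltr0n // => -[h1 h2].
  by apply/eqP; rewrite floor_eq h1 h2.
by apply: sigma_setI => //; [apply: mG_le|apply: mG_lt] => //; exact: mG_cst.
Qed.

(** The random time [lap n (f w)] takes countably many values, so evaluation there is measurable;
    left-continuity gives the limit. *)
Lemma mG_proc G (H : R -> Omega -> R) f : salg G ->
  (forall q, mG G (H q)) -> mG G f ->
  (forall w e, 0 < e -> exists2 h, 0 < h &
     forall v, f w - h < v -> v < f w -> `|H v w - H (f w) w| < e) ->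
  mG G (fun w => H (f w) w).
Proof.
move=> sG mH mf lc.
apply: (@mG_lim _ _ _ _ (fun n w => H (lap n (f w)) w)) => [n|w].
  apply: (mG_count (idx := fun w => Num.ceil (f w * n.+1%:R))
    (H := fun z => H ((z - 1)%:~R / n.+1%:R))) => // z.
  exact: mG_ceil.
apply/cvgrPdist_lt => e e0; have [h h0 hh] := lc w e e0.
have [N hN] := inv_lt h0; exists N => // n /= Nn.
rewrite distrC; apply: hh; last exact: lap_lt.
by apply: lt_le_trans (lap_ge n _); rewrite ltrD2l ltrN2; exact: hN.
Qed.

(** The right limit at [t] is read off at [rap n (t w)], which lies before [u] for large [n]
    whenever [t w < u]; right-continuity of the filtration then makes it known at [t]. At [T] there
    is no right limit and the value is set to 0. *)
Lemma mG_rlim (t : Omega -> R) (K : R -> Omega -> R) f : stopt t ->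
  (forall u, mG (Fi u) (fun w => if t w < u then K u w else 0)) ->
  (forall w, t w < T -> exists2 e, 0 < e &
     forall u, t w < u -> u < t w + e -> u <= T -> K u w = f w) ->
  (forall w, t w = T -> f w = 0) ->
  mG (Fat t) f.
Proof.
move=> st mK hr hT; apply: mG_FatP => // u.
have mt : mG (Fi u) (fun w => if t w < u then t w else u).
  have -> : (fun w => if t w < u then t w else u) = (fun w => Num.min (t w) u).
    by apply/funext => w; rewrite minElt.
  exact: stopt_minC.
pose H z n (w : Omega) := let q := (z + 1)%:~R / n.+1%:R in
  if (q < u) && (q <= T) then (if t w < q then K q w else 0) else 0.
apply: (@mG_lim _ _ _ _ (fun n w =>
  if w \in [set w | t w < u] then H (Num.floor ((if t w < u then t w else u) * n.+1%:R)) n w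
  else 0)).
  move=> n; apply: mG_if; [exact: Fs|exact: stopt_lt| |exact: mG_cst].
  apply: (mG_count (idx := fun w => Num.floor ((if t w < u then t w else u) * n.+1%:R))
    (H := fun z => H z n)) => // z; first exact: mG_floor.
  pose q : R := (z + 1)%:~R / n.+1%:R.
  case: (boolP ((q < u) && (q <= T))) => h.
    have -> : H z n = fun w => if t w < q then K q w else 0.
      by apply/funext => w; rewrite /H -/q h.
    by apply: mG_sub (mK _) => //; apply: Fm; case/andP: h => /ltW.
  have -> : H z n = fun=> 0 by apply/funext => w; rewrite /H -/q (negbTE h).
  exact: mG_cst.
move=> w; have [tu|tu] := ltP (t w) u; last first.
  rewrite memNset; last by move=> /=; rewrite ltNge tu.
  exact: cvg_cst.
rewrite mem_set //; have [tT|tT] := ltP (t w) T; last first.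
  have -> : f w = 0 by apply: hT; apply: le_anti; rewrite tT stopt_leT.
  apply: cvg_near_cst; exists 0%N => // n _ /=; rewrite /H.
  case: ifP => // /andP[_ qT]; rewrite ltNge (le_trans qT tT) //.
have [e e0 he] := hr w tT.
have e'0 : 0 < Num.min e (Num.min (u - t w) (T - t w)).
  by rewrite !lt_min e0 !subr_gt0 tu tT.
have [N hN] := inv_lt e'0.
apply: cvg_near_cst; exists N => // n /= Nn.
have := hN n Nn; rewrite !lt_min => /and3P[h1 h2 h3].
have := rap_gt n (t w); have := rap_le n (t w); rewrite /H -/(rap n (t w)).
set q := rap n (t w); set i := n.+1%:R^-1 in h1 h2 h3 *.
move=> h4 h5; rewrite h5.
have -> : q < u by apply: le_lt_trans h4 _; rewrite -ltrBrDl.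
have qT : q <= T by apply: ltW; apply: le_lt_trans h4 _; rewrite -ltrBrDl.
rewrite qT /=; apply: he => //.
by apply: le_lt_trans h4 _; rewrite ltrD2l.
Qed.

(** [T] belongs to the set, so the infimum exists and equals [T] when [G] never becomes negative. *)
Definition hit (t : Omega -> R) (G : R -> Omega -> R) w : R :=
  inf ([set T] `|` [set u | [/\ t w < u, u <= T & G u w < 0]]).

(** By left-continuity [G] is still nonnegative at the hitting time itself; the negative values
    accumulate from the right. *)
Lemma hitP (t : Omega -> R) (G : R -> Omega -> R) w : stopt t -> lcont (t w) (G ^~ w) ->
  [/\ t w <= hit t G w, hit t G w <= T,
    (forall u, t w < u -> u <= hit t G w -> 0 <= G u w) &
    (hit t G w < T -> forall e, 0 < e -> exists u,
       [/\ hit t G w < u, u < hit t G w + e, u <= T & G u w < 0])].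
Proof.
move=> st lc; set E := [set T] `|` [set u | [/\ t w < u, u <= T & G u w < 0]].
have lbE : lbound E (t w).
  by move=> u [->|[h _ _]]; [exact: stopt_leT|exact: ltW].
have hE : has_inf E by split; [exists T; left|exists (t w)].
have iE : forall u, E u -> hit t G w <= u by move=> u Eu; apply: ge_inf => //; case: hE.
have h1 : t w <= hit t G w by apply: lb_le_inf => //; exists T; left.
have h2 : hit t G w <= T by apply: iE; left.
have h3 u : t w < u -> u <= hit t G w -> 0 <= G u w.
  move=> tu uh; rewrite leNgt; apply/negP => Gu.
  have uT : u <= T by exact: le_trans uh _.
  have Gu' : 0 < - G u w by rewrite oppr_gt0.
  have [h h0 hh] := lc u tu uT _ Gu'.
  have [v [v1 v2 v3]] : exists v, [/\ t w < v, u - h < v & v < u].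
    exists (Num.max ((t w + u) / 2) (u - h / 2)); rewrite !lt_max gt_max.
    by split; [apply/orP; left|apply/orP; right|apply/andP; split]; lra.
  have := hh v v1 v2 (ltW v3); rewrite ltr_norml => /andP[_ h3].
  have : hit t G w <= v.
    by apply: iE; right; split=> //; [rewrite (le_trans (ltW v3))|lra].
  by move=> h4; have := lt_le_trans v3 uh; rewrite ltNge h4.
split=> // hT e e0.
have e'0 : 0 < Num.min e (T - hit t G w) by rewrite lt_min e0 subr_gt0.
have [u Eu] := inf_adherent e'0 hE; rewrite -/(hit t G w) => hu.
have uT : u < T.
  by apply: lt_le_trans hu _; rewrite -lerBrDl min_leR.
have ue : u < hit t G w + e.
  by apply: lt_le_trans hu _; rewrite lerD2l min_leL.
case: Eu uT => [->|[tu _ Gu] uT]; first by rewrite ltxx.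
exists u; split=> //; last exact: ltW.
rewrite ltNge; apply/negP => uh.
by have := h3 u tu uh; rewrite leNgt Gu.
Qed.

(** A negative value of a left-continuous path persists on an interval to its left, hence is seen at
    a rational time. This describes [hit t G w < u] only, with a strict inequality, so
    right-continuity of the filtration is used. *)
Lemma hit_stopt (t : Omega -> R) (G : R -> Omega -> R) : stopt t ->
  (forall u, mG (Fi u) (fun w => if t w < u then G u w else 0)) ->
  (forall w, lcont (t w) (G ^~ w)) -> stopt (hit t G).
Proof.
move=> st mGu lc; apply: stopt_rc => [w|u].
  have [h1 h2 _ _] := hitP st (lc w); rewrite h2 andbT.
  by apply: le_trans h1; exact: stopt_ge0 st.
have [Tu|uT] := ltP T u.
  have -> : [set w | hit t G w < u] = setT.
    apply/seteqP; split=> // w _ /=; have [_ h2 _ _] := hitP st (lc w).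
    exact: le_lt_trans h2 Tu.
  exact: sigma_setT.
have -> : [set w | hit t G w < u] = \bigcup_(q : rat) [set w | (ratr q < u :> R) /\
   ([set w | t w < ratr q] `&` [set w | (if t w < ratr q then G (ratr q) w else 0) < 0]) w].
  apply/seteqP; split=> w /=; have [h1 h2 h3 h4] := hitP st (lc w).
    move=> hu; have e0 : 0 < u - hit t G w by rewrite subr_gt0.
    have [v [v1 v2 v3 Gv]] := h4 (lt_le_trans hu uT) _ e0.
    have tv : t w < v := le_lt_trans h1 v1.
    have Gv' : 0 < - G v w by rewrite oppr_gt0.
    have [h h0 hh] := lc w v tv v3 _ Gv'.
    have mv : Num.max (t w) (v - h) < v by rewrite gt_max tv ltrBlDr ltrDl.
    have [q] := rat_in_itvoo mv; rewrite in_itv /= gt_max => /andP[/andP[q1 q2] q3].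
    exists q => //=; split; first by apply: lt_trans q3 _; move: v2; rewrite addrC subrK.
    split=> //=; rewrite q1; have := hh _ q1 q2 (ltW q3).
    by rewrite ltr_norml => /andP[_]; lra.
  case=> q _ /= [qu [tq]]; rewrite tq => Gq.
  apply: le_lt_trans qu; rewrite leNgt; apply/negP => qh.
  have := h3 _ tq (ltW qh); by rewrite leNgt Gq.
apply: sigma_bigcup_count => // q; apply: sigma_cond => // qu.
apply: sigma_setI => //; apply: Fm (ltW qu) _ _; first exact: stopt_lt.
by apply: mG_lt => //; exact: mG_cst.
Qed.

Lemma stopt_sup (a : nat -> Omega -> R) : (forall n, stopt (a n)) ->
  stopt (fun w => sup (range (a ^~ w))).
Proof.
move=> sa.
have hs w : has_sup (range (a ^~ w)).
  by split; [exists (a 0 w); exists 0|exists T => _ [n _ <-]; exact: stopt_leT].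
split=> [w|t].
  apply/andP; split.
    apply: le_trans (stopt_ge0 w (sa 0)) _; apply: sup_upper_bound => //; by exists 0.
  by apply: ge_sup => [|_ [n _ <-]]; [case: (hs w)|exact: stopt_leT].
have -> : [set w | sup (range (a ^~ w)) <= t] = \bigcap_n [set w | a n w <= t].
  apply/seteqP; split=> w /=.
    move=> h n _ /=; apply: le_trans h; apply: sup_upper_bound => //; by exists n.
  by move=> h; apply: ge_sup => [|_ [n _ <-]]; [case: (hs w)|exact: h].
by apply: sigma_bigcap => // n; case: (sa n).
Qed.

Lemma stopt_inf (a : nat -> Omega -> R) : (forall n, stopt (a n)) ->
  stopt (fun w => inf (range (a ^~ w))).
Proof.
move=> sa.
have hi w : has_inf (range (a ^~ w)).
  by split; [exists (a 0 w); exists 0|exists 0 => _ [n _ <-]; exact: stopt_ge0].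
apply: stopt_rc => [w|u].
  apply/andP; split.
    by apply: lb_le_inf => [|_ [n _ <-]]; [case: (hi w)|exact: stopt_ge0].
  apply: le_trans (stopt_leT w (sa 0)); apply: ge_inf; [by case: (hi w)|by exists 0].
have -> : [set w | inf (range (a ^~ w)) < u] = \bigcup_n [set w | a n w < u].
  apply/seteqP; split=> w /=.
    move=> h; have := h; rewrite -subr_gt0 => h'.
    have [_ [n _ <-]] := inf_adherent h' (hi w); rewrite addrC subrK => h2.
    by exists n.
  case=> n _ /=; apply: le_lt_trans; apply: ge_inf; [by case: (hi w)|by exists n].
by apply: sigma_bigcup => // n; exact: stopt_lt.
Qed.

End StoppingTimes.

(** * The abstract market *)

Unset Implicit Arguments.

(* [mD] is a density process under which the price [mS] is a martingale. *)
Record market {R : realType} {d : measure_display} {Omega : measurableType d} := Market {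
  mP : probability Omega R;
  mT : R;
  mFi : R -> set (set Omega);
  mdl : R;
  mmu : R;
  mS : R -> Omega -> R;
  mX : R -> Omega -> R;
  mY : R -> Omega -> R;
  mD : R -> Omega -> R;
  mZ : Omega -> R;
  mT0 : 0 < mT;
  mFs : forall t, salg (mFi t);
  mFm : forall s t, s <= t -> mFi s `<=` mFi t;
  mFmeas : forall t, mFi t `<=` measurable;
  mFrc : forall t A, (forall u, t < u -> mFi u A) -> mFi t A;
  mdl0 : 0 < mdl;
  mmu0 : 0 < mmu;
  mmu1 : mmu < 1;
  mSc : forall w, continuous (mS ^~ w);
  mXc : forall w, continuous (mX ^~ w);
  mYc : forall w, continuous (mY ^~ w);
  mDc : forall w, continuous (mD ^~ w);
  mSa : forall t, mG (mFi t) (mS t);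
  mXa : forall t, mG (mFi t) (mX t);
  mYa : forall t, mG (mFi t) (mY t);
  mDa : forall t, mG (mFi t) (mD t);
  mS0 : forall t w, 0 < mS t w;
  mD0 : forall t w, 0 < mD t w;
  mYX : forall t w, mY t w <= mX t w;
  mXZ : forall t w, `|mX t w| <= mZ w;
  mYZ : forall t w, `|mY t w| <= mZ w;
  mIZ : Ib mP mZ;
  mDint : forall tau, stopt mT mFi tau ->
    Ib mP (fun w => mD (tau w) w) /\ Ib mP (fun w => mD (tau w) w * mS (tau w) w);
  mDmart : forall tau A, stopt mT mFi tau -> Fat mFi tau A ->
    Ex mP (fun w => \1_A w * mD (tau w) w) = Ex mP (fun w => \1_A w * mD mT w) /\
    Ex mP (fun w => \1_A w * (mD (tau w) w * mS (tau w) w)) =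
    Ex mP (fun w => \1_A w * (mD mT w * mS mT w)) }.

Arguments market R {d} Omega.
Arguments mFm {R d Omega} M [s t] : rename.
Set Implicit Arguments.

Record hedge (R : realType) (Omega : Type) :=
  Hedge { hK : R -> Omega -> R; hB : R -> Omega -> R; hs : Omega -> R }.

Ltac mg := repeat first [assumption | exact: mG_cst | apply: mGB | apply: mGD | apply: mGM
  | apply: mG_norm | apply: mG_max | apply: mG_min].

(** * Tools of real analysis and integration *)

Section HedgeTheory.
Context {R : realType} {d : measure_display} {Omega : measurableType d}.

Lemma continuous_dist (f : R -> R) u (e : R) : continuous f -> 0 < e ->
  exists2 h, 0 < h & forall v, `|v - u| < h -> `|f v - f u| < e.
Proof.
move=> cf e0; have /cvgrPdist_lt /(_ e e0) := cf u.
move=> [h /= h0 hh]; exists h => // v vu; rewrite distrC; apply: hh => /=.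
by rewrite distrC.
Qed.

Section Clamp.
Implicit Types (T u v : R).

(** The projection onto [[0, T]]. It extends processes from [[0, T]] to all real times, on which the
    fields of [market] are stated. *)
Definition cl T u : R := Num.max 0 (Num.min u T).

Lemma cl_id T u : 0 <= u -> u <= T -> cl T u = u.
Proof. by move=> u0 uT; rewrite /cl (min_idPl uT) (max_idPr u0). Qed.

Lemma cl_le0 T u : u <= 0 -> cl T u = 0.
Proof. by move=> u0; rewrite /cl (max_idPl _) // ge_min u0. Qed.

Lemma cl_ge0 T u : 0 <= cl T u. Proof. by rewrite /cl le_maxL. Qed.

Lemma cl_leT T u : 0 <= T -> cl T u <= T.
Proof. by move=> T0; rewrite /cl ge_max T0 min_leR. Qed.

Lemma cl_mono T u v : u <= v -> cl T u <= cl T v.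
Proof.
move=> uv; rewrite /cl ge_max le_maxL /= le_max le_min !ge_min lexx uv /= orbT.
by rewrite orbT.
Qed.

Lemma cl_dist T u v : 0 <= T -> `|cl T u - cl T v| <= `|u - v|.
Proof.
move=> T0; have := ler_norm (u - v); have := ler_norm (v - u); rewrite [`|v - u|]distrC.
have := normr_ge0 (u - v); rewrite /cl; set n := `|u - v|.
move=> n0 h1 h2; have [uT|Tu] := ltP u T; have [vT|Tv] := ltP v T;
  have [u0|u0] := ltP 0 u; have [v0|v0] := ltP 0 v;
  rewrite ?(max_idPr T0) ler_norml; apply/andP; split; lra.
Qed.

Lemma cl_cont T (f : R -> R) : 0 <= T -> continuous f -> continuous (fun u => f (cl T u)).
Proof.
move=> T0 cf u; apply/cvgrPdist_lt => e e0; have [h h0 hh] := continuous_dist (cl T u) cf e0.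
near=> v; rewrite distrC; apply: hh; apply: le_lt_trans (cl_dist _ _ T0) _; rewrite distrC.
by near: v; exact: cvgr_dist_lt.
Unshelve. all: by end_near. Qed.

End Clamp.

Section MoreExpectation.
Variable P : probability Omega R.
Local Notation Ex := (Ex P).
Local Notation Ib := (Ib P).
Implicit Types (f g Z U : Omega -> R) (A : set Omega) (c : R).

Lemma Ib_fatou (F : nat -> Omega -> R) f c : (forall n, Ib (F n)) -> (forall n w, 0 <= F n w) ->
  (forall n, Ex (F n) <= c) -> (forall w, F ^~ w @ \oo --> f w) -> Ib f /\ Ex f <= c.
Proof.
move=> IF F0 EF Ff.
have mf : mfun f.
  by apply: (@measurable_fun_cvg _ _ _ setT F) => [n|w _]; [exact: Ib_measurable|exact: Ff].
have f0 w : 0 <= f w.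
  have <- := cvg_lim (@Rhausdorff R) (Ff w); apply: limr_ge; first exact: cvgP (Ff w).
  by near=> n; exact: F0.
have Ff' w : (EFin \o F n) w @[n --> \oo] --> (EFin \o f) w.
  by apply: cvg_EFin; [exact: nearW|exact: Ff].
have mF n : mfun (EFin \o F n) by apply/measurable_EFinP; exact: Ib_measurable.
have fin n : (\int[P]_w (F n w)%:E = (Ex (F n))%:E)%E.
  by rewrite /Ex /Rintegral fineK //; apply: integrable_fin_num => //; exact: IF.
have F0' n w : setT w -> (0 <= (EFin \o F n) w)%E by move=> _; rewrite lee_fin.
have := @fatou _ _ _ P setT measurableT (fun n => EFin \o F n) mF F0'.
have -> : (\int[P]_(x in setT) limn_einf ((fun n => EFin \o F n) ^~ x) = \int[P]_x (f x)%:E)%E.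
  by apply: eq_integral => w _; have [-> _] := cvg_limn_einf_sup (Ff' w).
move=> h.
have {}h : (\int[P]_x (f x)%:E <= c%:E)%E.
  apply: (le_trans h); rewrite limn_einf_lim; apply: lime_le; first exact: is_cvg_einfs.
  near=> n; apply: (@le_trans _ _ (\int[P]_w (F n w)%:E)%E); last by rewrite fin lee_fin.
  by apply: ereal_inf_lbound; exists n => //=.
have If : Ib f.
  apply/integrableP; split; first exact/measurable_EFinP.
  rewrite (eq_integral (fun x => (f x)%:E)); last by move=> w _; rewrite /= ger0_norm.
  exact: le_lt_trans h (ltry _).
split=> //; rewrite -lee_fin; apply: le_trans h.
by rewrite /Ex /Rintegral fineK //; apply: integrable_fin_num.
Unshelve. all: by end_near. Qed.

Lemma Ex_sum (I : Type) (s : seq I) (F : I -> Omega -> R) : (forall i, Ib (F i)) ->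
  Ib (fun w => \sum_(i <- s) F i w) /\ Ex (fun w => \sum_(i <- s) F i w) = \sum_(i <- s) Ex (F i).
Proof.
move=> IF; elim: s => [|i s [IH1 IH2]].
  rewrite big_nil; have -> : (fun w => \sum_(i <- [::]) F i w) = fun=> 0.
    by apply/funext => w; rewrite big_nil.
  by split; [exact: Ib_cst|rewrite Ex_cst].
have -> : (fun w => \sum_(j <- i :: s) F j w) = fun w => F i w + \sum_(j <- s) F j w.
  by apply/funext => w; rewrite big_cons.
by split; [exact: IbD|rewrite big_cons ExD // IH2].
Qed.

Lemma Ex_norm f : Ib f -> `|Ex f| <= Ex (fun w => `|f w|).
Proof.
move=> If; have In : Ib (fun w => `|f w|) by exact: integrable_norm.
rewrite ler_norml; apply/andP; split; last by apply: Ex_le => // w; exact: ler_norm.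
rewrite -[X in - X]mul1r -mulNr -ExZ //; apply: Ex_le => //; first exact: IbZ.
by move=> w; rewrite mulN1r lerNl -normrN ler_norm.
Qed.

Lemma Ib_mult f g c : mfun f -> (forall w, `|f w| <= c) -> Ib g ->
  Ib (fun w => f w * g w).
Proof.
move=> mf fc Ig; apply: (@Ib_le _ _ _ _ _ (fun w => c * `|g w|)).
- by apply: measurable_funM => //; exact: Ib_measurable Ig.
- by apply: IbZ; exact: integrable_norm.
- by move=> w; rewrite normrM ler_wpM2r.
Qed.

(* A bounded multiplier is a uniform limit of multipliers with finitely many values. *)
Lemma Ex_mult0 (G : set (set Omega)) f U c : salg G -> G `<=` measurable ->
  mG G f -> (forall w, `|f w| <= c) -> Ib U ->
  (forall A, G A -> Ex (fun w => \1_A w * U w) = 0) -> Ex (fun w => f w * U w) = 0.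
Proof.
move=> sG Gm mf fc IU hU.
have mf' : mfun f by exact: mG_measurable Gm mf.
have IN : Ib (fun w => `|U w|) by exact: integrable_norm.
have ET : Ex U = 0.
  rewrite -(hU setT); last exact: sigma_setT.
  by apply: eq_Ex => w; rewrite indicT mul1r.
pose g w := f w + c.
have Ig : Ib (fun w => g w * U w).
  apply: (@Ib_mult _ _ (c + c)) => //; first by apply: measurable_funD.
  by move=> w; rewrite (le_trans (ler_normD _ _)) // lerD // ger0_norm // (le_trans _ (fc w)).
suff : Ex (fun w => g w * U w) = 0.
  have If : Ib (fun w => f w * U w) by exact: Ib_mult fc IU.
  have -> : (fun w => g w * U w) = fun w => f w * U w + c * U w.
    by apply/funext => w; rewrite /g mulrDl.
  by rewrite ExD //; [rewrite ExZ // ET mulr0 addr0|exact: IbZ].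
have g0 w : 0 <= g w by rewrite /g -lerBlDr sub0r; have := fc w; rewrite ler_norml => /andP[].
have gc w : g w <= c + c by rewrite /g lerD2r; have := fc w; rewrite ler_norml => /andP[].
have mg : mG G g by apply: mGD => //; exact: mG_cst.
apply/eqP; rewrite -normr_le0; apply/ler_addgt0Pr => e e0; rewrite add0r.
have EN0 : 0 <= Ex (fun w => `|U w|) by exact: Ex_ge0.
have [n hn] : exists n, n.+1%:R^-1 < e / (Ex (fun w => `|U w|) + 1).
  have h0 : 0 < e / (Ex (fun w => `|U w|) + 1) by rewrite divr_gt0 // ltr_wpDl.
  by have [n h] := inv_lt h0; exists n; exact: h.
have n0 : (0 : R) < n.+1%:R by rewrite ltr0n.
pose q w : nat := Num.truncn (g w * n.+1%:R).
have qP w : (q w)%:R <= g w * n.+1%:R < (q w).+1%:R.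
  by apply: truncn_itv; rewrite mulr_ge0.
pose A i := [set w | q w = i].
have GA i : G (A i).
  have -> : A i = [set w | i%:R / n.+1%:R <= g w] `&` [set w | g w < i.+1%:R / n.+1%:R].
    apply/seteqP; split=> w /=.
      by move=> <-; rewrite ler_pdivrMr // ltr_pdivlMr //; case/andP: (qP w).
    rewrite ler_pdivrMr // ltr_pdivlMr // => -[h1 h2].
    rewrite /A /=; apply/eqP; rewrite /q truncn_eq ?mulr_ge0 // h1 h2 //.
  by apply: sigma_setI => //; [apply: mG_le|apply: mG_lt] => //; exact: mG_cst.
pose K := (Num.truncn ((c + c) * n.+1%:R)).+1.
have qK w : (q w < K)%N by rewrite ltnS; apply: le_truncn; rewrite ler_pM2r.
pose gn w : R := \sum_(i < K) (i%:R / n.+1%:R) * \1_(A i) w.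
have gnE w : gn w = (q w)%:R / n.+1%:R.
  rewrite /gn (bigD1 (Ordinal (qK w))) //= indicE mem_set // mulr1 big1 ?addr0 // => i iq.
  rewrite indicE memNset ?mulr0 // /A /= => h; move: iq; rewrite -val_eqE /= -h eqxx //.
have IFi i : Ib (fun w => i%:R / n.+1%:R * (\1_(A i) w * U w)).
  by apply: IbZ; apply: Ib_indic => //; exact: Gm.
have [In En] := @Ex_sum _ (index_enum 'I_K) (fun i w => i%:R / n.+1%:R * (\1_(A i) w * U w)) IFi.
have eqn : (fun w => gn w * U w) = fun w => \sum_(i < K) i%:R / n.+1%:R * (\1_(A i) w * U w).
  by apply/funext => w; rewrite /gn mulr_suml; apply: eq_bigr => i _; rewrite mulrA.
have E0 : Ex (fun w => gn w * U w) = 0.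
  rewrite eqn En big1 // => i _; rewrite ExZ ?hU ?mulr0 //.
  by apply: Ib_indic => //; exact: Gm.
have -> : Ex (fun w => g w * U w) = Ex (fun w => g w * U w - gn w * U w).
  by rewrite ExB // ?eqn // -eqn E0 subr0.
apply: le_trans (Ex_norm _) _; first by apply: IbB => //; rewrite eqn.
apply: (@le_trans _ _ (Ex (fun w => n.+1%:R^-1 * `|U w|))).
  apply: Ex_le; [|exact: IbZ|].
    by apply: integrable_norm; apply: IbB => //; rewrite eqn.
  move=> w; rewrite -mulrBl normrM ler_wpM2r // gnE.
  have /andP[h1 h2] := qP w.
  rewrite ger0_norm; last by rewrite subr_ge0 ler_pdivrMr.
  by rewrite lerBlDr -[X in X + _]mul1r -mulrDl nat1r ltW // ltr_pdivlMr.
rewrite ExZ //; move: hn; rewrite ltr_pdivlMr; last by rewrite ltr_wpDl.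
rewrite mulrDr mulr1; have : 0 <= n.+1%:R^-1 :> R by rewrite invr_ge0.
by set x := n.+1%:R^-1; set y := _ * _; lra.
Qed.

End MoreExpectation.

Section UniformContinuity.
Implicit Types (f : R -> R) (u v c : R).

(** Near the supremum of the admissible right ends [f] oscillates by less than [c], so the
    admissible interval can be extended unless it already ends at [T]. *)
Lemma unif_cont_itv f (T : R) c : 0 <= T -> continuous f -> 0 < c ->
  exists2 l : R, 0 < l & forall u v, 0 <= u -> u <= T -> 0 <= v -> v <= T -> `|u - v| <= l ->
    `|f u - f v| <= c.
Proof.
move=> T0 cf c0.
pose E := [set x | [/\ 0 <= x, x <= T & exists2 l : R, 0 < l &
  forall u v, 0 <= u -> u <= x -> 0 <= v -> v <= x -> `|u - v| <= l -> `|f u - f v| <= c]].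
have E0 : E 0.
  split=> //; exists 1 => // u v u0 u1 v0 v1 _.
  have -> : u = v by apply: le_anti; rewrite (le_trans u1) // (le_trans v1).
  by rewrite subrr normr0 ltW.
have hE : has_sup E by split; [exists 0|exists T => x []].
have c20 : 0 < c / 2 by rewrite divr_gt0.
have [h h0 hh] := continuous_dist (sup E) cf c20.
have h20 : 0 < h / 2 by rewrite divr_gt0.
have [x [x0 xT [l l0 hl]] sx] := sup_adherent h20 hE.
pose y := Num.min T (sup E + h / 2).
have xs : x <= sup E by apply: sup_upper_bound => //; split=> //; exists l.
have xy : x <= y by rewrite /y le_min xT /= (le_trans xs) // lerDl ltW.
have yE : E y.
  split; [exact: le_trans xy|by rewrite min_leL|].
  exists (Num.min l (h / 4)); first by rewrite lt_min l0 divr_gt0.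
  have ys : y <= sup E + h / 2 by rewrite min_leR.
  move=> u v u0 uy v0 vy; rewrite le_min => /andP[uvl uvh].
  have [/andP[ux vx]|] := boolP ((u <= x) && (v <= x)); first exact: hl.
  rewrite negb_and -!ltNge => uvx; move: uvh; rewrite ler_norml => /andP[uv1 uv2].
  have [u1 v1] : sup E - h < u /\ sup E - h < v by case/orP: uvx => uvx; split; lra.
  have /hh : `|u - sup E| < h by rewrite ltr_norml; apply/andP; split; lra.
  have /hh : `|v - sup E| < h by rewrite ltr_norml; apply/andP; split; lra.
  rewrite !ltr_norml ler_norml => /andP[? ?] /andP[? ?]; apply/andP; split; lra.
have yT : y = T.
  apply: le_anti; rewrite min_leL /=; rewrite /y le_min lexx /=.
  have := sup_upper_bound hE yE; rewrite {1}/y ge_min => /orP[|]; last by lra.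
  by move=> h1; rewrite (le_trans h1) // lerDl ltW.
by case: yE; rewrite yT.
Qed.

Lemma bounded_itv f (T : R) : 0 <= T -> continuous f ->
  exists2 c, 0 < c & forall u, 0 <= u -> u <= T -> `|f u| <= c.
Proof.
move=> T0 cf.
have [l l0 hl] := unif_cont_itv T0 cf ltr01.
have cf' : {within `[0, T], continuous (fun x => `|f x|)}.
  by apply: continuous_subspaceT => x; apply: cvg_norm; exact: cf.
have [c _ hc] := EVT_max T0 cf'; exists (`|f c| + 1); first by rewrite ltr_wpDl.
move=> u u0 uT; rewrite (le_trans (hc u _)) ?lerDl //.
by rewrite in_itv /= u0.
Qed.

Lemma continuous_rat f u c : continuous f -> c < f u ->
  exists2 e : R, 0 < e & forall v, `|v - u| < e -> c < f v.
Proof.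
move=> cf; rewrite -subr_gt0 => fu; have [h h0 hh] := continuous_dist u cf fu.
exists h => // v /hh; rewrite ltr_norml => /andP[h1 _]; move: h1; lra.
Qed.

Lemma rat_near u e : 0 < e -> exists q : rat, `|ratr q - u| < e :> R.
Proof.
move=> e0; have ue : u - e < u + e by lra.
have [q] := rat_in_itvoo ue; rewrite in_itv /= => /andP[h1 h2]; exists q.
by rewrite ltr_norml; apply/andP; split; lra.
Qed.

End UniformContinuity.

(** The errors are geometric so that infinitely many of them telescope, as in
    [3 * hf N - 2 * hf (N + i)]. *)
Definition hf (m : nat) : R := 2^-1 ^+ m.

Lemma hf_gt0 m : 0 < hf m :> R. Proof. by rewrite exprn_gt0 // invr_gt0. Qed.

Lemma hfS m : hf m.+1 = hf m / 2 :> R. Proof. by rewrite /hf exprSr. Qed.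

Lemma hf_arith (N n : nat) : 6 * hf n + (6 * hf N - 6 * hf n) <= 12 * hf N :> R.
Proof. by have := hf_gt0 N; set x := hf N; set y := hf _; lra. Qed.

Lemma hf_arith2 (x y : R) : 3 * y + (6 * x - 6 * y) <= 6 * x - 6 * (y / 2).
Proof. lra. Qed.

Lemma hf_arith3 (x y v : R) : 3 * x - 2 * y <= 3 * v ->
  3 * x + (- (2 * y) + (v + (v + v))) <= 6 * v.
Proof. lra. Qed.

Lemma hf_arith4 (x y v : R) : x <= v -> 0 < y -> 3 * x - 2 * y <= 3 * v.
Proof. lra. Qed.

Lemma hf_arith5 (v : R) : v + (v + v) <= 3 * v.
Proof. lra. Qed.

Lemma hf_mono m n : (m <= n)%N -> hf n <= hf m :> R.
Proof.
move/subnK => <-; elim: (n - m)%N => // i IH; rewrite addSn hfS; apply: le_trans IH.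
by have := hf_gt0 (i + m); set x := hf _; lra.
Qed.

Lemma hf_small (e : R) : 0 < e -> exists N, forall n, (N <= n)%N -> hf n < e.
Proof.
move=> e0; have [N hN] := inv_lt e0; exists N => n Nn; apply: le_lt_trans (hN N (leqnn N)).
apply: le_trans (hf_mono Nn) _; rewrite /hf exprVn lef_pV2 ?posrE ?exprn_gt0 ?ltr0n //.
by rewrite -natrX ler_nat; exact: ltn_expl.
Qed.

(** * Perturbation of states and limits of trades *)

Section Closeness.
Variables (delta mu : R).
Hypotheses (delta0 : 0 < delta) (mu0 : 0 < mu) (mu1 : mu < 1).
Local Notation liq := (liq delta mu).
Local Notation trade := (trade delta mu).
Local Notation action_cost := (action_cost delta mu).
Implicit Types (k b p C c g e : R).

Lemma action_cost_lip b b' p p' : 0 <= p -> 0 <= p' ->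
  action_cost b p - action_cost b' p' <= `|b - b'| * p + `|b'| * `|p - p'|.
Proof.
move=> p0 p'0.
have r0 : 0 <= `|b - b'| * p + `|b'| * `|p - p'| by rewrite addr_ge0 // mulr_ge0.
rewrite lerBlDr action_cost_le; apply/andP; split.
  by rewrite -[leLHS]add0r lerD // action_cost_delta.
have h1 : `|b| <= `|b'| + `|b - b'| by rewrite -{1}[b](subrK b') addrC ler_normD.
have h2 : `|b'| * (p - p') <= `|b'| * `|p - p'| by rewrite ler_wpM2l // ler_norm.
have h3 : `|b| * p <= (`|b'| + `|b - b'|) * p by rewrite ler_wpM2r.
have h4 : mu * (`|b| * p) <= mu * (`|b'| * p') + (`|b - b'| * p + `|b'| * `|p - p'|).
  have h5 : `|b| * p <= `|b'| * p' + (`|b - b'| * p + `|b'| * `|p - p'|).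
    by move: h2 h3; rewrite mulrDl mulrBr; lra.
  apply: le_trans (ler_wpM2l (ltW mu0) h5) _; rewrite mulrDr lerD2l.
  by rewrite ler_piMl // ltW.
rewrite -mulrA; apply: (le_trans h4); rewrite addrC lerD2l mulrA.
exact: action_cost_prop.
Qed.

Lemma ler_mulC (x y a c : R) : 0 <= y -> `|x| <= a -> y <= c -> x * y <= a * c.
Proof.
move=> y0 xa yc; apply: le_trans (ler_norm _) _; rewrite normrM [`|y|]ger0_norm //.
by apply: ler_pM.
Qed.

(** The state [(ks, bs)] pays exactly the cost of moving from [b] to [bs] at the price [p0]; an
    actual trade to a nearby position at a nearby price cannot leave noticeably more cash. Here
    [2 * C + g] bounds the shares moved by the actual trade. *)
Lemma trade_near k b kr br ks bs p0 p1 C g c : trade k b kr br p1 ->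
  ks = k - (bs - b) * p0 - action_cost (bs - b) p0 -> 0 <= p0 -> 0 <= p1 -> p0 <= C ->
  `|b| <= C -> `|bs| <= C -> `|br - bs| <= g -> `|p1 - p0| <= c ->
  kr <= ks + (2 * C * g + 2 * (2 * C + g) * c).
Proof.
rewrite /trade => tr -> p00 p10 p0C bC bsC brs pc.
have g0 : 0 <= g := le_trans (normr_ge0 _) brs.
have brC : `|br - b| <= 2 * C + g.
  have -> : br - b = (br - bs) + bs - b by ring.
  have := ler_normB (br - bs + bs) b; have := ler_normD (br - bs) bs.
  by move: bC bsC brs; set x := `|b|; set y := `|bs|; set v := `|br - bs|; lra.
have h1 := @action_cost_lip (bs - b) (br - b) p0 p1 p00 p10.
have e1 : bs - b - (br - b) = bs - br by ring.
rewrite e1 distrC [`|p0 - p1|]distrC in h1.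
have h2 : `|br - bs| * p0 <= g * C by apply: ler_pM.
have h3 : `|br - b| * `|p1 - p0| <= (2 * C + g) * c by apply: ler_pM.
have h4 : (bs - br) * p0 <= g * C by apply: ler_mulC => //; rewrite distrC.
have h5 : (br - b) * (p0 - p1) <= (2 * C + g) * c.
  apply: le_trans (ler_norm _) _; rewrite normrM [`|p0 - p1|]distrC; exact: h3.
by move: tr h1 h2 h3 h4 h5; set x := action_cost _ _; set y := action_cost _ _; lra.
Qed.

Lemma trade_near2 kr br ks bs k2 b2 p C g e : trade kr br k2 b2 p -> kr <= ks + e ->
  `|br - bs| <= g -> 0 <= p -> p <= C -> trade ks bs (k2 - (e + 2 * C * g)) b2 p.
Proof.
rewrite /trade => tr krs brs p0 pC.
have h1 := @action_cost_lip (b2 - bs) (b2 - br) p p p0 p0.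
have e1 : b2 - bs - (b2 - br) = br - bs by ring.
rewrite e1 subrr normr0 mulr0 addr0 in h1.
have h2 : `|br - bs| * p <= g * C by apply: ler_pM.
have h4 : (br - bs) * p <= g * C by apply: ler_mulC.
by move: tr krs h1 h2 h4; set x := action_cost _ _; set y := action_cost _ _; lra.
Qed.

(** The liquidation cost drops to zero at an empty position, so [liq] is only upper semicontinuous
    in the position. A nonzero [bs] must therefore be approached by nonzero [br], while a zero [bs]
    may be approached in any way. *)
Lemma liq_near kr br ks bs p C g e : kr <= ks + e -> `|br - bs| <= g -> (bs != 0 -> br != 0) ->
  0 <= p -> p <= C -> liq kr br p <= liq ks bs p + (e + 2 * C * g).
Proof.
move=> krs brs nz p0 pC; rewrite /liq.
have h4 : (br - bs) * p <= g * C by apply: ler_mulC.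
have h2 : `|br - bs| * p <= g * C by apply: ler_pM.
have : tcost delta mu bs p <= tcost delta mu br p + g * C.
  have [->|bs0] := eqVneq bs 0.
    by rewrite tcost0 addr_ge0 ?tcost_ge0 //; apply: le_trans h2; rewrite mulr_ge0.
  rewrite !tcost_neq0 ?nz // -lerBlDl.
  have := @action_cost_lip bs br p p p0 p0; rewrite subrr normr0 mulr0 addr0 distrC.
  by move=> h; apply: le_trans h2.
by move: krs h4; set x := tcost _ _ _ _; set y := tcost _ _ _ _; lra.
Qed.

End Closeness.

(** The position after the limiting action is such an upper limit: it exists on every path and
    depends measurably on it, whereas a convergent subsequence would vary with the path. *)
Lemma limsup_exists (u : nat -> R) (C : R) : (forall j, `|u j| <= C) ->
  exists l : R, (forall e : R, 0 < e -> exists n, forall j, (n <= j)%N -> u j <= l + e) /\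
    (forall e : R, 0 < e -> forall n, exists2 j, (n <= j)%N & l - e <= u j).
Proof.
move=> uC; pose A := [set x : R | exists n, forall j, (n <= j)%N -> u j <= x].
have hA : has_inf A.
  split; first by exists C, 0%N => j _; exact: le_trans (ler_norm _) (uC j).
  exists (- C) => x [n /(_ n (leqnn n))]; apply: le_trans.
  by have := uC n; rewrite ler_norml => /andP[].
exists (inf A); split=> e e0.
  have [x [n hn] xe] := inf_adherent e0 hA.
  by exists n => j nj; exact: le_trans (hn j nj) (ltW xe).
move=> n; apply: contrapT => hn.
have : A (inf A - e).
  exists n => j nj; rewrite leNgt; apply/negP => h; apply: hn; exists j => //; exact: ltW.
by move/(ge_inf (proj2 hA)); lra.
Qed.

(** Solvency passes to the limit because [liq] is upper semicontinuous; [trade_near] compares the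
    cash and [liq_near] the liquidation values. *)
Lemma trade_limit (delta mu k b p0 bs : R) : 0 < delta -> 0 < mu -> mu < 1 -> 0 < p0 ->
  (forall g : R, 0 < g -> exists kr br p1 : R, [/\ 0 < p1, trade delta mu k b kr br p1,
     0 <= liq delta mu kr br p1 & [/\ `|br - bs| <= g, `|p1 - p0| <= g & bs != 0 -> br != 0]]) ->
  0 <= liq delta mu (k - (bs - b) * p0 - action_cost delta mu (bs - b) p0) bs p0.
Proof.
move=> dl0 m0 m1 pp0 H; set ks := k - _ - _.
pose C := p0 + 1 + `|b| + `|bs|.
have [bC bsC p0C] : [/\ `|b| <= C, `|bs| <= C & p0 + 1 <= C].
  by rewrite /C; have := normr_ge0 b; have := normr_ge0 bs; split; lra.
have C0 : 0 < C by lra.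
apply/ler_addgt0Pl => e e0.
pose g : R := Num.min 1 (e / (10 * C + 2)).
have C10 : 0 < 10 * C + 2 by lra.
have g0 : 0 < g by rewrite lt_min ltr01 divr_gt0.
have g1 : g <= 1 by rewrite min_leL.
have ge : g * (10 * C + 2) <= e by rewrite -ler_pdivlMr // min_leR.
have [kr [br [p1 [p10 tr l0 [brs pp nz]]]]] := H g g0.
have p1C : p1 <= C.
  by apply: le_trans p0C; move: pp; rewrite ler_norml => /andP[_]; lra.
have h1 := trade_near m0 m1 tr (erefl ks) (ltW pp0) (ltW p10) (le_trans _ p0C) bC bsC brs pp.
have h2 := liq_near dl0 m0 m1 (h1 _) brs nz (ltW p10) p1C.
have h3 := le_trans (ler_norm _) (liq_cont delta m0 m1 ks bs p10 pp0).
have h4 : 2 * `|bs| * `|p1 - p0| <= 2 * C * g.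
  by apply: ler_pM => //; rewrite ler_pM2l ?ltr0n.
have h5 : p0 <= p0 + 1 by rewrite lerDl.
have h6 : g * g <= g by rewrite ler_piMl // ltW.
move: (h2 h5) h3 h4 h6 ge l0; set x := liq _ _ kr _ _; set y := liq _ _ ks _ p1.
set v := liq _ _ ks _ p0; move=> {h2 h1 H tr}; set nn := 2 * `|bs| * _.
by lra.
Qed.

(** Each trade lowers the wealth at the fixed price [p] by at least [delta / 2], while solvency at
    the nearby price [q n] keeps that wealth nonnegative. The tolerance [mu / 4] keeps the price
    error below the proportional cost in both estimates. *)
Lemma trades_finite (delta mu p : R) (k b q : nat -> R) : 0 < delta -> 0 < mu -> mu < 1 ->
  0 < p -> (forall n, trade delta mu (k n) (b n) (k n.+1) (b n.+1) (q n)) ->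
  (forall n, 0 < q n) -> (forall n, 0 <= liq delta mu (k n.+1) (b n.+1) (q n)) ->
  (forall n, `|q n - p| <= mu / 4 * p) -> False.
Proof.
move=> dl0 mu0 mu1 p0 tr q0 lq qp.
have e0 : 0 <= mu / 4 by rewrite divr_ge0 // ltW.
have e1 : mu / 4 <= 1 by lra.
have mm : mu * mu <= mu by rewrite ler_piMr // ltW.
have pos n : 0 <= k n.+1 + b n.+1 * p.
  have h1 := liq_wealth_ge0 (ltW (q0 n)) (lq n).
  have h2 : b n.+1 * (q n - p) <= `|b n.+1| * (mu / 4 * p).
    by apply: le_trans (ler_norm _) _; rewrite normrM ler_wpM2l.
  have h3 : mu * `|b n.+1| * ((1 - mu / 4) * p) <= mu * `|b n.+1| * q n.
    apply: ler_wpM2l; first by rewrite mulr_ge0 // ltW.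
    by move: (qp n); rewrite ler_norml => /andP[]; lra.
  have h4 : 0 <= `|b n.+1| * p by rewrite mulr_ge0 // ltW.
  have h5 := ler_wpM2l h4 mm.
  have h6 : 0 <= mu * (`|b n.+1| * p) by rewrite mulr_ge0 // ltW.
  by move: h1 h2 h3 h5 h6; rewrite mulrBr; set x := `|b n.+1|; lra.
have drop n : k n.+1 + b n.+1 * p <= k n + b n * p - delta / 2.
  have := trade_window mu0 (tr n) p0 e0 e1 (qp n).
  set c := `|_|; have c0 : 0 <= c by exact: normr_ge0.
  have h1 : delta <= Num.max delta (mu * (1 - mu / 4) * p * c) by rewrite le_maxL.
  have h2 : mu * (1 - mu / 4) * p * c <= Num.max delta (mu * (1 - mu / 4) * p * c).
    by rewrite le_maxR.
  have pc : 0 <= p * c by rewrite mulr_ge0 // ltW.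
  have h3 := ler_wpM2r pc mm.
  have h4 : 0 <= mu * (p * c) by rewrite mulr_ge0 // ltW.
  by move: h1 h2 h3 h4; set m := Num.max _ _; lra.
have dropn n : k n + b n * p <= k 0%N + b 0%N * p - n%:R * (delta / 2).
  elim: n => [|n IH]; first by rewrite mul0r subr0.
  by rewrite -natr1 mulrDl mul1r; have := drop n; move: IH; set x := n%:R * _; lra.
have d20 : 0 < delta / 2 by rewrite divr_gt0.
have := truncnS_gt ((k 0%N + b 0%N * p) / (delta / 2)); set n := Num.trunc _.
rewrite ltr_pdivrMr // => h; have := le_trans (pos n) (dropn n.+1).
by rewrite subr_ge0 leNgt h.
Qed.

(** * Hedges from a node and their risk *)

Section Hedges.
Variable M : market R Omega.
Local Notation P := (mP M).
Local Notation T := (mT M).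
Local Notation Fi := (mFi M).
Local Notation dl := (mdl M).
Local Notation mu := (mmu M).
Local Notation S := (mS M).
Local Notation X := (mX M).
Local Notation Y := (mY M).
Local Notation Z := (mZ M).
Local Notation liq := (liq dl mu).
Local Notation trade := (trade dl mu).
Local Notation legal := (legal T dl mu).
Local Notation stopt := (stopt T Fi).
Local Notation Fat := (Fat Fi).
Local Notation Ex := (Ex P).
Local Notation Ib := (Ib P).
Local Notation hdg := (hedge R Omega).
Local Notation lq k b t w := (liq (k w) (b w) (S (t w) w)).
Implicit Types (t a tau sig k b ks bs al : Omega -> R) (A : set Omega) (h g : hdg) (u v e c : R) (w : Omega).

Definition Vh h u w := liq (hK h u w) (hB h u w) (S u w).

(** Solvency holds on all paths, not almost surely, and up to [t] the path shows the node state.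
    Hedges from different nodes can then be pasted and compared without exceptional sets. *)
Record isH t k b h : Prop := IsH {
  isH_st : stopt t;
  isH_k : mG (Fat t) k;
  isH_b : mG (Fat t) b;
  isH_Kad : forall u, mG (Fi u) (fun w => if t w < u then hK h u w else 0 : R);
  isH_Bad : forall u, mG (Fi u) (fun w => if t w < u then hB h u w else 0 : R);
  isH_pre : forall w u, u <= t w -> hK h u w = k w /\ hB h u w = b w;
  isH_leg : forall w, exists n, legal (S ^~ w) n (t w) (k w) (b w) (hK h ^~ w) (hB h ^~ w);
  isH_adm : forall w u, t w <= u -> u <= T -> 0 <= Vh h u w;
  isH_s : stopt (hs h);
  isH_ts : forall w, t w <= hs h w }.

(** At a tie [Y] is paid, as in [shortfall_given]. After the node the value is nonnegative by
    solvency, so the cost is at most [Z] ([cost_leZ]). *)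
Definition cost h tau w : R :=
  if hs h w < tau w then Num.max (X (hs h w) w - Vh h (hs h w) w) 0
  else Num.max (Y (tau w) w - Vh h (tau w) w) 0.

Definition J A h tau : R := Ex (fun w => \1_A w * cost h tau w).

(** The adversary starts at the node, and the risk is localized to an event [A]. On events known at
    [t] it is additive in [A] ([rho_split]), which is the basis of all pasting arguments. *)
Definition rho t A h : R :=
  sup [set J A h tau | tau in [set tau | stopt tau /\ forall w, t w <= tau w]].

Lemma Z0 w : 0 <= Z w. Proof. exact: le_trans (normr_ge0 _) (mXZ M 0 w). Qed.

Lemma S_ge0 u w : 0 <= S u w. Proof. exact/ltW/mS0. Qed.

Lemma stoptT : stopt (fun=> T).
Proof. by apply: stopt_cst; [exact: mFs|rewrite ltW ?mT0 /=]. Qed.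

Lemma Fat_measurable t A : stopt t -> Fat t A -> measurable A.
Proof. by move=> st hA; apply: (mFmeas M T); apply: Fat_setT st hA. Qed.

Lemma stopt_meas t : stopt t -> mG (Fi T) t.
Proof.
move=> st; apply: mG_ray => [|c]; first exact: mFs.
have [cT|Tc] := leP c T; first by apply: (mFm M cT); case: st.
have -> : [set w | t w <= c] = setT.
  by apply/seteqP; split=> // w _ /=; apply: le_trans (ltW Tc); exact: stopt_leT st.
exact: (sigma_setT (mFs M T)).
Qed.

Lemma mG_FatT t (f : Omega -> R) : stopt t -> mG (Fat t) f -> mG (Fi T) f.
Proof.
move=> st; apply: mG_sub; [exact: Fat_sigma (mFs M) _ st|exact: mFs|].
by move=> A; exact: Fat_setT.
Qed.

Lemma mG_FiT (f : Omega -> R) : mG (Fi T) f -> mfun f.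
Proof. exact: (mG_measurable (mFs M T) (mFmeas M T)). Qed.

Lemma isH_KT t k b h u : isH t k b h -> u <= T -> mG (Fi T) (hK h u).
Proof.
move=> hh uT; have -> : hK h u = fun w => if w \in [set w | t w < u]
    then (if t w < u then hK h u w else 0) else k w.
  apply/funext => w; case: ifPn => [/set_mem /= -> //|]; rewrite notin_setE /= => /negP.
  by rewrite -leNgt => ut; case: (isH_pre hh ut).
have st := isH_st hh.
apply: mG_if; [exact: mFs| | |exact: mG_FatT st (isH_k hh)].
  by apply: (mFm M uT); apply: stopt_lt st; [exact: mFs|exact: mFm].
exact (mG_sub (mFs M u) (mFs M T) (mFm M uT) (isH_Kad hh u)).
Qed.

Lemma isH_BT t k b h u : isH t k b h -> u <= T -> mG (Fi T) (hB h u).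
Proof.
move=> hh uT; have -> : hB h u = fun w => if w \in [set w | t w < u]
    then (if t w < u then hB h u w else 0) else b w.
  apply/funext => w; case: ifPn => [/set_mem /= -> //|]; rewrite notin_setE /= => /negP.
  by rewrite -leNgt => ut; case: (isH_pre hh ut).
have st := isH_st hh.
apply: mG_if; [exact: mFs| | |exact: mG_FatT st (isH_b hh)].
  by apply: (mFm M uT); apply: stopt_lt st; [exact: mFs|exact: mFm].
exact (mG_sub (mFs M u) (mFs M T) (mFm M uT) (isH_Bad hh u)).
Qed.

Lemma mG_tcost (G : set (set Omega)) (f g : Omega -> R) : salg G -> mG G f -> mG G g ->
  mG G (fun w => tcost dl mu (f w) (g w)).
Proof.
move=> sG mf mg.
have -> : (fun w => tcost dl mu (f w) (g w)) = fun w => if w \in [set w | f w = 0] then 0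
   else Num.max dl (mu * `|f w| * g w).
  apply/funext => w; rewrite /tcost; case: eqVneq => h.
    by rewrite mem_set.
  by rewrite memNset //=; apply/eqP.
apply: mG_if => //; first exact (mG_eq sG mf (mG_cst _ _)).
apply: mG_max; first exact: mG_cst.
by apply: mGM => //; apply: mGM; [exact: mG_cst|exact: mG_norm].
Qed.

Lemma mG_liq (G : set (set Omega)) (f g p : Omega -> R) : salg G -> mG G f -> mG G g -> mG G p ->
  mG G (fun w => liq (f w) (g w) (p w)).
Proof.
move=> sG mf mg mp; apply: mGB; last exact: mG_tcost.
by apply: mGD => //; exact: mGM.
Qed.

Lemma liq_left u w (e k b : R) : 0 < e -> exists2 h, 0 < h & forall v, `|v - u| < h ->
  `|liq k b (S v w) - liq k b (S u w)| < e.
Proof.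
move=> e0; have c0 : 0 < e / (2 * `|b| + 1).
  by rewrite divr_gt0 // ltr_wpDl // mulr_ge0.
have [h h0 hh] := continuous_dist u (mSc M w) c0; exists h => // v vu.
apply: (le_lt_trans (liq_cont dl (mmu0 M) (mmu1 M) k b (mS0 M v w) (mS0 M u w))).
have := hh v vu; rewrite ltr_pdivlMr ?ltr_wpDl // ?mulr_ge0 // mulrDr mulr1.
by rewrite mulrC; have := normr_ge0 (S v w - S u w); lra.
Qed.

Lemma V_left t k b h w u (e : R) : isH t k b h -> u <= T -> 0 < e -> exists2 h', 0 < h' &
  forall v, u - h' < v -> v <= u -> `|Vh h v w - Vh h u w| < e.
Proof.
move=> hh uT e0.
have [e1 e10 h1] : exists2 e1, 0 < e1 & forall v, u - e1 < v -> v <= u ->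
  hK h v w = hK h u w /\ hB h v w = hB h u w.
  have [ut|tu] := leP u (t w).
    exists 1 => // v _ vu; have [-> ->] := isH_pre hh ut.
    exact: isH_pre hh _ _ (le_trans vu ut).
  have [n leg] := isH_leg hh w; have [e1 e10 h1] := legal_lconst leg tu uT.
  exists (Num.min e1 (u - t w)); first by rewrite lt_min e10 subr_gt0.
  move=> v; rewrite ltrBlDr -ltrBlDl lt_min => /andP[v1 v2] vu.
  by apply: h1 => //; lra.
have [h2 h20 hh2] := liq_left u w (hK h u w) (hB h u w) e0.
exists (Num.min e1 h2); first by rewrite lt_min e10.
move=> v; rewrite ltrBlDr -ltrBlDl lt_min => /andP[v1 v2] vu.
have [||eK eB] := h1 v; [lra|by []|].
rewrite /Vh eK eB; apply: hh2; rewrite ler0_norm; lra.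
Qed.

Lemma mG_cproc (H : R -> Omega -> R) tau : (forall w, continuous (H ^~ w)) ->
  (forall u, mG (Fi u) (H u)) -> stopt tau -> mG (Fi T) (fun w => H (tau w) w).
Proof.
move=> cH aH st.
have -> : (fun w => H (tau w) w) = (fun w => H (Num.min (tau w) T) w).
  by apply/funext => w; rewrite (min_idPl (stopt_leT w st)).
apply: (mG_proc (H := fun u w => H (Num.min u T) w)) => [|q||w e e0].
- exact: mFs.
- by apply: (mG_sub (mFs M _) (mFs M T) _ (aH _)); apply: (mFm M); rewrite min_leR.
- exact: stopt_meas.
have [h h0 hh] := continuous_dist (Num.min (tau w) T) (cH w) e0.
exists h => // v v1 v2; apply: hh; rewrite (min_idPl (stopt_leT w st)).
rewrite (min_idPl _); last by apply: le_trans (ltW v2) (stopt_leT w st).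
by rewrite ler0_norm; lra.
Qed.

Lemma V_meas t k b h tau : isH t k b h -> stopt tau -> mG (Fi T) (fun w => Vh h (tau w) w).
Proof.
move=> hh st.
have -> : (fun w => Vh h (tau w) w) = (fun w => Vh h (Num.min (tau w) T) w).
  by apply/funext => w; rewrite (min_idPl (stopt_leT w st)).
apply: (mG_proc (H := fun u w => Vh h (Num.min u T) w)) => [|q||w e e0].
- exact: mFs.
- have qT : Num.min q T <= T by rewrite min_leR.
  apply: mG_liq; [exact: mFs|exact: isH_KT hh _|exact: isH_BT hh _|].
  exact: (mG_sub (mFs M _) (mFs M T) (mFm M qT) (mSa M _)).
- exact: stopt_meas.
have tT := stopt_leT w st.
have [h' h0 h1] := V_left w hh tT e0; exists h' => // v v1 v2.
rewrite (min_idPl tT) (min_idPl _); last exact: le_trans (ltW v2) tT.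
by apply: h1 => //; exact: ltW.
Qed.

Lemma mcost t k b h tau : isH t k b h -> stopt tau -> mfun (cost h tau).
Proof.
move=> hh st; apply: mG_FiT.
have -> : cost h tau = fun w => if w \in [set w | hs h w < tau w]
  then Num.max (X (hs h w) w - Vh h (hs h w) w) 0
  else Num.max (Y (tau w) w - Vh h (tau w) w) 0.
  apply/funext => w; rewrite /cost; case: ifPn => h1; first by rewrite mem_set.
  by rewrite memNset //=; apply/negP.
have ss := isH_s hh.
apply: mG_if; [exact: mFs|apply: mG_lt; [exact: mFs|exact: stopt_meas|exact: stopt_meas]| |];
  apply: mG_max; try exact: mG_cst; apply: mGB.
- exact: (mG_cproc (mXc M) (mXa M) ss).
- exact: V_meas hh ss.
- exact: (mG_cproc (mYc M) (mYa M) st).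
- exact: V_meas hh st.
Qed.

Lemma cost_ge0 h tau w : 0 <= cost h tau w.
Proof. by rewrite /cost; case: ifP => _; rewrite le_maxR. Qed.

Lemma cost_leZ t k b h tau w : isH t k b h -> stopt tau -> t w <= tau w -> cost h tau w <= Z w.
Proof.
move=> hh st tt; rewrite /cost.
have := mXZ M (hs h w) w; have := mYZ M (tau w) w; have := Z0 w.
have := isH_adm hh (isH_ts hh w) (stopt_leT w (isH_s hh)).
have := isH_adm hh tt (stopt_leT w st).
rewrite !ler_norml => h1 h2 h3 /andP[_ h4] /andP[_ h5].
by case: ifP => _; rewrite ge_max h3 andbT; lra.
Qed.

Lemma Ib_cost t k b h tau : isH t k b h -> stopt tau -> t <=w tau -> Ib (cost h tau).
Proof.
move=> hh st tt; apply: Ib_le (mIZ M) _; first exact: mcost hh st.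
by move=> w; rewrite ger0_norm ?cost_ge0 //; apply: cost_leZ hh st (tt w).
Qed.

(* Comparing these terms up to conversion is expensive, so they are abstracted
   before calling lra. *)
Ltac rlra := repeat match goal with
  | |- context [rho ?t ?A ?h] => let x := fresh "x" in generalize (rho t A h) => x
  | |- context [J ?A ?h ?t] => let x := fresh "x" in generalize (J A h t) => x
  | |- context [Ex ?P ?f] => let x := fresh "x" in generalize (Ex P f) => x
  end; clear; lra.

Definition ite A (T' : Type) (f g : Omega -> T') (w : Omega) := if w \in A then f w else g w.

Lemma ite_in A (T' : Type) (f g : Omega -> T') w : A w -> ite A f g w = f w.
Proof. by move=> h; rewrite /ite mem_set. Qed.

Lemma ite_out A (T' : Type) (f g : Omega -> T') w : ~ A w -> ite A f g w = g w.
Proof. by move=> h; rewrite /ite memNset. Qed.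

Lemma iteid A (T' : Type) (f : Omega -> T') : ite A f f = f.
Proof. by apply/funext => w; rewrite /ite; case: ifP. Qed.

Lemma stopt_ite A t a : stopt t -> stopt a -> Fat t A -> Fat a (~` A) -> stopt (ite A t a).
Proof.
move=> st sa hA hA'; apply: stopt_if => // w; [exact: mFs|by case: st|by case: sa].
Qed.

Lemma mG_Fat_ite A t a (f g : Omega -> R) : stopt t -> stopt a -> Fat t A -> Fat a (~` A) ->
  mG (Fat t) f -> mG (Fat a) g -> mG (Fat (ite A t a)) (ite A f g).
Proof.
move=> st sa hA hA' /(mGP _ (Fat_sigma (mFs M) st)) mf /(mGP _ (Fat_sigma (mFs M) sa)) mg.
have si := stopt_ite st sa hA hA'.
apply/(mGP _ (Fat_sigma (mFs M) si)) => B mB u.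
have -> : ite A f g @^-1` B `&` [set w | ite A t a w <= u] =
  ((f @^-1` B `&` [set w | t w <= u]) `&` (A `&` [set w | t w <= u])) `|`
  ((g @^-1` B `&` [set w | a w <= u]) `&` (~` A `&` [set w | a w <= u])).
  apply/seteqP; split=> w /=; have [Aw|nAw] := pselect (A w).
  - by rewrite !ite_in // => -[h1 h2]; left.
  - by rewrite !ite_out // => -[h1 h2]; right.
  - by case=> [[[h1 h2] _]|[_ [/(_ Aw)]]] //; rewrite !ite_in.
  - by case=> [[_ [/nAw]]|[[h1 h2] _]] //; rewrite !ite_out.
have Fs := mFs M u.
by apply: sigma_setU => //; apply: sigma_setI => //; [exact: mf|exact: mg].
Qed.

Definition paste A h g : hdg := Hedge (fun u => ite A (hK h u) (hK g u))
  (fun u => ite A (hB h u) (hB g u)) (ite A (hs h) (hs g)).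

Lemma ad_paste A t a (f g : Omega -> R) u : stopt t -> stopt a -> Fat t A -> Fat a (~` A) ->
  mG (Fi u) (fun w => if t w < u then f w else 0) ->
  mG (Fi u) (fun w => if a w < u then g w else 0) ->
  mG (Fi u) (fun w => if ite A t a w < u then ite A f g w else 0).
Proof.
move=> st sa hA hA' mf mg.
have -> : (fun w => if ite A t a w < u then ite A f g w else 0) =
  fun w => (if w \in A `&` [set w | t w < u] then (if t w < u then f w else 0) else 0) +
           (if w \in ~` A `&` [set w | a w < u] then (if a w < u then g w else 0) else 0).
  apply/funext => w; have [Aw|nAw] := pselect (A w).
    rewrite !ite_in // [w \in ~` _ `&` _]memNset /=; last by case=> /(_ Aw).
    rewrite addr0; case: ifPn => h; first by rewrite mem_set.
    by rewrite memNset //=; case=> _; apply/negP.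
  rewrite !ite_out // [w \in A `&` _]memNset /=; last by case=> /nAw.
  rewrite add0r; case: ifPn => h; first by rewrite mem_set.
  by rewrite memNset //=; case=> _; apply/negP.
have Fs := mFs M u.
apply: mGD; apply: mG_if => //; try exact: mG_cst.
  by apply: (Fat_lt (mFs M) (mFm M) u st).
by apply: (Fat_lt (mFs M) (mFm M) u sa).
Qed.

Lemma isH_paste A t a k b k' b' h g : isH t k b h -> isH a k' b' g ->
  Fat t A -> Fat a (~` A) ->
  isH (ite A t a) (ite A k k') (ite A b b') (paste A h g).
Proof.
move=> hh hg hA hA'; have [st sa] := (isH_st hh, isH_st hg).
split.
- exact: stopt_ite.
- exact: mG_Fat_ite (isH_k hh) (isH_k hg).
- exact: mG_Fat_ite (isH_b hh) (isH_b hg).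
- by move=> u; apply: ad_paste => //; [exact: isH_Kad hh u|exact: isH_Kad hg u].
- by move=> u; apply: ad_paste => //; [exact: isH_Bad hh u|exact: isH_Bad hg u].
- move=> w u; rewrite /= /ite; case: ifP => _; [exact: isH_pre hh _ _|exact: isH_pre hg _ _].
- move=> w; rewrite /= /ite; case: ifP => _; [exact: isH_leg hh w|exact: isH_leg hg w].
- move=> w u; rewrite /Vh /= /ite; case: ifP => _; [exact: isH_adm hh _ _|exact: isH_adm hg _ _].
- apply: stopt_ite; [exact: isH_s hh|exact: isH_s hg| |].
    exact: (Fat_mon (mFs M) st (isH_s hh) (isH_ts hh)).
  exact: (Fat_mon (mFs M) sa (isH_s hg) (isH_ts hg)).
- move=> w; rewrite /= /ite; case: ifP => _; [exact: isH_ts hh w|exact: isH_ts hg w].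
Qed.

Lemma FatC t A : stopt t -> Fat t A -> Fat t (~` A).
Proof. by move=> st; exact: sigma_setC (Fat_sigma (mFs M) st). Qed.

Lemma isH_paste1 A t k b h g : isH t k b h -> isH t k b g -> Fat t A -> isH t k b (paste A h g).
Proof.
move=> hh hg hA; have := isH_paste hh hg hA (FatC (isH_st hh) hA).
by rewrite !iteid.
Qed.

Lemma cost_paste A h g tau w : cost (paste A h g) tau w = ite A (cost h tau) (cost g tau) w.
Proof.
have [Aw|nAw] := pselect (A w); first by rewrite ite_in // /cost /Vh /= !ite_in.
by rewrite ite_out // /cost /Vh /= !ite_out.
Qed.

Lemma cost_ext h g tau tau' w : tau w = tau' w -> hs h w = hs g w ->
  hK h ^~ w = hK g ^~ w -> hB h ^~ w = hB g ^~ w -> cost h tau w = cost g tau' w.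
Proof.
move=> e1 e2 e3 e4; rewrite /cost /Vh e1 e2.
by have /= -> := congr1 (fun f => f (hs g w)) e3; have /= -> := congr1 (fun f => f (hs g w)) e4;
   have /= -> := congr1 (fun f => f (tau' w)) e3; have /= -> := congr1 (fun f => f (tau' w)) e4.
Qed.

Lemma cost_tau h tau tau' w : tau w = tau' w -> cost h tau w = cost h tau' w.
Proof. by rewrite /cost => ->. Qed.

Lemma Ib_Jc A t k b h tau : measurable A -> isH t k b h -> stopt tau ->
  t <=w tau -> Ib (fun w => \1_A w * cost h tau w).
Proof. by move=> mA hh st tt; apply: Ib_indic => //; exact: Ib_cost hh st tt. Qed.

Lemma has_sup_rho A t k b h : measurable A -> isH t k b h ->
  has_sup [set J A h tau | tau in [set tau | stopt tau /\ forall w, t w <= tau w]].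
Proof.
move=> mA hh; split.
  exists (J A h (fun=> T)), (fun=> T) => //; split; first exact: (stoptT).
  by move=> w; exact: stopt_leT (isH_st hh).
exists (Ex Z) => _ [tau [st tt] <-].
apply: Ex_le; [exact: Ib_Jc hh st tt|exact: mIZ|].
move=> w; apply: le_trans (cost_leZ hh st (tt w)).
by rewrite indicE ler_piMl ?cost_ge0 // lern1 leq_b1.
Qed.

Lemma J_rho A t k b h tau : measurable A -> isH t k b h -> stopt tau ->
  t <=w tau -> J A h tau <= rho t A h.
Proof.
move=> mA hh st tt; apply: sup_upper_bound; first exact: has_sup_rho mA hh.
by exists tau.
Qed.

Lemma rho_le A t k b h c : measurable A -> isH t k b h ->
  (forall tau, stopt tau -> t <=w tau -> J A h tau <= c) -> rho t A h <= c.
Proof.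
move=> mA hh hc; apply: ge_sup; first by case: (has_sup_rho mA hh).
by move=> _ [tau [st tt] <-]; exact: hc.
Qed.

Lemma rho_near A t k b h e : measurable A -> isH t k b h -> 0 < e ->
  exists tau, [/\ stopt tau, forall w, t w <= tau w & rho t A h - e < J A h tau].
Proof.
move=> mA hh e0; have [_ [tau [st tt] <-] h1] := sup_adherent e0 (has_sup_rho mA hh).
by exists tau.
Qed.

Lemma J_ge0 A h tau : 0 <= J A h tau.
Proof. by apply: Ex_ge0 => w; rewrite mulr_ge0 ?cost_ge0 // indicE. Qed.

Lemma rho_ge0 A t k b h : measurable A -> isH t k b h -> 0 <= rho t A h.
Proof.
move=> mA hh; apply: le_trans (J_ge0 A h (fun=> T)) _; apply: (J_rho mA hh (stoptT)).
by move=> w; exact: stopt_leT (isH_st hh).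
Qed.

Lemma J_split A t k b h tau : measurable A -> isH t k b h -> stopt tau ->
  t <=w tau -> forall C, measurable C ->
  J C h tau = J (C `&` A) h tau + J (C `\` A) h tau.
Proof.
move=> mA hh st tt C mC; rewrite /J -ExD.
- apply: eq_Ex => w; rewrite -mulrDl; congr (_ * _); rewrite !indicE.
  rewrite in_setI in_setD; case: (w \in C) => //=; case: (w \in A) => //=; rewrite ?addr0 ?add0r //.
- by apply: (Ib_Jc _ hh st tt); exact: measurableI.
- by apply: (Ib_Jc _ hh st tt); exact: measurableD.
Qed.

Lemma J_eq A h g tau tau' : (forall w, A w -> cost h tau w = cost g tau' w) ->
  J A h tau = J A g tau'.
Proof.
move=> e; apply: eq_Ex => w; rewrite indicE; case: (boolP (w \in A)) => [/set_mem/e -> //|_].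
by rewrite !mul0r.
Qed.

(** An event known at [t] is known before the adversary stops, so his choices on [A] and off [A] can
    be pasted, and the two suprema are approached independently. *)
Lemma rho_split A C t k b h : isH t k b h -> Fat t A -> Fat t C ->
  rho t C h = rho t (C `&` A) h + rho t (C `\` A) h.
Proof.
move=> hh hA hC; have st := isH_st hh.
have [mA mC] := (Fat_measurable st hA, Fat_measurable st hC).
have mI : measurable (C `&` A) by exact: measurableI.
have mD : measurable (C `\` A) by exact: measurableD.
apply: le_anti; apply/andP; split.
  apply: (rho_le mC hh) => tau s1 tt; rewrite (J_split mA hh s1 tt mC).
  by apply: lerD; [exact: J_rho mI hh s1 tt|exact: J_rho mD hh s1 tt].
apply/ler_addgt0Pr => e e0; have e20 : 0 < e / 2 by rewrite divr_gt0.
have [tau [s1 t1 h1]] := rho_near mI hh e20.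
have [tau' [s2 t2 h2]] := rho_near mD hh e20.
have s3 : stopt (ite A tau tau').
  apply: stopt_ite => //; first exact: (Fat_mon (mFs M) st s1 t1).
  by apply: (Fat_mon (mFs M) st s2 t2); exact: FatC.
have t3 w : t w <= ite A tau tau' w by rewrite /ite; case: ifP.
have := J_rho mC hh s3 t3; rewrite (J_split mA hh s3 t3 mC).
rewrite (@J_eq (C `&` A) h h _ tau); last by move=> w [_ Aw]; apply: cost_tau; rewrite ite_in.
rewrite (@J_eq (C `\` A) h h _ tau'); last by move=> w [_ Aw]; apply: cost_tau; rewrite ite_out.
by lra.
Qed.

Lemma rho_eq A t h g : (forall tau w, A w -> cost h tau w = cost g tau w) ->
  rho t A h = rho t A g.
Proof.
move=> e; rewrite /rho; congr sup; apply/seteqP; split=> _ [tau ht <-]; exists tau => //.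
  by apply: J_eq => w Aw; rewrite e.
by apply: J_eq => w Aw; rewrite e.
Qed.

(* A nearly optimal element of a class that is stable under pasting is nearly
   optimal on every event that is known at the node. *)
Lemma rho_eps t k b (C : set hdg) e : C !=set0 -> (forall h, C h -> isH t k b h) ->
  (forall A h g, Fat t A -> C h -> C g -> C (paste A h g)) -> 0 < e ->
  exists2 h, C h & forall g, C g -> forall A, Fat t A -> rho t A h <= rho t A g + e.
Proof.
move=> [h0 Ch0] CH Cp e0; have st := isH_st (CH _ Ch0).
pose E := [set rho t setT h | h in C].
have hE : has_inf E.
  split; first by exists (rho t setT h0); exists h0.
  by exists 0 => _ [h Ch <-]; exact: rho_ge0 measurableT (CH _ Ch).
have [_ [h Ch <-] h1] := inf_adherent e0 hE.
exists h => // g Cg A hA.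
have hp : isH t k b (paste A g h) by apply: isH_paste1 => //; exact: CH.
have : inf E <= rho t setT (paste A g h).
  by apply: ge_inf; [case: hE|exists (paste A g h) => //; exact: Cp].
have FT : Fat t setT by exact: sigma_setT (Fat_sigma (mFs M) st).
rewrite (rho_split hp hA FT) !setTI.
rewrite (@rho_eq A t _ g); last by move=> tau w Aw; rewrite cost_paste ite_in.
rewrite (@rho_eq (setT `\` A) t _ h); last first.
  by move=> tau w [_ Aw]; rewrite cost_paste ite_out.
move: h1; rewrite (rho_split (CH _ Ch) hA FT) !setTI.
by rlra.
Qed.

Lemma rho_dom A t k b h g e : measurable A -> isH t k b h -> isH t k b g ->
  (forall tau, stopt tau -> t <=w tau ->
     Ex (fun w => Num.max (cost h tau w - cost g tau w) 0) <= e) ->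
  rho t A h <= rho t A g + e.
Proof.
move=> mA hh hg hd; apply: (rho_le mA hh) => tau st tt.
apply: le_trans (lerD (J_rho mA hg st tt) (hd tau st tt)).
have Im : Ib (fun w => Num.max (cost h tau w - cost g tau w) 0).
  apply: (Ib_le _ (mIZ M)).
    apply: measurable_maxr; last exact: measurable_cst.
    by apply: measurable_funB; [exact: mcost hh st|exact: mcost hg st].
  move=> w; rewrite ger0_norm; last by rewrite le_maxR.
  rewrite ge_max Z0 andbT lerBlDr.
  by apply: le_trans (cost_leZ hh st (tt w)) _; rewrite lerDl cost_ge0.
rewrite /J -ExD //; last exact: Ib_Jc hg st tt.
apply: Ex_le; first exact: Ib_Jc hh st tt.
  by apply: IbD => //; exact: Ib_Jc hg st tt.
move=> w; rewrite indicE; case: (w \in A) => /=.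
  rewrite !mul1r -lerBlDl; by rewrite le_maxL.
by rewrite !mul0r add0r le_maxR.
Qed.

Lemma sgF t : stopt t -> salg (Fat t).
Proof. exact: (Fat_sigma (mFs M)). Qed.

Lemma stlt a u : stopt a -> Fi u [set w | a w < u].
Proof. by move=> sa; exact (stopt_lt (mFs M) (mFm M) u sa). Qed.

Lemma stminC a u : stopt a -> mG (Fi u) (fun w => Num.min (a w) u).
Proof. by move=> sa; exact (stopt_minC (mFs M) (mFm M) u sa). Qed.

Lemma mFatP t (f : Omega -> R) : stopt t ->
  (forall u, mG (Fi u) (fun w => if t w < u then f w else 0)) -> mG (Fat t) f.
Proof. by move=> st; exact (mG_FatP (mFs M) (mFm M) (mFrc M) st). Qed.

Lemma Fmon t a A : stopt t -> stopt a -> t <=w a -> Fat t A -> Fat a A.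
Proof. by move=> st sa ta; apply: (Fat_mon (mFs M) st sa ta). Qed.

Lemma mG_mon t a (f : Omega -> R) : stopt t -> stopt a -> t <=w a ->
  mG (Fat t) f -> mG (Fat a) f.
Proof.
by move=> st sa ta; apply: mG_sub; [exact: sgF|exact: sgF|move=> A; exact: Fmon].
Qed.

Lemma Fle t a : stopt t -> stopt a -> Fat t [set w | t w <= a w].
Proof. by move=> st sa; exact (Fat_le (mFs M) (mFm M) st sa). Qed.

Lemma Fler t a : stopt t -> stopt a -> Fat a [set w | t w <= a w].
Proof. by move=> st sa; exact (Fat_ler (mFs M) (mFm M) st sa). Qed.

Lemma Flt t a : stopt t -> stopt a -> Fat t [set w | t w < a w].
Proof. by move=> st sa; exact (Fat_ltl (mFs M) (mFm M) st sa). Qed.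

Lemma Fltr t a : stopt t -> stopt a -> Fat a [set w | t w < a w].
Proof. by move=> st sa; exact (Fat_ltr (mFs M) (mFm M) st sa). Qed.

Lemma smax t a : stopt t -> stopt a -> stopt (fun w => Num.max (t w) (a w)).
Proof. by move=> st sa; apply: (stopt_max (mFs M)). Qed.

Lemma smin t a : stopt t -> stopt a -> stopt (fun w => Num.min (t w) (a w)).
Proof. by move=> st sa; apply: (stopt_min (mFs M)). Qed.

Lemma smG t : stopt t -> mG (Fat t) t.
Proof. by move=> st; exact (stopt_mG (mFs M) (mFm M) st). Qed.

(** The default hedge: hold [(k, b)] up to [a], then give everything up. Its stopping time [sig] is
    left free. *)
Definition liqd a k b (sig : Omega -> R) : hdg :=
  Hedge (fun u w => if u <= a w then k w else frozen dl (k w) (b w))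
        (fun u w => if u <= a w then b w else 0) sig.

Lemma mG_frozen (G : set (set Omega)) k b : salg G -> mG G k -> mG G b ->
  mG G (fun w => frozen dl (k w) (b w)).
Proof.
move=> sG mk mb.
have -> : (fun w => frozen dl (k w) (b w)) =
    fun w => if w \in [set w | b w = 0] `&` [set w | k w < dl] then k w else 0.
  apply/funext => w; rewrite /frozen; case: ifPn => [/andP[/eqP h1 h2]|h]; first by rewrite mem_set.
  by rewrite memNset //= => -[h1 h2]; move: h; rewrite h1 h2 eqxx.
apply: mG_if => //.
by apply: sigma_setI => //; [apply: mG_eq|apply: mG_lt] => //; exact: mG_cst.
Qed.

Definition prep a k b h : hdg :=
  Hedge (fun u w => if u <= a w then k w else hK h u w)
        (fun u w => if u <= a w then b w else hB h u w) (hs h).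

Lemma mG_Fat_lt a (f : Omega -> R) u : stopt a -> mG (Fat a) f ->
  mG (Fi u) (fun w => if a w < u then f w else 0).
Proof.
move=> sa mf.
have -> : (fun w => if a w < u then f w else 0) =
  fun w => if w \in [set w | a w < u] then (if a w <= u then f w else 0) else 0.
  apply/funext => w; case: ifPn => h; first by rewrite mem_set //= ltW.
  by rewrite memNset //=; apply/negP.
apply: mG_if; [exact: mFs| | |exact: mG_cst].
  exact: stlt.
exact (mG_Fat_le (mFs M) u sa mf).
Qed.

Lemma mG_at (H : R -> Omega -> R) a : (forall w, continuous (H ^~ w)) ->
  (forall u, mG (Fi u) (H u)) -> stopt a -> mG (Fat a) (fun w => H (a w) w).
Proof.
move=> cH aH sa; apply: mFatP => // u.
have -> : (fun w => if a w < u then H (a w) w else 0) =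
  fun w => if w \in [set w | a w < u] then H (Num.min (a w) u) w else 0.
  apply/funext => w; case: ifPn => h; first by rewrite mem_set // (min_idPl (ltW h)).
  by rewrite memNset //=; apply/negP.
apply: mG_if; [exact: mFs| | |exact: mG_cst].
  exact: stlt.
have -> : (fun w => H (Num.min (a w) u) w) = fun w => H (Num.min (Num.min (a w) u) u) w.
  by apply/funext => w; rewrite -minA minxx.
apply: (mG_proc (H := fun v w => H (Num.min v u) w)) => [|q||w e e0].
- exact: mFs.
- apply: (mG_sub (mFs M _) (mFs M u) _ (aH _)); apply: (mFm M).
  by rewrite min_leR.
- exact: stminC.
have [h h0 hh] := continuous_dist (Num.min (Num.min (a w) u) u) (cH w) e0.
exists h => // v v1 v2; apply: hh; rewrite -minA minxx.
rewrite (min_idPl _); last by rewrite (le_trans (ltW v2)) // min_leR.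
by rewrite ler0_norm; move: v1 v2; set m := Num.min (a w) u; lra.
Qed.

Lemma isH_liqd a k b sig : stopt a -> mG (Fat a) k -> mG (Fat a) b ->
  (forall w, 0 <= lq k b a w) -> stopt sig -> a <=w sig ->
  isH a k b (liqd a k b sig).
Proof.
move=> sa mk mb l0 ss ts; split=> //=.
- move=> u.
  have -> : (fun w => if a w < u then if u <= a w then k w else frozen dl (k w) (b w) else 0) =
    fun w => if a w < u then frozen dl (k w) (b w) else 0.
    by apply/funext => w; case: ifPn => // h; rewrite leNgt h /=.
  by apply: mG_Fat_lt => //; apply: mG_frozen => //; exact: sgF.
- move=> u; have -> : (fun w => if a w < u then if u <= a w then b w else 0 else 0) = fun=> 0.
    by apply/funext => w; case: ifPn => // h; rewrite leNgt h.
  exact: mG_cst.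
- by move=> w u ->.
- move=> w; have [aT|Ta] := ltP (a w) T; last first.
    by exists 0; apply: legal_hold => u au uT; have := lt_le_trans au uT; rewrite ltNge Ta.
  have [||m leg] := @legal_freeze _ T dl mu (mdl0 M) (S ^~ w) 0 (a w) (k w) (b w)
    (fun=> k w) (fun=> b w) (a w) (k w) (b w) _ (lexx _) aT _ (l0 w).
  + exact: legal_hold.
  + by rewrite ltxx.
  by exists m.
- move=> w u au uT; rewrite /Vh /=; case: ifPn => h.
    have -> : u = a w by apply: le_anti; rewrite h au.
    exact: l0.
  rewrite /liq tcost0 mul0r addr0 subr0; exact: frozen_ge0 (l0 w).
Qed.

Lemma isH_prep a k b k' b' h : isH a k' b' h -> mG (Fat a) k -> mG (Fat a) b ->
  (forall w, 0 <= lq k b a w) ->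
  (forall w, a w < T -> trade (k w) (b w) (k' w) (b' w) (S (a w) w) \/
     k' w = k w /\ b' w = b w) ->
  isH a k b (prep a k b h).
Proof.
move=> hh mk mb l0 htr; have sa := isH_st hh; split=> //=.
- move=> u.
  have -> : (fun w => if a w < u then if u <= a w then k w else hK h u w else 0) =
    fun w => if a w < u then hK h u w else 0.
    by apply/funext => w; case: ifPn => // au; rewrite leNgt au.
  exact: isH_Kad hh u.
- move=> u.
  have -> : (fun w => if a w < u then if u <= a w then b w else hB h u w else 0) =
    fun w => if a w < u then hB h u w else 0.
    by apply/funext => w; case: ifPn => // au; rewrite leNgt au.
  exact: isH_Bad hh u.
- by move=> w u ->.
- move=> w; have [n leg] := isH_leg hh w.
  have leg' : legal (S ^~ w) n (a w) (k' w) (b' w)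
     (fun u => if u <= a w then k w else hK h u w) (fun u => if u <= a w then b w else hB h u w).
    by apply: legal_ext leg _ => u au uT; rewrite leNgt au.
  have [aT|Ta] := ltP (a w) T; last first.
    by exists 0; apply: legal_hold => u au uT; have := lt_le_trans au uT; rewrite ltNge Ta.
  have [tr|[ek eb]] := htr w aT; last by exists n; move: leg'; rewrite ek eb.
  exists n.+1; apply: (legal_jump (lexx _) aT _ tr leg') => u au ua.
  by have := lt_le_trans au ua; rewrite ltxx.
- move=> w u au uT; rewrite /Vh /=; case: ifPn => h'.
    have -> : u = a w by apply: le_anti; rewrite h' au.
    exact: l0.
  exact: isH_adm hh _ _ au uT.
- exact: isH_s hh.
- exact: isH_ts hh.
Qed.

Definition okto (t a k b : Omega -> R) :=
  forall w u, t w <= u -> u <= a w -> 0 <= liq (k w) (b w) (S u w).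

(** Before [a] the hedge holds [(k, b)] anyway, so only the solvency of this position between [t]
    and [a] has to be added. *)
Lemma isH_lower t a k b h : isH a k b h -> stopt t -> mG (Fat t) k -> mG (Fat t) b ->
  t <=w a -> okto t a k b -> isH t k b h.
Proof.
move=> hh st mk mb ta ok; have sa := isH_st hh.
have adF (H : R -> Omega -> R) (f : Omega -> R) u : (forall w, u <= a w -> H u w = f w) ->
    mG (Fat t) f -> mG (Fi u) (fun w => if a w < u then H u w else 0) ->
    mG (Fi u) (fun w => if t w < u then H u w else 0).
  move=> Hf mf mH.
  have -> : (fun w => if t w < u then H u w else 0) =
    fun w => if w \in [set w | a w < u] then (if a w < u then H u w else 0)
             else (if t w < u then f w else 0).
    apply/funext => w; have [au|ua] := ltP (a w) u.
      by rewrite mem_set // (le_lt_trans (ta w) au).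
    rewrite memNset /=; last by rewrite ltNge ua.
    by case: ifP => // _; exact: Hf.
  apply: mG_if => //; first exact: mFs.
    exact: stlt.
  exact: mG_Fat_lt.
split=> //.
- move=> u; apply: (adF _ k) => //; last exact: isH_Kad hh u.
  by move=> w ua; case: (isH_pre hh ua).
- move=> u; apply: (adF _ b) => //; last exact: isH_Bad hh u.
  by move=> w ua; case: (isH_pre hh ua).
- by move=> w u ut; apply: (isH_pre hh); exact: le_trans ut (ta w).
- move=> w; have [n leg] := isH_leg hh w; exists n.
  by apply: legal_extend leg (ta w) _ => u _ ua; exact: (isH_pre hh ua).
- move=> w u tu uT; have [ua|au] := leP u (a w).
    by rewrite /Vh; have [-> ->] := isH_pre hh ua; exact: ok.
  exact: (isH_adm hh (ltW au) uT).
- exact: isH_s hh.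
- by move=> w; exact: le_trans (ta w) (isH_ts hh w).
Qed.

Lemma isH_liq0 t k b h w : isH t k b h -> 0 <= lq k b t w.
Proof.
move=> hh; have := isH_adm hh (lexx (t w)) (stopt_leT w (isH_st hh)).
by rewrite /Vh; have [-> ->] := isH_pre hh (lexx (t w)).
Qed.

(* Hold the node state until [a]; then stop on [Sg], otherwise continue with [h]. *)
Definition comb a k b (Sg : set Omega) h : hdg := paste Sg (liqd a k b a) (prep a k b h).

Lemma isH_comb a k b k' b' (Sg : set Omega) h : isH a k' b' h -> mG (Fat a) k -> mG (Fat a) b ->
  Fat a Sg -> (forall w, 0 <= lq k b a w) ->
  (forall w, a w < T -> trade (k w) (b w) (k' w) (b' w) (S (a w) w) \/
     k' w = k w /\ b' w = b w) ->
  isH a k b (comb a k b Sg h).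
Proof.
move=> hh mk mb hS l0 htr; have sa := isH_st hh.
apply: isH_paste1 => //; last exact: isH_prep hh _ _ _ htr.
exact: isH_liqd.
Qed.

Lemma cost_comb_le a k b (Sg : set Omega) h tau w : a w <= hs h w -> tau w <= a w ->
  cost (comb a k b Sg h) tau w = Num.max (Y (tau w) w - lq k b tau w) 0.
Proof.
move=> ah ta; rewrite cost_paste /ite; case: ifP => _; rewrite /cost /Vh /=.
  by rewrite ltNge ta /=.
by rewrite ltNge (le_trans ta ah) ta.
Qed.

Lemma cost_comb_stop a k b (Sg : set Omega) h tau w : Sg w -> a w < tau w ->
  cost (comb a k b Sg h) tau w = Num.max (X (a w) w - lq k b a w) 0.
Proof. by move=> hw ta; rewrite cost_paste ite_in // /cost /Vh /= ta lexx. Qed.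

Lemma cost_comb_go a k b (Sg : set Omega) h tau w : ~ Sg w -> a w < tau w -> a w < hs h w ->
  cost (comb a k b Sg h) tau w = cost h tau w.
Proof.
move=> hw ta ah; rewrite cost_paste ite_out // /cost /Vh /=.
by rewrite !leNgt ah ta.
Qed.

Lemma isH_raise t a k b h : isH t k b h -> stopt a -> t <=w a ->
  (forall w u, t w < u -> u <= a w -> hK h u w = k w /\ hB h u w = b w) ->
  (forall w, a w <= hs h w) -> isH a k b h.
Proof.
move=> hh sa ta hold as'; have st := isH_st hh.
have ad (H : R -> Omega -> R) u : mG (Fi u) (fun w => if t w < u then H u w else 0) ->
    mG (Fi u) (fun w => if a w < u then H u w else 0).
  move=> mH; have -> : (fun w => if a w < u then H u w else 0) = fun w =>
      if w \in [set w | a w < u] then (if t w < u then H u w else 0) else 0.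
    apply/funext => w; case: ifPn => au; last by rewrite memNset //=; exact/negP.
    by rewrite mem_set // (le_lt_trans (ta w) au).
  by apply: mG_if => //; [exact: mFs|exact: stlt].
split=> //.
- exact: mG_mon st sa ta (isH_k hh).
- exact: mG_mon st sa ta (isH_b hh).
- by move=> u; apply: ad; exact: isH_Kad hh u.
- by move=> u; apply: ad; exact: isH_Bad hh u.
- move=> w u ua; have [ut|tu] := leP u (t w); first exact: (isH_pre hh ut).
  exact: hold.
- move=> w; have [n leg] := isH_leg hh w; have := ta w; rewrite le_eqVlt => /orP[/eqP <-|tw].
    by exists n.
  have [m lm] := legal_at leg tw (stopt_leT w sa); exists m.
  by have [<- <-] := hold w (a w) tw (lexx _).
- by move=> w u au uT; apply: (isH_adm hh) => //; exact: le_trans au.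
- exact: isH_s hh.
Qed.

Lemma cost_hold t k b h tau w : isH t k b h -> tau w <= t w ->
  cost h tau w = Num.max (Y (tau w) w - lq k b tau w) 0.
Proof.
move=> hh ta; rewrite /cost ltNge (le_trans ta (isH_ts hh w)) /= /Vh.
by have [-> ->] := isH_pre hh ta.
Qed.

(** An adversary who stops before [a] meets the same cost with both hedges, since both still hold
    [(k, b)]; elsewhere he is a stopping time after [a], where the assumption applies. *)
Lemma rho_mono t a k b h g e : isH t k b h -> isH t k b g -> isH a k b h -> isH a k b g ->
  t <=w a -> forall A, Fat t A ->
  (forall C, Fat a C -> C `<=` A -> rho a C h <= rho a C g + e) ->
  rho t A h <= rho t A g + e.
Proof.
move=> th tg ah ag ta A hA hC; have [st sa] := (isH_st th, isH_st ah).
have mA := Fat_measurable st hA.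
apply: (rho_le mA th) => tau s1 tt.
pose D := [set w | tau w < a w].
have FD : Fat tau D by exact: Flt.
have FD' : Fat a D by exact: Fltr.
have mD := Fat_measurable s1 FD.
have FC : Fat a (A `\` D).
  by apply: (sigma_setD (sgF sa)) => //; exact: (Fmon st sa ta hA).
have mC := Fat_measurable sa FC.
have mAD : measurable (A `&` D) by exact: measurableI.
rewrite (J_split mD th s1 tt mA).
have s2 := smax s1 sa.
have J1 : J (A `\` D) h tau <= rho a (A `\` D) h.
  rewrite (@J_eq _ h h tau (fun w => Num.max (tau w) (a w))); last first.
    move=> w [_] /= /negP; rewrite -leNgt => h1; apply: cost_tau; by rewrite (max_idPl h1).
  by apply: (J_rho mC ah s2) => w; rewrite le_maxR.
have J2 := hC _ FC (@subDsetl _ _ _).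
rewrite (@J_eq (A `&` D) h g tau tau); last first.
  by move=> w [_] /= h1; rewrite (cost_hold ah (ltW h1)) (cost_hold ag (ltW h1)).
suff : J (A `&` D) g tau + rho a (A `\` D) g <= rho t A g.
  by move=> H; apply: le_trans (lerD (lexx _) (le_trans J1 J2)) _; rewrite addrA lerD2r.
apply/ler_addgt0Pr => e1 e10.
have [tau' [s3 t3 h3]] := rho_near mC ag e10.
have s4 : stopt (ite D tau tau').
  apply: stopt_ite => //; apply: (Fmon sa s3 t3); exact: FatC.
have t4 w : t w <= ite D tau tau' w.
  by rewrite /ite; case: ifP => _ //; exact: le_trans (t3 w).
have := J_rho mA tg s4 t4; rewrite (J_split mD tg s4 t4 mA).
rewrite (@J_eq (A `&` D) g g (ite D tau tau') tau); last first.
  by move=> w [_ Dw]; apply: cost_tau; rewrite ite_in.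
rewrite (@J_eq (A `\` D) g g (ite D tau tau') tau'); last first.
  by move=> w [_ Dw]; apply: cost_tau; rewrite ite_out.
by move: h3; rlra.
Qed.

Definition restr h (a k b : Omega -> R) : hdg :=
  Hedge (fun u w => if u <= a w then k w else hK h u w)
        (fun u w => if u <= a w then b w else hB h u w)
        (fun w => Num.max (hs h w) (a w)).

Definition rnbhd h w (u k b : R) := exists2 e : R, 0 < e &
  forall v, u < v -> v < u + e -> v <= T -> hK h v w = k /\ hB h v w = b.

Lemma rnbhd_uniq h w (u k b k' b' : R) : u < T -> rnbhd h w u k b -> rnbhd h w u k' b' ->
  k = k' /\ b = b'.
Proof.
move=> uT [e e0 h1] [e' e'0 h2].
pose m := Num.min (Num.min e e') (T - u).
have m0 : 0 < m by rewrite !lt_min e0 e'0 subr_gt0.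
have [m1 m2 m3] : [/\ m <= e, m <= e' & m <= T - u].
  by split; rewrite /m !ge_min lexx ?orbT.
have [||| <- <-] := h1 (u + m / 2); [lra|lra|lra|].
by apply: h2; lra.
Qed.

(** The path at [u] shows the state before the trades at [u]. The state after them is solvent just
    to the right of [u], hence at [u] by continuity of the price. *)
Lemma rnbhd_liq t k b h w (u k' b' : R) : isH t k b h -> t w <= u -> u < T -> rnbhd h w u k' b' ->
  0 <= liq k' b' (S u w).
Proof.
move=> hh tu uT [e e0 hr]; rewrite leNgt; apply/negP => l0.
have l0' : 0 < - liq k' b' (S u w) by rewrite oppr_gt0.
have [c c0 hc] := liq_left u w k' b' l0'.
pose m := Num.min (Num.min e c) (T - u).
have m0 : 0 < m by rewrite !lt_min e0 c0 subr_gt0.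
have [m1 m2 m3] : [/\ m <= e, m <= c & m <= T - u].
  by split; rewrite /m !ge_min lexx ?orbT.
have [|||h1 h2] := hr (u + m / 2); [lra|lra|lra|].
have := isH_adm hh (w := w) (u := u + m / 2).
have -> : t w <= u + m / 2 by move: tu; lra.
have -> : u + m / 2 <= T by lra.
move=> /(_ isT isT); rewrite /Vh h1 h2.
have := hc (u + m / 2); rewrite addrC addKr ger0_norm; last by lra.
have -> : m / 2 < c by lra.
by move=> /(_ isT); rewrite ltr_norml => /andP[_]; lra.
Qed.

(** The right limits at [a] are measurable by [mG_rlim], so the state after the trades at [a] is
    again a node from which [h] can be continued. Where [a w = T] the new state is [(0, 0)], which
    is solvent. *)
Lemma isH_restr t a k b h : isH t k b h -> stopt a -> t <=w a ->
  exists k' b', [/\ isH a k' b' (restr h a k' b'),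
    (forall w, a w < T -> rnbhd h w (a w) (k' w) (b' w)),
    (forall w, a w < T -> trades dl mu (S ^~ w) (t w) (k w) (b w) (a w) (k' w) (b' w)) &
    (forall w n, a w < T -> legal (S ^~ w) n (t w) (k w) (b w) (hK h ^~ w) (hB h ^~ w) ->
       exists2 m, (m <= n)%N & legal (S ^~ w) m (a w) (k' w) (b' w) (hK h ^~ w) (hB h ^~ w))].
Proof.
move=> hh sa ta; have st := isH_st hh.
have /choice[p hp] : forall w, exists p : R * R, (a w < T ->
   [/\ rnbhd h w (a w) p.1 p.2,
    trades dl mu (S ^~ w) (t w) (k w) (b w) (a w) p.1 p.2 &
    exists n, legal (S ^~ w) n (a w) p.1 p.2 (hK h ^~ w) (hB h ^~ w)]) /\ (a w = T -> p = (0, 0)).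
  move=> w; have [aT|Ta] := ltP (a w) T; last by exists (0, 0).
  have [n leg] := isH_leg hh w.
  have [m [k' [b' [mn lm tr [e e0 he]]]]] := legal_split leg (ta w) aT.
  exists (k', b'); split=> [_|aT']; last by move: aT; rewrite aT' ltxx.
  by split=> //; [exists e|exists m].
exists (fun w => (p w).1), (fun w => (p w).2).
have ad (H : R -> Omega -> R) u : mG (Fi u) (fun w => if t w < u then H u w else 0) ->
    mG (Fi u) (fun w => if a w < u then H u w else 0).
  move=> mH; have -> : (fun w => if a w < u then H u w else 0) = fun w =>
      if w \in [set w | a w < u] then (if t w < u then H u w else 0) else 0.
    apply/funext => w; case: ifPn => au; last by rewrite memNset //=; exact/negP.
    by rewrite mem_set // (le_lt_trans (ta w) au).
  by apply: mG_if => //; [exact: mFs|exact: stlt].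
have ad' (H : R -> Omega -> R) (f : Omega -> R) u :
    mG (Fi u) (fun w => if t w < u then H u w else 0) ->
    mG (Fi u) (fun w => if a w < u then (if u <= a w then f w else H u w) else 0).
  move=> /ad; congr (mG _ _); apply/funext => w; case: ifPn => // au.
  by rewrite leNgt au.
split.
- split=> //=.
  + apply: (mG_rlim (mFs M) (mFm M) (mFrc M) sa (K := hK h)).
    * by move=> u; apply: ad; exact: isH_Kad hh u.
    * by move=> w aT; have [[[e e0 he] _ _] _] := (proj1 (hp w) aT, I); exists e => // u h1 h2 h3;
        case: (he u h1 h2 h3).
    * by move=> w /(proj2 (hp w)) ->.
  + apply: (mG_rlim (mFs M) (mFm M) (mFrc M) sa (K := hB h)).
    * by move=> u; apply: ad; exact: isH_Bad hh u.
    * by move=> w aT; have [[[e e0 he] _ _] _] := (proj1 (hp w) aT, I); exists e => // u h1 h2 h3;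
        case: (he u h1 h2 h3).
    * by move=> w /(proj2 (hp w)) ->.
  + by move=> u; apply: ad'; exact: isH_Kad hh u.
  + by move=> u; apply: ad'; exact: isH_Bad hh u.
  + by move=> w u ->.
  + move=> w; have [aT|Ta] := ltP (a w) T; last first.
      by exists 0; apply: legal_hold => u au uT; have := lt_le_trans au uT; rewrite ltNge Ta.
    have [_ _ [n leg]] := proj1 (hp w) aT; exists n.
    by apply: legal_ext leg _ => u au uT; rewrite leNgt au.
  + move=> w u au uT; rewrite /Vh /=; case: ifPn => [ua|_]; last first.
      by apply: (isH_adm hh) => //; exact: le_trans au.
    have -> : u = a w by apply: le_anti; rewrite ua au.
    have [aT|Ta] := ltP (a w) T.
      by have [rn _ _] := proj1 (hp w) aT; exact: (rnbhd_liq hh (ta w) aT rn).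
    rewrite (proj2 (hp w)) /=; first by rewrite /liq tcost0 mul0r addr0 subr0.
    by apply: le_anti; rewrite Ta andbT; exact: stopt_leT sa.
  + exact: smax (isH_s hh) sa.
  + by move=> w; rewrite le_maxR.
- by move=> w aT; case: (proj1 (hp w) aT).
- by move=> w aT; case: (proj1 (hp w) aT).
- move=> w n aT leg.
  have [m [k' [b' [mn lm tr [e e0 he]]]]] := legal_split leg (ta w) aT.
  have [rn _ _] := proj1 (hp w) aT; exists m => //.
  have rn' : rnbhd h w (a w) k' b' by exists e.
  by have [-> ->] := rnbhd_uniq aT rn rn'.
Qed.

(** Takes the values 0 and -1 only, so that [hit] applied to it finds the first change of the
    state. *)
Definition moved h k b (u : R) w : R := if (hK h u w == k w) && (hB h u w == b w) then 0 else -1.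

Lemma moved_lcont t k b h w : isH t k b h -> lcont T (t w) (moved h k b ^~ w).
Proof.
move=> hh u tu uT e e0; have [n leg] := isH_leg hh w.
have [e1 e10 he] := legal_lconst leg tu uT; exists e1 => // v tv uv vu.
by rewrite /moved; have [-> ->] := he v tv uv vu; rewrite subrr normr0.
Qed.

Lemma moved_ad t k b h u : isH t k b h -> mG (Fi u) (fun w => if t w < u then moved h k b u w else 0).
Proof.
move=> hh; have st := isH_st hh; have sF := mFs M u.
have -> : (fun w => if t w < u then moved h k b u w else 0) = fun w =>
  if w \in [set w | (if t w < u then hK h u w else 0) = (if t w < u then k w else 0)] `&`
           [set w | (if t w < u then hB h u w else 0) = (if t w < u then b w else 0)]
  then 0 else -1.
  apply/funext => w; case: ifPn => tu; last first.
    by rewrite mem_set //=; rewrite (negbTE tu).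
  rewrite /moved; case: ifPn => [/andP[/eqP h1 /eqP h2]|h1]; first by rewrite mem_set //= tu.
  rewrite memNset //= tu => -[h2 h3]; by move: h1; rewrite h2 h3 !eqxx.
apply: mG_if => //; apply: sigma_setI => //.
  apply: mG_eq => //; first exact: isH_Kad hh u.
  by apply: mG_Fat_lt => //; exact: isH_k hh.
apply: mG_eq => //; first exact: isH_Bad hh u.
by apply: mG_Fat_lt => //; exact: isH_b hh.
Qed.

(** A trade costs at least [delta], so it always changes the state. Hence the first change of the
    state, which is a stopping time, is the first action time of every representation of the path as
    [legal]. *)
Lemma first_jump t k b h : isH t k b h -> exists s, [/\ stopt s, forall w, t w <= s w,
  (forall w u, u <= s w -> hK h u w = k w /\ hB h u w = b w) &
  (forall w n, s w < T -> legal (S ^~ w) n (t w) (k w) (b w) (hK h ^~ w) (hB h ^~ w) ->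
     exists m (k' b' : R), [/\ (m < n)%N, trade (k w) (b w) k' b' (S (s w) w), rnbhd h w (s w) k' b' &
     legal (S ^~ w) m (s w) k' b' (hK h ^~ w) (hB h ^~ w)])].
Proof.
move=> hh; have st := isH_st hh; pose s := hit T t (moved h k b).
have lc w := @moved_lcont t k b h w hh.
have sP w := hitP st (lc w); exists s; split.
- by apply: (hit_stopt (mFs M) (mFm M) (mFrc M) st _ lc) => u; exact: moved_ad.
- by move=> w; case: (sP w).
- move=> w u us; have [ut|tu] := leP u (t w); first exact: (isH_pre hh ut).
  have [_ _ h3 _] := sP w; have := h3 u tu us; rewrite /moved.
  case: ifPn => [/andP[/eqP -> /eqP ->] //|_]; lra.
move=> w n sT leg; have [h1 h2 h3 h4] := sP w.
have [hold|[m [s' [k' [b' [mn ts' s'T [hold tr lm [e e0 he]]]]]]]] := legal_first (mdl0 M) (mmu0 M) (S_ge0 ^~ w) leg.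
  have [u [u1 u2 u3]] := h4 sT 1 ltr01.
  rewrite /moved; have [-> ->] := hold u (le_lt_trans h1 u1) u3.
  by rewrite !eqxx ltxx.
have ne : ~ (k' = k w /\ b' = b w).
  move=> [e1 e2]; move: tr; rewrite /trade e1 e2 subrr mul0r subr0.
  have := action_cost_delta dl mu 0 (S s' w); have := mdl0 M.
  by set c := action_cost _ _ _ _; lra.
have ss' : s w = s'.
  apply: le_anti; apply/andP; split; rewrite leNgt; apply/negP => ss.
    pose u := s' + Num.min (e / 2) (s w - s').
    have m0 : 0 < Num.min (e / 2) (s w - s') by rewrite lt_min subr_gt0 ss divr_gt0.
    have m1 : Num.min (e / 2) (s w - s') <= e / 2 by rewrite min_leL.
    have m2 : Num.min (e / 2) (s w - s') <= s w - s' by rewrite min_leR.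
    have := h3 u; rewrite /moved; have [|||-> ->] := he u; rewrite /u; try (move: h2; rewrite -/s; lra).
    case: ifPn => [/andP[/eqP e1 /eqP e2] _|_]; first exact: ne.
    have -> : t w < s' + Num.min (e / 2) (s w - s') by move: ts'; lra.
    have -> : s' + Num.min (e / 2) (s w - s') <= hit T t (moved h k b) w by rewrite -/s; lra.
    by move=> /(_ isT isT); lra.
  have ee : 0 < s' - s w by rewrite subr_gt0.
  have [u [u1 u2 u3]] := h4 sT _ ee; rewrite -/s in u1 u2.
  rewrite /moved; have [||-> ->] := hold u; [exact: le_lt_trans u1|lra|].
  by rewrite !eqxx ltxx.
exists m, k', b'; rewrite ss'; split=> //; by exists e.
Qed.

(** * The liquidation value under the martingale density *)

Section Supermartingale.
Local Notation D := (mD M).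

(** For [b <> 0] the liquidation value of a held position is the minimum of two affine functions of
    the price. The one that attains the minimum at [a] is [p + q * S]: equal to the liquidation
    value at [a], not below it later, and a martingale after weighting with [D]. Bounded
    coefficients make [Ex_mult0] applicable. *)
Lemma hold_bounded a tau k b (C : set Omega) c : stopt a -> stopt tau -> a <=w tau ->
  mG (Fat a) k -> mG (Fat a) b -> Fat a C ->
  (forall w, C w -> `|k w| <= c /\ `|b w| <= c) ->
  (forall w, C w -> 0 <= lq k b a w) ->
  (forall w, C w -> 0 <= lq k b tau w) ->
  [/\ Ib (fun w => \1_C w * (D (a w) w * lq k b a w)),
      Ib (fun w => \1_C w * (D (tau w) w * lq k b tau w)) &
      Ex (fun w => \1_C w * (D (tau w) w * lq k b tau w)) <=
      Ex (fun w => \1_C w * (D (a w) w * lq k b a w))].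
Proof.
move=> sa st at' mk mb FC bd la lt'.
have sG := sgF sa.
(* [C1] and [C2] are the events on which the fixed and the proportional part decide the closing cost
   at the time [a]. *)
pose C1 := C `&` [set w | b w <> 0] `&` [set w | mu * `|b w| * S (a w) w <= dl].
pose C2 := C `&` [set w | b w <> 0] `\` [set w | mu * `|b w| * S (a w) w <= dl].
have mSat : mG (Fat a) (fun w => S (a w) w) := mG_at (mSc M) (mSa M) sa.
have Fb : Fat a [set w | b w <> 0].
  by apply: (sigma_setC sG); apply: (mG_eq sG); mg.
have Fd : Fat a [set w | mu * `|b w| * S (a w) w <= dl].
  by apply: (mG_le sG); mg.
have F1 : Fat a C1 by do 2!apply: (sigma_setI sG) => //.
have F2 : Fat a C2 by apply: (sigma_setD sG) => //; apply: (sigma_setI sG).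
pose p w := (if w \in C then k w else 0) - (if w \in C1 then dl else 0).
pose q w := (if w \in C then b w else 0) - (if w \in C2 then mu * `|b w| else 0).
have mp : mG (Fat a) p by apply: mGB; apply: (mG_if sG); mg.
have mq : mG (Fat a) q.
  by apply: mGB; apply: (mG_if sG); mg.
have pb w : `|p w| <= `|c| + dl.
  rewrite /p (le_trans (ler_normB _ _)) // lerD //.
    by case: ifPn => [/set_mem/bd[h _]|_]; [exact: le_trans h (ler_norm _)|rewrite normr0].
  by case: ifPn => _; rewrite ?normr0 ?gtr0_norm // ?(ltW (mdl0 M)) // mdl0.
have qb w : `|q w| <= `|c| + `|c|.
  rewrite /q (le_trans (ler_normB _ _)) // lerD //.
    by case: ifPn => [/set_mem/bd[_ h]|_]; [exact: le_trans h (ler_norm _)|rewrite normr0].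
  case: ifPn => [/set_mem[[/bd[_ h] _] _]|_]; last by rewrite normr0.
  rewrite normrM normr_id (gtr0_norm (mmu0 M)); apply: le_trans (ler_norm c).
  by apply: le_trans h; rewrite ler_piMl // ltW // mmu1.
have [IDa IDSa] := mDint M _ sa; have [IDt IDSt] := mDint M _ st.
have Gm A : Fat a A -> measurable A by exact: Fat_measurable.
have Ip (tau' : Omega -> R) : Ib (fun w => D (tau' w) w) -> Ib (fun w => D (tau' w) w * S (tau' w) w) ->
    Ib (fun w => p w * D (tau' w) w) /\ Ib (fun w => q w * (D (tau' w) w * S (tau' w) w)).
  move=> I1 I2; split.
    by apply: Ib_mult pb I1; exact: (mG_measurable sG Gm mp).
  by apply: Ib_mult qb I2; exact: (mG_measurable sG Gm mq).
have [I1a I2a] := Ip _ IDa IDSa; have [I1t I2t] := Ip _ IDt IDSt.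
have Ft A : Fat a A -> Fat tau A by exact: (Fmon sa st at').
have E1 : Ex (fun w => p w * D (tau w) w) = Ex (fun w => p w * D (a w) w).
  apply/eqP; rewrite -subr_eq0 -ExB //; apply/eqP.
  rewrite -(@Ex_mult0 P _ p (fun w => D (tau w) w - D (a w) w) _ sG Gm mp pb); last 2 first.
  - exact: IbB.
  - move=> A FA; under eq_Ex do rewrite mulrBr.
    rewrite ExB; [|exact: Ib_indic (Gm _ FA) _|exact: Ib_indic (Gm _ FA) _].
    have [-> _] := mDmart M _ _ sa FA; have [-> _] := mDmart M _ _ st (Ft _ FA).
    by rewrite subrr.
  by apply: eq_Ex => w; rewrite mulrBr.
have E2 : Ex (fun w => q w * (D (tau w) w * S (tau w) w)) =
    Ex (fun w => q w * (D (a w) w * S (a w) w)).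
  apply/eqP; rewrite -subr_eq0 -ExB //; apply/eqP.
  rewrite -(@Ex_mult0 P _ q
    (fun w => D (tau w) w * S (tau w) w - D (a w) w * S (a w) w) _ sG Gm mq qb); last 2 first.
  - exact: IbB.
  - move=> A FA; under eq_Ex do rewrite mulrBr.
    rewrite ExB; [|exact: Ib_indic (Gm _ FA) _|exact: Ib_indic (Gm _ FA) _].
    have [_ ->] := mDmart M _ _ sa FA; have [_ ->] := mDmart M _ _ st (Ft _ FA).
    by rewrite subrr.
  by apply: eq_Ex => w; rewrite mulrBr.
have eqa w : \1_C w * (D (a w) w * lq k b a w) =
    p w * D (a w) w + q w * (D (a w) w * S (a w) w).
  rewrite indicE /p /q; case: (boolP (w \in C)) => [/set_mem Cw|nC] /=; last first.
    rewrite [w \in C1]memNset; last by case=> [[Cw]]; move: nC; rewrite mem_set.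
    rewrite [w \in C2]memNset; last by case=> [[Cw]]; move: nC; rewrite mem_set.
    by rewrite !subr0 !mul0r addr0.
  rewrite /liq /tcost mul1r; have [b0|b0] := eqVneq (b w) 0.
    rewrite [w \in C1]memNset; last by case=> [[_]] /= /(_ b0).
    rewrite [w \in C2]memNset; last by case=> [[_]] /= /(_ b0).
    by rewrite b0; ring.
  have b0' : b w <> 0 by apply/eqP.
  have [h|h] := leP (mu * `|b w| * S (a w) w) dl.
    rewrite [w \in C1]mem_set // [w \in C2]memNset; last by case=> _ /(_ h).
    by ring.
  rewrite [w \in C1]memNset; last by case=> _ /=; rewrite leNgt h.
  rewrite [w \in C2]mem_set; last by split=> //=; apply/negP; rewrite -ltNge.
  by ring.
have let' w : \1_C w * (D (tau w) w * lq k b tau w) <=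
    p w * D (tau w) w + q w * (D (tau w) w * S (tau w) w).
  have D0 := ltW (mD0 M (tau w) w).
  rewrite indicE /p /q; case: (boolP (w \in C)) => [/set_mem Cw|nC] /=; last first.
    rewrite [w \in C1]memNset; last by case=> [[Cw]]; move: nC; rewrite mem_set.
    rewrite [w \in C2]memNset; last by case=> [[Cw]]; move: nC; rewrite mem_set.
    by rewrite !subr0 !mul0r addr0.
  rewrite /liq /tcost mul1r; have [b0|b0] := eqVneq (b w) 0.
    rewrite [w \in C1]memNset; last by case=> [[_]] /= /(_ b0).
    rewrite [w \in C2]memNset; last by case=> [[_]] /= /(_ b0).
    by rewrite b0 !(subr0, mul0r, addr0) mulrC.
  have b0' : b w <> 0 by apply/eqP.
  set m := Num.max _ _.
  have m1 : dl <= m by rewrite le_maxL.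
  have m2 : mu * `|b w| * S (tau w) w <= m by rewrite le_maxR.
  have [h|h] := leP (mu * `|b w| * S (a w) w) dl.
    rewrite [w \in C1]mem_set // [w \in C2]memNset; last by case=> _ /(_ h).
    have := ler_wpM2l D0 m1; set x := D _ _; lra.
  rewrite [w \in C1]memNset; last by case=> _ /=; rewrite leNgt h.
  rewrite [w \in C2]mem_set; last by split=> //=; apply/negP; rewrite -ltNge.
  by have := ler_wpM2l D0 m2; set x := D _ _; set y := mu * _; lra.
have IR : Ib (fun w => p w * D (tau w) w + q w * (D (tau w) w * S (tau w) w)) by exact: IbD.
have mst : mfun (fun w => \1_C w * (D (tau w) w * lq k b tau w)).
  apply: measurable_funM; first by apply: measurable_indic; exact: Gm.
  apply: mG_FiT; apply: mGM; first exact: (mG_cproc (mDc M) (mDa M) st).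
  apply: mG_liq; [exact: mFs|exact: mG_FatT sa mk|exact: mG_FatT sa mb|].
  exact: (mG_cproc (mSc M) (mSa M) st).
have It : Ib (fun w => \1_C w * (D (tau w) w * lq k b tau w)).
  apply: Ib_le mst IR _ => w; rewrite ger0_norm //.
  rewrite indicE; case: (boolP (w \in C)) => [/set_mem Cw|_]; last by rewrite mul0r.
  by rewrite mul1r mulr_ge0 ?lt' // ltW // mD0.
split=> //.
  by rewrite (_ : (fun w => _) = fun w => p w * D (a w) w + q w * (D (a w) w * S (a w) w));
    [exact: IbD|apply/funext].
rewrite [leRHS](eq_Ex P eqa) ExD // -E1 -E2 -ExD //.
exact: Ex_le.
Qed.

(** The bound on the state is removed by truncation; solvency makes the weighted values nonnegative,
    so Fatou's lemma keeps the inequality. *)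
Lemma hold_super a tau k b (C : set Omega) : stopt a -> stopt tau -> a <=w tau ->
  mG (Fat a) k -> mG (Fat a) b -> Fat a C ->
  (forall w, C w -> 0 <= lq k b a w) ->
  (forall w, C w -> 0 <= lq k b tau w) ->
  Ib (fun w => \1_C w * (D (a w) w * lq k b a w)) ->
  Ib (fun w => \1_C w * (D (tau w) w * lq k b tau w)) /\
  Ex (fun w => \1_C w * (D (tau w) w * lq k b tau w)) <=
  Ex (fun w => \1_C w * (D (a w) w * lq k b a w)).
Proof.
move=> sa st at' mk mb FC la lt' Ia; have sG := sgF sa.
pose Cn (n : nat) := C `&` [set w | `|k w| <= n%:R] `&` [set w | `|b w| <= n%:R].
have FCn n : Fat a (Cn n).
  by apply: (sigma_setI sG); [apply: (sigma_setI sG) => //|]; apply: (mG_le sG); mg.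
have hn n := @hold_bounded a tau k b (Cn n) n%:R sa st at' mk mb (FCn n).
apply: (@Ib_fatou P (fun n w => \1_(Cn n) w * (D (tau w) w * lq k b tau w))).
- by move=> n; case: (hn n) => // w [[Cw _] _] //; [exact: la|exact: lt'].
- move=> n w; rewrite indicE; case: (boolP (w \in Cn n)) => [/set_mem[[Cw _] _]|_]; last by rewrite mul0r.
  by rewrite mul1r mulr_ge0 ?lt' // ltW // mD0.
- move=> n; case: (hn n) => [w [[_ h1] h2]|w [[Cw _] _]|w [[Cw _] _]|I1 I2 E1] //;
    [exact: la|exact: lt'|].
  apply: le_trans E1 _; apply: Ex_le => // w; rewrite !indicE.
  case: (boolP (w \in Cn n)) => [/set_mem[[Cw _] _]|_]; first by rewrite mem_set.
  rewrite mul0r; case: (boolP (w \in C)) => [/set_mem Cw|_]; last by rewrite mul0r.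
  by rewrite mul1r mulr_ge0 ?la // ltW // mD0.
- move=> w; apply: cvg_near_cst; have [Cw|nC] := pselect (C w); last first.
    exists 0%N => // n _ /=; rewrite !indicE !memNset //; by case=> [[]].
  exists (Num.truncn (`|k w| + `|b w|)).+1 => // n /= hn'.
  rewrite !indicE !mem_set //; have : `|k w| + `|b w| <= n%:R.
    by rewrite ltW // (lt_le_trans (truncnS_gt _)) // ler_nat.
  by have := normr_ge0 (k w); have := normr_ge0 (b w); split; [split=> //|] => /=; lra.
Qed.

Definition node : Type := (Omega -> R) * (Omega -> R) * (Omega -> R) * hdg.

Definition nt (x : node) := x.1.1.1.

Definition nk (x : node) := x.1.1.2.

Definition nb (x : node) := x.1.2.

Definition nh (x : node) := x.2.

Definition isN (x : node) := isH (nt x) (nk x) (nb x) (nh x).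

(** The right limit after the first trade becomes the node for the rest of the path. The strict
    decrease [m < n] makes the iteration end on each path. *)
Lemma next_node (x : node) : isN x -> exists x' : node, [/\ isN x', forall w, nt x w <= nt x' w,
  (forall w u, u <= nt x' w -> hK (nh x) u w = nk x w /\ hB (nh x) u w = nb x w),
  (forall w u, nt x' w < u -> hK (nh x') u w = hK (nh x) u w /\ hB (nh x') u w = hB (nh x) u w) &
  (forall w n, nt x' w < T ->
     legal (S ^~ w) n (nt x w) (nk x w) (nb x w) (hK (nh x) ^~ w) (hB (nh x) ^~ w) ->
     trade (nk x w) (nb x w) (nk x' w) (nb x' w) (S (nt x' w) w) /\
     exists2 m, (m < n)%N &
      legal (S ^~ w) m (nt x' w) (nk x' w) (nb x' w) (hK (nh x') ^~ w) (hB (nh x') ^~ w))].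
Proof.
move=> hx; have [s [ss ts hold jp]] := first_jump hx.
have [k [b [hr rn _ _]]] := isH_restr hx ss ts.
exists (s, k, b, restr (nh x) s k b); split=> //=.
  by move=> w u su; rewrite /nh /= !leNgt su.
move=> w n sT leg; have [m [k' [b' [mn tr rn' lm]]]] := jp w n sT leg.
have [ek eb] := rnbhd_uniq sT (rn w sT) rn'.
rewrite /nk /nb /nt /= ek eb; split=> //; exists m => //.
by apply: legal_ext lm _ => u su uT; rewrite /nh /= !leNgt su.
Qed.

(** The inequality is iterated from action to action: holding loses by [hold_super], trading by
    [liq_trade]. The number of actions is finite on each path but not bounded, so the limit is again
    taken with Fatou's lemma. *)
Lemma hedge_super t k b h tau (C : set Omega) : isH t k b h -> stopt tau ->
  t <=w tau -> Fat t C ->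
  Ib (fun w => \1_C w * (D (t w) w * lq k b t w)) ->
  Ib (fun w => \1_C w * (D (tau w) w * Vh h (tau w) w)) /\
  Ex (fun w => \1_C w * (D (tau w) w * Vh h (tau w) w)) <=
  Ex (fun w => \1_C w * (D (t w) w * lq k b t w)).
Proof.
move=> hh st tt FC IC.
have /choice[nx hnx] : forall x : node, exists x' : node, isN x -> [/\ isN x', forall w, nt x w <= nt x' w,
  (forall w u, u <= nt x' w -> hK (nh x) u w = nk x w /\ hB (nh x) u w = nb x w),
  (forall w u, nt x' w < u -> hK (nh x') u w = hK (nh x) u w /\ hB (nh x') u w = hB (nh x) u w) &
  (forall w n, nt x' w < T ->
     legal (S ^~ w) n (nt x w) (nk x w) (nb x w) (hK (nh x) ^~ w) (hB (nh x) ^~ w) ->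
     trade (nk x w) (nb x w) (nk x' w) (nb x' w) (S (nt x' w) w) /\
     exists2 m, (m < n)%N &
      legal (S ^~ w) m (nt x' w) (nk x' w) (nb x' w) (hK (nh x') ^~ w) (hB (nh x') ^~ w))].
  move=> x; have [hx|nx] := pselect (isN x); last by exists x.
  by have [x' hx'] := next_node hx; exists x'.
pose x0 : node := (t, k, b, h).
pose xs i := iter i nx x0.
have hN i : isN (xs i) by elim: i => //= i IH; case: (hnx _ IH).
have mono i w : nt (xs i) w <= nt (xs i.+1) w by case: (hnx _ (hN i)).
have t0 i w : t w <= nt (xs i) w.
  by elim: i => // i IH; exact: le_trans IH (mono i w).
have same i w u : nt (xs i) w < u -> hK (nh (xs i)) u w = hK h u w /\ hB (nh (xs i)) u w = hB h u w.
  elim: i => // i IH su; have [_ _ _ h1 _] := hnx _ (hN i).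
  have [e1 e2] := h1 w u su; have [e3 e4] := IH (le_lt_trans (mono i w) su).
  by rewrite -e3 -e4.
have fin w : exists i, forall j, (i <= j)%N -> nt (xs j) w = T.
  have [n leg] := isH_leg hh w.
  suff [i hi] : exists i, nt (xs i) w = T.
    exists i => j /subnK <-; elim: (j - i)%N => // m IH; rewrite addSn.
    apply: le_anti; rewrite (stopt_leT w (isH_st (hN _))) /= -IH; exact: mono.
  apply: contrapT => /forallNP nT.
  have lT i : nt (xs i) w < T.
    by rewrite lt_neqAle (stopt_leT w (isH_st (hN _))) andbT; apply/eqP; exact: nT.
  have : forall i, exists2 m, (m + i <= n)%N &
     legal (S ^~ w) m (nt (xs i) w) (nk (xs i) w) (nb (xs i) w)
       (hK (nh (xs i)) ^~ w) (hB (nh (xs i)) ^~ w).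
    elim=> [|i [m mi lm]]; first by exists n => //; rewrite addn0.
    have [_ _ _ _ h1] := hnx _ (hN i); have [_ [m' m'm lm']] := h1 w m (lT i.+1) lm.
    by exists m' => //; rewrite addnS -addSn (leq_trans _ mi) // leq_add2r.
  by move=> /(_ n.+1)[m]; rewrite addnS ltnNge leq_addl.
(* The weighted value at the earlier of [tau] and the [i]-th action time; if [tau] has not come by
   then, it is taken after the trade. *)
pose U i w := if tau w <= nt (xs i) w then D (tau w) w * Vh h (tau w) w
  else D (nt (xs i) w) w * liq (nk (xs i) w) (nb (xs i) w) (S (nt (xs i) w) w).
have U0 i w : 0 <= U i w.
  rewrite /U; case: ifP => _; rewrite mulr_ge0 ?(ltW (mD0 M _ _)) //.
    by apply: (isH_adm hh) => //; exact: stopt_leT st.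
  exact: (isH_liq0 w (hN i)).
have step i : Ib (fun w => \1_C w * U i w) ->
   Ib (fun w => \1_C w * U i.+1 w) /\ Ex (fun w => \1_C w * U i.+1 w) <= Ex (fun w => \1_C w * U i w).
  move=> Ii; have si := isH_st (hN i); have sj := isH_st (hN i.+1).
  have [_ _ hold _ jp] := hnx _ (hN i).
  pose E := [set w | nt (xs i) w < tau w].
  have FE : Fat (nt (xs i)) E by exact: Flt.
  have FCi : Fat (nt (xs i)) C by apply: (Fmon (isH_st hh) si _ FC) => w; exact: t0.
  have FCE : Fat (nt (xs i)) (C `&` E) by exact: (sigma_setI (sgF si)).
  have mC := Fat_measurable (isH_st hh) FC.
  have mE := Fat_measurable si FE.
  pose m w := Num.max (nt (xs i) w) (Num.min (tau w) (nt (xs i.+1) w)).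
  have sm : stopt m by apply: smax => //; exact: smin.
  have im w : nt (xs i) w <= m w by rewrite le_maxL.
  have mj w : m w <= nt (xs i.+1) w by rewrite ge_max mono min_leR.
  have lm w : 0 <= liq (nk (xs i) w) (nb (xs i) w) (S (m w) w).
    have := isH_adm (hN i) (im w) (stopt_leT w sm).
    by rewrite /Vh; have [-> ->] := hold w (m w) (mj w).
  have [|I1 E1] := hold_super si sm im (isH_k (hN i)) (isH_b (hN i)) FCE
    (fun w _ => isH_liq0 w (hN i)) (fun w _ => lm w).
    have := Ib_indic mE Ii; congr (Ib _); apply/funext => w.
    rewrite !indicE in_setI; case: (boolP (w \in E)) => [/set_mem Ew|nE].
      by rewrite andbT mul1r /U leNgt Ew.
    by rewrite andbF !mul0r.
  have Inot : Ib (fun w => \1_(~` E) w * (\1_C w * U i w)).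
    by apply: Ib_indic => //; exact: measurableC.
  have Iin : Ib (fun w => \1_E w * (\1_C w * U i w)) by exact: Ib_indic.
  have EU : Ex (fun w => \1_C w * U i w) = Ex (fun w => \1_(~` E) w * (\1_C w * U i w)) +
     Ex (fun w => \1_(C `&` E) w * (D (nt (xs i) w) w * liq (nk (xs i) w) (nb (xs i) w) (S (nt (xs i) w) w))).
    rewrite (_ : Ex (fun w => \1_(C `&` E) w * _) = Ex (fun w => \1_E w * (\1_C w * U i w))).
      rewrite -ExD //; apply: eq_Ex => w; rewrite !indicE in_setC.
      by case: (w \in E); rewrite !(mul0r, mul1r, add0r, addr0).
    apply: eq_Ex => w; rewrite !indicE in_setI; case: (boolP (w \in E)) => [/set_mem Ew|nE].
      by rewrite andbT mul1r /U leNgt Ew.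
    by rewrite andbF !mul0r.
  pose B w := \1_(~` E) w * (\1_C w * U i w) +
     \1_(C `&` E) w * (D (m w) w * liq (nk (xs i) w) (nb (xs i) w) (S (m w) w)).
  have IB : Ib B by exact: IbD.
  have UB w : \1_C w * U i.+1 w <= B w.
    rewrite /B !indicE in_setI in_setC; case: (boolP (w \in C)) => Cw; last by rewrite !mul0r mulr0 addr0.
    rewrite !mul1r /=; case: (boolP (w \in E)) => [/set_mem Ew|nE] /=; last first.
      rewrite mul1r mul0r addr0 /U; have ti : tau w <= nt (xs i) w.
        by rewrite leNgt; apply: contra nE => h1; rewrite mem_set.
      by rewrite ti (le_trans ti (mono i w)).
    rewrite mul0r add0r mul1r /U; have [tj|jt] := leP (tau w) (nt (xs i.+1) w).
      have -> : m w = tau w by rewrite /m (min_idPl tj) (max_idPr (ltW Ew)).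
      have [e1 e2] := same i w (tau w) Ew; have [e3 e4] := hold w (tau w) tj.
      by rewrite /Vh -e1 -e2 e3 e4.
    have -> : m w = nt (xs i.+1) w by rewrite /m (min_idPr (ltW jt)) (max_idPr (mono i w)).
    have jT : nt (xs i.+1) w < T := lt_le_trans jt (stopt_leT w st).
    have [n leg] := isH_leg (hN i) w; have [tr _] := jp w n jT leg.
    rewrite ler_wpM2l ?(ltW (mD0 M _ _)) //.
    exact: (liq_trade (mdl0 M) (mmu0 M) (S_ge0 _ w) tr).
  have IU : Ib (fun w => \1_C w * U i.+1 w).
    apply: (@Ib_le _ _ _ _ _ B) => // [|w].
      apply: measurable_funM; first exact: measurable_indic.
      have -> : U i.+1 = fun w => if w \in [set w | tau w <= nt (xs i.+1) w]
         then D (tau w) w * Vh h (tau w) w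
         else D (nt (xs i.+1) w) w * liq (nk (xs i.+1) w) (nb (xs i.+1) w) (S (nt (xs i.+1) w) w).
        apply/funext => w; rewrite /U; case: ifPn => h1; first by rewrite mem_set.
        by rewrite memNset //=; exact/negP.
      apply: mG_FiT; apply: (mG_if (mFs M T)).
      - by apply: (mG_le (mFs M T)); exact: stopt_meas.
      - by apply: mGM; [exact: (mG_cproc (mDc M) (mDa M) st)|exact: V_meas hh st].
      - apply: mGM; first exact: (mG_cproc (mDc M) (mDa M) sj).
        apply: (mG_liq (mFs M T)); [exact: mG_FatT sj (isH_k (hN i.+1))|exact: mG_FatT sj (isH_b (hN i.+1))|].
        exact: (mG_cproc (mSc M) (mSa M) sj).
    by rewrite ger0_norm ?UB // mulr_ge0 // ?U0 // indicE.
  split=> //; rewrite EU; apply: le_trans (lerD (lexx _) E1); rewrite -ExD //.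
  exact: Ex_le.
have I0 : Ib (fun w => \1_C w * U 0%N w) /\ Ex (fun w => \1_C w * U 0%N w) <=
    Ex (fun w => \1_C w * (D (t w) w * lq k b t w)).
  have -> : (fun w => \1_C w * U 0%N w) =
      fun w => \1_C w * (D (t w) w * lq k b t w); last by split.
  apply/funext => w; rewrite /U /= /xs /= /nt /nk /nb /=; case: ifPn => // h1; congr (_ * _).
  have e1 : tau w = t w by apply: le_anti; rewrite h1 tt.
  by rewrite /Vh e1; have [-> ->] := isH_pre hh (lexx (t w)).
have all i : Ib (fun w => \1_C w * U i w) /\ Ex (fun w => \1_C w * U i w) <=
    Ex (fun w => \1_C w * (D (t w) w * lq k b t w)).
  elim: i => // i [Ii Ei]; have [Ij Ej] := step i Ii; split=> //.
  exact: le_trans Ej Ei.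
apply: (@Ib_fatou P (fun i w => \1_C w * U i w)).
- by move=> i; case: (all i).
- by move=> i w; rewrite mulr_ge0 // ?U0 // indicE.
- by move=> i; case: (all i).
- move=> w; apply: cvg_near_cst; have [i hi] := fin w; exists i => // j /= ij.
  by rewrite /U hi // (stopt_leT w st).
Qed.

End Supermartingale.

(** * Bounds and moduli off small events, and the loss of a nearly worthless hedge *)

Section Moduli.
Local Notation D := (mD M).

Lemma mG_cl (H : R -> Omega -> R) u : (forall v, mG (Fi v) (H v)) -> mG (Fi T) (H (cl T u)).
Proof.
move=> mH; apply: (mG_sub (mFs M _) (mFs M T) _ (mH _)); apply: (mFm M).
exact: (cl_leT _ (ltW (mT0 M))).
Qed.

(** The exceptional event is written with rational times, which makes it measurable; by continuity
    its complement controls the whole path. *)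
Lemma bd_proc (H : R -> Omega -> R) e : (forall w, continuous (H ^~ w)) ->
  (forall u, mG (Fi u) (H u)) -> 0 < e ->
  exists (C : R) (B : set Omega), [/\ 0 < C, measurable B, Ex (fun w => \1_B w * Z w) < e &
   forall w, ~ B w -> forall u, 0 <= u -> u <= T -> `|H u w| <= C].
Proof.
move=> cH mH e0.
pose A (n : nat) := \bigcup_(q in @setT rat) [set w | n%:R < `|H (cl T (ratr q)) w|].
have mA n : measurable (A n).
  apply: (mFmeas M T); apply: (sigma_bigcup_count (mFs M T)) => q.
  by apply: (mG_lt (mFs M T)); mg; exact: mG_cl.
have [|N hN] := Ex_tail mA (mIZ M) _ e0.
  move=> w; have [c c0 hc] := bounded_itv (ltW (mT0 M)) (cH w).
  exists (Num.truncn c).+1 => n cn [q _ /=]; have q1 := cl_ge0 T (ratr q); have q2 := cl_leT (ratr q) (ltW (mT0 M)).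
  move=> h; have := hc _ q1 q2; rewrite leNgt => /negP; apply; apply: le_lt_trans h.
  by rewrite (le_trans (ltW (truncnS_gt c))) // ler_nat.
exists N.+1%:R, (A N.+1); split=> //; first by apply: hN.
move=> w nA u u0 uT; rewrite leNgt; apply/negP => h; apply: nA.
have cf : continuous (fun v => `|H (cl T v) w|).
  by move=> x; apply: cvg_norm; exact: (cl_cont (ltW (mT0 M)) (cH w)).
rewrite -(cl_id u0 uT) in h; have [h' h'0 hh] := continuous_rat cf h.
by have [q /hh hq] := rat_near u h'0; exists q.
Qed.

Lemma osc_proc (H : R -> Omega -> R) e c : (forall w, continuous (H ^~ w)) ->
  (forall u, mG (Fi u) (H u)) -> 0 < e -> 0 < c ->
  exists (l : R) (B : set Omega), [/\ 0 < l, measurable B, Ex (fun w => \1_B w * Z w) < e &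
   forall w, ~ B w -> forall u v, 0 <= u -> u <= T -> 0 <= v -> v <= T -> `|u - v| <= l ->
     `|H u w - H v w| <= c].
Proof.
move=> cH mH e0 c0.
pose A (n : nat) := \bigcup_(q in @setT (rat * rat)%type)
  [set w | (`|ratr q.1 - ratr q.2| < n.+1%:R^-1 :> R) /\
     [set w | c < `|H (cl T (ratr q.1)) w - H (cl T (ratr q.2)) w|] w].
have mA n : measurable (A n).
  apply: (mFmeas M T); apply: (sigma_bigcup_count (mFs M T)) => q.
  apply: (sigma_cond (mFs M T)) => _.
  apply: (mG_lt (mFs M T)); first exact: mG_cst.
  by apply: mG_norm; apply: mGB; [exact: (@mG_cl H (ratr q.1))|exact: (@mG_cl H (ratr q.2))].
have [|N hN] := Ex_tail mA (mIZ M) _ e0.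
  move=> w; have [l l0 hl] := unif_cont_itv (ltW (mT0 M)) (cH w) c0.
  have [N hN] := inv_lt l0; exists N => n Nn [q _ /= [q12]].
  have cT v : 0 <= cl T v <= T by rewrite cl_ge0 (cl_leT _ (ltW (mT0 M))).
  have /andP[q1 q2] := cT (ratr q.1); have /andP[q3 q4] := cT (ratr q.2).
  rewrite ltNge => /negP; apply; apply: hl => //.
  apply: le_trans (cl_dist _ _ (ltW (mT0 M))) _; apply: ltW; apply: lt_trans q12 _; exact: hN.
exists (N.+1%:R^-1 / 2), (A N); split=> //.
  exact: hN.
move=> w nA u v u0 uT v0 vT uv; rewrite leNgt; apply/negP => h; apply: nA.
have cf : continuous (fun v => H (cl T v) w) by exact: (cl_cont (ltW (mT0 M)) (cH w)).
pose z := (`|H u w - H v w| - c) / 2.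
have z0 : 0 < z by rewrite divr_gt0 // subr_gt0.
have [h1 h10 hh1] := continuous_dist u cf z0; have [h2 h20 hh2] := continuous_dist v cf z0.
have i0 : (0 : R) < N.+1%:R^-1 by rewrite invr_gt0.
have m1 : 0 < Num.min h1 (N.+1%:R^-1 / 4) by rewrite lt_min h10 divr_gt0.
have m2 : 0 < Num.min h2 (N.+1%:R^-1 / 4) by rewrite lt_min h20 divr_gt0.
have [q] := rat_near u m1; rewrite lt_min => /andP[/hh1 q1 q2].
have [r] := rat_near v m2; rewrite lt_min => /andP[/hh2 r1 r2].
exists (q, r) => //=; split.
  move: q2 r2 uv i0; set i := N.+1%:R^-1; rewrite !ltr_norml ler_norml.
  by move=> /andP[? ?] /andP[? ?] /andP[? ?] ?; apply/andP; split; lra.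
move: q1 r1; rewrite (cl_id u0 uT) (cl_id v0 vT).
set x := H (cl T (ratr q)) w; set y := H (cl T (ratr r)) w; rewrite -/x -/y => q1 r1.
have e1 : H u w - H v w = - (x - H u w) + (y - H v w) + (x - y) by ring.
have := ler_normD (- (x - H u w) + (y - H v w)) (x - y); rewrite -e1.
have := ler_normD (- (x - H u w)) (y - H v w); rewrite normrN.
by move: q1 r1; rewrite /z; set a := `|x - _|; set b := `|y - _|; set n := `|x - y|; lra.
Qed.

Lemma bd_rv (f : Omega -> R) e : mG (Fi T) f -> 0 < e ->
  exists (C : R) (B : set Omega), [/\ 0 < C, measurable B, Ex (fun w => \1_B w * Z w) < e &
   forall w, ~ B w -> `|f w| <= C].
Proof.
move=> mf e0; pose A (n : nat) := [set w | n%:R < `|f w|].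
have mA n : measurable (A n).
  by apply: (mFmeas M T); apply: (mG_lt (mFs M T)); mg.
have [|N hN] := Ex_tail mA (mIZ M) _ e0.
  move=> w; exists (Num.truncn `|f w|).+1 => n cn /=; apply/negP; rewrite -leNgt.
  by rewrite (le_trans (ltW (truncnS_gt _))) // ler_nat.
exists N.+1%:R, (A N.+1); split=> //; first exact: hN.
by move=> w /negP; rewrite -leNgt.
Qed.

(* [min(x, y) <= 1{d < c} x + d y / c] for [d > 0]. *)
Lemma loss e : 0 < e -> exists2 eta, 0 < eta & forall t k b h a k' b' tau,
  isH t k b h -> t <=w a -> isH a k' b' (restr h a k' b') -> stopt tau ->
  Ib (fun w => \1_[set w | a w < tau w /\ lq k' b' a w <= eta] w *
        Num.min (Z w) (Vh h (tau w) w)) /\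
  Ex (fun w => \1_[set w | a w < tau w /\ lq k' b' a w <= eta] w *
        Num.min (Z w) (Vh h (tau w) w)) <= e.
Proof.
move=> e0; have e20 : 0 < e / 2 by rewrite divr_gt0.
have cV : forall w, continuous ((fun u w => (D u w)^-1) ^~ w).
  by move=> w u; apply: cvgV; [rewrite gt_eqF // mD0|exact: mDc].
have mV u : mG (Fi u) (fun w => (D u w)^-1).
  have -> : (fun w => (D u w)^-1) = fun w => (D u w) `^ (-1).
    by apply/funext => w; rewrite powR_inv1 // ltW // mD0.
  by apply: (@mG_comp _ _ _ _ (fun x => x `^ (-1))); [exact: measurable_powR|exact: mDa].
have [C [B [C0 mB EB hB]]] := bd_proc cV mV e20.
have ED0 : 0 <= Ex (fun w => D T w) by apply: Ex_ge0 => w; exact/ltW/mD0.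
(* [C] bounds [1 / D] off [B]. By the supermartingale property the weighted value is at most [eta]
   times the expectation of [D T], and this [eta] makes [C] times that product at most [e / 2]. The
   [+ 1] avoids a zero denominator. *)
exists (e / 2 / (C * (Ex (fun w => D T w) + 1))).
  by rewrite divr_gt0 // mulr_gt0 // ltr_wpDl.
set eta := _ / _ => t k b h a k' b' tau hh ta hr st.
have eta0 : 0 < eta by rewrite divr_gt0 // mulr_gt0 // ltr_wpDl.
have sa := isH_st hr; have sG := sgF sa.
pose A := [set w | a w < tau w] `&` [set w | lq k' b' a w <= eta].
have FA : Fat a A.
  apply: (sigma_setI sG); first exact: Flt.
  apply: (mG_le sG); last exact: mG_cst.
  apply: (mG_liq sG); [exact: isH_k hr|exact: isH_b hr|exact: (mG_at (mSc M) (mSa M) sa)].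
have mA := Fat_measurable sa FA.
rewrite (_ : [set w | _ /\ _] = A) //.
pose xi w := Num.max (tau w) (a w).
have sx : stopt xi by exact: smax.
have ax w : a w <= xi w by rewrite le_maxR.
have [IDa _] := mDint M _ sa.
have IA : Ib (fun w => \1_A w * (D (a w) w * lq k' b' a w)).
  apply: (@Ib_le _ _ _ _ _ (fun w => eta * D (a w) w)); [|exact: IbZ|].
    apply: measurable_funM; first exact: measurable_indic.
    apply: mG_FiT; apply: (mG_FatT sa); apply: mGM; first exact: (mG_at (mDc M) (mDa M) sa).
    apply: (mG_liq sG); [exact: isH_k hr|exact: isH_b hr|exact: (mG_at (mSc M) (mSa M) sa)].
  move=> w; rewrite indicE; case: (boolP (w \in A)) => [/set_mem[_ /= h1]|_]; last first.
    by rewrite mul0r normr0 mulr_ge0 // ltW // mD0.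
  have D0 := ltW (mD0 M (a w) w); have l0 := isH_liq0 w hr.
  by rewrite mul1r ger0_norm ?mulr_ge0 // mulrC ler_wpM2r.
have [I1 E1] := hedge_super hr sx ax FA IA.
have IZB : Ib (fun w => \1_B w * Z w) by apply: Ib_indic => //; exact: mIZ.
have IR : Ib (fun w => \1_B w * Z w + C * (\1_A w * (D (xi w) w * Vh (restr h a k' b') (xi w) w))).
  by apply: IbD => //; exact: IbZ.
have le w : \1_A w * Num.min (Z w) (Vh h (tau w) w) <=
    \1_B w * Z w + C * (\1_A w * (D (xi w) w * Vh (restr h a k' b') (xi w) w)).
  have z0 := Z0 w; have V0 := isH_adm hr (ax w) (stopt_leT w sx); have D0 := mD0 M (xi w) w.
  rewrite !indicE; case: (boolP (w \in A)) => [/set_mem[/= Aw _]|_]; last first.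
    by rewrite !mul0r mulr0 addr0 mulr_ge0.
  rewrite !mul1r; case: (boolP (w \in B)) => [_|nB].
    rewrite mul1r ler_wpDr ?ge_min ?lexx //.
    by rewrite mulr_ge0 ?(ltW C0) // mulr_ge0 // ltW.
  rewrite mul0r add0r.
  have xt : xi w = tau w by rewrite /xi (max_idPl (ltW Aw)).
  have -> : Vh h (tau w) w = Vh (restr h a k' b') (xi w) w by rewrite xt /Vh /= !leNgt Aw.
  apply: (@le_trans _ _ (Vh (restr h a k' b') (xi w) w)); first by rewrite min_leR.
  rewrite mulrA ler_peMl // -ler_pdivrMr // mul1r.
  have xT := stopt_leT w sx; have x0 := stopt_ge0 w sx.
  have nB' : ~ B w by move=> Bw; move: nB; rewrite mem_set.
  have := hB w nB' (xi w) x0 xT; by rewrite ger0_norm ?invr_ge0 ?(ltW D0).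
split.
  apply: (@Ib_le _ _ _ _ _ _ _ IR) => [|w].
    apply: measurable_funM; first exact: measurable_indic.
    apply: measurable_minr; last by apply: mG_FiT; exact: V_meas hh st.
    exact: Ib_measurable (mIZ M).
  rewrite ger0_norm //; rewrite indicE; case: (boolP (w \in A)) => [/set_mem[/= Aw _]|_]; last by rewrite mul0r.
  rewrite mul1r le_min Z0 /=; apply: (isH_adm hh); last exact: stopt_leT st.
  exact: le_trans (ta w) (ltW Aw).
apply: le_trans (Ex_le _ IR le) _.
  apply: (@Ib_le _ _ _ _ _ _ _ IR) => [|w].
    apply: measurable_funM; first exact: measurable_indic.
    apply: measurable_minr; last by apply: mG_FiT; exact: V_meas hh st.
    exact: Ib_measurable (mIZ M).
  rewrite ger0_norm //; rewrite indicE; case: (boolP (w \in A)) => [/set_mem[/= Aw _]|_]; last by rewrite mul0r.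
  rewrite mul1r le_min Z0 /=; apply: (isH_adm hh); last exact: stopt_leT st.
  exact: le_trans (ta w) (ltW Aw).
rewrite ExD //; last exact: IbZ.
rewrite ExZ // [leRHS](splitr e); apply: lerD; first exact: ltW.
apply: (@le_trans _ _ (C * (eta * Ex (fun w => D T w)))); last first.
  rewrite /eta; set E := Ex _ in ED0 *; rewrite mulrCA mulrAC -mulrA ler_piMr //.
    exact: ltW.
  by rewrite ler_pdivrMr ?mulr_gt0 // ?ltr_wpDl // mul1r ler_pM2l // lerDl.
rewrite ler_pM2l //; apply: le_trans E1 _.
have [ET _] := mDmart M _ _ sa (sigma_setT sG).
have -> : Ex (fun w => D T w) = Ex (fun w => D (a w) w).
  have e1 (f : Omega -> R) : Ex (fun w => \1_setT w * f w) = Ex f.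
    by apply: eq_Ex => w; rewrite indicT mul1r.
  by rewrite -[LHS]e1 -ET e1.
rewrite -ExZ //; apply: Ex_le => //; first exact: IbZ.
move=> w; rewrite indicE; case: (boolP (w \in A)) => [/set_mem[_ /= h1]|_]; last first.
  by rewrite mul0r mulr_ge0 // ltW // mD0.
by rewrite mul1r mulrC ler_wpM2r // ltW // mD0.
Qed.

End Moduli.

(** * Repairing, transferring and grafting trading paths *)

Lemma mG_lproc (H : R -> Omega -> R) t a (f : Omega -> R) : stopt t -> stopt a ->
  t <=w a -> (forall u, mG (Fi u) (fun w => if t w < u then H u w else 0)) ->
  (forall w, lcont T (t w) (H ^~ w)) -> mG (Fat t) f ->
  mG (Fat a) (fun w => if t w < a w then H (a w) w else f w).
Proof.
move=> st sa ta mH lc mf; apply: mFatP => // u; have sF := mFs M u.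
pose H' v w := if v < u then (if t w < v then H v w else if t w < u then f w else 0) else 0.
pose phi w := if w \in [set w | a w < u] then Num.min (a w) u else u + 1.
have mphi : mG (Fi u) phi.
  by apply: (mG_if sF); [exact: stlt|exact: stminC|exact: mG_cst].
have -> : (fun w => if a w < u then if t w < a w then H (a w) w else f w else 0) =
    fun w => H' (phi w) w.
  apply/funext => w; rewrite /phi; case: ifPn => au.
    rewrite mem_set // (min_idPl (ltW au)) /H' au; case: ifPn => // _.
    by rewrite (le_lt_trans (ta w) au).
  rewrite memNset /=; last exact/negP.
  by rewrite /H' ltNge lerDl ler01.
apply: (mG_proc sF (H := H')) => [q|//|w e e0].
- case: (ltP q u) => qu; last first.
    have -> : H' q = fun=> 0 by apply/funext => w; rewrite /H' ltNge qu.
    exact: mG_cst.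
  have -> : H' q = fun w => if w \in [set w | t w < q] then (if t w < q then H q w else 0)
      else (if t w < u then f w else 0).
    apply/funext => w; rewrite /H' qu; case: ifPn => tq; first by rewrite mem_set.
    by rewrite memNset //=; exact/negP.
  apply: (mG_if sF); last exact: mG_Fat_lt.
    by apply: (mFm M (ltW qu)); exact: stlt.
  exact: (mG_sub (mFs M q) sF (mFm M (ltW qu)) (mH q)).
rewrite /phi; have [au|ua] := ltP (a w) u; last first.
  rewrite memNset /=; last by apply/negP; rewrite -leNgt.
  exists 1 => // v; rewrite addrK => uv _.
  by rewrite /H' [v < u]ltNge (ltW uv) [u + 1 < u]ltNge lerDl ler01 /= subrr normr0.
rewrite mem_set //; have [tw|wt] := ltP (t w) (a w); last first.
  exists 1 => // v _ va; rewrite /H' (lt_trans va au) au.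
  rewrite [t w < v]ltNge (le_trans (ltW va) wt) /= [t w < a w]ltNge wt /=.
  by rewrite subrr normr0.
have [h h0 hh] := lc w (a w) tw (stopt_leT w sa) e e0.
exists (Num.min h (a w - t w)); first by rewrite lt_min h0 subr_gt0.
move=> v; rewrite ltrBlDr -ltrBlDl lt_min => /andP[v1 v2] va.
have tv : t w < v by lra.
rewrite /H' (lt_trans va au) au tv tw; apply: hh => //; [lra|exact: ltW].
Qed.

(* Follow a trading path until its liquidation value becomes negative, then freeze. *)
Lemma repair a k b (K B : R -> Omega -> R) sig : stopt a -> mG (Fat a) k -> mG (Fat a) b ->
  (forall u, mG (Fi u) (fun w => if a w < u then K u w else 0)) ->
  (forall u, mG (Fi u) (fun w => if a w < u then B u w else 0)) ->
  (forall w, exists n, legal (S ^~ w) n (a w) (k w) (b w) (K ^~ w) (B ^~ w)) ->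
  (forall w, 0 <= lq k b a w) -> stopt sig -> a <=w sig ->
  exists (beta : Omega -> R) h, [/\ stopt beta, forall w, a w <= beta w, isH a k b h, hs h = sig &
   [/\ (forall w u, a w < u -> u <= beta w -> hK h u w = K u w /\ hB h u w = B u w),
    (forall w, beta w < T -> forall e, 0 < e -> exists u, [/\ beta w < u, u < beta w + e, u <= T &
       liq (K u w) (B u w) (S u w) < 0]) &
    (forall w u, beta w = a w -> a w < u -> hK h u w = frozen dl (k w) (b w) /\ hB h u w = 0)]].
Proof.
move=> sa mk mb mK mB leg l0 ss asg.
pose V u w := liq (K u w) (B u w) (S u w).
have lK w : lcont T (a w) (K ^~ w).
  move=> u au uT e e0; have [n ln] := leg w; have [e1 e10 he] := legal_lconst ln au uT.
  by exists e1 => // v v1 v2 v3; have [-> _] := he v v1 v2 v3; rewrite subrr normr0.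
have lB w : lcont T (a w) (B ^~ w).
  move=> u au uT e e0; have [n ln] := leg w; have [e1 e10 he] := legal_lconst ln au uT.
  by exists e1 => // v v1 v2 v3; have [_ ->] := he v v1 v2 v3; rewrite subrr normr0.
have lV w : lcont T (a w) (V ^~ w).
  move=> u au uT e e0; have [n ln] := leg w; have [e1 e10 he] := legal_lconst ln au uT.
  have [h h0 hh] := liq_left u w (K u w) (B u w) e0.
  exists (Num.min e1 h); first by rewrite lt_min e10.
  move=> v av; rewrite ltrBlDr -ltrBlDl lt_min => /andP[v1 v2] vu.
  have ev : u - e1 < v by lra.
  rewrite /V; have [-> ->] := he v av ev vu; apply: hh.
  by rewrite ler0_norm; lra.
have mV u : mG (Fi u) (fun w => if a w < u then V u w else 0).
  have -> : (fun w => if a w < u then V u w else 0) = fun w => if w \in [set w | a w < u] then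
      liq (if a w < u then K u w else 0) (if a w < u then B u w else 0) (S u w) else 0.
    apply/funext => w; case: ifPn => au; first by rewrite mem_set.
    by rewrite memNset //=; exact/negP.
  apply: (mG_if (mFs M u)); [exact: stlt| |exact: mG_cst].
  by apply: (mG_liq (mFs M u)) => //; exact: mSa.
(* Up to and including [beta] the path is solvent by left-continuity, so the state reached there can
   still be liquidated. *)
pose beta := hit T a V.
have sb : stopt beta by exact: (hit_stopt (mFs M) (mFm M) (mFrc M) sa mV lV).
have bP w := hitP sa (lV w).
have ab w : a w <= beta w by case: (bP w).
pose kb w := if a w < beta w then K (beta w) w else k w.
pose bb w := if a w < beta w then B (beta w) w else b w.
have mkb : mG (Fat beta) kb by exact: (mG_lproc sa sb ab mK lK mk).
have mbb : mG (Fat beta) bb by exact: (mG_lproc sa sb ab mB lB mb).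
have lb w : 0 <= lq kb bb beta w.
  rewrite /kb /bb; case: ifPn => h1; first by have [_ _ h3 _] := bP w; exact: h3.
  have -> : beta w = a w by apply: le_anti; rewrite ab andbT leNgt.
  exact: l0.
pose h := Hedge (fun u w => if u <= a w then k w else if u <= beta w then K u w else frozen dl (kb w) (bb w))
  (fun u w => if u <= a w then b w else if u <= beta w then B u w else 0) sig.
have ad (G : R -> Omega -> R) (p f : Omega -> R) u : mG (Fi u) (fun w => if a w < u then G u w else 0) ->
   mG (Fat beta) f ->
   mG (Fi u) (fun w => if a w < u then (if u <= a w then p w else if u <= beta w then G u w else f w) else 0).
  move=> mGu mf.
  have -> : (fun w => if a w < u then (if u <= a w then p w else if u <= beta w then G u w else f w) else 0) =
    fun w => if w \in [set w | beta w < u] then (if beta w < u then f w else 0)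
      else (if a w < u then G u w else 0).
    apply/funext => w; have [bu|ub] := ltP (beta w) u.
      by rewrite mem_set // (le_lt_trans (ab w) bu) leNgt (le_lt_trans (ab w) bu) /=.
    rewrite memNset /=; last by apply/negP; rewrite -leNgt.
    by case: ifPn => // au; rewrite leNgt au /=.
  by apply: (mG_if (mFs M u)) => //; [exact: stlt|exact: mG_Fat_lt].
exists beta, h; split=> //; last split.
- split=> //.
  + by move=> u; apply: ad => //; apply: (mG_frozen (sgF sb)).
  + by move=> u; apply: ad => //; exact: mG_cst.
  + by move=> w u ua; rewrite /= ua.
  + move=> w; have [n ln] := leg w; have [bT|Tb] := ltP (beta w) T; last first.
      exists n; apply: legal_ext ln _ => u au uT /=.
      by rewrite leNgt au /= (le_trans uT Tb).
    have e0 : (kb w, bb w) = (if a w < beta w then (K (beta w) w, B (beta w) w) else (k w, b w)).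
      by rewrite /kb /bb; case: ifP.
    have [m lm] := legal_freeze (mdl0 M) ln (ab w) bT e0 (lb w).
    exists m; apply: legal_ext lm _ => u au uT /=.
    by rewrite leNgt au.
  + move=> w u au uT; rewrite /Vh /=; case: ifPn => [ua|].
      have -> : u = a w by apply: le_anti; rewrite ua au.
      exact: l0.
    rewrite -ltNge => au'; case: ifPn => ub; first by have [_ _ h3 _] := bP w; exact: h3.
    by rewrite /liq mul0r addr0 tcost0 subr0; exact: frozen_ge0 (lb w).
- by move=> w u au ub; rewrite /= leNgt au ub.
- by move=> w bT e e0; have [_ _ _ h4] := bP w; have [u] := h4 bT e e0; exists u.
- by move=> w u ba au; rewrite /= /kb /bb ba ltxx leNgt au.
Qed.

(* Hold [(k, b)] until [r], then, on [E], follow the path of [g] with [eta] less cash. *)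
Lemma transfer t0 k0 b0 g a r k b k' b' (E : set Omega) (eta : R) sig :
  isH t0 k0 b0 g -> stopt a -> a <=w r -> t0 <=w r ->
  mG (Fat a) k -> mG (Fat a) b -> (forall w, 0 <= lq k b a w) ->
  isH r k' b' (restr g r k' b') -> Fat r E ->
  (forall w, E w -> r w < T /\ trade (k w) (b w) (k' w - eta) (b' w) (S (r w) w)) ->
  stopt sig -> a <=w sig ->
  exists (beta : Omega -> R) h, [/\ stopt beta, forall w, a w <= beta w, isH a k b h, hs h = sig &
   [/\ (forall w u, a w < u -> u <= beta w -> u <= r w -> hK h u w = k w /\ hB h u w = b w),
    (forall w u, E w -> r w < u -> u <= beta w -> hK h u w = hK g u w - eta /\ hB h u w = hB g u w),
    (forall w, E w -> r w <= beta w -> beta w < T -> forall e, 0 < e -> exists u,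
      [/\ beta w < u, u < beta w + e, u <= T & Vh g u w - eta < 0]),
    (forall w, beta w < r w -> forall e, 0 < e -> exists u,
      [/\ beta w < u, u < beta w + e, u <= r w & liq (k w) (b w) (S u w) < 0]) &
    (forall w u, beta w = a w -> a w < u -> hK h u w = frozen dl (k w) (b w) /\ hB h u w = 0)]].
Proof.
move=> hg sa ar tr mk mb l0 hr FE hE ss asg.
have sr := isH_st hr.
(* This candidate path disregards solvency; [repair] cuts it at the first violation. *)
pose K u w := if u <= r w then k w else if w \in E then hK g u w - eta else k w.
pose B u w := if u <= r w then b w else if w \in E then hB g u w else b w.
have FEu u : Fi u (E `&` [set w | r w < u]).
  exact: (Fat_lt (mFs M) (mFm M) u sr FE).
have mK u : mG (Fi u) (fun w => if a w < u then K u w else 0).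
  have -> : (fun w => if a w < u then K u w else 0) = fun w =>
     if w \in E `&` [set w | r w < u] then (if r w < u then (if u <= r w then k' w else hK g u w) else 0) - eta
     else (if a w < u then k w else 0).
    apply/funext => w; have [[Ew ru]|nE] := pselect ((E `&` [set w | r w < u]) w).
      by rewrite mem_set // ru /K (le_lt_trans (ar w) ru) leNgt ru /= mem_set.
    rewrite memNset // /K; case: ifPn => // au; case: ifPn => // ur.
    by rewrite memNset // => Ew; apply: nE; split=> //=; rewrite ltNge.
  apply: (mG_if (mFs M u)) => //; last exact: mG_Fat_lt.
  by apply: mGB; [exact: isH_Kad hr u|exact: mG_cst].
have mB u : mG (Fi u) (fun w => if a w < u then B u w else 0).
  have -> : (fun w => if a w < u then B u w else 0) = fun w =>
     if w \in E `&` [set w | r w < u] then (if r w < u then (if u <= r w then b' w else hB g u w) else 0)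
     else (if a w < u then b w else 0).
    apply/funext => w; have [[Ew ru]|nE] := pselect ((E `&` [set w | r w < u]) w).
      by rewrite mem_set // ru /B (le_lt_trans (ar w) ru) leNgt ru /= mem_set.
    rewrite memNset // /B; case: ifPn => // au; case: ifPn => // ur.
    by rewrite memNset // => Ew; apply: nE; split=> //=; rewrite ltNge.
  apply: (mG_if (mFs M u)) => //; last exact: mG_Fat_lt.
  exact: isH_Bad hr u.
have leg w : exists n, legal (S ^~ w) n (a w) (k w) (b w) (K ^~ w) (B ^~ w).
  have [Ew|nE] := pselect (E w); last first.
    exists 0; apply: legal_hold => u au uT; rewrite /K /B memNset //.
    by rewrite !if_same.
  have [rT td] := hE w Ew; have [n ln] := isH_leg hr w; exists n.+1.
  apply: (legal_jump (ar w) rT _ td); first by move=> u au ur; rewrite /K /B ur.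
  apply: legal_ext (legal_shift eta ln) _ => u ru uT.
  by rewrite /K /B /= !leNgt ru /= mem_set.
have [beta [h [sb ab hh hs_ [h1 h2 h3]]]] := repair sa mk mb mK mB leg l0 ss asg.
exists beta, h; split=> //; split=> //.
- by move=> w u au ub ur; have [-> ->] := h1 w u au ub; rewrite /K /B ur.
- move=> w u Ew ru ub; have [-> ->] := h1 w u (le_lt_trans (ar w) ru) ub.
  by rewrite /K /B leNgt ru /= mem_set.
- move=> w Ew rb bT e e0; have [u [u1 u2 u3 u4]] := h2 w bT e e0; exists u; split=> //.
  move: u4; rewrite /K /B leNgt (le_lt_trans rb u1) /= mem_set // /Vh /liq.
  set c := tcost _ _ _ _; lra.
- move=> w br e e0; have bT := lt_le_trans br (stopt_leT w sr).
  have m0 : 0 < Num.min e (r w - beta w) by rewrite lt_min e0 subr_gt0.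
  have [u [u1 u2 u3 u4]] := h2 w bT _ m0.
  have m1 : Num.min e (r w - beta w) <= e by rewrite min_leL.
  have m2 : Num.min e (r w - beta w) <= r w - beta w by rewrite min_leR.
  have ur : u <= r w by lra.
  by exists u; split=> //; [lra|move: u4; rewrite /K /B ur].
Qed.

(** The bound [1 <= C * S u w] keeps the price away from zero, which turns absolute price
    oscillations into the relative ones needed for merging. *)
Lemma good_bd k b e : mG (Fi T) k -> mG (Fi T) b -> 0 < e ->
  exists (C : R) (B : set Omega), [/\ 1 <= C, measurable B, Ex (fun w => \1_B w * Z w) < e &
   forall w, ~ B w -> [/\ `|k w| <= C, `|b w| <= C &
     forall u, 0 <= u -> u <= T -> S u w <= C /\ 1 <= C * S u w]].
Proof.
move=> mk mb e0; have e4 : 0 < e / 4 by rewrite divr_gt0.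
have cV : forall w, continuous ((fun u w => (S u w)^-1) ^~ w).
  by move=> w u; apply: cvgV; [rewrite gt_eqF // mS0|exact: mSc].
have mV u : mG (Fi u) (fun w => (S u w)^-1).
  have -> : (fun w => (S u w)^-1) = fun w => (S u w) `^ (-1).
    by apply/funext => w; rewrite powR_inv1 // S_ge0.
  by apply: (@mG_comp _ _ _ _ (fun x => x `^ (-1))); [exact: measurable_powR|exact: mSa].
have [C1 [B1 [C10 mB1 E1 h1]]] := bd_proc (mSc M) (mSa M) e4.
have [C2 [B2 [C20 mB2 E2 h2]]] := bd_proc cV mV e4.
have [C3 [B3 [C30 mB3 E3 h3]]] := bd_rv mk e4.
have [C4 [B4 [C40 mB4 E4 h4]]] := bd_rv mb e4.
exists (1 + C1 + C2 + C3 + C4), (B1 `|` B2 `|` B3 `|` B4); split.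
- lra.
- by do !apply: measurableU.
- have IB (B : set Omega) : measurable B -> Ib (fun w => \1_B w * Z w).
    by move=> mB; apply: Ib_indic => //; exact: mIZ.
  apply: (@le_lt_trans _ _ (Ex (fun w => \1_B1 w * Z w + \1_B2 w * Z w + \1_B3 w * Z w + \1_B4 w * Z w))).
    apply: Ex_le; first by apply: IB; do !apply: measurableU.
      by do !apply: IbD; exact: IB.
    move=> w; have z0 := Z0 w; rewrite -!mulrDl ler_wpM2r // !indicE !in_setU.
    by case: (w \in B1); case: (w \in B2); case: (w \in B3); case: (w \in B4) => /=; lra.
  rewrite !ExD; try by do ?apply: IbD; exact: IB.
  by move: E1 E2 E3 E4; rlra.
move=> w nB.
have n1 : ~ B1 w by move=> h; apply: nB; left; left; left.
have n2 : ~ B2 w by move=> h; apply: nB; left; left; right.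
have n3 : ~ B3 w by move=> h; apply: nB; left; right.
have n4 : ~ B4 w by move=> h; apply: nB; right.
split; [have := h3 w n3; lra|have := h4 w n4; lra|move=> u u0 uT].
have S0 := mS0 M u w; have := h1 w n1 u u0 uT; have := h2 w n2 u u0 uT.
rewrite !ger0_norm ?invr_ge0 ?(ltW S0) // => i1 i2; split; first by lra.
rewrite -ler_pdivrMr // mul1r; lra.
Qed.

Lemma good_osc e c : 0 < e -> 0 < c ->
  exists (l : R) (B : set Omega), [/\ 0 < l, measurable B, Ex (fun w => \1_B w * Z w) < e &
   forall w, ~ B w -> forall u v, 0 <= u -> u <= T -> 0 <= v -> v <= T -> `|u - v| <= l ->
     [/\ `|S u w - S v w| <= c, `|X u w - X v w| <= c & `|Y u w - Y v w| <= c]].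
Proof.
move=> e0 c0; have e4 : 0 < e / 4 by rewrite divr_gt0.
have [l1 [B1 [l10 mB1 E1 h1]]] := osc_proc (mSc M) (mSa M) e4 c0.
have [l2 [B2 [l20 mB2 E2 h2]]] := osc_proc (mXc M) (mXa M) e4 c0.
have [l3 [B3 [l30 mB3 E3 h3]]] := osc_proc (mYc M) (mYa M) e4 c0.
exists (Num.min l1 (Num.min l2 l3)), (B1 `|` B2 `|` B3); split.
- by rewrite !lt_min l10 l20.
- by do !apply: measurableU.
- have IB (B : set Omega) : measurable B -> Ib (fun w => \1_B w * Z w).
    by move=> mB; apply: Ib_indic => //; exact: mIZ.
  apply: (@le_lt_trans _ _ (Ex (fun w => \1_B1 w * Z w + \1_B2 w * Z w + \1_B3 w * Z w))).
    apply: Ex_le; first by apply: IB; do !apply: measurableU.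
      by do !apply: IbD; exact: IB.
    move=> w; have z0 := Z0 w; rewrite -!mulrDl ler_wpM2r // !indicE !in_setU.
    by case: (w \in B1); case: (w \in B2); case: (w \in B3) => /=; lra.
  rewrite !ExD; try by do ?apply: IbD; exact: IB.
  by move: e0 E1 E2 E3; rlra.
move=> w nB u v u0 uT v0 vT; rewrite !le_min => /and3P[i1 i2 i3].
have n1 : ~ B1 w by move=> h; apply: nB; left; left.
have n2 : ~ B2 w by move=> h; apply: nB; left; right.
have n3 : ~ B3 w by move=> h; apply: nB; right.
by split; [exact: h1|exact: h2|exact: h3].
Qed.

(** Together with [isH a], which fixes the state up to [a], this makes [a] the time of the first
    action. *)
Definition acts a k b h := forall w, hs h w = a w \/ (a w < T /\
  exists k' b' : R, trade (k w) (b w) k' b' (S (a w) w) /\ rnbhd h w (a w) k' b').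

Lemma max0_shift (x y c : R) : 0 <= c -> x <= y + c -> Num.max x 0 <= Num.max y 0 + c.
Proof.
move=> c0 h; rewrite ge_max; apply/andP; split.
  by apply: (le_trans h); rewrite lerD2r le_maxL.
by rewrite addr_ge0 // le_maxR.
Qed.

Lemma max0_loss (x v z : R) : 0 <= v -> x <= z -> 0 <= z ->
  Num.max x 0 <= Num.max (x - v) 0 + Num.min z v.
Proof.
move=> v0 xz z0; have [vz|zv] := leP z v; rewrite ge_max; apply/andP; split.
- by rewrite -[leLHS]add0r lerD // le_maxR.
- by rewrite addr_ge0 // le_maxR.
- by rewrite -lerBlDr le_maxL.
- by rewrite addr_ge0 // le_maxR.
Qed.

Lemma cost_V h tau w : cost h tau w =
  Num.max ((if hs h w < tau w then X (hs h w) w else Y (tau w) w) - Vh h (Num.min (tau w) (hs h w)) w) 0.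
Proof.
rewrite /cost; case: ifPn => h1; first by rewrite (min_idPr (ltW h1)).
by rewrite (min_idPl _) // leNgt.
Qed.

Lemma rlim_le h w (u k b : R) (x : R) : rnbhd h w u k b -> u < T ->
  (forall e, 0 < e -> exists v, [/\ u < v, v < u + e, v <= T & Vh h v w <= x]) -> liq k b (S u w) <= x.
Proof.
move=> [e1 e10 rn] uT hx; apply/ler_addgt0Pr => e e0.
have [e2 e20 hc] := liq_left u w k b e0.
have m0 : 0 < Num.min e1 e2 by rewrite lt_min e10.
have [v [v1 v2 v3 v4]] := hx _ m0.
have m1 : Num.min e1 e2 <= e1 by rewrite min_leL.
have m2 : Num.min e1 e2 <= e2 by rewrite min_leR.
have [|ek eb] := rn v v1 _ v3; first by lra.
have := hc v; rewrite ger0_norm; last by lra.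
have -> : v - u < e2 by lra.
move=> /(_ isT); rewrite ltr_norml => /andP[h1 _].
by move: v4 h1; rewrite /Vh ek eb; set a := liq _ _ _; set c := liq _ _ _; lra.
Qed.

Lemma mG_trade (G : set (set Omega)) (k b k' b' p : Omega -> R) : salg G ->
  mG G k -> mG G b -> mG G k' -> mG G b' -> mG G p ->
  G [set w | trade (k w) (b w) (k' w) (b' w) (p w)].
Proof.
move=> sG mk mb mk' mb' mp.
have h : mG G (fun w => k w - (b' w - b w) * p w - Num.max dl (mu * `|b' w - b w| * p w)) by mg.
exact: (mG_le sG mk' h).
Qed.

(** The first action of [g] is postponed from [a] to [t']. The trades of [g] up to [t'] are merged
    into one trade at [t'], and then the path of [g] is followed with [eta] less cash until this
    becomes insolvent; at that moment [g] itself has a liquidation value of at most [eta], which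
    [loss] makes harmless. The length [l] depends on the node state and on [e] only, not on [g]. *)
Lemma graft k b e : mG (Fi T) k -> mG (Fi T) b -> 0 < e ->
  exists2 l : R, 0 < l & forall a t' g,
  isH a k b g -> acts a k b g -> stopt t' -> a <=w t' -> okto a t' k b ->
  exists h, [/\ isH t' k b h, acts t' k b h & forall tau, stopt tau ->
     Ex (fun w => Num.max (cost h tau w - cost g tau w) 0) <=
     e + Ex (fun w => \1_[set w | l < t' w - a w] w * Z w)].
Proof.
move=> mk mb e0; have e8 : 0 < e / 8 by rewrite divr_gt0.
have [C [B1 [C1 mB1 E1 hB1]]] := good_bd mk mb e8.
have [eta0 eta00 hloss] := loss e8.
have C0 : 0 < C by lra.
have m0 := mmu0 M.
pose eta : R := Num.min eta0 (e / 8).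
have eta_gt0 : 0 < eta by rewrite lt_min eta00.
have eta_le : eta <= e / 8 by rewrite min_leR.
have eta_le0 : eta <= eta0 by rewrite min_leL.
(* [ep] is a relative price oscillation for which the merging loss [4 * ep * (k + b * S) / mu] is at
   most [eta]; the constant [c] below is a matching absolute oscillation. *)
pose ep : R := Num.min (mu / 4) (mu * eta / (4 * (C + C * C))).
have CC0 : 0 < 4 * (C + C * C) by rewrite mulr_gt0 // addr_gt0 // mulr_gt0.
have ep0 : 0 < ep by rewrite lt_min !divr_gt0 // mulr_gt0.
have ep1 : ep <= mu / 4 by rewrite min_leL.
have ep2 : 4 * ep * (C + C * C) <= mu * eta.
  have : ep <= mu * eta / (4 * (C + C * C)) by rewrite min_leR.
  by rewrite ler_pdivlMr // => h; rewrite mulrAC mulrC.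
pose c : R := Num.min (ep / C) (e / 8 / (1 + 2 * C)).
have C20 : 0 < 1 + 2 * C by lra.
have c0 : 0 < c by rewrite lt_min !divr_gt0.
have cC : c * C <= ep by rewrite -ler_pdivlMr // min_leL.
have cc : c + 2 * C * c <= e / 8.
  have : c <= e / 8 / (1 + 2 * C) by rewrite min_leR.
  by rewrite ler_pdivlMr //; lra.
have [l [B2 [l0 mB2 E2 hB2]]] := good_osc e8 c0.
exists l => // a t' g hg ag st at' ok.
have sa := isH_st hg; have sg := isH_s hg; have sG := sgF st.
have [k' [b' [hr rn _ _]]] := isH_restr hg st at'.
have mkt : mG (Fat t') k by exact: (mG_mon sa st at' (isH_k hg)).
have mbt : mG (Fat t') b by exact: (mG_mon sa st at' (isH_b hg)).
have mSt : mG (Fat t') (fun w => S (t' w) w) by exact: (mG_at (mSc M) (mSa M) st).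
(* Where [g] still runs after [t'] and the merged trade is affordable. Off [E] the new hedge stops
   at [t']. *)
pose E := [set w | t' w < T] `&` [set w | t' w < hs g w] `&`
  [set w | trade (k w) (b w) (k' w - eta) (b' w) (S (t' w) w)].
have FE : Fat t' E.
  apply: (sigma_setI sG); [apply: (sigma_setI sG)|].
  - by apply: (mG_lt sG); [exact: smG|exact: mG_cst].
  - exact: Flt.
  - have mk' := isH_k hr; have mb' := isH_b hr.
    by apply: (@mG_trade _ k b (fun w => k' w - eta) b') => //; mg.
pose sig := ite E (fun w => Num.max (hs g w) (t' w)) t'.
have s2 : stopt (fun w => Num.max (hs g w) (t' w)) by exact: smax.
have ss : stopt sig.
  apply: stopt_ite => //; last exact: FatC.
  by apply: (Fmon st s2 _ FE) => w; rewrite le_maxR.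
have ts w : t' w <= sig w by rewrite /sig /ite; case: ifP => _ //; rewrite le_maxR.
have lt0 w : 0 <= lq k b t' w by exact: ok.
have hE w : E w -> t' w < T /\ trade (k w) (b w) (k' w - eta) (b' w) (S (t' w) w) by case=> [[]].
have [beta [h [sb tb hh hsE [p1 p2 p3 _ p5]]]] := transfer hg st
  (fun w => lexx (t' w)) at' mkt mbt lt0 hr FE hE ss ts.
have hha : isH a k b h := isH_lower hh sa (isH_k hg) (isH_b hg) at' ok.
exists h; split=> //.
  move=> w; have [Ew|nE] := pselect (E w); last by left; rewrite hsE /sig ite_out.
  right; have [[tT tg] tr] := Ew; split=> //.
  have := tb w; rewrite le_eqVlt => /orP[/eqP bt|bt]; last first.
    exists (k' w - eta), (b' w); split=> //; have [e1 e10 rn1] := rn w tT.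
    exists (Num.min e1 (beta w - t' w)); first by rewrite lt_min e10 subr_gt0.
    move=> u tu; rewrite -ltrBlDl lt_min => /andP[u1 u2] uT.
    have ub : u <= beta w by lra.
    have [-> ->] := p2 w u Ew tu ub; have [||-> ->] := rn1 u tu; rewrite ?uT //; lra.
  exists (frozen dl (k w) (b w)), 0; split; last by exists 1 => // u tu _ uT; exact: p5.
  have [[b0 fk]|//] := frozen_trade (mdl0 M) (lt0 w).
  (* Freezing could fail to be a trade only for [b = 0] and cash below [delta]; but [g] trades at
     [a] from this very state and pays at least [delta]. *)
  exfalso; case: (ag w) => [ga|[aT [k1 [b1 [tr1 rn1]]]]].
    by move: tg; rewrite /= ga ltNge at'.
  have := liq_wealth_ge0 (S_ge0 _ w) (rnbhd_liq hg (lexx _) aT rn1).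
  have := action_cost_delta dl mu (b1 - b w) (S (a w) w); have := mdl0 M.
  have : 0 <= mu * `|b1| * S (a w) w by rewrite !mulr_ge0 ?S_ge0 // ltW.
  move: tr1 fk; rewrite /frozen /trade b0 eqxx /= subr0; case: ltP => h1.
    by set x := action_cost _ _ _ _; set y := _ * S _ _; lra.
  by set x := action_cost _ _ _ _; set y := _ * S _ _; lra.
move=> tau s1.
pose xi w := Num.min (tau w) (hs g w).
have sx : stopt xi by exact: smin.
have ab w : a w <= beta w by exact: le_trans (at' w) (tb w).
have [kb [bb [hrb rnb _ _]]] := isH_restr hg sb ab.
have [IL EL] := hloss a k b g beta kb bb xi hg ab hrb sx.
set L := [set w | _] in IL EL; set FL := (fun w => _) in IL EL.
pose W := [set w | l < t' w - a w].
have mW : measurable W.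
  apply: (mFmeas M T); apply: (mG_lt (mFs M T)); first exact: mG_cst.
  by apply: mGB; exact: stopt_meas.
have IB (B : set Omega) : measurable B -> Ib (fun w => \1_B w * Z w).
  by move=> mB; apply: Ib_indic => //; exact: mIZ.
pose RHS w := e / 4 + \1_B1 w * Z w + \1_B2 w * Z w + \1_W w * Z w + FL w.
have IR : Ib RHS by do ?apply: IbD => //; try exact: IB; exact: Ib_cst.
have FL0 w : 0 <= FL w.
  rewrite /FL indicE; case: (boolP (w \in L)) => [/set_mem[/= bx _]|_]; last by rewrite mul0r.
  rewrite mul1r le_min Z0 /=; apply: (isH_adm hg); last exact: stopt_leT sx.
  exact: le_trans (ab w) (ltW bx).
have zB (B : set Omega) w : 0 <= \1_B w * Z w by rewrite mulr_ge0 ?Z0 // indicE.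
have zB1 (B : set Omega) w : B w -> \1_B w * Z w = Z w.
  by move=> Bw; rewrite indicE mem_set // mul1r.
have key w : Num.max (cost h tau w - cost g tau w) 0 <= RHS w.
  have e40 : 0 <= e / 4 by rewrite divr_ge0 // ltW.
  have [ta|at1] := leP (tau w) (a w).
    rewrite (cost_hold hh (le_trans ta (at' w))) (cost_hold hg ta) subrr maxxx.
    by rewrite /RHS; have := (zB B1 w, zB B2 w, zB W w, FL0 w) => -[[[]]]; lra.
  have cZ : Num.max (cost h tau w - cost g tau w) 0 <= Z w.
    rewrite ge_max Z0 andbT; apply: le_trans (cost_leZ hha s1 (ltW at1)).
    by rewrite gerBl cost_ge0.
  have [bad|ngood] := pselect (B1 w \/ B2 w \/ W w).
    rewrite /RHS; have := (zB B1 w, zB B2 w, zB W w, FL0 w) => -[[[]]].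
    by move: cZ e40; set x := Num.max _ _; case: bad => [|[|]] /zB1 ->; clear; lra.
  have [n1 n2 nW] : [/\ ~ B1 w, ~ B2 w & ~ W w].
    by split=> h1; apply: ngood; [left|right; left|right; right].
  have [kC bC SC] := hB1 w n1; have osc := hB2 w n2.
  have wl : t' w - a w <= l by move/negP: nW; rewrite -leNgt.
  have a0 := stopt_ge0 w sa; have tT := stopt_leT w st.
  suff : cost h tau w <= cost g tau w + e / 4 + FL w.
    move=> hcost; rewrite ge_max; apply/andP; split; rewrite /RHS;
      have := (zB B1 w, zB B2 w, zB W w, FL0 w) => -[[[]]]; move: hcost e40; set x := cost _ _ _;
      set y := cost _ _ _; clear; lra.
  have osc' u v : a w <= u -> u <= t' w -> a w <= v -> v <= t' w ->
     [/\ `|S u w - S v w| <= c, `|X u w - X v w| <= c & `|Y u w - Y v w| <= c].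
    move=> au ut av vt; apply: osc; [exact: le_trans au|exact: le_trans ut _|exact: le_trans av|
      exact: le_trans vt _|].
    by rewrite ler_norml; apply/andP; split; clear -au ut av vt wl; lra.
  have Lq u v : a w <= u -> u <= t' w -> a w <= v -> v <= t' w ->
     liq (k w) (b w) (S u w) <= liq (k w) (b w) (S v w) + 2 * C * c.
    move=> au ut av vt; have [oS _ _] := osc' u v au ut av vt.
    have := liq_cont dl m0 (mmu1 M) (k w) (b w) (mS0 M u w) (mS0 M v w).
    rewrite -lerBlDl => /(le_trans (ler_norm _)) h1; apply: (le_trans h1).
    by apply: ler_pM => //; rewrite ler_pM2l.
  have rel u v : a w <= u -> u <= t' w -> a w <= v -> v <= t' w -> `|S u w - S v w| <= ep * S v w.
    move=> au ut av vt; have [oS _ _] := osc' u v au ut av vt; apply: (le_trans oS).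
    have [_ s3] := SC v (le_trans a0 av) (le_trans vt tT).
    have h1 : c <= c * C * S v w by rewrite -mulrA ler_peMr // ltW.
    by apply: (le_trans h1); rewrite ler_wpM2r // S_ge0.
  have eta_m u : a w <= u -> u <= t' w -> 4 * ep * (k w + b w * S u w) / mu <= eta.
    move=> au ut; rewrite ler_pdivrMr // [eta * _]mulrC; apply: le_trans ep2.
    rewrite ler_pM2l ?mulr_gt0 //.
    have [s3 _] := SC u (le_trans a0 au) (le_trans ut tT).
    apply: lerD; first exact: le_trans (ler_norm _) kC.
    apply: le_trans (ler_norm _) _; rewrite normrM.
    by apply: ler_pM => //; rewrite ger0_norm ?S_ge0.
  (* Up to [t'] the hedge [g] is worth at most [eta] more than the position that is simply held,
     since its trades can be merged. *)
  have Vle u : a w <= u -> u <= t' w -> Vh g u w <= liq (k w) (b w) (S u w) + eta.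
    move=> au ut; move: (au); rewrite le_eqVlt => /orP[/eqP ua|alu].
      by rewrite /Vh -ua; have [-> ->] := isH_pre hg (lexx (a w)); rewrite lerDl ltW.
    have uT := le_trans ut tT; have [n leg] := isH_leg hg w.
    have trs := legal_left leg alu uT.
    apply: le_trans (trades_merge_liq (mdl0 M) m0 (mmu1 M) trs (mS0 M u w) (ltW ep0) ep1 _ _ _) _.
    - by move=> v av vu; apply: rel => //; exact: le_trans ut.
    - have := liq_wealth_ge0 (S_ge0 u w) (isH_adm hg au uT).
      by apply: le_trans; rewrite !mulr_ge0 ?S_ge0 // ltW.
    - have := liq_wealth_ge0 (S_ge0 u w) (ok w u au ut).
      by apply: le_trans; rewrite !mulr_ge0 ?S_ge0 // ltW.
    by rewrite lerD2l; exact: eta_m.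
  have ag' := isH_ts hg w.
  have fl := FL0 w.
  (* Three cases: the adversary stops by [t']; or [g] stops by [t'], and then the new hedge stops at
     [t']; or both go on, and then [E] holds. *)
  have [tt'|t't] := leP (tau w) (t' w).
    suff : cost h tau w <= cost g tau w + e / 4 by move=> h1; apply: (le_trans h1); rewrite lerDl.
    rewrite (cost_hold hh tt') /cost; have [st1|ts1] := ltP (hs g w) (tau w).
      have h1 := Vle (hs g w) ag' (le_trans (ltW st1) tt').
      have h2 := Lq (hs g w) (tau w) ag' (le_trans (ltW st1) tt') (ltW at1) tt'.
      have [_ _] := osc' (hs g w) (tau w) ag' (le_trans (ltW st1) tt') (ltW at1) tt'.
      rewrite ler_norml => /andP[h3 _]; have h4 := mYX M (hs g w) w.
      by apply: max0_shift => //; move: h1 h2 h3 h4 cc eta_le; set x1 := liq _ _ _; set x2 := liq _ _ _; clear; lra.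
    have h1 := Vle (tau w) (ltW at1) tt'.
    by apply: max0_shift => //; move: h1 eta_le e0; set x1 := liq _ _ _; clear; lra.
  have [gt'|t'g] := leP (hs g w) (t' w).
    suff : cost h tau w <= cost g tau w + e / 4 by move=> h1; apply: (le_trans h1); rewrite lerDl.
    have nE : ~ E w by case=> [[_ /=]]; rewrite ltNge gt'.
    rewrite /cost hsE /sig ite_out // t't (le_lt_trans gt' t't) /Vh.
    have [-> ->] := isH_pre hh (lexx (t' w)).
    have h1 := Vle (hs g w) ag' gt'.
    have h2 := Lq (hs g w) (t' w) ag' gt' (at' w) (lexx _).
    have [_ + _] := osc' (hs g w) (t' w) ag' gt' (at' w) (lexx _).
    rewrite ler_norml => /andP[h3 _].
    by apply: max0_shift => //; move: h1 h2 h3 cc eta_le; rewrite /Vh; set x1 := liq _ _ _;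
       set x2 := liq _ _ _; set x3 := liq _ _ _; clear; lra.
  have t'T : t' w < T := lt_le_trans t'g (stopt_leT w sg).
  have Ew : E w.
    split=> //=; case: (ag w) => [ga|[aT [k1 [b1 [tr1 rn1]]]]].
      by move: t'g; rewrite ga ltNge at'.
    have [n leg] := isH_leg hg w.
    have [ka [ba [hra rna _ lega]]] := isH_restr hg sa (fun w => lexx _).
    have [n' _ leg'] := lega w n aT leg.
    have [ek eb] := rnbhd_uniq aT (rna w aT) rn1; rewrite ek eb in leg'.
    have [m [k2 [b2 [_ _ trs [e2 e20 he2]]]]] := legal_split leg' (at' w) t'T.
    have rn2 : rnbhd g w (t' w) k2 b2 by exists e2.
    have [ek' eb'] := rnbhd_uniq t'T rn2 (rn w t'T); rewrite ek' eb' in trs.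
    have wl0 : 0 <= k' w + b' w * S (t' w) w.
      have := liq_wealth_ge0 (S_ge0 (t' w) w) (rnbhd_liq hg (at' w) t'T (rn w t'T)).
      by apply: le_trans; rewrite !mulr_ge0 ?S_ge0 // ltW.
    have := trades_merge1 (mdl0 M) m0 (mmu1 M) (at' w) tr1 trs (mS0 M _ w) (ltW ep0) ep1 _ wl0.
    have hrel : forall u : R, a w <= u -> u <= t' w -> `|S u w - S (t' w) w| <= ep * S (t' w) w.
      by move=> u au ut; apply: rel.
    move=> /(_ hrel); apply: trade_le => //; have := eta_m (t' w) (at' w) (lexx _).
    by set x := _ / mu; clear; lra.
  have hsx : hs h w = hs g w by rewrite hsE /sig ite_in // (max_idPl (ltW t'g)).
  have tx : t' w < xi w by rewrite lt_min t't t'g.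
  have xT := stopt_leT w sx.
  rewrite !cost_V hsx -/(xi w); set pay := (if _ then _ else _).
  have [xb|bx] := leP (xi w) (beta w).
    suff h1 : Num.max (pay - Vh h (xi w) w) 0 <= Num.max (pay - Vh g (xi w) w) 0 + e / 4.
      by apply: (le_trans h1); rewrite lerDl.
    apply: max0_shift => //; have [ek eb] := p2 w (xi w) Ew tx xb.
    by rewrite /Vh ek eb /liq; set x := tcost _ _ _ _; move: eta_le e0; clear; lra.
  have Lw : L w.
    split=> //; have bT := lt_le_trans bx xT; apply: le_trans eta_le0.
    apply: (rlim_le (rnb w bT) bT) => e1 e10.
    have [u [u1 u2 u3 u4]] := p3 w Ew (tb w) bT e1 e10.
    by exists u; split=> //; rewrite ltW // -subr_lt0.
  have V0 : 0 <= Vh h (xi w) w by apply: (isH_adm hh) => //; exact: ltW.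
  have Vg0 : 0 <= Vh g (xi w) w by apply: (isH_adm hg) => //; exact: le_trans (at' w) (ltW tx).
  have payZ : pay <= Z w.
    by rewrite /pay; case: ifP => _; apply: le_trans (ler_norm _) _; [exact: mXZ|exact: mYZ].
  apply: (@le_trans _ _ (Num.max pay 0)).
    by rewrite ge_max !le_max lexx orbT andbT gerBl V0.
  apply: le_trans (max0_loss Vg0 payZ (Z0 w)) _.
  by rewrite /FL indicE mem_set // mul1r -addrA lerD2l lerDr.
have mmax : mfun (fun w => Num.max (cost h tau w - cost g tau w) 0).
  apply: measurable_maxr; last exact: measurable_cst.
  by apply: measurable_funB; [exact: mcost hh s1|exact: mcost hg s1].
have Imax : Ib (fun w => Num.max (cost h tau w - cost g tau w) 0).
  apply: (Ib_le mmax IR) => w; rewrite ger0_norm //; by rewrite le_maxR.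
apply: le_trans (Ex_le Imax IR key) _; rewrite /RHS !ExD ?Ex_cst; try exact: IL; try by do ?apply: IbD => //; try exact: IB; exact: Ib_cst.
by rewrite -/W; move: e0 E1 E2 EL; rlra.
Qed.

(** A stopping time after one node is raised to the other node by a maximum, which changes nothing
    on [A]. *)
Lemma rho_transport t t' k b k' b' A h h' : isH t k b h -> isH t' k' b' h' -> measurable A ->
  (forall w, A w -> t w = t' w) -> (forall tau w, A w -> cost h tau w = cost h' tau w) ->
  rho t A h = rho t' A h'.
Proof.
move=> th th' mA tt hc.
have half t1 t2 k1 b1 k2 b2 h1 h2 : isH t1 k1 b1 h1 -> isH t2 k2 b2 h2 ->
    (forall w, A w -> t1 w = t2 w) -> (forall tau w, A w -> cost h1 tau w = cost h2 tau w) ->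
    rho t1 A h1 <= rho t2 A h2.
  move=> i1 i2 e1 e2; apply: (rho_le mA i1) => tau s1 l1.
  rewrite (@J_eq _ h1 h2 tau (fun w => Num.max (tau w) (t2 w))); last first.
    move=> w Aw; rewrite e2 //; apply: cost_tau; by rewrite (max_idPl _) // -(e1 w Aw).
  apply: (J_rho mA i2); first exact: smax s1 (isH_st i2).
  by move=> w; rewrite le_maxR.
apply/le_anti/andP; split; first exact: (half _ _ _ _ _ _ _ _ th th').
by apply: (half _ _ _ _ _ _ _ _ th' th) => [w /tt //|tau w /hc //].
Qed.

Lemma Fat_loc t t' A : Fat t A -> (forall w, A w -> t w = t' w) -> Fat t' A.
Proof.
move=> FA tt u; have -> : A `&` [set w | t' w <= u] = A `&` [set w | t w <= u]; last exact: FA.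
by apply/seteqP; split=> w /= [Aw]; rewrite tt.
Qed.

(** [z] is the limit of patience: just after it the held position becomes insolvent, so every hedge
    has to act by then ([act_le_end]). It is obtained by repairing the constant path. *)
Lemma hold_end t k b : stopt t -> mG (Fat t) k -> mG (Fat t) b ->
  (forall w, 0 <= lq k b t w) ->
  exists z : Omega -> R, [/\ stopt z, forall w, t w <= z w, okto t z k b &
   forall w, z w < T -> forall e, 0 < e -> exists u, [/\ z w < u, u < z w + e, u <= T &
       liq (k w) (b w) (S u w) < 0]].
Proof.
move=> st mk mb l0.
have [||||beta [h [sb tb hh _ [h1 h2 _]]]] := repair (K := fun u w => k w) (B := fun u w => b w)
  st mk mb _ _ _ l0 (stoptT) _.
- by move=> u; exact: mG_Fat_lt.
- by move=> u; exact: mG_Fat_lt.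
- by move=> w; exists 0; apply: legal_hold.
- by move=> w; exact: stopt_leT st.
exists beta; split=> // w u; rewrite le_eqVlt => /orP[/eqP <- _|tu ub]; first exact: l0.
have := isH_adm hh (ltW tu) (le_trans ub (stopt_leT w sb)).
by rewrite /Vh; have [-> ->] := h1 w u tu ub.
Qed.

Lemma first_act t k b h : isH t k b h -> exists a, [/\ forall w, t w <= a w, isH a k b h & acts a k b h].
Proof.
move=> hh; have [s [ss ts hold jp]] := first_jump hh.
pose a w := Num.min (s w) (hs h w).
have sa : stopt a by apply: smin => //; exact: isH_s hh.
have ta w : t w <= a w by rewrite le_min ts (isH_ts hh).
exists a; split=> //.
  apply: (isH_raise hh sa ta) => [w u _ ua|w]; last by rewrite min_leR.
  by apply: hold; apply: le_trans ua _; rewrite min_leL.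
move=> w; rewrite /a; have [sh|hs'] := ltP (s w) (hs h w); last by left.
right; have sT := lt_le_trans sh (stopt_leT w (isH_s hh)); split=> //.
have [n leg] := isH_leg hh w; have [m [k' [b' [_ tr rn _]]]] := jp w n sT leg.
by exists k', b'.
Qed.

Lemma quarter3 e : 0 < e -> e / 4 + e / 4 + e / 4 <= e.
Proof. lra. Qed.

Lemma acts_paste (E : set Omega) a a' k b h h' : acts a k b h -> acts a' k b h' ->
  acts (ite E a a') k b (paste E h h').
Proof.
move=> aa aa' w; have [Ew|nE] := pselect (E w).
  rewrite ite_in //; case: (aa w) => [hs1|[aT [k' [b' [tr [e1 e10 rn]]]]]].
    by left; rewrite /= ite_in.
  by right; split=> //; exists k', b'; split=> //; exists e1 => // v v1 v2 v3 /=; rewrite !ite_in //; exact: rn.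
rewrite ite_out //; case: (aa' w) => [hs1|[aT [k' [b' [tr [e1 e10 rn]]]]]].
  by left; rewrite /= ite_out.
by right; split=> //; exists k', b'; split=> //; exists e1 => // v v1 v2 v3 /=; rewrite !ite_out //; exact: rn.
Qed.

(** * Nearly optimal plans at a node *)

Section Node.
Variables (t k b z : Omega -> R).
Hypotheses (st : stopt t) (mk : mG (Fat t) k) (mb : mG (Fat t) b).
Hypotheses (sz : stopt z) (tz : forall w, t w <= z w) (okz : okto t z k b).
Hypothesis zend : forall w, z w < T -> forall e, 0 < e -> exists u, [/\ z w < u, u < z w + e, u <= T &
       liq (k w) (b w) (S u w) < 0].
Implicit Types (kap : Omega -> R).

Lemma okz_sub kap a : t <=w kap -> a <=w z -> okto kap a k b.
Proof.
move=> tk az w u ku ua; apply: okz; [exact: le_trans (tk w) ku|exact: le_trans ua (az w)].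
Qed.

Lemma lower_to a h kap : isH a k b h -> stopt kap -> t <=w kap ->
  kap <=w a -> a <=w z -> isH kap k b h.
Proof.
move=> ha sk tk ka az; apply: (isH_lower ha sk) => //.
- exact: (mG_mon st sk tk mk).
- exact: (mG_mon st sk tk mb).
- exact: okz_sub.
Qed.

Lemma act_le_end kap a h : isH kap k b h -> isH a k b h -> t <=w kap ->
  kap <=w z -> forall w, a w <= z w.
Proof.
move=> hk ha tk kz w; rewrite leNgt; apply/negP => za.
have aT := stopt_leT w (isH_st ha); have zT := lt_le_trans za aT.
have d0 : 0 < a w - z w by rewrite subr_gt0.
have [u [zu ua uT]] := zend zT d0; rewrite ltNge => /negP; apply.
have := isH_adm hk (le_trans (kz w) (ltW zu)) uT.
rewrite /Vh; have [|-> ->//] := isH_pre ha (w := w) (u := u).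
by move: ua; rewrite addrC subrK => /ltW.
Qed.

(** Near-optimality is required at every stopping time [kap] between [t] and the first action, and
    on every event known at [kap]. In this form a plan that acts later can replace one that acts
    earlier ([perfect_max]). *)
Definition perfect a h (e : R) := [/\ isH a k b h, acts a k b h, forall w, t w <= a w,
  forall w, a w <= z w & forall kap, stopt kap -> t <=w kap -> kap <=w a ->
  forall g, isH kap k b g -> forall A, Fat kap A -> rho kap A h <= rho kap A g + e].

(** If [kap] precedes [a] only on [E], it is replaced by its minimum with [a], and the competitor is
    pasted with [h] off [E]. *)
Lemma perfect_loc a h e kap h' g (E : set Omega) : perfect a h e -> stopt kap ->
  t <=w kap -> isH kap k b h' -> isH kap k b g -> Fat kap E ->
  (forall w, E w -> kap w <= a w) -> (forall tau w, E w -> cost h' tau w = cost h tau w) ->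
  forall A, Fat kap A -> A `<=` E -> rho kap A h' <= rho kap A g + e.
Proof.
move=> [ha act ta az hopt] sk tk hh' hg FE Ea Ec A FA AE.
pose kap' w := Num.min (kap w) (a w).
have sa := isH_st ha.
have sk' : stopt kap' by exact: smin.
have tk' w : t w <= kap' w by rewrite le_min tk ta.
have ka' w : kap' w <= a w by rewrite min_leR.
have eqk w : E w -> kap w = kap' w by move=> Ew; rewrite /kap' (min_idPl (Ea w Ew)).
have FE' : Fat kap' E by exact: Fat_loc FE eqk.
have FA' : Fat kap' A by apply: (Fat_loc FA) => w /AE; exact: eqk.
have hk' : isH kap' k b h by exact: lower_to ha _ _ _ _.
have hp : isH kap' k b (paste E g h).
  have := isH_paste hg hk' FE (FatC sk' FE').
  by rewrite !iteid (_ : ite E kap kap' = kap') //; apply/funext => w; rewrite /ite;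
    case: ifPn => // /set_mem; exact: eqk.
have mA := Fat_measurable sk FA.
have := hopt kap' sk' tk' ka' _ hp A FA'.
rewrite -(rho_transport hh' hk' mA); [|by move=> w /AE; exact: eqk|by move=> tau w /AE; exact: Ec].
rewrite -(rho_transport hg hp mA) //; first by move=> w /AE; exact: eqk.
by move=> tau w /AE Ew; rewrite cost_paste ite_in.
Qed.

Section Grid.
Variable n : nat.

(** The uniform deterministic grid of [[0, T]], clipped to [[t, z]]; so [gt 0] is [t] and [gt n.+1]
    is [z]. *)
Definition gt (i : nat) w := Num.min (Num.max (t w) (i%:R * T / n.+1%:R)) (z w).

Definition grid (j : nat) kap := forall w, exists2 i, (j <= i <= n.+1)%N & kap w = gt i w.

Lemma gt_stopt i : (i <= n.+1)%N -> stopt (gt i).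
Proof.
move=> ij; apply: smin => //; apply: smax => //; apply: stopt_cst; first exact: mFs.
rewrite divr_ge0 ?mulr_ge0 ?(ltW (mT0 M)) //= ler_pdivrMr ?ltr0n // mulrC.
by rewrite ler_pM2l ?mT0 // ler_nat.
Qed.

Lemma gt_mono i j w : (i <= j)%N -> gt i w <= gt j w.
Proof.
move=> ij; rewrite /gt le_min !ge_min lexx !orbT andbT ge_max !le_max lexx /=.
apply/orP; left; apply/orP; right.
by rewrite ler_wpM2r ?invr_ge0 // ler_wpM2r ?(ltW (mT0 M)) // ler_nat.
Qed.

Lemma gt_ge i w : t w <= gt i w. Proof. by rewrite le_min le_maxL tz. Qed.

Lemma gt_le i w : gt i w <= z w. Proof. by rewrite min_leR. Qed.

Lemma gt0 w : gt 0 w = t w.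
Proof. by rewrite /gt mul0r mul0r (max_idPl _) ?(min_idPl (tz w)) // (stopt_ge0 w st). Qed.

Lemma gtT w : gt n.+1 w = z w.
Proof.
rewrite /gt mulrAC divff ?pnatr_eq0 // mul1r (max_idPr (stopt_leT w st)).
by rewrite (min_idPr (stopt_leT w sz)).
Qed.

Lemma gridS j kap : grid j.+1 kap -> grid j kap.
Proof. by move=> h w; have [i /andP[ji ij] e] := h w; exists i => //; rewrite (ltnW ji). Qed.

Lemma grid_ite j (E : set Omega) a a' : grid j a -> grid j a' -> grid j (ite E a a').
Proof. by move=> h h' w; rewrite /ite; case: ifP. Qed.

Lemma grid_min j a a' : grid j a -> grid j a' -> grid j (fun w => Num.min (a w) (a' w)).
Proof. by move=> h h' w; have [_|_] := ltP (a w) (a' w). Qed.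

Lemma grid_ge j a w : grid j a -> gt j w <= a w.
Proof. by move=> /(_ w)[i /andP[ji _] ->]; exact: gt_mono. Qed.

Lemma grid_le j a w : grid j a -> a w <= z w.
Proof. by move=> /(_ w)[i _ ->]; exact: gt_le. Qed.

Definition plan j a h := [/\ isH a k b h, acts a k b h & grid j a].

Lemma plan_paste j (E : set Omega) a a' h h' : plan j a h -> plan j a' h' -> Fat a E -> Fat a' (~` E) ->
  plan j (ite E a a') (paste E h h').
Proof.
move=> [ha aa ga] [ha' aa' ga'] FE FE'; split; last exact: grid_ite.
  by have := isH_paste ha ha' FE FE'; rewrite !iteid.
exact: acts_paste.
Qed.

Lemma plan_lower j a h kap : plan j a h -> stopt kap -> t <=w kap ->
  kap <=w a -> isH kap k b h.
Proof. by move=> [ha _ ga] sk tk ka; apply: (lower_to ha) => // w; exact: grid_le ga. Qed.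

Lemma plan_stop i : (i <= n.+1)%N -> plan i (gt i) (liqd (gt i) k b (gt i)).
Proof.
move=> ij; have si := gt_stopt ij; split.
- apply: isH_liqd => //.
  + by apply: (mG_mon st si _ mk) => w; exact: gt_ge.
  + by apply: (mG_mon st si _ mb) => w; exact: gt_ge.
  + by move=> w; apply: okz; [exact: gt_ge|exact: gt_le].
- by move=> w; left.
- by move=> w; exists i => //; rewrite leqnn.
Qed.

Lemma grid_perfect j e : (j <= n.+1)%N -> 0 < e -> exists a h, plan j a h /\
  forall kap, stopt kap -> grid j kap -> kap <=w a ->
  forall a' g, plan j a' g -> kap <=w a' -> forall A, Fat kap A ->
  rho kap A h <= rho kap A g + e.
Proof.
move=> jn; have [i ei] : exists i, n.+1 = (i + j)%N by exists (n.+1 - j)%N; rewrite subnK.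
elim: i j jn ei e => [|i IH] j jn ei e e0.
  have ej : j = n.+1 by rewrite ei.
  pose C := [set h | exists a, plan n.+1 a h].
  have sT := gt_stopt (leqnn n.+1).
  have eqa a : grid n.+1 a -> a = gt n.+1.
    move=> ga; apply/funext => w; have [i0 /andP[h1 h2] ->] := ga w.
    by have -> : i0 = n.+1 by apply/eqP; rewrite eqn_leq h1 h2.
  have Ci h : C h -> isH (gt n.+1) k b h by move=> [a [ha _ ga]]; rewrite -(eqa a ga).
  have [||h Ch hopt] := @rho_eps (gt n.+1) k b C e _ Ci _ e0.
  - by exists (liqd (gt n.+1) k b (gt n.+1)), (gt n.+1); exact: plan_stop.
  - move=> A h g FA [a pa] [a' pa']; exists (ite A a a'); apply: plan_paste => //.
      by rewrite (eqa a); [|case: pa].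
    by rewrite (eqa a'); [exact: FatC|case: pa'].
  have [a pa] := Ch; exists a, h; rewrite ej; split=> // kap sk gk ka a' g pa' ka' A FA.
  have ek := eqa kap gk; rewrite ek in FA *; apply: hopt => //; by exists a'.
have e40 : 0 < e / 4 by rewrite divr_gt0.
have j1 : (j.+1 <= n.+1)%N by rewrite ei addSn ltnS leq_addl.
have [|a1 [h1 [p1 o1']]] := IH j.+1 j1 _ _ e40; first by rewrite ei addSn addnS.
pose kj := gt j; have sj : stopt kj := gt_stopt jn.
have tj w : t w <= kj w by exact: gt_ge.
have gj : grid j kj by move=> w; exists j => //; rewrite leqnn.
pose C := [set h | exists a, plan j a h].
have Ci h : C h -> isH kj k b h.
  by move=> [a pa]; apply: (plan_lower pa) => // w; apply: grid_ge; case: pa.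
have [||h0 [a0 p0] hopt] := @rho_eps kj k b C (e / 4) _ Ci _ e40.
- by exists (liqd kj k b kj), kj; exact: plan_stop.
- move=> A h g FA [a pa] [a' pa']; exists (ite A a a'); apply: plan_paste => //.
    by case: pa => ha _ ga; apply: (Fmon sj (isH_st ha) _ FA) => w; exact: grid_ge.
  by case: pa' => ha _ ga; apply: (Fmon sj (isH_st ha)) => [w|]; [exact: grid_ge|exact: FatC].
have ka0 w : kj w <= a0 w by apply: grid_ge; case: p0.
have sa0 : stopt a0 by case: p0 => /isH_st.
have sa1 : stopt a1 by case: p1 => /isH_st.
have kj1 := gt_stopt j1.
have ka1 w : gt j.+1 w <= a1 w by apply: grid_ge; case: p1.
have p1j : plan j a1 h1 by case: p1 => ? ? /gridS.
have ja1 w : kj w <= a1 w by apply: le_trans (ka1 w); exact: gt_mono.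
(* Since [a0] is never before [kj], equality holds on [D]: there [h0] acts at once. *)
pose D := [set w | a0 w <= kj w].
have FD : Fat kj D by exact: Fler.
have FD0 : Fat a0 D by exact: (Fmon sj sa0 ka0 FD).
have FD1 : Fat a1 (~` D) by apply: (Fmon sj sa1 ja1); exact: FatC.
pose a := ite D a0 a1; pose h := paste D h0 h1.
have pa : plan j a h by exact: plan_paste.
exists a, h; split=> // kap sk gk ka a' g pa' ka' A FA.
have jk w : kj w <= kap w by exact: grid_ge.
have tk w : t w <= kap w by exact: le_trans (tj w) (jk w).
have hk : isH kap k b h by exact: (plan_lower pa).
have gk' : isH kap k b g by exact: (plan_lower pa').
pose B := [set w | kap w <= kj w].
have FB : Fat kap B by exact: Fle.
rewrite (rho_split hk FB FA) (rho_split gk' FB FA).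
have sG := sgF sk.
have FAB : Fat kap (A `&` B) by exact: (sigma_setI sG).
have FAB' : Fat kap (A `\` B) by exact: (sigma_setD sG).
have hkj : isH kj k b h by apply: Ci; exists a.
have h0kj : isH kj k b h0 by apply: Ci; exists a0.
have gkj : isH kj k b g by apply: Ci; exists a'.
have mono2 w : kj w <= gt j.+1 w by exact: gt_mono.

(* Localize the competitor [g0] to an event where it acts after [gt j.+1]. *)
have later kap2 g0 a2 (E : set Omega) : plan j a2 g0 -> stopt kap2 -> t <=w kap2 ->
    isH kap2 k b g0 -> isH kap2 k b h ->
    Fat kap2 E -> (forall w, E w -> gt j.+1 w <= kap2 w /\ kap2 w <= a2 w) ->
    (forall w, E w -> kap2 w <= a1 w /\ exists2 m, (j.+1 <= m <= n.+1)%N & kap2 w = gt m w) ->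
    (forall w, E w -> exists2 m, (j.+1 <= m <= n.+1)%N & a2 w = gt m w) -> E `<=` ~` D ->
    forall A', Fat kap2 A' -> A' `<=` E -> rho kap2 A' h <= rho kap2 A' g0 + e / 4.
  move=> pg0 sk2 tk2 hg0 hh FE E1 E2 E3 ED A' FA' AE.
  (* Off [E] the comparison is made trivial: the time is the action time of [h1], and the competitor
     is [h1] itself. *)
  pose kap3 := ite E kap2 a1.
  pose km w := Num.min (kap2 w) (a1 w).
  have skm : stopt km by exact: smin.
  have Em w : E w -> kap2 w = km w by move=> Ew; rewrite /km (min_idPl (proj1 (E2 w Ew))).
  have FEm : Fat km E := Fat_loc FE Em.
  have s3 : stopt kap3.
    apply: stopt_ite => //; apply: (Fmon skm sa1) => [w|]; last exact: FatC.
    by rewrite min_leR.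
  have FE3 : Fat kap3 E by apply: (Fat_loc FE) => w Ew; rewrite /kap3 ite_in.
  have g3 : grid j.+1 kap3.
    move=> w; rewrite /kap3; have [Ew|nE] := pselect (E w).
      by rewrite ite_in //; case: (E2 w Ew).
    by rewrite ite_out //; case: p1 => _ _ /(_ w).
  have k31 w : kap3 w <= a1 w.
    rewrite /kap3; have [Ew|nE] := pselect (E w); last by rewrite ite_out.
    by rewrite ite_in //; case: (E2 w Ew).
  have ja3 w : kap2 w <= Num.max (kap2 w) (a2 w) by rewrite le_maxL.
  have sa2 : stopt a2 by case: pg0 => /isH_st.
  have pp : plan j.+1 (ite E a2 a1) (paste E g0 h1).
    have FE2 : Fat a2 E.
      pose kq w := Num.min (kap2 w) (a2 w).
      have sq : stopt kq by exact: smin.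
      apply: (Fmon sq sa2) => [w|]; first by rewrite min_leR.
      by apply: (Fat_loc FE) => w Ew; rewrite /kq (min_idPl (proj2 (E1 w Ew))).
    have FEn : Fat a1 (~` E).
      apply: (Fmon skm sa1) => [w|]; last exact: FatC.
      by rewrite min_leR.
    have [q1 q2 _] := plan_paste pg0 p1j FE2 FEn; split=> //.
    move=> w; have [Ew|nE] := pselect (E w); first by rewrite ite_in //; exact: E3.
    by rewrite ite_out //; case: p1 => _ _ /(_ w).
  have k3p w : kap3 w <= ite E a2 a1 w.
    rewrite /kap3 /ite; case: ifPn => // /set_mem Ew; exact: (proj2 (E1 w Ew)).
  have FA3 : Fat kap3 A' by apply: (Fat_loc FA') => w /AE Ew; rewrite /kap3 ite_in.
  have := o1' kap3 s3 g3 k31 _ _ pp k3p A' FA3.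
  have mA' := Fat_measurable sk2 FA'.
  have t3 w : t w <= kap3 w.
    by apply: le_trans (grid_ge w g3); exact: gt_ge.
  have i1 : isH kap3 k b h1 by exact: (plan_lower p1).
  have i2 : isH kap3 k b (paste E g0 h1) by exact: (plan_lower pp).
  rewrite -(rho_transport hh i1 mA'); last 2 first.
  - by move=> w /AE Ew; rewrite /kap3 ite_in.
  - by move=> tau w /AE /ED nD; rewrite /h cost_paste ite_out.
  rewrite -(rho_transport hg0 i2 mA') //.
  - by move=> w /AE Ew; rewrite /kap3 ite_in.
  - by move=> tau w /AE Ew; rewrite cost_paste ite_in.
have nextj kap2 w : grid j kap2 -> kj w < kap2 w -> exists2 m, (j.+1 <= m <= n.+1)%N & kap2 w = gt m w.
  move=> /(_ w)[m /andP[jm mn] ekm] jk2; exists m => //; rewrite mn andbT ltn_neqAle jm andbT.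
  by apply/eqP => ejm; move: jk2; rewrite ekm -ejm ltxx.
have nextj' kap2 w : grid j kap2 -> kj w < kap2 w -> gt j.+1 w <= kap2 w.
  by move=> gk2 /(nextj _ _ gk2)[m /andP[jm _] ->]; exact: gt_mono.
(* On [B] the time is [gt j]. Exchanging [h0] for [h1] off [D] costs [e / 4], and replacing [g] by
   [h0] another [e / 4]. *)
have part1 : rho kap (A `&` B) h <= rho kap (A `&` B) g + (e / 4 + e / 4).
  have mAB := Fat_measurable sk FAB.
  have eqk w : (A `&` B) w -> kap w = kj w.
    by case=> _ /= kb; apply: le_anti; rewrite kb jk.
  have FABj : Fat kj (A `&` B) by exact: Fat_loc FAB eqk.
  rewrite (rho_transport hk hkj mAB eqk) // (rho_transport gk' gkj mAB eqk) //.
  have : rho kj (A `&` B) h <= rho kj (A `&` B) h0 + e / 4.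
    rewrite (rho_split hkj FD FABj) (rho_split h0kj FD FABj).
    rewrite (@rho_eq (A `&` B `&` D) kj h h0); last first.
      by move=> tau w [_ Dw]; rewrite /h cost_paste ite_in.
    rewrite -addrA lerD2l.
    have FABD : Fat kj (A `&` B `\` D) by exact: (sigma_setD (sgF sj)).
    pose kn w := Num.min (gt j.+1 w) (a w).
    pose kn0 w := Num.min (kn w) (a0 w).
    have sn : stopt kn by apply: smin => //; case: pa => /isH_st.
    have sn0 : stopt kn0 by exact: smin.
    have kjn w : kj w <= kn0 w.
      by rewrite /kn0 le_min ka0 andbT /kn le_min mono2 /=; apply: grid_ge; case: pa.
    have tn w : t w <= kn0 w by exact: le_trans (tj w) (kjn w).
    have hn : isH kn0 k b h.
      by apply: (plan_lower pa) => // w; rewrite !ge_min lexx !orbT.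
    have h0n : isH kn0 k b h0.
      by apply: (plan_lower p0) => // w; rewrite !ge_min lexx !orbT.
    apply: (rho_mono hkj h0kj hn h0n kjn FABD) => A' FA' A'D.
    have Dk w : (~` D) w -> kn0 w = gt j.+1 w.
      move=> nD; have ja0 : kj w < a0 w by move/negP: nD; rewrite -ltNge.
      have g0' : gt j.+1 w <= a0 w by apply: nextj' => //; case: p0.
      by rewrite /kn0 /kn /a ite_out // (min_idPl (ka1 w)) (min_idPl g0').
    have FDn : Fat kn0 (~` D) by apply: (Fmon sj sn0 kjn); exact: FatC.
    apply: (later kn0 h0 a0 (~` D) p0 sn0 tn h0n hn FDn) => //.
    - by move=> w nD; split; [rewrite (Dk w nD)|rewrite /kn0 min_leR].
    - move=> w nD; rewrite (Dk w nD) ka1; split=> //; exists j.+1 => //.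
      by rewrite leqnn.
    - by move=> w /negP; rewrite -ltNge => /nextj; apply; case: p0.
    - by move=> w /A'D[].
  have Cg : C g by exists a'.
  by move=> H1; apply: (le_trans H1); rewrite addrA lerD2r; exact: hopt.
(* Off [B] the condition [kap <= a] excludes [D], so [h] coincides with [h1] there. *)
have part2 : rho kap (A `\` B) h <= rho kap (A `\` B) g + e / 4.
  pose B' := ~` B.
  have B'E w : B' w -> kj w < kap w by move=> /negP; rewrite -ltNge.
  have B'D w : B' w -> ~ D w.
    move=> /B'E jk2 Dw; have := ka w; rewrite /a ite_in // leNgt => /negP; apply.
    exact: le_lt_trans Dw jk2.
  have FB' : Fat kap B' by exact: FatC.
  apply: (later kap g a' B' pa' sk tk gk' hk FB') => //.
  - by move=> w /B'E jk2; split=> //; exact: nextj'.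
  - move=> w Bw; split; last by apply: nextj => //; exact: B'E.
    by have := ka w; rewrite /a ite_out //; exact: B'D.
  - move=> w /B'E jk2; apply: nextj; first by case: pa'.
    exact: lt_le_trans jk2 (ka' w).
by apply: le_trans (lerD part1 part2) _; rewrite addrACA lerD2l; exact: quarter3.
Qed.

(** For [m = n + 1] this is the first grid time not before [kap], written as a minimum of stopping
    times; a grid time that comes too early is replaced by [z]. *)
Fixpoint nxt kap m : Omega -> R :=
  if m is m'.+1 then fun w => Num.min (nxt kap m' w) (ite [set w | kap w <= gt m w] (gt m) z w)
  else ite [set w | kap w <= gt 0 w] (gt 0) z.

Lemma nxtP kap m : stopt kap -> kap <=w z -> (m <= n.+1)%N ->
  [/\ stopt (nxt kap m), forall w, kap w <= nxt kap m w, grid 0 (nxt kap m) &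
   forall w i, (i <= m)%N -> kap w <= gt i w -> nxt kap m w <= gt i w].
Proof.
move=> sk kz; have gz : grid 0 z.
  by move=> w; exists n.+1; [rewrite leqnn|rewrite gtT].
have si i : (i <= n.+1)%N -> stopt (ite [set w | kap w <= gt i w] (gt i) z).
  move=> ij; apply: stopt_ite => //; [exact: gt_stopt|exact: Fler sk (gt_stopt ij)|].
  apply: (Fmon (gt_stopt ij) sz) => [w|]; first exact: gt_le.
  by apply: FatC; [exact: gt_stopt|exact: Fler sk (gt_stopt ij)].
have gi i : (i <= n.+1)%N -> grid 0 (ite [set w | kap w <= gt i w] (gt i) z).
  by move=> ij; apply: grid_ite => // w; exists i.
have ki i w : kap w <= ite [set w | kap w <= gt i w] (gt i) z w.
  by rewrite /ite; case: ifPn => // /set_mem.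
have li i w : kap w <= gt i w -> ite [set w | kap w <= gt i w] (gt i) z w <= gt i w.
  by move=> h; rewrite ite_in.
elim: m => [|m IH] mn.
  split=> //=; [exact: si|exact: gi|].
  by move=> w i; rewrite leqn0 => /eqP ->; exact: li.
have [s1 k1 g1 l1] := IH (ltnW mn); split.
- by apply: smin => //; exact: si.
- by move=> w; rewrite /= le_min k1 ki.
- by apply: grid_min => //; exact: gi.
- move=> w i; rewrite leq_eqVlt => /orP[/eqP -> /li h|].
    by apply: le_trans h; rewrite /= min_leR.
  by rewrite ltnS => im /(l1 w i im) h; apply: le_trans h; rewrite /= min_leL.
Qed.

Lemma nxt_mesh kap w : stopt kap -> t <=w kap -> kap <=w z ->
  nxt kap n.+1 w - kap w <= T / n.+1%:R.
Proof.
move=> sk tk kz; have [_ _ _ l1] := nxtP sk kz (leqnn n.+1).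
have c0 : 0 <= T / n.+1%:R by rewrite divr_ge0 // ltW // mT0.
have ex : exists i, kap w <= gt i w by exists n.+1; rewrite gtT.
have [i ki mini] := ex_minnP ex; clear ex.
have iN : (i <= n.+1)%N by apply: mini; rewrite gtT.
have := l1 w i iN ki; case: i ki mini iN => [|i] ki mini iN h.
  by rewrite lerBlDl (le_trans h) // gt0 (le_trans (tk w)) // lerDl.
have : gt i w < kap w by rewrite ltNge; apply/negP => /mini; rewrite ltnn.
rewrite {1}/gt gt_min [z w < _]ltNge kz orbF gt_max => /andP[_ qk].
have : gt i.+1 w <= Num.max (t w) (i.+1%:R * T / n.+1%:R) by rewrite min_leL.
rewrite le_max => /orP[h2|h2]; first by rewrite lerBlDl (le_trans h) // (le_trans h2) // (le_trans (tk w)) // lerDl.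
have e1 : i.+1%:R * T / n.+1%:R = i%:R * T / n.+1%:R + T / n.+1%:R.
  by rewrite -natr1 !mulrDl !mul1r.
by rewrite lerBlDl (le_trans h) // (le_trans h2) // e1 lerD2r ltW.
Qed.

End Grid.

(** The mesh is finer than the length [l] of [graft]. So any competitor can postpone its first
    action to the next grid time for a loss of [e / 2], after which the result on the grid
    applies. *)
Lemma perfect_exists e : 0 < e -> exists a h, perfect a h e.
Proof.
move=> e0; have e20 : 0 < e / 2 by rewrite divr_gt0.
have [l l0 hgr] := graft (mG_FatT st mk) (mG_FatT st mb) e20.
have [n hn] : exists n, T / n.+1%:R < l.
  have h : 0 < l / T by rewrite divr_gt0 // mT0.
  have [N hN] := inv_lt h; exists N; have := hN N (leqnn N).
  by rewrite ltr_pdivlMr ?mT0 // mulrC.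
have [a [h [[ha acth ga] hopt]]] := grid_perfect (leq0n n.+1) e20.
have ta w : t w <= a w by rewrite -(gt0 n w); exact: grid_ge ga.
exists a, h; split=> //; first by move=> w; exact: grid_le ga.
move=> kap sk tk ka g hg A FA.
have az w : a w <= z w by exact: grid_le ga.
have kz w : kap w <= z w := le_trans (ka w) (az w).
have [ag [kag hag actg]] := first_act hg.
have agz := act_le_end hg hag tk kz.
have sag := isH_st hag.
have tag w : t w <= ag w := le_trans (tk w) (kag w).
have [s1 k1 g1 l1] := nxtP (n := n) sag agz (leqnn n.+1).
have nz w : nxt n ag n.+1 w <= z w by exact: grid_le g1.
have [g' [hg' actg' dom]] := hgr ag (nxt n ag n.+1) g hag actg s1 k1 (okz_sub tag nz).
have k1' w : kap w <= nxt n ag n.+1 w := le_trans (kag w) (k1 w).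
have hg'k : isH kap k b g' by exact: (lower_to hg' sk tk k1' nz).
have [s2 k2 g2 l2] := nxtP (n := n) sk kz (leqnn n.+1).
have t2 w : t w <= nxt n kap n.+1 w := le_trans (tk w) (k2 w).
have n2a w : nxt n kap n.+1 w <= a w.
  by have [i /andP[_ im] ei] := ga w; rewrite ei; apply: l2 => //; rewrite -ei.
have n2g w : nxt n kap n.+1 w <= nxt n ag n.+1 w.
  by have [i /andP[_ im] ei] := g1 w; rewrite ei; apply: l2 => //; rewrite -ei.
have hk : isH kap k b h by exact: (lower_to ha).
have hk2 : isH (nxt n kap n.+1) k b h by exact: (lower_to ha).
have hg2 : isH (nxt n kap n.+1) k b g' by exact: (lower_to hg').
have step1 : rho kap A h <= rho kap A g' + e / 2.
  apply: (rho_mono hk hg'k hk2 hg2 k2 FA) => C FC _.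
  by apply: (hopt _ s2 g2 n2a (nxt n ag n.+1) g') => //; split.
have step2 : rho kap A g' <= rho kap A g + e / 2.
  apply: (rho_dom (Fat_measurable sk FA) hg'k hg) => tau stau _.
  apply: le_trans (dom tau stau) _; rewrite (@eq_Ex _ _ _ P _ (fun=> 0)) ?Ex_cst ?addr0 // => w.
  rewrite indicE memNset ?mul0r //= ltNge => /negP; apply.
  by apply: le_trans (ltW hn); exact: nxt_mesh.
by apply: (le_trans step1); rewrite [in leRHS](splitr e) addrA lerD2r.
Qed.

End Node.

(** * Latest nearly optimal action times *)

Section NodeLimit.
Variables (t k b z : Omega -> R).
Hypotheses (st : stopt t) (mk : mG (Fat t) k) (mb : mG (Fat t) b).
Hypotheses (sz : stopt z) (tz : forall w, t w <= z w) (okz : okto t z k b).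
Hypothesis zend : forall w, z w < T -> forall e, 0 < e -> exists u, [/\ z w < u, u < z w + e, u <= T &
       liq (k w) (b w) (S u w) < 0].
Implicit Types (kap : Omega -> R).
Local Notation perfect := (perfect t k b z).

Let low := lower_to st mk mb okz.

Lemma perfect_le a h e e' : e <= e' -> perfect a h e -> perfect a h e'.
Proof.
move=> ee' [h1 h2 h3 h4 h5]; split=> // kap sk tk ka g hg A FA.
by apply: le_trans (h5 kap sk tk ka g hg A FA) _; rewrite lerD2l.
Qed.

(** Where [a1 < a2], waiting from [a1] until [a2] loses at most [e2], because [h2] is nearly optimal
    at the time [a1] too. The error [e2] occurs twice, for the times [kap] before [a1] and for those
    after. *)
Lemma perfect_max a1 h1 e1 a2 h2 e2 : 0 <= e2 -> perfect a1 h1 e1 -> perfect a2 h2 e2 ->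
  exists h, perfect (fun w => Num.max (a1 w) (a2 w)) h (e1 + 2 * e2).
Proof.
move=> e20 p1 p2; have [ha1 ac1 ta1 az1 _] := p1; have [ha2 ac2 ta2 az2 _] := p2.
have sa1 := isH_st ha1; have sa2 := isH_st ha2.
pose D := [set w | a1 w < a2 w].
have FD1 : Fat a1 D by exact: Flt.
have FD2 : Fat a2 D by exact: Fltr.
pose h := paste D h2 h1; exists h.
pose a w := Num.max (a1 w) (a2 w).
have ae : ite D a2 a1 = a.
  by apply/funext => w; rewrite /ite /a maxElt; case: ifPn => [/set_mem /= ->//|];
    rewrite notin_setE /= => /negP/negbTE ->.
have ha : isH a k b h by have := isH_paste ha2 ha1 FD2 (FatC sa1 FD1); rewrite !iteid ae.
have sa := isH_st ha.
have az w : a w <= z w by rewrite ge_max az1 az2.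
split=> //; [by rewrite -/a -ae; exact: acts_paste|by move=> w; rewrite le_max ta1|].
move=> kap sk tk ka g hg A FA.
pose B := [set w | kap w <= a1 w].
have FB : Fat kap B by exact: Fle.
have hk : isH kap k b h by exact: (low ha).
have sG := sgF sk.
have FAB : Fat kap (A `&` B) by exact: (sigma_setI sG).
have FAB' : Fat kap (A `\` B) by exact: (sigma_setD sG).
rewrite (rho_split hk FB FA) (rho_split hg FB FA).
have part2 : rho kap (A `\` B) h <= rho kap (A `\` B) g + e2.
  have BD w : (~` B) w -> D w.
    move=> /negP; rewrite -ltNge => ka1; rewrite /D /= ltNge; apply/negP => a21.
    have := ka w; rewrite (max_idPl a21) leNgt => /negP; exact.
  apply: (perfect_loc st mk mb okz p2 sk tk hk hg (FatC sk FB)) => //.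
  - by move=> w /BD Dw; have := ka w; rewrite (max_idPr (ltW Dw)).
  - by move=> tau w /BD Dw; rewrite cost_paste ite_in.
have part1 : rho kap (A `&` B) h <= rho kap (A `&` B) g + (e1 + e2).
  pose kap' w := Num.min (kap w) (a1 w).
  have sk' : stopt kap' by exact: smin.
  have tk' w : t w <= kap' w by rewrite le_min tk ta1.
  have eqk w : B w -> kap w = kap' w by move=> Bw; rewrite /kap' (min_idPl Bw).
  have ka1 w : kap' w <= a1 w by rewrite min_leR.
  have a1a w : a1 w <= a w by rewrite le_maxL.
  have FB' : Fat kap' B by exact: Fat_loc FB eqk.
  have hk' : isH kap' k b h by apply: (low ha) => // w; exact: le_trans (ka1 w) (a1a w).
  have h1k' : isH kap' k b h1 by exact: (low ha1).
  have mAB := Fat_measurable sk FAB.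
  have FAB1 : Fat kap' (A `&` B) by apply: (Fat_loc FAB) => w [_]; exact: eqk.
  have hp : isH kap k b (paste B h1 g).
    have := isH_paste h1k' hg FB' (FatC sk FB); rewrite !iteid.
    by rewrite (_ : ite B kap' kap = kap) //; apply/funext => w; rewrite /ite;
      case: ifPn => // /set_mem/eqk.
  have s1 : rho kap (A `&` B) h <= rho kap (A `&` B) (paste B h1 g) + e2.
    rewrite (rho_transport hk hk' mAB (fun w hw => eqk w (proj2 hw)) (fun _ _ _ => erefl)).
    rewrite (rho_transport hp h1k' mAB); last 2 first.
    - by move=> w [_]; exact: eqk.
    - by move=> tau w [_ Bw]; rewrite cost_paste ite_in.
    have ha1' : isH a1 k b h by exact: (low ha).
    apply: (rho_mono hk' h1k' ha1' ha1 ka1 FAB1) => C FC _.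
    rewrite (rho_split ha1' FD1 FC) (rho_split ha1 FD1 FC).
    rewrite (@rho_eq (C `\` D) a1 h h1); last first.
      by move=> tau w [_ nD]; rewrite cost_paste ite_out.
    rewrite [leRHS]addrAC lerD2r.
    have FCD : Fat a1 (C `&` D) by exact: (sigma_setI (sgF sa1)).
    apply: (perfect_loc st mk mb okz p2 sa1 ta1 ha1' ha1 FD1) => //.
    - by move=> w /ltW.
    - by move=> tau w Dw; rewrite cost_paste ite_in.
  have s2 : rho kap (A `&` B) (paste B h1 g) <= rho kap (A `&` B) g + e1.
    apply: (perfect_loc st mk mb okz p1 sk tk hp hg FB) => //.
    by move=> tau w Bw; rewrite cost_paste ite_in.
  by apply: (le_trans s1); rewrite addrA lerD2r.
apply: le_trans (lerD part1 part2) _; rewrite addrACA lerD2l.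
by rewrite mulr_natl mulr2n addrA.
Qed.

(* Nearly optimal actions at times [tt j] that decrease to [al]. *)
Record cascade (al : Omega -> R) (tt : nat -> Omega -> R) (l : nat -> hdg) : Prop := Cascade {
  cas_al : stopt al;
  cas_tal : forall w, t w <= al w;
  cas_st : forall j, stopt (tt j);
  cas_altt : forall j w, al w <= tt j w;
  cas_dec : forall j w, tt j.+1 w <= tt j w;
  cas_z : forall j w, tt j w <= z w;
  cas_lim : forall w e, 0 < e -> exists J, forall j, (J <= j)%N -> tt j w - al w <= e;
  cas_H : forall j, isH (tt j) k b (l j);
  cas_act : forall j, acts (tt j) k b (l j);
  cas_opt : forall j g, isH t k b g -> forall A, Fat t A -> rho t A (l j) <= rho t A g + 6 * hf j;
  cas_delay : forall j A, Fat (tt j.+1) A ->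
    rho (tt j.+1) A (l j) <= rho (tt j.+1) A (l j.+1) + 3 * hf j }.

(** [al] is the upper limit of the first action times [am m] of plans with error [hf m]. The suprema
    [tN N] of the tails are limits of the maxima given by [perfect_max], and [al] is their infimum.
    Along the indices [Ns] the times come within the length of [graft] of [al], up to an event on
    which [Z] has small expectation. *)
Lemma cascade_exists : exists al tt l, cascade al tt l.
Proof.
have /choice[p hp] : forall m : nat, exists p : (Omega -> R) * hdg, perfect p.1 p.2 (hf m).
  move=> m; have [a [h ph]] := perfect_exists st mk mb sz tz okz zend (hf_gt0 m).
  by exists (a, h).
pose am m := (p m).1.
pose mx := fix mx N i := if i is i'.+1 then fun w => Num.max (mx N i' w) (am (N + i)%N w) else am N.
(* The new error is [2 * hf (N + i + 1)], which equals [hf (N + i)]; so the bound telescopes and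
   stays below [3 * hf N]. *)
have mxP N i : exists h, perfect (mx N i) h (3 * hf N - 2 * hf (N + i)).
  elim: i => [|i [h IH]].
    by exists (p N).2; apply: perfect_le (hp N); rewrite addn0 -mulrBl; set x := hf N; lra.
  have [h' ph'] := perfect_max (ltW (hf_gt0 _)) IH (hp (N + i.+1)%N).
  exists h'; apply: perfect_le ph'; rewrite addnS hfS; set x := hf N; set y := hf _; lra.
have mxS N i : stopt (mx N i) by have [h [/isH_st]] := mxP N i.
pose tN N w := sup (range (fun i => mx N i w)).
have sN N : stopt (tN N) by exact: (stopt_sup (mFs M) (mxS N)).
have hs' N w : has_sup (range (fun i => mx N i w)).
  by split; [exists (mx N 0 w); exists 0|exists T => _ [i _ <-]; exact: stopt_leT].
have mxle N i w : mx N i w <= tN N w by apply: sup_upper_bound => //; exists i.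
have tNz N w : tN N w <= z w.
  by apply: ge_sup => [|_ [i _ <-]]; [case: (hs' N w)|have [h [_ _ _ h4 _]] := mxP N i; exact: h4].
have tNdec N w : tN N.+1 w <= tN N w.
  apply: ge_sup => [|_ [i _ <-]]; first by case: (hs' N.+1 w).
  apply: le_trans (mxle N i.+1 w).
  elim: i => [|i IH] /=; first by rewrite addn1 le_maxR.
  rewrite ge_max; apply/andP; split; first by apply: le_trans IH _; rewrite le_maxL.
  by rewrite addSnnS le_maxR.
have tNt N w : t w <= tN N w.
  by apply: le_trans (mxle N 0 w); have [h [_ _ h3 _ _]] := mxP N 0; exact: h3.
pose al w := inf (range (fun N => tN N w)).
have sal : stopt al by exact: (stopt_inf (mFs M) (mFm M) (mFrc M) sN).
have hi w : has_inf (range (fun N => tN N w)).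
  by split; [exists (tN 0 w); exists 0|exists 0 => _ [i _ <-]; exact: stopt_ge0].
have allt N w : al w <= tN N w by apply: ge_inf; [case: (hi w)|exists N].
have tNle N N' w : (N <= N')%N -> tN N' w <= tN N w.
  move/subnK => <-; elim: (N' - N)%N => // i IH; rewrite addSn; exact: le_trans (tNdec _ w) IH.
have tal w : t w <= al w.
  by apply: lb_le_inf => [|_ [N _ <-]]; [case: (hi w)|exact: tNt].
have /choice[lam hlam] : forall j : nat, exists l : R, 0 < l /\ forall a t' g,
  isH a k b g -> acts a k b g -> stopt t' -> a <=w t' -> okto a t' k b ->
  exists h, [/\ isH t' k b h, acts t' k b h & forall tau, stopt tau ->
     Ex (fun w => Num.max (cost h tau w - cost g tau w) 0) <=
     hf j + Ex (fun w => \1_[set w | l < t' w - a w] w * Z w)].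
  move=> j; have [l l0 hl] := graft (mG_FatT st mk) (mG_FatT st mb) (hf_gt0 j).
  by exists l.
have mW (a a' : Omega -> R) (c : R) : stopt a -> stopt a' -> measurable [set w | c < a w - a' w].
  move=> sa sa'; apply: (mFmeas M T); apply: (mG_lt (mFs M T)); first exact: mG_cst.
  by apply: mGB; exact: stopt_meas.
have IW (A : set Omega) : measurable A -> Ib (fun w => \1_A w * Z w).
  by move=> mA; apply: Ib_indic => //; exact: mIZ.
have /choice[nn hnn] : forall j : nat, exists N, forall n, (N <= n)%N ->
    Ex (fun w => \1_[set w | lam j < tN n w - al w] w * Z w) < hf j.
  move=> j; apply: Ex_tail => //; [by move=> n; exact: mW|exact: mIZ| |exact: hf_gt0].
  move=> w; have [l0 _] := hlam j; have [_ [N _ <-] hN] := inf_adherent l0 (hi w).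
  exists N => n Nn /=; apply/negP; rewrite -leNgt lerBlDl ltW //.
  exact: le_lt_trans (tNle _ _ w Nn) hN.
pose Ns := fix Ns j := if j is j'.+1 then maxn (maxn (nn j) j) (Ns j') else nn 0%N.
have Ns1 j : (nn j <= Ns j)%N by case: j => //= j; rewrite !leq_max leqnn.
have Ns2 j : (j <= Ns j)%N by case: j => //= j; rewrite !leq_max leqnn orbT.
have Ns3 j : (Ns j <= Ns j.+1)%N by rewrite /= leq_max leqnn orbT.
pose tt j := tN (Ns j).
(* The times being fixed, [l j] is chosen nearly optimal among all hedges whose first action is at
   [tt j]. *)
pose C j := [set h | isH (tt j) k b h /\ acts (tt j) k b h].
have Cp j A h g : Fat (tt j) A -> C j h -> C j g -> C j (paste A h g).
  move=> FA [h1 h2] [g1 g2]; split; first exact: isH_paste1.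
  by have := acts_paste A h2 g2; rewrite iteid.
have C0 j : C j !=set0.
  exists (liqd (tt j) k b (tt j)); split; last by move=> w; left.
  apply: isH_liqd => //; try exact: sN.
  - exact: (mG_mon st (sN _) (tNt _) mk).
  - exact: (mG_mon st (sN _) (tNt _) mb).
  - by move=> w; apply: okz; [exact: tNt|exact: tNz].
have /choice[l hl] : forall j, exists h, C j h /\
    forall g, C j g -> forall A, Fat (tt j) A -> rho (tt j) A h <= rho (tt j) A g + hf j.
  move=> j; have [h Ch hh] := rho_eps (C0 j) (fun h hC => proj1 hC) (Cp j) (hf_gt0 j).
  by exists h.
have lH j : isH (tt j) k b (l j) by case: (hl j) => -[].
have lA j : acts (tt j) k b (l j) by case: (hl j) => -[].
exists al, tt, l; split=> //.
- by move=> j; exact: sN.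
- by move=> j w; exact: allt.
- by move=> j w; exact: tNle.
- by move=> j w; exact: tNz.
- move=> w e e0; have [_ [N _ <-] hN] := inf_adherent e0 (hi w).
  exists N => j Nj; rewrite lerBlDl ltW //; apply: le_lt_trans hN.
  by apply: tNle; exact: leq_trans Nj (Ns2 j).
- move=> j g hg A FA; pose N := Ns j.
  have [l0 hl0] := hlam j.
  have [|i hii] := Ex_tail (fun i => mW _ _ (lam j) (sN N) (mxS N i)) (mIZ M) _ (hf_gt0 j).
    move=> w; have [_ [i _ <-] hi'] := sup_adherent l0 (hs' N w); exists i => n i_n /=.
    apply/negP; rewrite -leNgt lerBlDr -lerBlDl ltW //; apply: lt_le_trans hi' _.
    move: i_n => /subnK <-; elim: (n - i)%N => // m IH; rewrite addSn /=.
    by apply: le_trans IH _; rewrite le_maxL.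
  have {hii}hii := hii i (leqnn i).
  have [h [ph1 ph2 ph3 ph4 ph5]] := mxP N i.
  have okm : okto (mx N i) (tN N) k b by exact: (okz_sub okz ph3 (tNz N)).
  have [h' [hh' acth' dom]] := hl0 (mx N i) (tN N) h ph1 ph2 (sN N) (mxle N i) okm.
  have lt : isH t k b (l j) by apply: (low (lH j)) => //; try by first [exact: sN|move=> w; first [exact: tNt|exact: tNz|exact: tNle]].
  have h't : isH t k b h' by apply: (low hh') => //; try by first [exact: sN|move=> w; first [exact: tNt|exact: tNz|exact: tNle]].
  have ht : isH t k b h by exact: (low ph1).
  have s1 : rho t A (l j) <= rho t A h' + hf j.
    apply: (rho_mono lt h't (lH j) hh' (tNt N) FA) => D FD _.
    by have [_ hopt] := hl j; apply: hopt.
  have s2 : rho t A h' <= rho t A h + (hf j + hf j).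
    apply: (rho_dom (Fat_measurable st FA) h't ht) => tau stau _.
    by apply: le_trans (dom tau stau) _; rewrite lerD2l ltW.
  have s3 : rho t A h <= rho t A g + (3 * hf N - 2 * hf (N + i)).
    by apply: (ph5 t st) => // w.
  have s4 : 3 * hf N - 2 * hf (N + i) <= 3 * hf j :> R.
    exact: hf_arith4 (hf_mono (Ns2 j)) (hf_gt0 _).
  apply: (le_trans s1); apply: (le_trans (lerD s2 (lexx _))).
  apply: (le_trans (lerD (lerD s3 (lexx _)) (lexx _))); rewrite -!addrA lerD2l.
  exact: hf_arith3 s4.
- move=> j A FA; have [l0 hl0] := hlam j.
  have dle w : tt j.+1 w <= tt j w by exact: tNle.
  have okm : okto (tt j.+1) (tt j) k b by exact: (okz_sub okz (tNt _) (tNz _)).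
  have [h' [hh' acth' dom]] := hl0 _ _ _ (lH j.+1) (lA j.+1) (sN (Ns j)) dle okm.
  have lt : isH (tt j.+1) k b (l j).
    by apply: (low (lH j)) => //; try by first [exact: sN|move=> w; first [exact: tNt|exact: tNz|exact: tNle]].
  have h't : isH (tt j.+1) k b h'.
    by apply: (low hh') => //; try by first [exact: sN|move=> w; first [exact: tNt|exact: tNz|exact: tNle]].
  have s1 : rho (tt j.+1) A (l j) <= rho (tt j.+1) A h' + hf j.
    apply: (rho_mono lt h't (lH j) hh' dle FA) => D FD _.
    by have [_ hopt] := hl j; apply: hopt.
  have s2 : rho (tt j.+1) A h' <= rho (tt j.+1) A (l j.+1) + (hf j + hf j).
    apply: (rho_dom (Fat_measurable (sN _) FA) h't (lH j.+1)) => tau stau _.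
    apply: le_trans (dom tau stau) _; rewrite lerD2l; apply: le_trans (ltW (hnn j _ (Ns1 j))).
    apply: Ex_le; [by apply: IW; apply: mW; exact: sN|by apply: IW; apply: mW => //; exact: sN|].
    move=> w; rewrite ler_wpM2r ?Z0 // !indicE.
    case: (boolP (w \in [set w | lam j < tN (Ns j) w - tt j.+1 w])) => //= /set_mem /= h1.
    rewrite mem_set //=; apply: lt_le_trans h1 _; rewrite lerB //; exact: allt.
  apply: (le_trans s1); apply: (le_trans (lerD s2 (lexx _))); rewrite -!addrA lerD2l.
  exact: hf_arith5.
Qed.

(** A condition that every path meets infinitely often need not hold at any fixed index. So the last
    index in [[N, N + i]] with [Q] is taken path by path, with [N] as default. Keeping the previous
    choice where [Q] fails loses at most [3 * hf n] by [cas_delay], and these losses telescope. *)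
Lemma roll al tt l (Q : nat -> set Omega) N i : cascade al tt l -> (forall j, Fat (tt j) (Q j)) ->
  exists a h, [/\ isH a k b h, acts a k b h, forall w, tt (N + i)%N w <= a w,
   (forall g, isH t k b g -> forall A, Fat t A -> rho t A h <= rho t A g + 12 * hf N) &
   forall w, exists m, [/\ (N <= m <= N + i)%N, a w = tt m w, m = N \/ Q m w,
     (forall m', (m < m' <= N + i)%N -> ~ Q m' w) &
     [/\ hs h w = hs (l m) w, hK h ^~ w = hK (l m) ^~ w & hB h ^~ w = hB (l m) ^~ w]]].
Proof.
move=> cas FQ.
have ttle j m w : tt (j + m)%N w <= tt j w.
  by elim: m => [|m IH]; [rewrite addn0|rewrite addnS; exact: le_trans (cas_dec cas _ w) IH].
have tt0 j w : t w <= tt j w := le_trans (cas_tal cas w) (cas_altt cas j w).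
suff [a [h [ha aa at' roll hm]]] : exists a h, [/\ isH a k b h, acts a k b h,
   forall w, tt (N + i)%N w <= a w /\ a w <= tt N w,
   (forall A, Fat (tt (N + i)%N) A -> rho (tt (N + i)%N) A h <= rho (tt (N + i)%N) A (l (N + i)%N) +
      (6 * hf N - 6 * hf (N + i))) &
   forall w, exists m, [/\ (N <= m <= N + i)%N, a w = tt m w, m = N \/ Q m w,
     (forall m', (m < m' <= N + i)%N -> ~ Q m' w) &
     [/\ hs h w = hs (l m) w, hK h ^~ w = hK (l m) ^~ w & hB h ^~ w = hB (l m) ^~ w]]].
  exists a, h; split=> //; first by move=> w; case: (at' w).
  move=> g hg A FA; have h1 := cas_opt cas (N + i) hg FA.
  have az w : a w <= z w by case: (at' w) => _ h'; exact: le_trans h' (cas_z cas N w).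
  have ta w : t w <= a w by case: (at' w) => h' _; exact: le_trans (tt0 _ w) h'.
  have ht : isH t k b h by exact: (low ha).
  have httn : isH (tt (N + i)%N) k b h.
    by apply: (low ha) => //; [exact: cas_st cas _|move=> w; case: (at' w)].
  have lt : isH t k b (l (N + i)%N).
    by apply: (low (cas_H cas _)) => // w; exact: (cas_z cas).
  have h2 : rho t A h <= rho t A (l (N + i)%N) + (6 * hf N - 6 * hf (N + i)).
    by apply: (rho_mono ht lt httn (cas_H cas _) (tt0 _) FA) => C FC _; exact: roll.
  apply: (le_trans h2); apply: (le_trans (lerD h1 (lexx _))); rewrite -!addrA lerD2l.
  exact: hf_arith.
elim: i => [|i [a [h [ha aa at' roll hm]]]].
  exists (tt N), (l N); rewrite addn0; split=> //.
  - exact: (cas_H cas).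
  - exact: (cas_act cas).
  - by move=> A FA; rewrite subrr addr0.
  - move=> w; exists N; split=> //; [by rewrite leqnn|by left|].
    by move=> m' /andP[m1 m2]; have := leq_trans m1 m2; rewrite ltnn.
have sa := isH_st ha; pose n := (N + i)%N; have en : (N + i.+1)%N = n.+1 by rewrite addnS.
have sn := cas_st cas n; have sn1 := cas_st cas n.+1.
have nle w : tt n.+1 w <= tt n w by exact: (cas_dec cas).
have n1a w : tt n.+1 w <= a w by case: (at' w) => h' _; exact: le_trans (nle w) h'.
have FQa : Fat a (~` Q n.+1).
  by apply: (Fmon sn1 sa n1a); apply: FatC.
pose a' := ite (Q n.+1) (tt n.+1) a; pose h' := paste (Q n.+1) (l n.+1) h.
have ha' : isH a' k b h'.
  by have := isH_paste (cas_H cas n.+1) ha (FQ n.+1) FQa; rewrite !iteid.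
have aa' w : tt n.+1 w <= a' w /\ a' w <= tt N w.
  rewrite /a' /ite; case: ifP => _; last by split=> //; case: (at' w).
  by split=> //; rewrite -en; exact: ttle.
exists a', h'; rewrite en; split=> //.
- by apply: acts_paste => //; exact: (cas_act cas).
- move=> A FA.
  have az w : a w <= z w by case: (at' w) => _ h1; exact: le_trans h1 (cas_z cas N w).
  have az' w : a' w <= z w by case: (aa' w) => _ h1; exact: le_trans h1 (cas_z cas N w).
  have h'n : isH (tt n.+1) k b h' by apply: (low ha') => // w; case: (aa' w).
  have ln := cas_H cas n.+1.
  rewrite (rho_split h'n (FQ n.+1) FA) (rho_split ln (FQ n.+1) FA).
  rewrite (@rho_eq (A `&` Q n.+1) (tt n.+1) h' (l n.+1)); last first.
    by move=> tau w [_ Qw]; rewrite cost_paste ite_in.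
  rewrite -addrA lerD2l.
  rewrite (@rho_eq (A `\` Q n.+1) (tt n.+1) h' h); last first.
    by move=> tau w [_ Qw]; rewrite cost_paste ite_out.
  have FAQ : Fat (tt n.+1) (A `\` Q n.+1) by exact: (sigma_setD (sgF sn1)).
  have hn1 : isH (tt n.+1) k b h by exact: (low ha).
  have hn : isH (tt n) k b h by apply: (low ha) => // w; case: (at' w).
  have lnn : isH (tt n.+1) k b (l n).
    by apply: (low (cas_H cas n)) => // w; exact: (cas_z cas).
  have s1 : rho (tt n.+1) (A `\` Q n.+1) h <= rho (tt n.+1) (A `\` Q n.+1) (l n) + (6 * hf N - 6 * hf n).
    by apply: (rho_mono hn1 lnn hn (cas_H cas n) nle FAQ) => C FC _; exact: roll.
  have s2 := cas_delay cas FAQ.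
  apply: (le_trans s1); apply: (le_trans (lerD s2 (lexx _))); rewrite -!addrA lerD2l hfS.
  exact: hf_arith2.
- move=> w; have [Qw|nQ] := pselect (Q n.+1 w).
    exists n.+1; rewrite /a' /h' /= !ite_in //; split=> //.
    + by rewrite leqnn andbT ltnW // ltnS leq_addr.
    + by right.
    + by move=> m' /andP[m1 m2]; have := leq_trans m1 m2; rewrite ltnn.
    + by split=> //; apply/funext => u; rewrite ite_in.
  have [m [/andP[m1 m2] em mQ m' [e1 e2 e3]]] := hm w; exists m; rewrite /a' /h' /= !ite_out //; split=> //.
  + by rewrite m1 (leq_trans m2).
  + move=> m0 /andP[i1]; rewrite leq_eqVlt => /orP[/eqP -> //|]; rewrite ltnS => i2.
    by apply: m'; rewrite i1 i2.
  + by split=> //; apply/funext => u; rewrite ite_out //; [have := congr1 (fun f => f u) e2|have := congr1 (fun f => f u) e3].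
Qed.

End NodeLimit.

(** * The limiting action at a node *)

Lemma stopt_add a c : stopt a -> 0 <= c -> stopt (fun w => Num.min (a w + c) T).
Proof.
move=> sa c0; split=> [w|u].
  by rewrite le_min addr_ge0 ?(stopt_ge0 w sa) //= (ltW (mT0 M)) min_leR.
have [Tu|uT] := leP T u.
  have -> : [set w | Num.min (a w + c) T <= u] = setT.
    by apply/seteqP; split=> // w _ /=; rewrite ge_min Tu orbT.
  exact: (sigma_setT (mFs M u)).
have -> : [set w | Num.min (a w + c) T <= u] = [set w | a w <= u - c].
  by apply/seteqP; split=> w /=; rewrite ge_min [T <= u]leNgt uT orbF lerBrDr.
have uc : u - c <= u by rewrite gerBl.
by apply: (mFm M uc); case: sa.
Qed.

(** A trade needs some time left before [T]; off a small event, [a < T] is turned into a uniform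
    margin. *)
Lemma near_end a e : stopt a -> 0 < e -> exists (c : R) (B : set Omega),
  [/\ 0 < c, measurable B, Ex (fun w => \1_B w * Z w) < e & forall w, ~ B w -> a w < T -> c < T - a w].
Proof.
move=> sa e0; pose A (n : nat) := [set w | T - a w <= n.+1%:R^-1] `&` [set w | a w < T].
have mA n : measurable (A n).
  apply: (mFmeas M T); apply: (sigma_setI (mFs M T)).
    apply: (mG_le (mFs M T)); last exact: mG_cst.
    by apply: mGB; [exact: mG_cst|exact: stopt_meas].
  by apply: (mG_lt (mFs M T)); [exact: stopt_meas|exact: mG_cst].
have [|N hN] := Ex_tail mA (mIZ M) _ e0.
  move=> w; have [aT|Ta] := ltP (a w) T; last first.
    by exists 0%N => n _ [_ /=]; rewrite ltNge Ta.
  have d0 : 0 < T - a w by rewrite subr_gt0.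
  by have [N hN] := inv_lt d0; exists N => n Nn [/= h _]; have := hN n Nn; rewrite ltNge h.
exists N.+1%:R^-1, (A N); split=> //; first exact: hN.
by move=> w nA aT; rewrite ltNge; apply/negP => h; apply: nA.
Qed.

Lemma next_jump a k b h : isH a k b h -> exists s k' b' k2 b2, [/\ stopt s, forall w, a w <= s w,
  (forall w, a w < T -> a w < s w /\ rnbhd h w (a w) (k' w) (b' w)),
  (forall w u, a w < u -> u <= s w -> hK h u w = k' w /\ hB h u w = b' w) &
  [/\ isH s k2 b2 (restr h s k2 b2), isH a k' b' (restr h a k' b') &
   forall w, s w < T -> trade (k' w) (b' w) (k2 w) (b2 w) (S (s w) w)]].
Proof.
move=> hh; have sa := isH_st hh.
have [k' [b' [hr rn _ _]]] := isH_restr hh sa (fun w => lexx _).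
have [s [ss as_ hold jp]] := first_jump hr.
have [k2 [b2 [hr2 rn2 _ _]]] := isH_restr hh ss as_.
have tr w : s w < T -> exists k3 b3 : R, [/\ trade (k' w) (b' w) k3 b3 (S (s w) w),
    rnbhd h w (s w) k3 b3 & k3 = k2 w /\ b3 = b2 w].
  move=> sT; have [n leg] := isH_leg hr w; have [m [k3 [b3 [_ tr [e3 e30 rn3] _]]]] := jp w n sT leg.
  have rn3' : rnbhd h w (s w) k3 b3.
    exists e3 => // u u1 u2 u3; have [<- <-] := rn3 u u1 u2 u3.
    by rewrite /= leNgt (le_lt_trans (as_ w) u1).
  by exists k3, b3; split=> //; exact: rnbhd_uniq sT rn3' (rn2 w sT).
exists s, k', b', k2, b2; split=> //; last split=> //.
- move=> w aT; split; last exact: rn.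
  rewrite lt_neqAle as_ andbT; apply/eqP => es.
  have sT : s w < T by rewrite -es.
  have [k3 [b3 [td rn3 _]]] := tr w sT; rewrite -es in rn3 td.
  have [ek eb] := rnbhd_uniq aT (rn w aT) rn3; move: td.
  rewrite /trade ek eb subrr mul0r subr0.
  have := action_cost_delta dl mu 0 (S (a w) w); have := mdl0 M.
  by set c := action_cost _ _ _ _; lra.
- move=> w u au us; have := hold w u us; by rewrite /= leNgt au.
- by move=> w sT; have [k3 [b3 [td _ [<- <-]]]] := tr w sT.
Qed.

(* [ks], [bs]: the state after the action at [al]. *)
Lemma replace t k b (z : Omega -> R) al (Sg : set Omega) ks bs e : stopt t -> mG (Fat t) k ->
  mG (Fat t) b -> stopt z -> okto t z k b -> stopt al -> t <=w al ->
  al <=w z -> Fat al Sg -> mG (Fat al) ks -> mG (Fat al) bs ->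
  (forall w, Sg w -> ks w = k w /\ bs w = b w) ->
  (forall w, ~ Sg w -> al w < T /\
    ks w = k w - (bs w - b w) * S (al w) w - action_cost dl mu (bs w - b w) (S (al w) w)) ->
  (forall w, 0 <= lq ks bs al w) -> 0 < e ->
  exists2 g : R, 0 < g & forall a h (W : set Omega), isH a k b h -> acts a k b h ->
   al <=w a -> a <=w z -> measurable W ->
   (forall w, ~ W w -> [/\ a w - al w <= g, Sg w -> hs h w = a w &
     ~ Sg w -> hs h w <> a w /\ exists k' b' : R, [/\ trade (k w) (b w) k' b' (S (a w) w),
       rnbhd h w (a w) k' b', `|b' - bs w| <= g & bs w != 0 -> b' != 0]]) ->
   exists h', [/\ isH al ks bs h', forall w, al w < T -> al w < hs h' w &
    forall A, Fat t A -> rho t A (comb al k b Sg h') <=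
      rho t A h + (e + Ex (fun w => \1_W w * Z w))].
Proof.
move=> st mk mb sz okz; have low := lower_to st mk mb okz.
move=> sal tal alz FS mks mbs xS xn ls e0.
have e16 : 0 < e / 16 by rewrite divr_gt0.
have [C1 [B1 [C11 mB1 E1 hB1]]] := good_bd (mG_FatT st mk) (mG_FatT st mb) e16.
have [C2 [B2 [C20 mB2 E2 hB2]]] := bd_rv (mG_FatT sal mbs) e16.
have [eta0 eta00 hloss] := loss e16.
pose C := C1 + C2; have C0 : 0 < C by rewrite /C; lra.
have C10' : C1 <= C by rewrite /C; lra.
have C20' : C2 <= C by rewrite /C; lra.
have m0 := mmu0 M.
pose eta : R := Num.min (eta0 / 2) (e / 16).
have eta_gt0 : 0 < eta by rewrite lt_min divr_gt0.
have eta_le : eta <= e / 16 by rewrite min_leR.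
have eta_le0 : eta <= eta0 / 2 by rewrite min_leL.
pose g1 : R := Num.min 1 (eta / (8 * C)).
have C80 : 0 < 8 * C by rewrite mulr_gt0.
have g10 : 0 < g1 by rewrite lt_min ltr01 divr_gt0.
have g11 : g1 <= 1 by rewrite min_leL.
have g1C : 8 * C * g1 <= eta.
  have h1 : g1 <= eta / (8 * C) by rewrite min_leR.
  by rewrite mulrC -ler_pdivlMr.
pose c : R := Num.min (eta / (2 * (4 * C + 2))) (Num.min (e / 16) (eta / (2 * C))).
have C40 : 0 < 2 * (4 * C + 2) by rewrite mulr_gt0 // ltr_wpDl // mulr_ge0 // ltW.
have C20b : 0 < 2 * C by rewrite mulr_gt0.
have c0 : 0 < c by rewrite !lt_min !divr_gt0.
have c1 : 2 * (4 * C + 2) * c <= eta.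
  have h1 : c <= eta / (2 * (4 * C + 2)) by rewrite min_leL.
  by rewrite mulrC -ler_pdivlMr.
have c2 : c <= e / 16 by rewrite !ge_min lexx !orbT.
have c3 : 2 * C * c <= eta.
  have h1 : c <= eta / (2 * C) by rewrite !ge_min lexx !orbT.
  by rewrite mulrC -ler_pdivlMr.
have [l [B3 [l0 mB3 E3 hB3]]] := good_osc e16 c0.
have [cT [B4 [cT0 mB4 E4 hB4]]] := near_end sal e16.
pose g : R := Num.min g1 (Num.min (l / 2) cT).
have g0 : 0 < g by rewrite /g lt_min g10 /= lt_min cT0 andbT divr_gt0.
have gg1 : g <= g1 by rewrite min_leL.
have gl : g <= l / 2 by rewrite /g ge_min; apply/orP; right; rewrite min_leL.
have gT : g <= cT by rewrite /g ge_min; apply/orP; right; rewrite min_leR.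
pose e1 := 2 * C * g + 2 * (2 * C + g) * c.
have e1eta : e1 + 2 * C * g <= eta.
  have h1 : C * g <= C * g1 by rewrite ler_pM2l.
  have h2 : g * c <= c by rewrite ler_piMl // ?(ltW c0) //; exact: le_trans gg1 g11.
  by rewrite /e1; clear -M g1C c1 h1 h2; lra.
exists g => // a h W hh act ala az mW hW.
have sa := isH_st hh; have sh := isH_s hh.
have ta w : t w <= a w := le_trans (tal w) (ala w).
have [s [kr [br [k2 [b2 [ss as_ asT hold [hr2 hra tr2]]]]]]] := next_jump hh.
have als w : al w <= s w := le_trans (ala w) (as_ w).
(* Where the next trade of [h], at [s], is affordable from the limiting state, with [eta] less cash
   after it. *)
pose E := [set w | s w < T] `&` [set w | trade (ks w) (bs w) (k2 w - eta) (b2 w) (S (s w) w)].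
have sG := sgF ss.
have FE : Fat s E.
  apply: (sigma_setI sG); first by apply: (mG_lt sG); [exact: smG|exact: mG_cst].
  apply: (@mG_trade _ ks bs (fun w => k2 w - eta) b2) => //.
  - exact: (mG_mon sal ss als mks).
  - exact: (mG_mon sal ss als mbs).
  - by apply: mGB; [exact: isH_k hr2|exact: mG_cst].
  - exact: isH_b hr2.
  - exact: (mG_at (mSc M) (mSa M) ss).
pose F := [set w | hs h w <= a w].
have FF : Fat a F by exact: Fler.
have FFT : Fat (fun=> T) F by apply: (Fmon sa (stoptT) _ FF) => w; exact: stopt_leT sa.
have FFh : Fat (hs h) (~` F) by apply: (Fmon sa sh (isH_ts hh)); exact: FatC.
pose sig := ite F (fun=> T) (hs h).
have ssig : stopt sig by apply: stopt_ite => //; exact: stoptT.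
have alsig w : al w <= sig w.
  rewrite /sig /ite; case: ifP => _; first exact: stopt_leT sal.
  exact: le_trans (ala w) (isH_ts hh w).
have hE w : E w -> s w < T /\ trade (ks w) (bs w) (k2 w - eta) (b2 w) (S (s w) w) by [].
have [beta [h' [sb alb hh' hsE [p1 p2 p3 p4 _]]]] :=
  transfer hh sal als as_ mks mbs ls hr2 FE hE ssig alsig.
have sgt w : al w < T -> al w < hs h' w.
  move=> alT; rewrite hsE /sig /ite; case: ifPn => // /negP.
  rewrite in_setE /F /= => /negP; rewrite -ltNge; exact: le_lt_trans.
exists h'; split=> // A FA.
have mA := Fat_measurable st FA.
have lal w : 0 <= lq k b al w by apply: okz.
have mkal : mG (Fat al) k := mG_mon st sal tal mk.
have mbal : mG (Fat al) b := mG_mon st sal tal mb.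
have hcal : isH al k b (comb al k b Sg h').
  apply: (isH_comb hh') => // w alT; have [Sw|nS] := pselect (Sg w).
    by right; exact: xS.
  by left; have [_ ->] := xn w nS; rewrite /trade lexx.
have hct : isH t k b (comb al k b Sg h') by exact: (low _ _ _ hcal st (fun w => lexx _) tal alz).
have ht : isH t k b h.
  by apply: (low _ _ _ hh st (fun w => lexx _) _ az) => w; exact: le_trans (tal w) (ala w).
apply: (rho_le mA hct) => tau stau ttau.
pose D := [set w | tau w <= al w].
pose q := ite F (fun=> T) (fun w => Num.min (s w) (hs h w)).
have aq w : a w <= q w.
  rewrite /q /ite; case: ifP => _; first exact: stopt_leT sa.
  by rewrite le_min as_ (isH_ts hh).
have sm : stopt (fun w => Num.min (s w) (hs h w)) by exact: smin.
have sq : stopt q.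
  apply: stopt_ite => //; first exact: stoptT.
  by apply: (Fmon sa sm) => [w|]; [rewrite le_min as_ (isH_ts hh)|exact: FatC].
(* On a path where [h] trades at [a], [r0] lies shortly after [a], but not after the next trade of
   [h] or its stop. An adversary who stops in []al, r0]] against the new hedge is translated into
   one who stops at [r0] against [h], so that two states after the trade are compared. *)
pose r0 w := Num.min (q w) (Num.min (a w + g) T).
have sr0 : stopt r0 by apply: smin => //; exact: stopt_add sa (ltW g0).
have ar0 w : a w <= r0 w.
  by rewrite !le_min aq lerDl (ltW g0) /=; exact: stopt_leT sa.
pose tau' := ite D tau (fun w => Num.max (tau w) (r0 w)).
have smx : stopt (fun w => Num.max (tau w) (r0 w)) by exact: smax.
have FD : Fat tau D by exact: Fle.
have st' : stopt tau'.
  apply: stopt_ite => //; apply: (Fmon stau smx) => [w|]; last exact: FatC.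
  by rewrite le_maxL.
have tt' w : t w <= tau' w.
  by rewrite /tau' /ite; case: ifP => _ //; rewrite le_max ttau.
pose xi w := Num.min (tau' w) (hs h w).
have sx : stopt xi by exact: smin.
pose be w := Num.max (beta w) (a w).
have sbe : stopt be by exact: smax.
have abe w : a w <= be w by rewrite le_maxR.
have [kb [bb [hrb rnb _ _]]] := isH_restr hh sbe abe.
have [IL EL] := hloss a k b h be kb bb xi hh abe hrb sx.
set L := [set w | _] in IL EL; set FL := (fun w => _) in IL EL.
have IB (B : set Omega) : measurable B -> Ib (fun w => \1_B w * Z w).
  by move=> mB; apply: Ib_indic => //; exact: mIZ.
pose Bd := B1 `|` B2 `|` B3 `|` B4.
have mBd : measurable Bd by do !apply: measurableU.
have EBd : Ex (fun w => \1_Bd w * Z w) <= e / 4.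
  apply: (@le_trans _ _ (Ex (fun w => \1_B1 w * Z w + \1_B2 w * Z w + \1_B3 w * Z w + \1_B4 w * Z w))).
    apply: Ex_le; [exact: IB|by do !apply: IbD; exact: IB|].
    move=> w; have z0 := Z0 w; rewrite -!mulrDl ler_wpM2r // !indicE !in_setU.
    by case: (w \in B1); case: (w \in B2); case: (w \in B3); case: (w \in B4); rewrite /=; clear -M; lra.
  rewrite !ExD; try by do ?apply: IbD; exact: IB.
  by move: E1 E2 E3 E4; set x1 := Ex _; set x2 := Ex _; set x3 := Ex _; set x4 := Ex _; clear -M; lra.
have FL0 w : 0 <= FL w.
  rewrite /FL indicE; case: (boolP (w \in L)) => [/set_mem[/= bx _]|_]; last by rewrite mul0r.
  rewrite mul1r le_min Z0 /=; apply: (isH_adm hh); last exact: stopt_leT sx.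
  exact: le_trans (abe w) (ltW bx).
have zB (B : set Omega) w : 0 <= \1_B w * Z w by rewrite mulr_ge0 ?Z0 // indicE.
have zB1 (B : set Omega) w : B w -> \1_B w * Z w = Z w.
  by move=> Bw; rewrite indicE mem_set // mul1r.
have e40 : 0 <= e / 4 by rewrite divr_ge0 // ltW.
have e34 : 3 * (e / 16) <= e / 4 by clear -M e0; lra.
have key w : cost (comb al k b Sg h') tau w <=
    cost h tau' w + (e / 4 + \1_Bd w * Z w + \1_W w * Z w + FL w).
  have cZ := cost_leZ hct stau (ttau w).
  have ch0 := cost_ge0 h tau' w.
  have [bad|ngood] := pselect (Bd w \/ W w).
    have := (zB Bd w, zB W w, FL0 w) => -[[]]; move: cZ ch0 e40.
    by set x := cost _ _ _; set y := cost _ _ _; case: bad => /zB1 ->; clear -M; lra.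
  have [nBd nW] : ~ Bd w /\ ~ W w by split=> h1; apply: ngood; [left|right].
  have n1 : ~ B1 w by move=> h1; apply: nBd; left; left; left.
  have n2 : ~ B2 w by move=> h1; apply: nBd; left; left; right.
  have n3 : ~ B3 w by move=> h1; apply: nBd; left; right.
  have n4 : ~ B4 w by move=> h1; apply: nBd; right.
  suff : cost (comb al k b Sg h') tau w <= cost h tau' w + (e / 4 + FL w).
    move=> h1; apply: (le_trans h1); rewrite lerD2l.
    by have := (zB Bd w, zB W w) => -[]; set x := FL w; clear -M; lra.
  have fl := FL0 w.
  have alh : al w <= hs h' w := isH_ts hh' w.
  have [tal'|altau] := leP (tau w) (al w).
    have te : tau' w = tau w by rewrite /tau' ite_in.
    rewrite (cost_comb_le _ _ _ alh tal') (cost_tau _ te).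
    by rewrite (cost_hold hh (le_trans tal' (ala w))) lerDl addr_ge0.
  have alT := lt_le_trans altau (stopt_leT w stau).
  have nD : ~ D w by rewrite /D /=; apply/negP; rewrite -ltNge.
  have et' : tau' w = Num.max (tau w) (r0 w) by rewrite /tau' ite_out.
  have [kC1 bC1 SC1] := hB1 w n1; have bsC2 := hB2 w n2.
  have osc := hB3 w n3; have [gal hS hnS] := hW w nW.
  have aT : a w < T.
    by have := hB4 w n4 alT; clear -M gal gT; lra.
  have al0 := stopt_ge0 w sal.
  have SC u : 0 <= u -> u <= T -> S u w <= C.
    by move=> u0 uT; have [h1 _] := SC1 u u0 uT; exact: le_trans h1 C10'.
  have bC : `|b w| <= C := le_trans bC1 C10'.
  have bsC : `|bs w| <= C := le_trans bsC2 C20'.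
  have r0T := stopt_leT w sr0.
  have r0g : r0 w <= a w + g by rewrite !ge_min lexx !orbT.
  have osc' u v : al w <= u -> u <= r0 w -> al w <= v -> v <= r0 w ->
     [/\ `|S u w - S v w| <= c, `|X u w - X v w| <= c & `|Y u w - Y v w| <= c].
    move=> au ut av vt; apply: osc; [exact: le_trans au|exact: le_trans ut _|exact: le_trans av|
      exact: le_trans vt _|].
    by rewrite ler_norml; apply/andP; split; clear -M au ut av vt r0g gal gl; lra.
  have Lq (K B : R) u v : `|B| <= C -> al w <= u -> u <= r0 w -> al w <= v -> v <= r0 w ->
     liq K B (S u w) <= liq K B (S v w) + 2 * C * c.
    move=> BC au ut av vt; have [oS _ _] := osc' u v au ut av vt.
    have := liq_cont dl m0 (mmu1 M) K B (mS0 M u w) (mS0 M v w).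
    rewrite -lerBlDl => /(le_trans (ler_norm _)) h1; apply: (le_trans h1).
    by apply: ler_pM => //; rewrite ler_pM2l ?ltr0n.
  have [Sw|nS] := pselect (Sg w).
    rewrite (cost_comb_stop _ _ _ Sw altau) /cost (hS Sw).
    have qT : q w = T by rewrite /q ite_in // /F /= (hS Sw).
    have r0a : a w < r0 w by rewrite /r0 qT !lt_min aT ltrDl g0.
    have -> : a w < tau' w by rewrite et' lt_max r0a orbT.
    rewrite /Vh; have [-> ->] := isH_pre hh (lexx (a w)).
    have h1 := Lq (k w) (b w) (a w) (al w) bC (ala w) (ar0 w) (lexx _) (le_trans (ala w) (ar0 w)).
    have [_ + _] := osc' (a w) (al w) (ala w) (ar0 w) (lexx _) (le_trans (ala w) (ar0 w)).
    rewrite ler_norml => /andP[h3 _]; rewrite addrA; apply: (@le_trans _ _ (Num.max (X (a w) w - lq k b a w) 0 + e / 4)).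
      apply: max0_shift => //; move: h1 h3 c2 c3 eta_le e34; set x1 := liq _ _ _; set x2 := liq _ _ _.
      by clear -M; lra.
    by rewrite lerDl.
  have [hsa [k' [b' [td rn' bn nz]]]] := hnS nS.
  have hsa' : a w < hs h w.
    by rewrite lt_neqAle (isH_ts hh) andbT; apply/eqP => e2; apply: hsa.
  have nF : ~ F w by rewrite /F /=; apply/negP; rewrite -ltNge.
  have [as2 rnr] := asT w aT.
  have [ekr ebr] := rnbhd_uniq aT rn' rnr; rewrite ekr in td; rewrite ebr in td bn nz.
  rewrite (cost_comb_go _ _ nS altau (sgt w alT)).
  have hsx : hs h' w = hs h w by rewrite hsE /sig ite_out.
  have qE : q w = Num.min (s w) (hs h w) by rewrite /q ite_out.
  have r0a : a w < r0 w by rewrite /r0 qE !lt_min as2 hsa' aT ltrDl g0.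
  have r0s : r0 w <= s w by rewrite /r0 qE !ge_min lexx.
  have r0h : r0 w <= hs h w by rewrite /r0 qE !ge_min lexx !orbT.
  have alr0 : al w <= r0 w := le_trans (ala w) (ar0 w).
  have a0 := stopt_ge0 w sa.
  have krs : kr w <= ks w + e1.
    have [_ eks] := xn w nS; apply: (trade_near m0 (mmu1 M) td eks) => //; try exact: S_ge0.
    - by apply: SC => //; exact: stopt_leT sal.
    - by have [] := osc' (a w) (al w) (ala w) (ar0 w) (lexx _) alr0.
  have Vn u : 0 <= u -> u <= T -> liq (kr w) (br w) (S u w) <= liq (ks w) (bs w) (S u w) + eta.
    move=> u0 uT; apply: (le_trans (liq_near (mdl0 M) m0 (mmu1 M) krs bn nz (S_ge0 u w) (SC u u0 uT))).
    by rewrite lerD2l.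
  have Ew : s w < T -> E w.
    move=> sT; split=> //=.
    have := trade_near2 m0 (mmu1 M) (tr2 w sT) krs bn (S_ge0 _ w) (SC (s w) (stopt_ge0 w ss) (ltW sT)).
    by apply: trade_le => //; clear -M e1eta; lra.
  have Vhold u : a w < u -> u <= s w -> Vh h u w = liq (kr w) (br w) (S u w).
    by move=> au us; rewrite /Vh; have [-> ->] := hold w u au us.
  have xT := stopt_leT w sx.
  have xr0 : r0 w <= xi w by rewrite /xi et' le_min r0h le_maxR.
  have ax : a w < xi w := lt_le_trans r0a xr0.
  have Vx0 : 0 <= Vh h (xi w) w by apply: (isH_adm hh) => //; exact: ltW.
  (* If the copied path breaks before the game ends, then the liquidation value of [h] was small at
     that moment, or at [a] if the break came earlier, and [loss] applies. *)
  have Lw : beta w < xi w -> L w.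
    move=> bx; have bex : be w < xi w by rewrite gt_max bx ax.
    split=> //; have beT := lt_le_trans bex xT.
    have [ba|ab] := ltP (beta w) (a w).
      have eb : be w = a w by rewrite /be (max_idPr (ltW ba)).
      have := rnb w beT; rewrite eb => rnb'; have [-> ->] := rnbhd_uniq aT rnb' rnr.
      have d0 : 0 < a w - beta w by rewrite subr_gt0.
      have [u [u1 u2 u3 u4]] := p4 w (lt_le_trans ba (as_ w)) _ d0.
      have ua : u <= a w by clear -M u2; lra.
      have alu : al w <= u by exact: le_trans (alb w) (ltW u1).
      have h1 := Vn (a w) a0 (ltW aT).
      have h2 := Lq (ks w) (bs w) (a w) u bsC (ala w) (ar0 w) alu (le_trans ua (ar0 w)).
      by move: h1 h2 u4 c3 eta_le0; set x1 := liq _ _ _; set x2 := liq _ _ _; set x3 := liq _ _ _; clear -M; lra.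
    have eb : be w = beta w by rewrite /be (max_idPl ab).
    have bT : beta w < T by rewrite -eb.
    have := rnb w beT; rewrite eb => rnb'.
    apply: le_trans (_ : eta <= _); last by clear -M eta_le0 eta00; lra.
    apply: (rlim_le rnb' bT) => e2 e20.
    have [bs'|sb'] := ltP (beta w) (s w).
      have [u [u1 u2 u3 u4]] := p4 w bs' _ e20; exists u; split=> //.
        exact: le_trans u3 (stopt_leT w ss).
      have au := le_lt_trans ab u1; rewrite (Vhold u au u3).
      have h1 := Vn u (le_trans a0 (ltW au)) (le_trans u3 (stopt_leT w ss)).
      by apply: (le_trans h1); rewrite gerDr ltW.
    have [u [u1 u2 u3 u4]] := p3 w (Ew (le_lt_trans sb' bT)) sb' bT _ e20.
    by exists u; split=> //; rewrite ltW // -subr_lt0.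
  have [tr0|r0t] := leP (tau w) (r0 w).
    have et : tau' w = r0 w by rewrite et' (max_idPr tr0).
    have xe : xi w = r0 w by rewrite /xi et (min_idPl r0h).
    have [_ _ oY] := osc' (tau w) (r0 w) (ltW altau) tr0 alr0 (lexx _).
    move: oY; rewrite ler_norml => /andP[_ oY].
    rewrite /cost hsx et ltNge (le_trans tr0 r0h) ltNge r0h /=.
    have [tb|bt] := leP (tau w) (beta w).
      have [ek eb] := p1 w (tau w) altau tb (le_trans tr0 r0s).
      rewrite /Vh ek eb -/(Vh h (r0 w) w) (Vhold (r0 w) r0a r0s).
      have h1 := Vn (r0 w) (le_trans a0 (ar0 w)) r0T.
      have h2 := Lq (ks w) (bs w) (r0 w) (tau w) bsC alr0 (lexx _) (ltW altau) tr0.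
      rewrite addrA; apply: (@le_trans _ _ (Num.max (Y (r0 w) w - lq kr br r0 w) 0 + e / 4)).
        apply: max0_shift => //; move: h1 h2 oY c2 c3 eta_le e34; set x1 := liq _ _ _; set x2 := liq _ _ _; set x3 := liq _ _ _.
        by clear -M; lra.
      by rewrite lerDl.
    have LLw : L w by apply: Lw; rewrite xe; exact: lt_le_trans bt tr0.
    have Vt0 : 0 <= Vh h' (tau w) w by apply: (isH_adm hh'); [exact: ltW|exact: stopt_leT stau].
    have FLw : FL w = Num.min (Z w) (Vh h (r0 w) w) by rewrite /FL indicE mem_set // mul1r xe.
    rewrite FLw; apply: (@le_trans _ _ (Num.max (Y (r0 w) w) 0 + c)).
      apply: (@le_trans _ _ (Num.max (Y (tau w) w) 0)).
        by rewrite ge_max !le_max lexx orbT andbT gerBl Vt0.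
      by apply: max0_shift; [exact: ltW|move: oY; clear -M; lra].
    rewrite xe in Vx0.
    have YZ : Y (r0 w) w <= Z w by apply: le_trans (ler_norm _) (mYZ M _ _).
    have h1 := max0_loss Vx0 YZ (Z0 w).
    apply: le_trans (lerD h1 (lexx c)) _; rewrite -addrA lerD2l addrC lerD2r.
    by move: c2 e34; clear -M e0; lra.
  have et : tau' w = tau w by rewrite et' (max_idPl (ltW r0t)).
  rewrite !cost_V hsx et -et -/(xi w) et; set pay := (if _ then _ else _).
  have alx : al w < xi w := le_lt_trans (ala w) ax.
  have [xb|bx] := leP (xi w) (beta w).
    suff h1 : Num.max (pay - Vh h' (xi w) w) 0 <= Num.max (pay - Vh h (xi w) w) 0 + e / 4.
      by apply: (le_trans h1); rewrite addrA lerDl.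
    apply: max0_shift => //.
    suff : Vh h (xi w) w <= Vh h' (xi w) w + eta.
      by move: eta_le e34; set x1 := Vh _ _ _; set x2 := Vh _ _ _; clear -M eta_gt0; lra.
    have [xs|sx'] := leP (xi w) (s w).
      have [ek eb] := p1 w (xi w) alx xb xs; rewrite (Vhold _ ax xs) /Vh ek eb.
      by apply: Vn => //; exact: stopt_ge0 sx.
    have [ek eb] := p2 w (xi w) (Ew (lt_le_trans sx' xT)) sx' xb.
    by rewrite /Vh ek eb /liq; set x := tcost _ _ _ _; clear -M; lra.
  have V0 : 0 <= Vh h' (xi w) w by apply: (isH_adm hh') => //; exact: ltW.
  have payZ : pay <= Z w.
    by rewrite /pay; case: ifP => _; apply: le_trans (ler_norm _) _; [exact: mXZ|exact: mYZ].
  apply: (@le_trans _ _ (Num.max pay 0)).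
    by rewrite ge_max !le_max lexx orbT andbT gerBl V0.
  apply: le_trans (max0_loss Vx0 payZ (Z0 w)) _.
  by rewrite /FL indicE mem_set ?mul1r ?lerD2l ?lerDr //; exact: Lw.
pose RHS w := e / 4 + \1_Bd w * Z w + \1_W w * Z w + FL w.
have IR : Ib RHS by do ?apply: IbD => //; try exact: IB; exact: Ib_cst.
have IJ : Ib (fun w => \1_A w * cost h tau' w) by exact: (Ib_Jc mA ht st' tt').
apply: (@le_trans _ _ (Ex (fun w => \1_A w * cost h tau' w + RHS w))).
  apply: Ex_le; [exact: (Ib_Jc mA hct stau ttau)|exact: IbD|].
  move=> w; have R0 : 0 <= RHS w by rewrite /RHS !addr_ge0.
  rewrite indicE; case: (w \in A); last by rewrite !mul0r add0r.
  by rewrite !mul1r; exact: key.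
rewrite ExD //; apply: lerD; first exact: (J_rho mA ht st' tt').
rewrite /RHS !ExD ?Ex_cst; try exact: IL; try by do ?apply: IbD => //; try exact: IB; exact: Ib_cst.
move: EBd EL; set x1 := Ex _; set x2 := Ex _; set x3 := Ex _ => h1 h2.
by clear -M h1 h2 e0; lra.
Qed.

Definition io (A : nat -> set Omega) := [set w | forall n, exists2 j, (n <= j)%N & A j w].

Section Decreasing.
Variables (al : Omega -> R) (tt : nat -> Omega -> R).
Hypotheses (sal : stopt al) (stt : forall j, stopt (tt j)) (altt : forall j w, al w <= tt j w).
Hypothesis ttdec : forall j w, tt j.+1 w <= tt j w.
Hypothesis ttlim : forall w e, 0 < e -> exists J, forall j, (J <= j)%N -> tt j w - al w <= e.

Lemma dec_le j m w : (j <= m)%N -> tt m w <= tt j w.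
Proof. by move/subnK <-; elim: (m - j)%N => // i; rewrite addSn; exact: le_trans. Qed.

(** An event known at every [tt N] is known immediately after [al], hence at [al] by
    right-continuity of the filtration. *)
Lemma Fat_tail A : (forall N, Fat (tt N) A) -> Fat al A.
Proof.
move=> hA; apply: (Fat_rc (mFs M) (mFm M) (mFrc M) sal) => u.
have -> : A `&` [set w | al w < u] = \bigcup_N (A `&` [set w | tt N w < u]).
  apply/seteqP; split=> w /=.
    move=> [Aw au]; have d0 : 0 < (u - al w) / 2 by rewrite divr_gt0 // subr_gt0.
    have [J hJ] := ttlim w d0; exists J => //; split=> //=.
    by have := hJ J (leqnn J); lra.
  by move=> [N _ [Aw h]]; split=> //; exact: le_lt_trans (altt N w) h.
apply: (sigma_bigcup (mFs M u)) => N.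
exact: (Fat_lt (mFs M) (mFm M) u (stt N) (hA N)).
Qed.

Lemma io_Fat (A : nat -> set Omega) : (forall j, Fat (tt j) (A j)) -> Fat al (io A).
Proof.
move=> hA; apply: Fat_tail => N.
have -> : io A = \bigcap_n \bigcup_j A (N + n + j)%N.
  apply/seteqP; split=> w /=.
    by move=> h n _; have [j nj Aj] := h (N + n)%N; exists (j - (N + n))%N => //; rewrite subnKC.
  by move=> h n; have [j _ Aj] := h n I; exists (N + n + j)%N => //; rewrite addnAC leq_addl.
have sG := sgF (stt N).
apply: (sigma_bigcap sG) => n; apply: (sigma_bigcup sG) => j.
apply: (Fmon (stt _) (stt N) _ (hA _)) => w; apply: dec_le.
by rewrite -addnA leq_addr.
Qed.

Lemma limsup_Fat (f : nat -> Omega -> R) (fs : Omega -> R) : (forall j, mG (Fat (tt j)) (f j)) ->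
  (forall w, (forall e : R, 0 < e -> exists n, forall j, (n <= j)%N -> f j w <= fs w + e) /\
    (forall e : R, 0 < e -> forall n, exists2 j, (n <= j)%N & fs w - e <= f j w)) ->
  mG (Fat al) fs.
Proof.
move=> mf hf'; apply: (mG_ray (sgF sal)) => c.
have -> : [set w | fs w <= c] = \bigcap_m ~` io (fun j => [set w | c + m.+1%:R^-1 < f j w]).
  apply/seteqP; split=> w /=.
    move=> fc m _ /= h; have [h1 _] := hf' w; have [|n hn] := h1 m.+1%:R^-1; first by rewrite invr_gt0.
    by have [j nj /=] := h n; rewrite ltNge (le_trans (hn j nj)) // lerD2r.
  move=> h; rewrite leNgt; apply/negP => cf.
  have d0 : 0 < (fs w - c) / 2 by rewrite divr_gt0 // subr_gt0.
  have [m hm] := inv_lt d0; apply: (h m I) => n.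
  have [_ h2] := hf' w; have [j nj hj] := h2 _ d0 n; exists j => //=.
  apply: lt_le_trans hj; have := hm m (leqnn m); set q := _^-1; lra.
apply: (sigma_bigcap (sgF sal)) => m; apply: (sigma_setC (sgF sal)); apply: io_Fat => j.
by apply: (mG_lt (sgF (stt j))) => //; exact: mG_cst.
Qed.

End Decreasing.

(** One link of the chain: hold until [al], then stop on [Sg] or trade to [(ks, bs)]. The link is
    chosen once for all [e] and only the continuation [h'] depends on [e]; so fixing this first
    action loses nothing in the infimum. *)
Record next t k b al (Sg : set Omega) ks bs : Prop := Next {
  nx_st : stopt al;
  nx_t : forall w, t w <= al w;
  nx_ok : okto t al k b;
  nx_S : Fat al Sg;
  nx_k : mG (Fat al) ks;
  nx_b : mG (Fat al) bs;
  nx_stop : forall w, Sg w -> ks w = k w /\ bs w = b w;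
  nx_go : forall w, ~ Sg w -> al w < T /\ trade (k w) (b w) (ks w) (bs w) (S (al w) w);
  nx_liq : forall w, 0 <= lq ks bs al w;
  nx_opt : forall e, 0 < e -> exists h', [/\ isH al ks bs h', forall w, al w < T -> al w < hs h' w &
    forall g, isH t k b g -> forall A, Fat t A -> rho t A (comb al k b Sg h') <= rho t A g + e] }.

(** The limiting action is a stop if the plans of the cascade stop infinitely often, and otherwise a
    trade to the upper limit of their positions. Off a small event, [roll] selects plans whose own
    action is close to the limiting one, and [replace] exchanges the one for the other. *)
Lemma next_exists t k b : stopt t -> mG (Fat t) k -> mG (Fat t) b ->
  (forall w, 0 <= lq k b t w) -> exists al Sg ks bs, next t k b al Sg ks bs.
Proof.
move=> st mk mb l0; have [z [sz tz okz zend]] := hold_end st mk mb l0.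
have [al [tt [l cas]]] := cascade_exists st mk mb sz tz okz zend.
have sal := cas_al cas; have stt := cas_st cas; have altt := cas_altt cas.
have ttdec := cas_dec cas; have ttlim := cas_lim cas; have tal := cas_tal cas.
have alz w : al w <= z w := le_trans (altt 0%N w) (cas_z cas 0%N w).
have okal : okto t al k b by move=> w u tu ua; apply: okz => //; exact: le_trans (alz w).
have /choice[x hx] : forall j, exists x : (Omega -> R) * (Omega -> R),
    isH (tt j) x.1 x.2 (restr (l j) (tt j) x.1 x.2) /\
    forall w, tt j w < T -> rnbhd (l j) w (tt j w) (x.1 w) (x.2 w).
  move=> j; have [k' [b' [h1 h2 _ _]]] := isH_restr (cas_H cas j) (stt j) (fun w => lexx _).
  by exists (k', b').
pose kr j := (x j).1; pose br j := (x j).2.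
have mkr j : mG (Fat (tt j)) (kr j) by have [/isH_k] := hx j.
have mbr j : mG (Fat (tt j)) (br j) by have [/isH_b] := hx j.
pose stp j := [set w | hs (l j) w <= tt j w].
have Fstp j : Fat (tt j) (stp j) by apply: Fler => //; exact: isH_s (cas_H cas j).
have go j w : ~ stp j w -> [/\ tt j w < T, trade (k w) (b w) (kr j w) (br j w) (S (tt j w) w),
   rnbhd (l j) w (tt j w) (kr j w) (br j w) & 0 <= liq (kr j w) (br j w) (S (tt j w) w)].
  move=> ns; have [e|[tT [k' [b' [td rn]]]]] := cas_act cas j w.
    by exfalso; apply: ns; rewrite /stp /= e.
  have [hr hn] := hx j; have [ek eb] := rnbhd_uniq tT (hn w tT) rn.
  rewrite /kr /br; split; [by []|by rewrite ek eb|exact: hn|].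
  have := isH_adm hr (lexx _) (ltW tT); rewrite /Vh.
  by have [-> ->] := isH_pre hr (lexx (tt j w)).
have stop j w : stp j w -> hs (l j) w = tt j w.
  by move=> h; apply: le_anti; rewrite h (isH_ts (cas_H cas j)).
(* Where the plan [j] stops there is no position after a trade; the value 0 keeps the sequence
   bounded and measurable. *)
pose br' j w := if w \in stp j then 0 else br j w.
have mbr' j : mG (Fat (tt j)) (br' j) by apply: (mG_if (sgF (stt j))) => //; exact: mG_cst.
have bdS w : exists2 C : R, 0 < C & forall u, 0 <= u -> u <= T -> S u w <= C /\ 1 <= C * S u w.
  have T0 := ltW (mT0 M).
  have [C1 C10 h1] := bounded_itv T0 (mSc M w).
  have cV : continuous (fun u => (S u w)^-1).
    by move=> u; apply: cvgV; [rewrite gt_eqF // mS0|exact: mSc].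
  have [C2 C20 h2] := bounded_itv T0 cV.
  exists (C1 + C2); first by rewrite addr_gt0.
  move=> u u0 uT; split.
    by apply: le_trans (ler_norm _) (le_trans (h1 u u0 uT) _); rewrite lerDl ltW.
  have s0 := mS0 M u w; rewrite -ler_pdivrMr // div1r.
  by apply: le_trans (ler_norm _) (le_trans (h2 u u0 uT) _); rewrite lerDr ltW.
(* Solvency after the trade bounds the proportional cost of the new position by the wealth before
   it, and the price is bounded above and below on each path. *)
have bd w : exists C : R, forall j, `|br' j w| <= C.
  have [C C0 hC] := bdS w; exists ((`|k w| + `|b w| * C) * C / mu) => j.
  have m0 := mmu0 M.
  rewrite ler_pdivlMr // /br'; case: ifPn => [_|/negP hs].
    by rewrite normr0 mul0r mulr_ge0 // ?addr_ge0 // ?mulr_ge0 // ltW.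
  have ns : ~ stp j w by move=> h; apply: hs; exact: mem_set.
  have [tT td _ lq] := go j w ns.
  have t0 := stopt_ge0 w (stt j); have [SC CS] := hC _ t0 (ltW tT).
  have S0 := mS0 M (tt j w) w.
  have h1 := liq_wealth_ge0 (ltW S0) lq.
  have h2 : mu * `|br j w| * S (tt j w) w <= `|k w| + `|b w| * C.
    apply: (le_trans h1); move: td; rewrite /trade.
    have := action_cost_delta dl mu (br j w - b w) (S (tt j w) w); have := mdl0 M.
    have := ler_mulC (ltW S0) (lexx `|b w|) SC; have := ler_norm (k w).
    set c := action_cost _ _ _ _; set p := S _ _; clear -M; lra.
  have h3 : 0 <= mu * `|br j w| by rewrite mulr_ge0 // ltW.
  have h4 := ler_wpM2r (ltW C0) h2.
  have h5 : mu * `|br j w| <= mu * `|br j w| * (S (tt j w) w * C) by rewrite ler_peMr // mulrC.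
  by rewrite [leLHS]mulrC; apply: (le_trans h5); rewrite mulrA.
have /choice[bstar hbs] : forall w, exists l0 : R,
   (forall e : R, 0 < e -> exists n, forall j, (n <= j)%N -> br' j w <= l0 + e) /\
    (forall e : R, 0 < e -> forall n, exists2 j, (n <= j)%N & l0 - e <= br' j w).
  by move=> w; have [C hC] := bd w; exact: limsup_exists hC.
have mbstar : mG (Fat al) bstar by exact: (limsup_Fat sal stt altt ttdec ttlim mbr' hbs).
pose Sg := io stp.
have FS : Fat al Sg by exact: (io_Fat sal stt altt ttdec ttlim Fstp).
have nSgo w : ~ Sg w -> exists n, forall j, (n <= j)%N -> ~ stp j w.
  move=> ns; apply: contrapT => h; apply: ns => n; apply: contrapT => h'.
  by apply: h; exists n => j nj sj; apply: h'; exists j.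
have br'E j w : ~ stp j w -> br' j w = br j w by move=> h; rewrite /br' memNset.
have near w : ~ Sg w -> forall e, 0 < e -> forall n, exists j, [/\ (n <= j)%N, ~ stp j w,
    `|br j w - bstar w| <= e & bstar w != 0 -> br j w != 0].
  move=> nS e e0 n; have [n1 h1] := nSgo w nS.
  (* An accuracy of [|bstar w| / 2] forces the approximating position to be nonzero when the limit
     is nonzero, as [liq_near] requires. *)
  pose e' := if bstar w == 0 then e else Num.min e (`|bstar w| / 2).
  have e'0 : 0 < e'.
    by rewrite /e'; case: eqVneq => // h; rewrite lt_min e0 divr_gt0 // normr_gt0.
  have e'e : e' <= e by rewrite /e'; case: ifP => // _; rewrite min_leL.
  have [hb1 hb2] := hbs w; have [n2 hn2] := hb1 e' e'0.
  have [j nj hj] := hb2 e' e'0 (maxn n (maxn n1 n2)).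
  have [nj0 nj1 nj2] : [/\ (n <= j)%N, (n1 <= j)%N & (n2 <= j)%N].
    by move: nj; rewrite !geq_max => /and3P[].
  have ns := h1 j nj1; have := hn2 j nj2; rewrite br'E // in hj * => hj2.
  have d1 : `|br j w - bstar w| <= e'.
    by rewrite ler_norml; apply/andP; split; clear -M hj hj2; lra.
  exists j; split=> //; first exact: le_trans d1 e'e.
  move=> b0; apply/eqP => bj0; move: d1; rewrite bj0 sub0r normrN /e' (negbTE b0) leNgt => /negP[].
  by rewrite gt_min; apply/orP; right; rewrite gtr_pMr ?normr_gt0 // invf_lt1 // ltr1n.
have alT w : ~ Sg w -> al w < T.
  move=> nS; have [n /(_ n (leqnn n)) ns] := nSgo w nS; have [tT _ _ _] := go n w ns.
  exact: le_lt_trans (altt n w) tT.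
pose bs w := if w \in Sg then b w else bstar w.
pose ks w := if w \in Sg then k w else
  k w - (bstar w - b w) * S (al w) w - action_cost dl mu (bstar w - b w) (S (al w) w).
have mkal : mG (Fat al) k := mG_mon st sal tal mk.
have mbal : mG (Fat al) b := mG_mon st sal tal mb.
have mSal : mG (Fat al) (fun w => S (al w) w) := mG_at (mSc M) (mSa M) sal.
have mbs : mG (Fat al) bs by exact: (mG_if (sgF sal)).
have mks : mG (Fat al) ks by apply: (mG_if (sgF sal)) => //; rewrite /action_cost; mg.
have xS w : Sg w -> ks w = k w /\ bs w = b w by move=> h; rewrite /ks /bs mem_set.
have xn w : ~ Sg w -> al w < T /\
    ks w = k w - (bs w - b w) * S (al w) w - action_cost dl mu (bs w - b w) (S (al w) w).
  by move=> h; split; [exact: alT|rewrite /ks /bs memNset].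
have ls w : 0 <= lq ks bs al w.
  have [Sw|nS] := pselect (Sg w); first by have [-> ->] := xS w Sw; apply: okal.
  have [_ ->] := xn w nS; rewrite /bs memNset //.
  apply: (trade_limit (mdl0 M) (mmu0 M) (mmu1 M) (mS0 M _ w)) => e e0.
  have [h' h'0 hh'] := continuous_dist (al w) (mSc M w) e0.
  have h20 : 0 < h' / 2 by rewrite divr_gt0.
  have [N hN] := ttlim w _ h20.
  have [j [Nj ns d1 nz]] := near w nS e e0 N.
  have [tT td _ lq] := go j w ns; exists (kr j w), (br j w), (S (tt j w) w); split=> //.
    exact: mS0.
  split=> //; apply/ltW/hh'; rewrite ger0_norm ?subr_ge0 //.
  by apply: le_lt_trans (hN j Nj) _; clear -M h'0; lra.
exists al, Sg, ks, bs; split=> //.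
  by move=> w ns; have [h1 h2] := xn w ns; split=> //; rewrite /trade h2 lexx.
move=> e e0; have e4 : 0 < e / 4 by rewrite divr_gt0.
have [g g0 rep] := replace st mk mb sz okz sal tal alz FS mks mbs xS xn ls e4.
(* The plan [j] acts like the limit: both stop, or both trade, with positions within [g], and its
   position is nonzero if the limiting one is. *)
pose Q j := (Sg `&` stp j) `|` (~` Sg `&` ~` stp j `&` [set w | `|br j w - bstar w| <= g] `&`
  ([set w | bstar w = 0] `|` ~` [set w | br j w = 0])).
have FQ j : Fat (tt j) (Q j).
  have sG := sgF (stt j); have FSj : Fat (tt j) Sg := Fmon sal (stt j) (altt j) FS.
  have mbj : mG (Fat (tt j)) bstar := mG_mon sal (stt j) (altt j) mbstar.
  apply: (sigma_setU sG); first exact: (sigma_setI sG).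
  apply: (sigma_setI sG).
    apply: (sigma_setI sG); first by apply: (sigma_setI sG); exact: (sigma_setC sG).
    by apply: (mG_le sG); [mg|exact: mG_cst].
  apply: (sigma_setU sG); first by apply: (mG_eq sG) => //; exact: mG_cst.
  by apply: (sigma_setC sG); apply: (mG_eq sG) => //; exact: mG_cst.
have Qio w n : exists2 j, (n <= j)%N & Q j w.
  have [Sw|nS] := pselect (Sg w).
    by have [j nj sj] := Sw n; exists j => //; left.
  have [j [nj ns d1 nz]] := near w nS g g0 n; exists j => //; right.
  split=> //=; have [b0|b0] := eqVneq (bstar w) 0; [by left|right => /= h].
  by have := nz b0; rewrite h eqxx.
pose W1 n := [set w | g < tt n w - al w].
have mW1 n : measurable (W1 n).
  apply: (mFmeas M T); apply: (mG_lt (mFs M T)); first exact: mG_cst.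
  by apply: mGB; exact: stopt_meas.
have [|N1 hN1] := Ex_tail mW1 (mIZ M) _ e4.
  move=> w; have [J' hJ] := ttlim w _ g0; exists J' => n Jn /=; rewrite /W1 /=; apply/negP.
  by rewrite -leNgt; exact: hJ.
have e48 : 0 < e / 48 by rewrite divr_gt0.
have [N2 hN2] := hf_small e48.
pose N := maxn N1 N2.
have hN : hf N < e / 48 by apply: hN2; rewrite leq_maxr.
(* The paths that have not met [Q] at any index from [N] to [N + i]; by [Qio] every path leaves
   these events. *)
pose W2 i := \bigcap_m (if (N <= m <= N + i)%N then ~` Q m else setT).
have mW2 i : measurable (W2 i).
  apply: bigcap_measurable => [|m _]; first by exists 0%N.
  case: ifP => _ //; apply: measurableC; exact: (Fat_measurable (stt m) (FQ m)).
have [|i0 /(_ i0 (leqnn i0)) hi] := Ex_tail mW2 (mIZ M) _ e4.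
  move=> w; have [j Nj Qj] := Qio w N; exists (j - N)%N => n jn /(_ j I); rewrite Nj /=.
  by have -> : (j <= N + n)%N by rewrite -leq_subLR.
have [a [h [ha aa tta opt hm]]] := roll st mk mb okz N i0 cas FQ.
pose W := W1 N `|` W2 i0.
have mW : measurable W by exact: measurableU.
have ala w : al w <= a w := le_trans (altt _ w) (tta w).
have az w : a w <= z w by have [m [_ -> _ _ _]] := hm w; exact: cas_z cas m w.
have [|h' [hh' hgt hopt]] := rep a h W ha aa ala az mW.
  move=> w nW; have [m [/andP[Nm mN] am mQ nQ [e1 e2 e3]]] := hm w.
  have Qm : Q m w.
    have [mE|//] := mQ; apply: contrapT => nQm; apply: nW; right => m' _ /=.
    case: ifPn => // /andP[h1 h2]; have [<-|mm'] := eqVneq m m'; first by [].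
    by apply: nQ; rewrite h2 andbT ltn_neqAle mm' mE h1.
  have aal : a w - al w <= g.
    have : ~ W1 N w by move=> h1; apply: nW; left.
    rewrite /W1 /= => /negP; rewrite -leNgt; apply: le_trans; rewrite lerD2r am.
    exact: (dec_le ttdec).
  split=> // hS.
    case: Qm => [[_ sm]|[[[]] //]]; by rewrite e1 am (stop m w).
  case: Qm => [[]//|[[[_ ns] d1] nz]]; have [tT td rn _] := go m w ns; split.
    by rewrite e1 am => h1; apply: ns; rewrite /stp /= h1.
  exists (kr m w), (br m w); rewrite am /bs memNset //; split=> //.
    case: rn => e' e'0 hrn; exists e' => // v v1 v2 v3; have [<- <-] := hrn v v1 v2 v3.
    by split; [exact: (congr1 (@^~ v) e2)|exact: (congr1 (@^~ v) e3)].
  by move=> b0; case: nz => [/= h1|/= /eqP//]; rewrite h1 eqxx in b0.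
exists h'; split=> // g' hg' A FA.
apply: (le_trans (hopt A FA)); apply: le_trans (lerD (opt g' hg' A FA) (lexx _)) _.
have EW : Ex (fun w => \1_W w * Z w) <= Ex (fun w => \1_(W1 N) w * Z w) + Ex (fun w => \1_(W2 i0) w * Z w).
  rewrite -ExD; try by apply: Ib_indic => //; exact: mIZ.
  apply: Ex_le; first by apply: Ib_indic => //; exact: mIZ.
    by apply: IbD; apply: Ib_indic => //; exact: mIZ.
  move=> w; have z0 := Z0 w; rewrite -!mulrDl ler_wpM2r // !indicE in_setU.
  by case: (w \in W1 N); case: (w \in W2 i0); rewrite /=; clear -M; lra.
have hN1' := hN1 N (leq_maxl _ _).
move: EW hN1' hi hN; set x1 := Ex _; set x2 := Ex _; set x3 := Ex _; set x4 := hf _; set x5 := rho _ _ _.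
by clear -M; lra.
Qed.

(** If [h] stops at [al] itself, the combined hedge is valued there before its trade, and by
    [liq_trade] that value is not smaller. *)
Lemma cost_comb_bound al k b ks bs (Sg : set Omega) h tau w : isH al ks bs h -> ~ Sg w -> al w < tau w ->
  trade (k w) (b w) (ks w) (bs w) (S (al w) w) ->
  cost (comb al k b Sg h) tau w <= cost h tau w.
Proof.
move=> hh nS at' td; have [ah|ha] := ltP (al w) (hs h w); first by rewrite (cost_comb_go _ _ nS at' ah).
have e : hs h w = al w by apply: le_anti; rewrite ha (isH_ts hh).
rewrite cost_paste ite_out // /cost /Vh /= e at' lexx.
have [-> ->] := isH_pre hh (lexx (al w)).
have := liq_trade (mdl0 M) (mmu0 M) (S_ge0 (al w) w) td; set x := liq _ _ _; set y := liq _ _ _ => xy.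
rewrite ge_max; apply/andP; split; last by rewrite le_maxR.
by rewrite le_max; apply/orP; left; rewrite lerD2l lerN2.
Qed.

(** * Splitting the risk at one action *)

Section OneNode.
Variables (t k b al : Omega -> R) (Sg : set Omega) (ks bs : Omega -> R).
Hypotheses (st : stopt t) (mk : mG (Fat t) k) (mb : mG (Fat t) b).
Hypothesis nx : next t k b al Sg ks bs.

Lemma next_comb h : isH al ks bs h -> isH al k b (comb al k b Sg h) /\ isH t k b (comb al k b Sg h).
Proof.
move=> hh; have sal := nx_st nx; have tal := nx_t nx.
have h1 : isH al k b (comb al k b Sg h).
  apply: (isH_comb hh (mG_mon st sal tal mk) (mG_mon st sal tal mb) (nx_S nx)) => w.
    by apply: (nx_ok nx).
  move=> alT; have [Sw|nS] := pselect (Sg w); first by right; exact: (nx_stop nx).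
  by left; have [] := nx_go nx nS.
by split=> //; exact: (isH_lower h1 st mk mb tal (nx_ok nx)).
Qed.

Let cont A tau := A `&` [set w | al w < tau w] `&` ~` Sg.

Lemma next_cont A tau : stopt tau -> Fat t A -> Fat al (cont A tau).
Proof.
move=> stau FA; have sal := nx_st nx; have sG := sgF sal.
apply: (sigma_setI sG); last exact: (sigma_setC sG (nx_S nx)).
by apply: (sigma_setI sG); [exact: (Fmon st sal (nx_t nx) FA)|exact: Flt].
Qed.

(** Off [cont] the game is over by the action at [al], so the continuation has no influence and any
    fixed [h0] may stand for it. *)
Lemma comb_base h0 h A tau w : isH al ks bs h0 -> isH al ks bs h -> (A `\` cont A tau) w ->
  cost (comb al k b Sg h) tau w = cost (comb al k b Sg h0) tau w.
Proof.
move=> hh0 hh [Aw nc]; have [ta|at'] := leP (tau w) (al w).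
  by rewrite !(cost_comb_le _ _ _ _ ta) //; [exact: (isH_ts hh0 w)|exact: (isH_ts hh w)].
have [Sw|nS] := pselect (Sg w); first by rewrite !(cost_comb_stop _ _ _ Sw at').
by exfalso; apply: nc.
Qed.

(** With [next_lower] this is the dynamic programming principle: for a given [tau] the cost consists
    of a part settled by the action at [al], which does not involve [h], and a new game from [al]
    on, against an unrestricted adversary. *)
Lemma next_upper h0 h A tau : isH al ks bs h0 -> isH al ks bs h -> Fat t A -> stopt tau ->
  t <=w tau -> J A (comb al k b Sg h) tau <=
  J (A `\` cont A tau) (comb al k b Sg h0) tau + rho al (cont A tau) h.
Proof.
move=> hh0 hh FA stau ttau; have sal := nx_st nx.
have Fc := next_cont stau FA; have mc := Fat_measurable sal Fc; have mA := Fat_measurable st FA.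
have [_ hc] := next_comb hh.
rewrite (J_split mc hc stau ttau mA) addrC; apply: lerD.
  by rewrite (J_eq (g := comb al k b Sg h0) (tau' := tau)) // => w; exact: comb_base.
have -> : A `&` cont A tau = cont A tau by rewrite /cont !setIA setIid.
have smx : stopt (fun w => Num.max (tau w) (al w)) by exact: smax.
have mxal w : al w <= Num.max (tau w) (al w) by rewrite le_maxR.
apply: le_trans (J_rho mc hh smx mxal).
apply: Ex_le; [exact: (Ib_Jc mc hc stau ttau)|exact: (Ib_Jc mc hh smx mxal)|].
move=> w; rewrite indicE; case: (boolP (w \in _)) => [/set_mem[[Aw /= at'] nS]|_]; last by rewrite !mul0r.
rewrite !mul1r; have [_ td] := nx_go nx nS.
apply: le_trans (cost_comb_bound hh nS at' td) _.
by rewrite (@cost_tau h tau (fun w => Num.max (tau w) (al w)) w) // (max_idPl (ltW at')).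
Qed.

(* The adversary who would stop at [al] itself waits a little instead, so that he
   faces the state after the trade. *)
Lemma next_lower h0 h A tau : isH al ks bs h0 -> isH al ks bs h -> (forall w, al w < T -> al w < hs h w) ->
  Fat t A -> stopt tau -> t <=w tau ->
  J (A `\` cont A tau) (comb al k b Sg h0) tau + rho al (cont A tau) h <= rho t A (comb al k b Sg h).
Proof.
move=> hh0 hh hgt FA stau ttau; have sal := nx_st nx.
have Fc := next_cont stau FA; have mc := Fat_measurable sal Fc; have mA := Fat_measurable st FA.
have [_ hc] := next_comb hh; set A' := cont A tau in Fc mc *.
rewrite -lerBrDl; apply: (rho_le mc hh) => tau2 st2 al2; rewrite lerBrDl.
pose an (n : nat) w := Num.max (tau2 w) (Num.min (al w + n.+1%:R^-1) T).
have san n : stopt (an n) by apply: smax => //; apply: stopt_add => //; rewrite invr_ge0.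
have alan n w : al w <= an n w by rewrite le_max al2.
have FA'n n : Fat (an n) A' := Fmon sal (san n) (alan n) Fc.
have FA't : Fat tau A'.
  have smn : stopt (fun w => Num.min (al w) (tau w)) by exact: smin.
  have h1 : Fat (fun w => Num.min (al w) (tau w)) A'.
    by apply: (Fat_loc Fc) => w [[_ /= /ltW at'] _]; rewrite (min_idPl at').
  by apply: (Fmon smn stau _ h1) => w; rewrite min_leR.
pose tn n := ite A' (an n) tau.
have stn n : stopt (tn n) by apply: stopt_ite => //; exact: FatC.
have ttn n w : t w <= tn n w.
  by rewrite /tn /ite; case: ifP => _ //; exact: le_trans (nx_t nx w) (alan n w).
pose D n w := \1_A' w * Num.max (cost h tau2 w - cost h (an n) w) 0.
have cZ n w : cost h (an n) w <= Z w by exact: (cost_leZ hh (san n) (alan n w)).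
have cZ2 w : cost h tau2 w <= Z w by exact: (cost_leZ hh st2 (al2 w)).
have D0 n w : 0 <= D n w by rewrite /D mulr_ge0 // ?indicE // le_maxR.
have DZ n w : `|D n w| <= Z w.
  rewrite ger0_norm // /D indicE; case: (w \in A'); last by rewrite mul0r Z0.
  rewrite mul1r ge_max Z0 andbT.
  by apply: le_trans (cZ2 w); rewrite gerBl cost_ge0.
have mD n : mfun (D n).
  apply: measurable_funM; first exact: measurable_indic.
  apply: measurable_maxr => //; apply: measurable_funB; [exact: mcost hh st2|exact: mcost hh (san n)].
(* Where [tau2] lies after [al], the times [an n] eventually equal it. Where [tau2 = al], the state
   just after [al] is [(ks, bs)] or reached from it by a trade, so its liquidation value is not
   larger and waiting does not hurt the adversary in the limit. *)
have Dc w : (fun n => D n w) @ \oo --> (0 : R).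
  apply/cvgrPdist_le => e e0.
  suff [N hN] : exists N, forall n, (N <= n)%N -> D n w <= e.
    by exists N => // n Nn /=; rewrite sub0r normrN ger0_norm // hN.
  rewrite /D indicE; case: (boolP (w \in A')) => [/set_mem[[Aw /= at'] nS]|_]; last first.
    by exists 0%N => n _; rewrite mul0r ltW.
  have [alT td] := nx_go nx nS; have ah := hgt w alT.
  have [a2|a2'] := ltP (al w) (tau2 w).
    have d0 : 0 < tau2 w - al w by rewrite subr_gt0.
    have [N hN] := inv_lt d0; exists N => n Nn; rewrite mul1r ge_max (ltW e0) andbT lerBlDr.
    suff -> : cost h (an n) w = cost h tau2 w by rewrite lerDr ltW.
    apply: cost_tau; rewrite /an; apply/max_idPl; rewrite ge_min.
    by apply/orP; left; rewrite -lerBrDl ltW // hN.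
  have e2 : tau2 w = al w by apply: le_anti; rewrite a2' al2.
  have [k' [b' [hr rn trs _]]] := isH_restr hh sal (fun w => lexx _).
  have [c1 c10 hc1] := rn w alT.
  have e20 : 0 < e / 2 by rewrite divr_gt0.
  have [c2 c20 hc2] := continuous_dist (al w) (mYc M w) e20.
  have [c3 c30 hc3] := liq_left (al w) w (k' w) (b' w) e20.
  pose c := Num.min (Num.min c1 c2) (Num.min c3 (Num.min (hs h w - al w) (T - al w))).
  have c0 : 0 < c by rewrite !lt_min c10 c20 c30 !subr_gt0 ah alT.
  have [q1 q2 q3 q4 q5] : [/\ c <= c1, c <= c2, c <= c3, c <= hs h w - al w & c <= T - al w].
    by rewrite /c; split; rewrite !ge_min lexx ?orbT.
  have [N hN] := inv_lt c0; exists N => n Nn; rewrite mul1r ge_max (ltW e0) andbT lerBlDr.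
  have nc : n.+1%:R^-1 < c by exact: hN.
  have n0 : 0 < n.+1%:R^-1 :> R by rewrite invr_gt0.
  pose v : R := n.+1%:R^-1; rewrite -/v in nc n0.
  have ean : an n w = al w + v.
    rewrite /an e2 -/v (min_idPl _) ?(max_idPr _) // ?lerDl ?(ltW n0) //.
    by move: nc q5; clear -st mk mb nx cont; lra.
  rewrite /cost ean e2 ltNge (ltW ah) ltNge /=.
  have -> : al w + v <= hs h w by move: nc q4; clear -st mk mb nx cont; lra.
  rewrite /= /Vh; have [-> ->] := isH_pre hh (lexx (al w)).
  have [|||-> ->] := hc1 (al w + v); [by rewrite ltrDl|by rewrite ltrD2l (lt_le_trans nc)|
    by move: nc q5; clear -st mk mb nx cont; lra|].
  have dv : `|al w + v - al w| = v by rewrite addrAC subrr add0r gtr0_norm.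
  have n2 : `|al w + v - al w| < c2 by rewrite dv (lt_le_trans nc).
  have n3 : `|al w + v - al w| < c3 by rewrite dv (lt_le_trans nc).
  have := ltW (hc2 _ n2); rewrite ler_norml => /andP[y1 _].
  have := ltW (hc3 _ n3); rewrite ler_norml => /andP[_ y2].
  have lle : lq k' b' al w <= lq ks bs al w.
    have [[-> ->]//|td'] := trades_same (mdl0 M) (mmu0 M) (S_ge0 (al w) w) (trs w alT) (lexx _).
    exact: (liq_trade (mdl0 M) (mmu0 M) (S_ge0 (al w) w) td').
  rewrite [leRHS]addrC; apply: max0_shift; first exact: ltW.
  move: y1 y2 lle; set x1 := liq _ _ _; set x2 := liq _ _ _; set x3 := liq _ _ _.
  by clear -st mk mb nx cont; lra.
have [_ ED] := Ex_dct mD (mIZ M) DZ Dc.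
rewrite Ex_cst in ED.
apply/ler_addgt0Pl => e e0.
have /cvgrPdist_le /(_ e e0) [N _ /(_ N (leqnn N)) /=] := ED.
rewrite sub0r normrN => /(le_trans (ler_norm _)) EN.
have ID : Ib (D N) by exact: Ib_le (mIZ M) _.
rewrite -lerBlDl; apply: le_trans (J_rho mA hc (stn N) (ttn N)).
rewrite (J_split mc hc (stn N) (ttn N) mA) [leRHS]addrC -addrA; apply: lerD; last first.
  have eA : A `&` A' = A' by rewrite /A' /cont !setIA setIid.
  rewrite eA lerBlDr; apply: le_trans (_ : J A' (comb al k b Sg h) (tn N) + Ex (D N) <= _); last by rewrite lerD2l.
  rewrite -ExD //; last exact: (Ib_Jc mc hc (stn N) (ttn N)).
  apply: Ex_le; first exact: (Ib_Jc mc hh st2 al2).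
    by apply: IbD => //; exact: (Ib_Jc mc hc (stn N) (ttn N)).
  move=> w; rewrite /D indicE; case: (boolP (w \in A')) => [A'w|_]; last by rewrite !mul0r addr0.
  have [[Aw /= at'] nS] := set_mem A'w; have [alT _] := nx_go nx nS.
  have etn : tn N w = an N w by rewrite /tn /ite A'w.
  have altn : al w < tn N w.
    by rewrite etn /an lt_max; apply/orP; right; rewrite lt_min alT ltrDl invr_gt0 ltr0n.
  rewrite !mul1r (cost_comb_go _ _ nS altn (hgt w alT)) (cost_tau _ etn) -lerBlDl le_maxL //.
rewrite (J_eq (g := comb al k b Sg h) (tau' := tn N)) // => w Dw.
rewrite -(comb_base hh0 hh Dw); apply: cost_tau; rewrite /tn ite_out //.
by case: Dw.
Qed.

End OneNode.

(** On each path the sequence is eventually constant. Measurability is kept in the limit, and the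
    conditions on a single path are those of some member of the sequence. *)
Lemma isH_lim t k b (hn : nat -> hdg) h : (forall n, isH t k b (hn n)) ->
  (forall w, exists N, forall n, (N <= n)%N ->
     [/\ hK (hn n) ^~ w = hK h ^~ w, hB (hn n) ^~ w = hB h ^~ w & hs (hn n) w = hs h w]) ->
  isH t k b h.
Proof.
move=> hh lim.
have same w : exists n, [/\ hK (hn n) ^~ w = hK h ^~ w, hB (hn n) ^~ w = hB h ^~ w & hs (hn n) w = hs h w].
  by have [N hN] := lim w; exists N; exact: hN.
split.
- exact: isH_st (hh 0%N).
- exact: isH_k (hh 0%N).
- exact: isH_b (hh 0%N).
- move=> u; apply: (mG_lim (F := fun n w => if t w < u then hK (hn n) u w else 0)) => [n|w].
    exact: isH_Kad (hh n) u.
  have [N hN] := lim w; apply: cvg_near_cst; exists N => // n Nn; have [e _ _] := hN n Nn.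
  by case: ifP => // _; exact: (congr1 (@^~ u) e).
- move=> u; apply: (mG_lim (F := fun n w => if t w < u then hB (hn n) u w else 0)) => [n|w].
    exact: isH_Bad (hh n) u.
  have [N hN] := lim w; apply: cvg_near_cst; exists N => // n Nn; have [_ e _] := hN n Nn.
  by case: ifP => // _; exact: (congr1 (@^~ u) e).
- move=> w u ut; have [n [e1 e2 _]] := same w; have [h1 h2] := isH_pre (hh n) ut.
  by rewrite -h1 -h2; split; [rewrite -(congr1 (@^~ u) e1)|rewrite -(congr1 (@^~ u) e2)].
- by move=> w; have [n [<- <- _]] := same w; exact: isH_leg (hh n) w.
- move=> w u tu uT; have [n [e1 e2 _]] := same w; have := isH_adm (hh n) tu uT.
  by rewrite /Vh (congr1 (@^~ u) e1 : hK (hn n) u w = hK h u w) (congr1 (@^~ u) e2 : hB (hn n) u w = hB h u w).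
- split=> [w|u].
    by have [n [_ _ <-]] := same w; have [] := isH_s (hh n).
  have -> : [set w | hs h w <= u] = \bigcup_N \bigcap_n [set w | hs (hn (N + n)%N) w <= u].
    apply/seteqP; split=> w /=; have [N hN] := lim w.
      move=> hu; exists N => // n _ /=; have [_ _ ->] := hN (N + n)%N (leq_addr _ _); exact: hu.
    by move=> [N' _ /(_ N I) /=]; have [_ _ ->] := hN (N' + N)%N (leq_addl _ _).
  apply: (sigma_bigcup (mFs M u)) => N; apply: (sigma_bigcap (mFs M u)) => n.
  by have [_] := isH_s (hh (N + n)%N).
- by move=> w; have [n [_ _ <-]] := same w; exact: isH_ts (hh n) w.
Qed.

(** * The chain of actions *)

Section Chain.
Variables (t k b : nat -> Omega -> R) (Sg : nat -> set Omega).
Hypotheses (st : forall n, stopt (t n)) (mk : forall n, mG (Fat (t n)) (k n)).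
Hypotheses (mb : forall n, mG (Fat (t n)) (b n)).
Hypothesis nx : forall n, next (t n) (k n) (b n) (t n.+1) (Sg n) (k n.+1) (b n.+1).
Hypothesis l0 : forall n w, 0 <= liq (k n w) (b n w) (S (t n w) w).

Let C n h := comb (t n.+1) (k n) (b n) (Sg n) h.

Fixpoint combs n N h := if N is N'.+1 then C n (combs n.+1 N' h) else h.

Let L n := liqd (t n) (k n) (b n) (t n).

Let HL n : isH (t n) (k n) (b n) (L n).
Proof. exact: isH_liqd. Qed.

Lemma isH_combs n N h : isH (t (n + N)%N) (k (n + N)%N) (b (n + N)%N) h ->
  isH (t n) (k n) (b n) (combs n N h).
Proof.
elim: N n => [|N IH] n /=; first by rewrite addn0.
by rewrite -addSnnS => /IH h1; have [] := next_comb (st n) (mk n) (mb n) (nx n) h1.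
Qed.

(** A certificate that the risk of [combs n N h] on [A] is at most [c]. The part of the cost settled
    at each node is independent of the continuation, so [h] enters only at the last node, and the
    certificate can be prolonged by one more action without revisiting the earlier ones
    ([bounds_tail]). *)
Fixpoint bounds n N h A (c : R) : Prop :=
  if N is N'.+1 then forall tau, stopt tau -> (forall w, t n w <= tau w) ->
    exists2 c' : R, bounds n.+1 N' h (A `&` [set w | t n.+1 w < tau w] `&` ~` Sg n) c' &
      J (A `\` (A `&` [set w | t n.+1 w < tau w] `&` ~` Sg n)) (C n (L n.+1)) tau + c' <= c
  else rho (t n) A h <= c.

Lemma bounds_le n N h A c c' : c <= c' -> bounds n N h A c -> bounds n N h A c'.
Proof.
case: N => [|N] cc /=; first by move/le_trans; apply.
move=> H tau stau ttau; have [c2 h1 h2] := H tau stau ttau; exists c2 => //; exact: le_trans cc.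
Qed.

Lemma bounds_rho n N h A c : isH (t (n + N)%N) (k (n + N)%N) (b (n + N)%N) h -> Fat (t n) A ->
  bounds n N h A c -> rho (t n) A (combs n N h) <= c.
Proof.
elim: N n A c => [//|N IH] n A c hh FA H.
rewrite -addSnnS in hh; have hh1 := isH_combs hh.
have [_ hc] := next_comb (st n) (mk n) (mb n) (nx n) hh1.
apply: (rho_le (Fat_measurable (st n) FA) hc) => tau stau ttau.
have [c' h1 h2] := H tau stau ttau; apply: le_trans h2.
apply: le_trans (next_upper (st n) (mk n) (mb n) (nx n) (HL n.+1) hh1 FA stau ttau) _.
rewrite lerD2l; apply: IH => //; exact: (next_cont (st n) (nx n)).
Qed.

Lemma bounds_tail n N h h' A c e m : m = (n + N)%N -> Fat (t n) A ->
  (forall B, Fat (t m) B -> bounds m 1 h' B (rho (t m) B h + e)) ->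
  bounds n N h A c -> bounds n N.+1 h' A (c + e).
Proof.
elim: N n A c => [|N IH] n A c em FA H.
  by rewrite addn0 in em; subst m => hc; apply: bounds_le (H A FA); rewrite lerD2r.
move=> H1 tau stau ttau; have [c' h1 h2] := H1 tau stau ttau.
exists (c' + e); last by rewrite addrA lerD2r.
apply: (IH n.+1 _ _ _ _ H h1); first by rewrite addSnnS.
exact: (next_cont (st n) (nx n)).
Qed.

(** With every further link a new tail is chosen, while the links already present stay; the error is
    split evenly between the shorter chain and the new tail. *)
Lemma bounds_exists N e : 0 < e -> exists2 h, isH (t N) (k N) (b N) h &
  forall g, isH (t 0%N) (k 0%N) (b 0%N) g -> bounds 0 N h setT (rho (t 0%N) setT g + e).
Proof.
elim: N e => [|N IH] e e0.
  have [h' [hh' _ opt]] := nx_opt (nx 0%N) e0.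
  exists (C 0%N h'); first by have [] := next_comb (st 0%N) (mk 0%N) (mb 0%N) (nx 0%N) hh'.
  by move=> g hg; apply: opt => //; exact: (sigma_setT (sgF (st 0%N))).
have e20 : 0 < e / 2 by rewrite divr_gt0.
have [h hh bh] := IH _ e20.
have [h' [hh' hgt opt]] := nx_opt (nx N) e20.
exists h' => // g hg.
have -> : rho (t 0%N) setT g + e = rho (t 0%N) setT g + e / 2 + e / 2 by rewrite -addrA -splitr.
apply: (bounds_tail (m := N) _ _ _ (bh g hg)) => //; first exact: (sigma_setT (sgF (st 0%N))).
move=> B FB tau stau ttau.
exists (rho (t N.+1) (B `&` [set w | t N.+1 w < tau w] `&` ~` Sg N) h'); first exact: lexx.
apply: le_trans (opt h hh B FB).
exact: (next_lower (st N) (mk N) (mb N) (nx N) (HL N.+1) hh' hgt FB stau ttau).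
Qed.

(** Otherwise the action times increase to some [th], near which the price is within the relative
    distance [mu / 4] of its value at [th]; [trades_finite] excludes infinitely many trades
    there. *)
Lemma chain_stops w : exists n, Sg n w.
Proof.
apply: contrapT => nS.
have nSn n : ~ Sg n w by move=> h; apply: nS; exists n.
have go n := nx_go (nx n) (nSn n).
have tT n : t n w <= T by exact: stopt_leT (st n).
have hsup : has_sup (range (fun n => t n w)).
  by split; [exists (t 0%N w), 0%N|exists T => _ [n _ <-]].
pose th := sup (range (fun n => t n w)).
have tth n : t n w <= th by apply: sup_upper_bound => //; exists n.
have mon n m : (n <= m)%N -> t n w <= t m w.
  by move/subnK <-; elim: (m - n)%N => // i IH; apply: le_trans IH _; exact: (nx_t (nx _)).
have p0 := mS0 M th w.
have e0 : 0 < mu / 4 * S th w by rewrite mulr_gt0 // divr_gt0 // mmu0.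
have [c c0 hc] := continuous_dist th (mSc M w) e0.
have [_ [N _ <-] hN] := sup_adherent c0 hsup.
apply: (@trades_finite dl mu (S th w) (fun n => k (N + n)%N w) (fun n => b (N + n)%N w)
   (fun n => S (t (N + n).+1 w) w) (mdl0 M) (mmu0 M) (mmu1 M) p0) => n.
- by rewrite addnS; have [] := go (N + n)%N.
- exact: mS0.
- by rewrite addnS.
- apply/ltW/hc; rewrite ler0_norm ?subr_le0 // opprB.
  have := mon N (N + n).+1 (leqW (leq_addr _ _)).
  by move: hN; rewrite -/th; clear -st mk mb nx l0 HL; lra.
Qed.

Lemma combs_agree w i n N1 N2 h1 h2 : Sg (n + i)%N w -> (i < N1)%N -> (i < N2)%N ->
  [/\ hK (combs n N1 h1) ^~ w = hK (combs n N2 h2) ^~ w,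
      hB (combs n N1 h1) ^~ w = hB (combs n N2 h2) ^~ w &
      hs (combs n N1 h1) w = hs (combs n N2 h2) w].
Proof.
elim: i n N1 N2 => [|i IH] n [|N1] [|N2] //= Si i1 i2.
  by rewrite addn0 in Si; split; [apply/funext => u|apply/funext => u|]; rewrite !ite_in.
rewrite -addSnnS in Si; have [e1 e2 e3] := IH n.+1 N1 N2 Si i1 i2.
have [Sw|nS] := pselect (Sg n w).
  by split; [apply/funext => u|apply/funext => u|]; rewrite !ite_in.
split; [apply/funext => u|apply/funext => u|]; rewrite !ite_out //=.
  by case: ifP => // _; exact: (congr1 (@^~ u) e1).
by case: ifP => // _; exact: (congr1 (@^~ u) e2).
Qed.

(** The limit hedge follows the chain until it stops. A hedge with [N] links and a nearly optimal
    tail agrees with it except where the chain has not stopped within [N] links, an event on which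
    [Z] has small expectation. *)
Lemma chain_optimal : exists2 h, isH (t 0%N) (k 0%N) (b 0%N) h &
  forall g, isH (t 0%N) (k 0%N) (b 0%N) g -> rho (t 0%N) setT h <= rho (t 0%N) setT g.
Proof.
have /choice[nn hnn] := chain_stops.
pose hn N := combs 0 N (L N).
have hhn N : isH (t 0%N) (k 0%N) (b 0%N) (hn N) by apply: isH_combs; exact: HL.
pose h := Hedge (fun u w => hK (hn (nn w).+1) u w) (fun u w => hB (hn (nn w).+1) u w)
  (fun w => hs (hn (nn w).+1) w).
have agr w N h' : (nn w < N)%N -> [/\ hK (combs 0 N h') ^~ w = hK h ^~ w,
    hB (combs 0 N h') ^~ w = hB h ^~ w & hs (combs 0 N h') w = hs h w].
  by move=> wN; have := @combs_agree w (nn w) 0 N (nn w).+1 h' (L (nn w).+1) (hnn w) wN (ltnSn _).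
have hh : isH (t 0%N) (k 0%N) (b 0%N) h.
  by apply: (isH_lim hhn) => w; exists (nn w).+1 => N wN; exact: agr.
exists h => // g hg; apply: (rho_le measurableT hh) => tau stau ttau.
apply/ler_addgt0Pl => e e0; have e20 : 0 < e / 2 by rewrite divr_gt0.
pose W N := \bigcap_n (if (n < N)%N then ~` Sg n else setT).
have mW N : measurable (W N).
  apply: bigcap_measurable => [|m _]; first by exists 0%N.
  case: ifP => _ //; apply: measurableC; exact: (Fat_measurable (st m.+1) (nx_S (nx m))).
have [|N /(_ N (leqnn N)) hN] := Ex_tail mW (mIZ M) _ e20.
  by move=> w; exists (nn w).+1 => n wn /(_ (nn w) I); rewrite wn => /(_ (hnn w)).
have [h' hh' bh] := bounds_exists N e20.
have F0 : Fat (t 0%N) setT := sigma_setT (sgF (st 0%N)).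
have hb := bounds_rho (n := 0%N) hh' F0 (bh g hg).
have hcn : isH (t 0%N) (k 0%N) (b 0%N) (combs 0 N h') by exact: isH_combs.
have IW : Ib (fun w => \1_(W N) w * Z w) by apply: Ib_indic => //; exact: mIZ.
have IJ := Ib_Jc measurableT hcn stau ttau.
apply: (@le_trans _ _ (Ex (fun w => \1_setT w * cost (combs 0 N h') tau w + \1_(W N) w * Z w))).
  apply: Ex_le; [exact: (Ib_Jc measurableT hh stau ttau)|exact: IbD|].
  move=> w; rewrite !indicT !mul1r; have [Ww|nW] := pselect (W N w).
    rewrite indicE mem_set // mul1r; apply: le_trans (cost_leZ hh stau (ttau w)) _.
    by rewrite lerDr cost_ge0.
  have [n [nN Sn]] : exists n, (n < N)%N /\ Sg n w.
    apply: contrapT => h1; apply: nW => n _; case: ifPn => // nN Sn; apply: h1; by exists n.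
  have [e1 e2 e3] := @combs_agree w n 0 N (maxn N (nn w).+1) h' h' Sn nN (leq_trans nN (leq_maxl _ _)).
  have [e1' e2' e3'] := agr w (maxn N (nn w).+1) h' (leq_maxr _ _).
  rewrite (@cost_ext h (combs 0 N h') tau tau w) //.
  - by rewrite lerDl mulr_ge0 ?indicE ?Z0.
  - by rewrite e3.
  - by rewrite e1.
  - by rewrite e2.
rewrite ExD //; move: (J_rho measurableT hcn stau ttau) hb hN; rewrite /J.
set x1 := Ex _; set x2 := Ex _; set x3 := rho _ _ _; set x4 := rho _ _ _.
by clear -st mk mb nx l0 HL; lra.
Qed.

End Chain.

Lemma optimal_hedge t k b : stopt t -> mG (Fat t) k -> mG (Fat t) b ->
  (forall w, 0 <= lq k b t w) -> exists2 h, isH t k b h &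
  forall g, isH t k b g -> rho t setT h <= rho t setT g.
Proof.
move=> st0 mk0 mb0 l00.
pose node := ((Omega -> R) * (Omega -> R) * (Omega -> R))%type.
pose ok (x : node) := [/\ stopt x.1.1, mG (Fat x.1.1) x.1.2, mG (Fat x.1.1) x.2 &
  forall w, 0 <= liq (x.1.2 w) (x.2 w) (S (x.1.1 w) w)].
have /choice[f hf'] : forall x : node, exists y : node * set Omega, ok x ->
    ok y.1 /\ next x.1.1 x.1.2 x.2 y.1.1.1 y.2 y.1.1.2 y.1.2.
  move=> [[t1 k1] b1]; have [hx|nx] := pselect (ok (t1, k1, b1)); last by exists ((t, k, b), setT).
  have [h1 h2 h3 h4] := hx; have [al [Sg [ks [bs nx]]]] := next_exists h1 h2 h3 h4.
  exists ((al, ks, bs), Sg) => _; split=> //; split; [exact: nx_st nx|exact: nx_k nx|exact: nx_b nx|exact: nx_liq nx].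
pose x n := iter n (fun y => (f y).1) (t, k, b).
have okx n : ok (x n) by elim: n => [//|n /hf'[]].
apply: (@chain_optimal (fun n => (x n).1.1) (fun n => (x n).1.2) (fun n => (x n).2) (fun n => (f (x n)).2)) => n;
  have [h1 h2 h3 h4] := okx n => //.
by have [_] := hf' (x n) (okx n).
Qed.

End Hedges.

End HedgeTheory.

(** * Conditional probabilities and independence *)

Section BlackScholesMarket.
Context {R : realType} {d : measure_display} {Omega : measurableType d}.

Section SubMeasure.
Variables (G : set (set Omega)) (sG : salg G) (Gm : G `<=` measurable).
Variable m : {finite_measure set Omega -> \bar R}.

Definition submeasure (_ : salg G) (_ : G `<=` measurable) :
  set (g_sigma_algebraType G) -> \bar R := m.
Local Notation sm := (submeasure sG Gm).

Let subm (B : set (g_sigma_algebraType G)) : measurable B -> measurable (B : set Omega).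
Proof. by move=> mB; apply: Gm; exact: measurable_sigma. Qed.

Let sm0 : sm set0 = 0%E. Proof. exact: measure0. Qed.
Let sm_ge0 B : (0 <= sm B)%E. Proof. exact: measure_ge0. Qed.
Let sm_additive : semi_sigma_additive sm.
Proof.
move=> F mF tF mU; apply: (@measure_semi_sigma_additive _ _ _ m F) => //; last exact: subm.
by move=> n; apply: subm; exact: mF.
Qed.

HB.instance Definition _ := isMeasure.Build _ _ _ sm sm0 sm_ge0 sm_additive.

Let sm_fin : fin_num_fun sm.
Proof. by move=> B mB; apply: fin_num_measure; exact: subm. Qed.

HB.instance Definition _ := Measure_isFinite.Build _ _ _ sm sm_fin.

End SubMeasure.

(** [phi] is a version of the conditional probability of [A] given [G]: the Radon-Nikodym derivative
    of [mrestr P mA] with respect to [P], both restricted to [G]. *)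
Lemma conditional_density (P : probability Omega R) (G : set (set Omega)) (A : set Omega) :
  salg G -> G `<=` measurable -> measurable A ->
  exists phi : Omega -> R, [/\ mG G phi, Ib P phi, forall w, 0 <= phi w &
    forall B, G B -> Ex P (fun w => \1_B w * phi w) = Ex P (fun w => \1_B w * \1_A w)].
Proof.
move=> sG Gm mA; pose T' : measurableType _ := g_sigma_algebraType G.
have sub (B : set T') : measurable B -> measurable (B : set Omega).
  by move=> mB; exact: (Gm _ (measurable_sigma sG mB)).
have [|f [f0 ff If hf]] := @radon_nikodym_sigma_finite _ T' R (submeasure P sG Gm)
    (submeasure (mrestr P mA) sG Gm).
  apply/null_content_dominatesP => B mB PB; apply: le_anti; rewrite measure_ge0 andbT -PB.
  by apply: le_measure; rewrite ?inE; [exact: (measurableI _ _ (sub _ mB))|exact: sub|move=> w []].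
have mi : mfun (fun w : Omega => w : T') by move=> _ B mB; rewrite setTI; exact: sub.
have mf : mfun f := measurable_int _ If.
have mfO : mfun (f : Omega -> \bar R) by move=> _ B mB; apply: sub; exact: mf.
have key B : G B -> (\int[P]_(w in B) f w = P (B `&` A))%E.
  move=> /(sigma_measurable sG) mB.
  transitivity (\int[submeasure P sG Gm]_(x in B) f x)%E; last by rewrite -hf.
  by symmetry; apply: (ge0_integral_pushforward mi P mB) => //; exact: measurable_funTS.
have key1 B : G B -> (\int[P]_w (\1_B w * fine (f w))%:E = P (B `&` A))%E.
  move=> GB; have mB := Gm _ GB; rewrite -key // [RHS]integral_mkcond; apply: eq_integral => w _.
  rewrite patchE indicE; case: (w \in B); rewrite ?mul0r // mul1r fineK //.
exists (fine \o f); split.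
- split; exact: (measurableT_comp (fine_measurable measurableT) mf).
- apply/integrableP; split; first by apply/measurable_EFinP; apply: measurableT_comp.
  rewrite (_ : (\int[P]_w _ = P (setT `&` A))%E).
    by rewrite setTI; exact: le_lt_trans (probability_le1 P mA) (ltry 1).
  rewrite -key1; last exact: sigma_setT.
  by apply: eq_integral => w _ /=; rewrite indicT mul1r ger0_norm // fine_ge0.
- by move=> w; exact: fine_ge0.
- move=> B GB; rewrite /Ex /Rintegral key1 //; congr fine.
  rewrite -[in LHS](setIT (B `&` A)) -integral_indic //; last exact: (measurableI _ _ (Gm _ GB) mA).
  by apply: eq_integral => w _; rewrite indicI.
Qed.

Section Independence.
Variable P : probability Omega R.
Local Notation Ex := (Ex P).
Local Notation Ib := (Ib P).
Implicit Types (A B : set Omega) (f g U : Omega -> R) (c : R).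

Definition pr A := Ex (\1_A).

Lemma Ib_ind A : measurable A -> Ib (\1_A).
Proof.
move=> mA; have := Ib_indic mA (Ib_cst P 1); apply: eq_integrable => // w _ /=.
by rewrite mulr1.
Qed.

Lemma prE A : measurable A -> P A = (pr A)%:E.
Proof.
move=> mA; rewrite /pr /Ex /Rintegral fineK ?integrable_fin_num //; last exact: Ib_ind.
by rewrite integral_indic // setIT.
Qed.

Lemma pr_ge0 A : 0 <= pr A. Proof. by apply: Ex_ge0 => w; rewrite indicE. Qed.

Lemma prT : pr setT = 1.
Proof. by rewrite /pr -(Ex_cst P 1); apply: eq_Ex => w; rewrite indicT. Qed.

Lemma pr_set0 : pr set0 = 0.
Proof. by rewrite /pr -[RHS](Ex_cst P 0); apply: eq_Ex => w; rewrite indic0. Qed.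

Lemma pr_mono A B : measurable A -> measurable B -> A `<=` B -> pr A <= pr B.
Proof.
move=> mA mB AB; apply: Ex_le; [exact: Ib_ind|exact: Ib_ind|] => w.
rewrite !indicE; case: (boolP (w \in A)) => [/set_mem/AB h|_]; last by [].
by rewrite mem_set.
Qed.

Lemma pr_split A B : measurable A -> measurable B -> pr A = pr (A `&` B) + pr (A `\` B).
Proof.
move=> mA mB; rewrite /pr -ExD; last 2 first.
  exact/Ib_ind/measurableI.
  exact/Ib_ind/measurableD.
apply: eq_Ex => w; rewrite !indicE in_setI in_setD.
by case: (w \in A); case: (w \in B) => /=; rewrite ?addr0 ?add0r.
Qed.

Lemma pr0 A B : measurable A -> measurable B -> A `<=` B -> pr B = 0 -> pr A = 0.
Proof. by move=> mA mB AB B0; apply: le_anti; rewrite pr_ge0 andbT -B0 pr_mono. Qed.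

Lemma pr_nd (F : nat -> set Omega) : (forall n, measurable (F n)) ->
  {homo F : n m / (n <= m)%N >-> (n <= m)%O} -> (fun n => pr (F n)) @ \oo --> pr (\bigcup_n F n).
Proof.
move=> mF ndF; have mU : measurable (\bigcup_n F n) by exact: bigcup_measurable.
have : P \o F @ \oo --> (pr (\bigcup_n F n))%:E by rewrite -prE //; exact: nondecreasing_cvg_mu.
move=> /fine_cvg.
rewrite (_ : fine \o _ = fun n => pr (F n)) //; apply/funext => n /=.
by rewrite prE.
Qed.

Lemma Ex_indicI A B : Ex (fun w => \1_A w * \1_B w) = pr (A `&` B).
Proof. by apply: eq_Ex => w; rewrite indicI. Qed.

Lemma Ex_indicZ A c : measurable A -> Ex (fun w => \1_A w * c) = pr A * c.
Proof. by move=> mA; rewrite mulrC -(ExZ _ (Ib_ind mA)); apply: eq_Ex => w; rewrite mulrC. Qed.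

Lemma mG_indic (G : set (set Omega)) A : salg G -> G A -> mG G (\1_A : Omega -> R).
Proof.
move=> sG GA; rewrite (_ : \1_A = fun w => if w \in A then (1 : R) else 0).
  by apply: (mG_if sG) => //; exact: mG_cst.
by apply/funext => w; rewrite indicE; case: (w \in A).
Qed.

Lemma indic_pr A w : measurable A -> `|\1_A w - pr A| <= 1.
Proof.
move=> mA; have p1 : pr A <= 1 by rewrite -(prT) pr_mono.
have p0 := pr_ge0 A; rewrite indicE ler_norml.
by case: (w \in A) => /=; apply/andP; split; lra.
Qed.

Lemma Ib_indic_pr A : measurable A -> Ib (fun w => \1_A w - pr A).
Proof. by move=> mA; apply: IbB; [exact: Ib_ind|exact: Ib_cst]. Qed.

Lemma Ex_indic_pr A B : measurable A -> measurable B ->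
  Ex (fun w => \1_A w * (\1_B w - pr B)) = pr (A `&` B) - pr A * pr B.
Proof.
move=> mA mB; rewrite -Ex_indicI -Ex_indicZ // -ExB; first by apply: eq_Ex => w; rewrite mulrBr.
  by apply: Ib_indic => //; exact: Ib_ind.
by apply: Ib_indic => //; exact: Ib_cst.
Qed.

Lemma min_nat_cvg (x : R) : (fun n : nat => Num.min x n%:R) @ \oo --> x.
Proof.
apply: cvg_near_cst; exists (Num.trunc x).+1 => // n nx /=.
apply/min_idPl; apply: le_trans (ltW (truncnS_gt x)) _.
by rewrite ler_nat.
Qed.

(** [Ex_mult0] carried over to nonnegative multipliers without a bound, by truncation and dominated
    convergence. *)
Lemma Ex_mult_ge0 (G : set (set Omega)) f U Z : salg G -> G `<=` measurable ->
  mG G f -> (forall w, 0 <= f w) -> Ib U -> Ib Z -> (forall w, `|f w * U w| <= Z w) ->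
  (forall A, G A -> Ex (fun w => \1_A w * U w) = 0) -> Ex (fun w => f w * U w) = 0.
Proof.
move=> sG Gm mf f0 IU IZ fZ hU; have n0 n w : 0 <= Num.min (f w) n%:R by rewrite le_min f0 ler0n.
have h n : Ex (fun w => Num.min (f w) n%:R * U w) = 0.
  apply: (Ex_mult0 sG Gm (c := n%:R) _ _ IU hU) => [|w]; first by mg.
  by rewrite ger0_norm // min_leR.
have [||||_] := @Ex_dct _ _ _ P (fun n w => Num.min (f w) n%:R * U w) (fun w => f w * U w) Z.
- move=> n; apply: measurable_funM; last exact: Ib_measurable IU.
  by apply: (mG_measurable sG Gm); mg.
- exact: IZ.
- move=> n w; apply: le_trans (fZ w); rewrite !normrM ler_wpM2r // !ger0_norm //.
  by rewrite min_leL.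
- by move=> w; apply: cvgMl; exact: min_nat_cvg.
by under eq_fun do rewrite h; move=> c; exact: cvg_unique c (cvg_cst _).
Qed.

Lemma indep_fun A (X : Omega -> R) (f : R -> R) : measurable A -> mfun X ->
  (forall C, measurable C -> pr (A `&` X @^-1` C) = pr A * pr (X @^-1` C)) ->
  mfun f -> (forall x, 0 <= f x) -> Ib (fun w => f (X w)) ->
  Ex (fun w => f (X w) * (\1_A w - pr A)) = 0.
Proof.
move=> mA mX hX mf f0 If; pose G := preimage_set_system setT X measurable.
have sG : salg G by apply: sigma_algebra_preimage; exact: sigma_algebra_measurable.
have Gm : G `<=` measurable by move=> _ [C mC <-]; exact: mX.
apply: (Ex_mult_ge0 sG Gm _ _ (Ib_indic_pr mA) If) => // [|w|_ [C mC <-]].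
- apply/(mGP _ sG) => B mB; exists (f @^-1` B); last by rewrite setTI.
  by rewrite -[f @^-1` B]setTI; exact: mf.
- by rewrite normrM ger0_norm // ler_piMr // indic_pr.
rewrite setTI; have mB : measurable (X @^-1` C) by rewrite -[X @^-1` C]setTI; exact: mX.
by rewrite Ex_indic_pr // setIC hX // mulrC subrr.
Qed.

(** Dynkin's argument: it remains to check the equality on a generating class stable under
    intersection ([lambda_system_subset]). *)
Lemma Ex_lambda f g : Ib f -> Ib g -> Ex f = Ex g ->
  lambda_system setT [set B | measurable B /\ Ex (fun w => \1_B w * f w) = Ex (fun w => \1_B w * g w)].
Proof.
move=> If Ig fg.
have D h B C : Ib h -> C `<=` B -> measurable B -> measurable C ->
    Ex (fun w => \1_(B `\` C) w * h w) = Ex (fun w => \1_B w * h w) - Ex (fun w => \1_C w * h w).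
  move=> Ih CB mB mC; rewrite -ExB; [|exact: Ib_indic|exact: Ib_indic].
  apply: eq_Ex => w; rewrite -mulrBl; congr (_ * _); rewrite !indicE in_setD.
  case: (boolP (w \in C)) => [/set_mem/CB/mem_set -> /=|_]; first by rewrite subrr.
  by rewrite andbT subr0.
have cv h (F : nat -> set Omega) : Ib h -> nondecreasing_seq F -> (forall n, measurable (F n)) ->
    (fun n => Ex (fun w => \1_(F n) w * h w)) @ \oo --> Ex (fun w => \1_(\bigcup_n F n) w * h w).
  move=> Ih ndF mF; apply: (proj2 (@Ex_dct _ _ _ P _ _ (fun w => `|h w|) _ _ _ _)).
  - by move=> n; exact: (Ib_measurable (Ib_indic (mF n) Ih)).
  - exact: integrable_norm.
  - by move=> n w; rewrite indicE; case: (w \in F n); rewrite ?mul1r // mul0r normr0.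
  move=> w; apply: cvgMl; have [[n _ Fn]|nF] := pselect ((\bigcup_n F n) w); apply: cvg_near_cst.
    exists n => // m /= nm; rewrite !indicE !mem_set //; first by exists n.
    by move/subsetPset: (ndF n m nm); apply.
  by apply: nearW => n; rewrite !indicE !memNset // => Fn; apply: nF; exists n.
split=> //=.
- split=> //; have e h : Ex (fun w => \1_setT w * h w) = Ex h by apply: eq_Ex => w; rewrite indicT mul1r.
  by rewrite !e.
- by move=> B C CB [mB hB] [mC hC]; split; [exact: measurableD|rewrite !D // hB hC].
- move=> F ndF hF; have mF n : measurable (F n) by case: (hF n).
  split; first exact: bigcup_measurable.
  have := cv _ _ If ndF mF; rewrite (_ : (fun n => _) = fun n => Ex (fun w => \1_(F n) w * g w)).
    by move=> h; exact: cvg_unique h (cv _ _ Ig ndF mF).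
  by apply/funext => n; case: (hF n).
Qed.

Lemma indep_pi A (G : set (set Omega)) : measurable A -> setI_closed G -> G `<=` measurable ->
  (forall B, G B -> pr (A `&` B) = pr A * pr B) ->
  forall B, <<s G >> B -> measurable B /\ pr (A `&` B) = pr A * pr B.
Proof.
move=> mA IG mG' hG B sB.
have L := Ex_lambda (Ib_ind mA) (Ib_cst P (pr A)) (esym (Ex_cst P _)).
have [|//|mB] := lambda_system_subset IG L _ _ sB.
  by move=> C GC; have mC := mG' _ GC; split=> //; rewrite Ex_indicZ // Ex_indicI setIC hG // mulrC.
by rewrite Ex_indicZ // Ex_indicI setIC mulrC.
Qed.

(* [A] is independent of the [sigma]-algebra [J], which together with [B0] generates
   [A]; then the conditional probability [phi] of [A] given [B0] is its own indicator. *)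
Lemma indep_germ (B0 A0 J : set (set Omega)) : salg B0 -> salg A0 ->
  salg J -> A0 `<=` measurable -> J `<=` measurable -> B0 `<=` A0 ->
  (forall A B, A0 A -> J B -> pr (A `&` B) = pr A * pr B) ->
  forall A, A0 A -> <<s B0 `|` J >> A ->
  exists2 B, B0 B & pr (A `\` B) = 0 /\ pr (B `\` A) = 0.
Proof.
move=> sB sA sJ mA0 mJ BA ind A AA sAA; have mA := mA0 A AA.
have mB0 : B0 `<=` measurable by move=> B h; exact/mA0/BA.
have [phi [mp Ip p0 hp]] := conditional_density P sB mB0 mA.
have phiJ B1 B2 : B0 B1 -> J B2 ->
    Ex (fun w => \1_(B1 `&` B2) w * phi w) = Ex (fun w => \1_B1 w * phi w) * pr B2.
  move=> h1 h2; have m1 := mB0 _ h1; have m2 := mJ _ h2.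
  have e0 : Ex (fun w => \1_B1 w * phi w * (\1_B2 w - pr B2)) = 0.
    apply: (Ex_mult_ge0 sB mB0 _ _ (Ib_indic_pr m2) Ip) => [|w|w|C BC].
    - by apply: mGM => //; exact: mG_indic.
    - by rewrite mulr_ge0 // indicE.
    - rewrite normrM -[leRHS]mulr1; apply: ler_pM; rewrite ?indic_pr // indicE ger0_norm; 
        by case: (w \in B1); rewrite ?mul1r ?mul0r.
    by rewrite Ex_indic_pr ?ind ?subrr //; [exact: BA|exact: mB0].
  have I1 := Ib_indic m1 Ip.
  rewrite mulrC -(ExZ _ I1); apply/eqP; rewrite -subr_eq0 -ExB; last 2 first.
  - by apply: Ib_indic => //; exact: measurableI.
  - exact: IbZ.
  by apply/eqP; rewrite -[RHS]e0; apply: eq_Ex => w; rewrite indicI /=; ring.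
pose G := [set C : set Omega | exists B1 B2, [/\ B0 B1, J B2 & C = B1 `&` B2]].
have IG : setI_closed G.
  move=> _ _ [B1 [B2 [h1 h2 ->]]] [B1' [B2' [h1' h2' ->]]]; exists (B1 `&` B1'), (B2 `&` B2').
  by split; [exact: (sigma_setI sB)|exact: (sigma_setI sJ)|rewrite setIACA].
have sUG : <<s B0 `|` J >> `<=` <<s G >>.
  apply: smallest_sub; first exact: smallest_sigma_algebra.
  move=> C [BC|JC]; apply: sub_sigma_algebra.
    by exists C, setT; split=> //; [exact: sigma_setT|rewrite setIT].
  by exists setT, C; split=> //; [exact: sigma_setT|rewrite setTI].
have hC C : <<s B0 `|` J >> C -> Ex (fun w => \1_C w * phi w) = pr (C `&` A).
  have eT : Ex phi = Ex \1_A.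
    have := hp setT (sigma_setT sB); rewrite Ex_indicI setTI -/(pr A) => <-.
    by apply: eq_Ex => w; rewrite indicT mul1r.
  rewrite -Ex_indicI; move=> /sUG sC.
  have [|//|//] := lambda_system_subset IG (Ex_lambda Ip (Ib_ind mA) eT) _ _ sC.
  move=> _ [B1 [B2 [h1 h2 ->]]]; split; first by apply: measurableI; [exact: mB0|exact: mJ].
  rewrite phiJ // hp // !Ex_indicI -ind //; first by rewrite setIAC.
  by apply: (sigma_setI sA) => //; exact: BA.
(* By [hC], [phi] agrees almost surely with the indicator of [A], so any level between 0 and 1
   recovers the event. *)
pose B := [set w | 2^-1 < phi w]; have BB : B0 B by apply: (mG_lt sB) => //; exact: mG_cst.
have mB := mB0 _ BB; exists B => //.
have sU : salg <<s B0 `|` J >> by exact: smallest_sigma_algebra.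
have sBU : <<s B0 `|` J >> B by apply: sub_sigma_algebra; left.
have mAB := measurableD mA mB; have mBA := measurableD mB mA.
have h1 := hC _ (sigma_setD sU sAA sBU); have h2 := hC _ (sigma_setD sU sBU sAA).
split; apply: le_anti; rewrite pr_ge0 andbT.
  suff : pr (A `\` B) <= 2^-1 * pr (A `\` B) by have := pr_ge0 (A `\` B); lra.
  rewrite -{1}(setIidl (@subDsetl _ A B)) -h1 -(ExZ _ (Ib_ind mAB)).
  apply: Ex_le; [exact: Ib_indic|by apply: IbZ; exact: Ib_ind|] => w.
  rewrite indicE; case: (boolP (w \in _)) => [/set_mem[_ /negP]|_]; last by rewrite mul0r mulr0.
  by rewrite -leNgt mul1r mulr1.
suff : 2^-1 * pr (B `\` A) <= 0 by lra.
have e : (B `\` A) `&` A = set0 by apply/seteqP; split=> w // [[_ nA] /nA].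
rewrite e pr_set0 in h2; rewrite -h2 -(ExZ _ (Ib_ind mBA)).
apply: Ex_le; [by apply: IbZ; exact: Ib_ind|exact: Ib_indic|] => w.
rewrite indicE; case: (boolP (w \in _)) => [/set_mem[/= h _]|_]; last by rewrite mul0r mulr0.
by rewrite mul1r mulr1 ltW.
Qed.

Lemma ae_trans (A B C : set Omega) : measurable A -> measurable B -> measurable C ->
  pr (A `\` B) = 0 -> pr (B `\` C) = 0 -> pr (A `\` C) = 0.
Proof.
move=> mA mB mC h1 h2; have mAC := measurableD mA mC.
rewrite (pr_split mAC mB).
have -> : pr ((A `\` C) `&` B) = 0.
  apply: (pr0 (B := B `\` C) _ _ _ h2); [exact: measurableI|exact: measurableD|].
  by move=> w [[]].
rewrite add0r; apply: (pr0 (B := A `\` B) _ _ _ h1); [exact: measurableD|exact: measurableD|].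
by move=> w [[]].
Qed.

End Independence.

Lemma within_dist (f : R -> R) u (e : R) : {within `[0, +oo[, continuous f} ->
  0 <= u -> 0 < e -> exists2 h : R, 0 < h & forall v, 0 <= v -> `|v - u| < h -> `|f v - f u| < e.
Proof.
move=> /subspace_continuousP cf u0 e0.
have /cf /cvgrPdist_lt /(_ e e0) : `[0, +oo[%classic u by rewrite /= in_itv /= u0.
move=> [h /= h0 hh]; exists h => // v v0 vu; rewrite distrC; apply: hh => /=.
  by rewrite distrC.
by rewrite in_itv /= v0.
Qed.

(** The clamp of [x] to [[0, 1]], written with absolute values so that continuity and measurability
    are immediate. *)
Definition ramp (x : R) := (1 + `|x| - `|x - 1|) / 2.

Lemma ramp_ge1 (x : R) : 1 <= x -> ramp x = 1.
Proof. by move=> x1; rewrite /ramp !ger0_norm ?subr_ge0 //; lra. Qed.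

Lemma ramp_le0 (x : R) : x <= 0 -> ramp x = 0.
Proof. by move=> x1; rewrite /ramp !ler0_norm ?subr_le0 //; lra. Qed.

Lemma ramp_ge0 (x : R) : 0 <= ramp x.
Proof. by have := ler_normB x (x - 1); have := ler_distD 0 x 1; rewrite /ramp subr0 sub0r normrN normr1 => *; lra. Qed.

Lemma ramp_bd (x : R) : `|ramp x| <= 1.
Proof.
have [x0|x0] := leP x 0; first by rewrite ramp_le0 // normr0.
have [x1|x1] := leP 1 x; first by rewrite ramp_ge1 // normr1.
by rewrite /ramp gtr0_norm // [`|x - 1|]ltr0_norm ?subr_lt0 // gtr0_norm; lra.
Qed.

Lemma ramp_cvg (u : nat -> R) (l : R) : u @ \oo --> l -> (ramp \o u) @ \oo --> ramp l.
Proof.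
move=> ul; apply: cvgMl; apply: cvgB; last first.
  by apply: cvg_norm; apply: cvgB => //; exact: cvg_cst.
by apply: cvgD; [exact: cvg_cst|exact: cvg_norm].
Qed.

Lemma measurable_ramp : mfun ramp.
Proof.
apply: measurable_funM => //; apply: measurable_funB.
  by apply: measurable_funD => //; apply: measurableT_comp.
by apply: measurableT_comp => //; exact: measurable_funB.
Qed.

Lemma normal_density (m s : R) (f : R -> \bar R) : (forall x, (0 <= f x)%E) ->
  mfun f ->
  (\int[normal_prob m s]_x f x = \int[lebesgue_measure]_x (f x * (normal_pdf m s x)%:E))%E.
Proof.
move=> f0 mf; have dom := normal_prob_dominates m s.
rewrite -(Radon_Nikodym_SigmaFinite.change_of_variables dom f0 measurableT mf).
have mpdf : mfun (fun x => (normal_pdf m s x)%:E).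
  by apply/measurable_EFinP; exact: measurable_normal_pdf.
have Ig := Radon_Nikodym_SigmaFinite.f_integrable dom.
have mg' := measurable_int _ Ig.
apply: ae_eq_integral => //; [exact: emeasurable_funM|exact: emeasurable_funM|].
have : ae_eq lebesgue_measure setT (Radon_Nikodym_SigmaFinite.f (normal_prob m s) lebesgue_measure)
    (fun x => (normal_pdf m s x)%:E).
  apply: integral_ae_eq => // E _ mE.
  by rewrite -(Radon_Nikodym_SigmaFinite.f_integral dom mE).
by apply: filterS => x h Tx; rewrite h.
Qed.

(** Completing the square: the exponential factor shifts the mean by [c * s ^+ 2]. *)
Lemma normal_tilt (s c x : R) : s != 0 ->
  expR (c * x) * normal_pdf 0 s x = expR (c ^+ 2 * s ^+ 2 / 2) * normal_pdf (c * s ^+ 2) s x.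
Proof.
move=> s0; rewrite !normal_pdfE // mulrCA [RHS]mulrCA; congr (_ * _).
rewrite /normal_fun -!expRD; congr expR; rewrite subr0; field.
by rewrite s0.
Qed.

Lemma normal_mgf (s c : R) : s != 0 ->
  (\int[normal_prob 0 s]_x (expR (c * x))%:E = (expR (c ^+ 2 * s ^+ 2 / 2))%:E)%E.
Proof.
move=> s0; rewrite normal_density; last 2 first.
- by move=> x; rewrite lee_fin expR_ge0.
- by apply/measurable_EFinP; apply: measurableT_comp => //; exact: measurable_funM.
under eq_integral => x _ do rewrite -EFinM normal_tilt // EFinM.
rewrite ge0_integralZl //.
- by rewrite integral_normal_pdf mule1.
- by apply/measurable_EFinP; exact: measurable_normal_pdf.
- by move=> x _; rewrite lee_fin normal_pdf_ge0.
Qed.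

(** * Piecewise linear paths and the measurability of payoffs *)

Section Tents.
Implicit Types (x y u v c e T : R) (f : R -> R).

(** The positive part of [1 - |x|]. Its integer translates form a partition of unity
    ([tent_sum]). *)
Definition tent x := (1 - `|x| + `|1 - `|x| |) / 2.

Lemma tent_out x : 1 <= `|x| -> tent x = 0.
Proof. by move=> x1; rewrite /tent [`|1 - _|]ler0_norm ?subr_le0 // opprB; lra. Qed.

Lemma tent_in x : `|x| <= 1 -> tent x = 1 - `|x|.
Proof. by move=> x1; rewrite /tent [`|1 - _|]ger0_norm ?subr_ge0 //; lra. Qed.

Lemma tent_ge0 x : 0 <= tent x.
Proof.
have [h|h] := leP 1 `|x|; first by rewrite tent_out.
by rewrite tent_in ?subr_ge0 // ltW.
Qed.

Lemma tent_sum m y : 0 <= y -> y <= m%:R -> \sum_(i < m.+1) tent (y - i%:R) = 1.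
Proof.
elim: m => [|m IH] y0 ym.
  have -> : y = 0 by apply: le_anti; rewrite y0 ym.
  by rewrite big_ord1 subr0 tent_in normr0 ?ler01 // subr0.
rewrite big_ord_recr /=; have [ym'|my] := leP y m%:R.
  rewrite IH // tent_out ?addr0 // ler0_norm -?natr1; last by lra.
  by lra.
rewrite big_ord_recr /= big1 ?add0r; last first.
  move=> i _; apply: tent_out; apply: le_trans (ler_norm _).
  have : i.+1%:R <= m%:R :> R by rewrite ler_nat ltn_ord.
  by rewrite -natr1; set z := i%:R; lra.
have h1 : `|y - m%:R| = y - m%:R by rewrite ger0_norm // subr_ge0 ltW.
have h2 : `|y - m.+1%:R| = m.+1%:R - y by rewrite ler0_norm ?opprB // subr_le0.
rewrite !tent_in ?h1 ?h2 -?natr1; first by lra.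
  by lra.
by move: ym; rewrite -natr1; lra.
Qed.

Lemma continuous_tent : continuous tent.
Proof.
move=> x; have h : (fun y => 1 - `|y|) y @[y --> x] --> 1 - `|x|.
  by apply: cvgB; [exact: cvg_cst|apply: cvg_norm; exact: cvg_id].
by apply: cvgMl; apply: cvgD => //; exact: cvg_norm.
Qed.

Lemma cont_Cspace T f : continuous f -> Cspace T f.
Proof. by move=> cf; exact: continuous_subspaceT. Qed.

Lemma CspaceB T f g : Cspace T f -> Cspace T g -> Cspace T (fun v => f v - g v).
Proof.
move=> /subspace_continuousP cf /subspace_continuousP cg; apply/subspace_continuousP => x Ax.
by apply: cvgB; [exact: cf|exact: cg].
Qed.

Lemma Cspace_dist T f u e : Cspace T f -> 0 <= u -> u <= T -> 0 < e ->
  exists2 h : R, 0 < h & forall v, 0 <= v -> v <= T -> `|v - u| < h -> `|f v - f u| < e.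
Proof.
move=> /subspace_continuousP cf u0 uT e0.
have /cf /cvgrPdist_lt /(_ e e0) : `[0, T]%classic u by rewrite /= in_itv /= u0.
move=> [h /= h0 hh]; exists h => // v v0 vT vu; rewrite distrC; apply: hh => /=.
  by rewrite distrC.
by rewrite in_itv /= v0.
Qed.

Lemma Cspace_stop T f u : Cspace T f -> 0 <= u -> u <= T -> continuous (fun v => f (cl u v)).
Proof.
move=> cf u0 uT x; apply/cvgrPdist_lt => e e0.
have c1 v : cl u v <= T := le_trans (cl_leT v u0) uT.
have [h h0 hh] := Cspace_dist cf (cl_ge0 u x) (c1 x) e0.
near=> v; rewrite distrC; apply: hh; rewrite ?cl_ge0 //; apply: le_lt_trans (cl_dist _ _ u0) _.
by rewrite distrC; near: v; exact: cvgr_dist_lt.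
Unshelve. all: by end_near. Qed.

Lemma Cspace_bd T f : 0 <= T -> Cspace T f -> exists C : R, forall u, 0 <= u -> u <= T -> `|f u| <= C.
Proof.
move=> T0 cf; have [|C C0 hC] := bounded_itv (f := fun v => f (cl T v)) T0; first exact: Cspace_stop.
by exists C => u u0 uT; have := hC u u0 uT; rewrite cl_id.
Qed.

Lemma supnorm_ge T f u : 0 <= T -> Cspace T f -> 0 <= u -> u <= T -> `|f u| <= supnorm T f.
Proof.
move=> T0 cf u0 uT; have [C hC] := Cspace_bd T0 cf.
apply: ub_le_sup; last by exists u => //=; rewrite in_itv /= u0.
by exists C => x [v /=]; rewrite in_itv /= => /andP[v0 vT] <-; exact: hC.
Qed.

Lemma supnorm_le T f c : 0 <= T -> (forall u, 0 <= u -> u <= T -> `|f u| <= c) -> supnorm T f <= c.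
Proof.
move=> T0 h; apply: ge_sup; first by exists `|f 0|, 0 => //=; rewrite in_itv /= lexx T0.
by move=> x [v /=]; rewrite in_itv /= => /andP[v0 vT] <-; exact: h.
Qed.

Lemma supnorm_ge0 T f : 0 <= T -> Cspace T f -> 0 <= supnorm T f.
Proof. by move=> T0 cf; apply: le_trans (normr_ge0 (f 0)) _; exact: supnorm_ge. Qed.

(** Interpolates the values [c i / (n + 1)] at the points [i T / (n + 1)]. With integer coefficients
    there are countably many such paths. *)
Definition polyline T (n : nat) (c : {ffun 'I_n.+2 -> int}) v : R :=
  \sum_(i < n.+2) (c i)%:~R / n.+1%:R * tent (n.+1%:R * (v / T) - i%:R).

Lemma continuous_polyline T n (c : {ffun 'I_n.+2 -> int}) : continuous (@polyline T n c).
Proof.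
move=> x; rewrite /polyline; elim: (index_enum _) => [|i s IH].
  by under eq_fun do rewrite big_nil; exact: cvg_cst.
under eq_fun do rewrite big_cons; apply: cvgD => //; apply: cvgMr.
have h : (n.+1%:R * (v / T) - i%:R) @[v --> x] --> n.+1%:R * (x / T) - i%:R.
  by apply: cvgB; [apply: cvgMr; apply: cvgMl; exact: cvg_id|exact: cvg_cst].
by apply: (cvg_comp _ _ h); exact: continuous_tent.
Qed.

Lemma polyline_near T n f l e : 0 < T -> 0 < l -> T / n.+1%:R <= l -> n.+1%:R^-1 <= e -> 0 <= e ->
  (forall u v, 0 <= u -> u <= T -> 0 <= v -> v <= T -> `|u - v| <= l -> `|f u - f v| <= e) ->
  forall v, 0 <= v -> v <= T ->
   `|f v - polyline T [ffun i : 'I_n.+2 => Num.floor (f (T * (i%:R / n.+1%:R)) * n.+1%:R)] v| <= 2 * e.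
Proof.
move=> T0 l0 Tl ne e0 uc v v0 vT.
have n0 : 0 < n.+1%:R :> R by rewrite ltr0n.
pose y := n.+1%:R * (v / T).
have y0 : 0 <= y by rewrite mulr_ge0 // ?divr_ge0 // ltW.
have yn : y <= n.+1%:R by rewrite -[leRHS]mulr1 ler_pM2l // ler_pdivrMr // mul1r.
have s1 := tent_sum y0 yn.
have fE : f v = \sum_(i < n.+2) f v * tent (y - i%:R) by rewrite -mulr_sumr s1 mulr1.
have eE : 2 * e = \sum_(i < n.+2) 2 * e * tent (y - i%:R) by rewrite -mulr_sumr s1 mulr1.
rewrite {1}fE /polyline -sumrB eE; apply: le_trans (ler_norm_sum _ _ _) _.
apply: ler_sum => i _; rewrite ffunE -/y -mulrBl normrM [`|tent _|]ger0_norm ?tent_ge0 //.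
have [h|h] := leP 1 `|y - i%:R|; first by rewrite tent_out // !mulr0.
apply: ler_wpM2r; first exact: tent_ge0.
set ti := T * (i%:R / n.+1%:R).
have ti0 : 0 <= ti by rewrite mulr_ge0 // ?divr_ge0 // ltW.
have tiT : ti <= T by rewrite ler_piMr ?(ltW T0) // ler_pdivrMr // mul1r ler_nat -ltnS.
have d1 : `|v - ti| <= l.
  apply: le_trans Tl; have -> : v - ti = T / n.+1%:R * (y - i%:R).
    rewrite /ti /y; move: n0; set N : R := n.+1%:R => n0; set I : R := i%:R; field.
    by rewrite !gt_eqF.
  by rewrite normrM gtr0_norm ?divr_gt0 // ler_piMr ?divr_ge0 ?ltW.
have d2 : `|f v - f ti| <= e by exact: uc.
have d3 : `|f ti - (Num.floor (f ti * n.+1%:R))%:~R / n.+1%:R| <= e.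
  apply: le_trans ne; set z := f ti * n.+1%:R.
  have -> : f ti = z / n.+1%:R by rewrite mulfK ?gt_eqF.
  rewrite -mulrBl normrM [`|_^-1|]gtr0_norm ?invr_gt0 // ler_piMl ?invr_ge0 ?(ltW n0) //.
  have /andP[z1 z2] := floor_itv z.
  by rewrite ger0_norm ?subr_ge0 // lerBlDl; move: z2; rewrite intrD => /ltW.
apply: (@le_trans _ _ (`|f v - f ti| + `|f ti - (Num.floor (f ti * n.+1%:R))%:~R / n.+1%:R|)); last by lra.
exact: ler_distD.
Qed.

End Tents.

Section PayoffMeasurability.

(** Non-anticipation replaces the path by the path stopped at [u], which is known at [u]. Its
    discretizations by [polyline] range over a countable set, so [F] of them is measurable; they
    converge uniformly, and the continuity of [F] gives the limit. *)
Lemma mG_functional (G : set (set Omega)) (T : R) (F : (R -> R) -> R -> R) (X : R -> Omega -> R) u :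
  salg G -> 0 < T -> payoff_functional T F -> (forall w, Cspace T (X ^~ w)) ->
  0 <= u -> u <= T -> (forall v, 0 <= v -> v <= u -> mG G (X v)) -> mG G (fun w => F (X ^~ w) u).
Proof.
move=> sG T0 [FC [Fcont Fna]] XC u0 uT mX.
pose Xu w v := X (cl u v) w.
have cXu w : continuous (Xu w) := Cspace_stop (XC w) u0 uT.
have CXu w : Cspace T (Xu w) := cont_Cspace (cXu w).
have eF w : F (X ^~ w) u = F (Xu w) u.
  apply: (Fna u) => // v v0 vu; by rewrite /Xu cl_id.
pose idx n w := [ffun i : 'I_n.+2 => Num.floor (Xu w (T * (i%:R / n.+1%:R)) * n.+1%:R)].
apply: (mG_lim (F := fun n w => F (polyline T (idx n w)) u)) => [n|w].
  apply: (@mG_count _ _ _ G {ffun 'I_n.+2 -> int} (idx n) (fun c _ => F (polyline T c) u) sG) => [c|c]; last exact: mG_cst.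
  rewrite (_ : [set w | idx n w = c] =
    \bigcap_(i : 'I_n.+2) [set w | Num.floor (Xu w (T * (i%:R / n.+1%:R)) * n.+1%:R) = c i]); last first.
    apply/seteqP; split=> w /=; first by move=> <- i _ /=; rewrite ffunE.
    by move=> h; apply/ffunP => i; rewrite ffunE; exact: h.
  apply: (sigma_bigcap_count sG) => i; apply: (mG_floor _ _ sG); apply: mX.
    exact: cl_ge0.
  exact: cl_leT.
rewrite eF; apply/cvgrPdist_lt => e e0.
have [eta eta0 heta] := Fcont _ (CXu w) e e0.
have e40 : 0 < eta / 4 by rewrite divr_gt0.
have [l l0 hl] := unif_cont_itv (ltW T0) (cXu w) e40.
have [N1 h1] := inv_lt (divr_gt0 l0 T0); have [N2 h2] := inv_lt e40.
exists (maxn N1 N2) => // n /=; rewrite geq_max => /andP[n1 n2].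
have Cp : Cspace T (polyline T (idx n w)) by apply: cont_Cspace; exact: continuous_polyline.
have Tl : T / n.+1%:R <= l by have := h1 n n1; rewrite ltr_pdivlMr // mulrC => /ltW.
have near := polyline_near T0 l0 Tl (ltW (h2 n n2)) (ltW e40) hl.
have sn : supnorm T (fun v => Xu w v - polyline T (idx n w) v) < eta.
  apply: (@le_lt_trans _ _ (2 * (eta / 4))); last by lra.
  by apply: supnorm_le; [exact: ltW|exact: near].
have := heta _ Cp sn; apply: le_lt_trans.
apply: (@supnorm_ge T (fun v => F (Xu w) v - F (polyline T (idx n w)) v) u) => //; first exact: ltW.
have c1 := FC _ (CXu w); have c2 := FC _ Cp.
exact: CspaceB.
Qed.

End PayoffMeasurability.

(** * Right-continuity of the completed Brownian filtration *)

Section Brownian.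
Variables (P : probability Omega R) (W : R -> Omega -> R).
Hypotheses (HC : measure_is_complete P) (BM : standard_BM P W).
Local Notation Ex := (Ex P).
Local Notation Ib := (Ib P).
Local Notation pr := (pr P).
Local Notation FW := (FW P W).
Implicit Types (A B : set Omega) (f g U : Omega -> R) (c t u v : R) (w : Omega).

Lemma W_meas t : 0 <= t -> mfun (W t).
Proof. by have [_ [_ [h _]]] := BM; exact: h. Qed.

Lemma W0 w : W 0 w = 0. Proof. by have [h _] := BM. Qed.

Lemma W_dist w u (e : R) : 0 <= u -> 0 < e ->
  exists2 h : R, 0 < h & forall v, 0 <= v -> `|v - u| < h -> `|W v w - W u w| < e.
Proof. by have [_ [h _]] := BM; exact: within_dist. Qed.

Lemma inc_meas t u (C : set R) : 0 <= t -> 0 <= u -> measurable C ->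
  measurable ((fun w => W u w - W t w) @^-1` C).
Proof.
move=> t0 u0 mC; rewrite -[_ @^-1` _]setTI.
by apply: measurable_funB => //; exact: W_meas.
Qed.

Lemma inc_indep n (tt : nat -> R) (B : nat -> set R) : 0 <= tt 0%N ->
  (forall i, (i < n)%N -> tt i < tt i.+1) -> (forall i, measurable (B i)) ->
  pr (\bigcap_(i < n) ((fun w => W (tt i.+1) w - W (tt i) w) @^-1` B i)) =
  \prod_(i < n) pr ((fun w => W (tt i.+1) w - W (tt i) w) @^-1` B i).
Proof.
move=> t0 ht mB; have [_ [_ [_ [_ /(_ n tt t0 ht B mB)]]]] := BM.
have tp i : (i <= n)%N -> 0 <= tt i.
  elim: i => [//|i IH] ni; exact: le_trans (IH (ltnW ni)) (ltW (ht i ni)).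
have mF i : (i < n)%N -> measurable ((fun w => W (tt i.+1) w - W (tt i) w) @^-1` B i).
  by move=> ni; apply: inc_meas => //; apply: tp => //; exact: ltnW.
rewrite prE; last by apply: bigcap_measurableType => i /=; exact: mF.
rewrite (eq_bigr (fun i : 'I_n => (pr ((fun w => W (tt i.+1) w - W (tt i) w) @^-1` B i))%:E)).
  by rewrite prodEFin => -[].
by move=> i _; rewrite prE //; exact: mF.
Qed.

Lemma sW_sigma t : salg (sigmaW W t).
Proof. exact: smallest_sigma_algebra. Qed.

Lemma sW_meas t : sigmaW W t `<=` measurable.
Proof.
apply: smallest_sub; first exact: sigma_algebra_measurable.
move=> A [u [B [u0 ut mB ->]]]; rewrite -[_ @^-1` _]setTI; exact: W_meas.
Qed.

Lemma sW_mono s t : s <= t -> sigmaW W s `<=` sigmaW W t.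
Proof.
move=> st; apply: sub_smallest2r; first exact: smallest_sigma_algebra.
by move=> A [u [B [u0 us mB ->]]]; exists u, B; split=> //; exact: le_trans st.
Qed.

Lemma mG_W t u : 0 <= u -> u <= t -> mG (sigmaW W t) (W u).
Proof.
move=> u0 ut; apply/(mGP _ (sW_sigma t)) => B mB; apply: sub_sigma_algebra.
by exists u, B.
Qed.

Lemma null_meas N A : measurable N -> P N = 0%E -> A `<=` N -> measurable A.
Proof. by move=> mN PN AN; apply: HC; exists N. Qed.

Lemma FW_meas t : FW t `<=` measurable.
Proof.
move=> A [G [N [sG mN PN h]]]; have mG' := sW_meas sG.
have m1 : measurable (A `\` G) by apply: (null_meas mN PN) => w hw; apply: h; left.
have m2 : measurable (G `\` A) by apply: (null_meas mN PN) => w hw; apply: h; right.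
have -> : A = (G `|` (A `\` G)) `\` (G `\` A).
  apply/seteqP; split=> w /=.
    move=> Aw; split; last by case.
    by have [Gw|nG] := pselect (G w); [left|right].
  by move=> [[Gw|[]//] n]; apply: contrapT => nA; apply: n.
by apply: measurableD => //; exact: measurableU.
Qed.

Lemma FWP t A : FW t A <-> measurable A /\
  exists G, [/\ sigmaW W t G, pr (A `\` G) = 0 & pr (G `\` A) = 0].
Proof.
split=> [FA|[mA [G [sG h1 h2]]]].
  have mA := FW_meas FA; split=> //; have [G [N [sG mN PN h]]] := FA; exists G.
  have pN : pr N = 0 by have := prE P mN; rewrite PN => -[].
  have mG' := sW_meas sG.
  by split=> //; apply: (pr0 _ mN _ pN); [exact: measurableD|move=> w hw; apply: h; left|
     exact: measurableD|move=> w hw; apply: h; right].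
have mG' := sW_meas sG.
have m1 : measurable (A `\` G) by exact: measurableD.
have m2 : measurable (G `\` A) by exact: measurableD.
exists G, ((A `\` G) `|` (G `\` A)); split=> //; first exact: measurableU.
have P1 : P (A `\` G) = 0%E := etrans (prE P m1) (congr1 EFin h1).
have P2 : P (G `\` A) = 0%E := etrans (prE P m2) (congr1 EFin h2).
by apply/negligibleP; [exact: measurableU|apply: negligibleU; apply/negligibleP].
Qed.

Lemma sW_FW t A : sigmaW W t A -> FW t A.
Proof. by move=> sA; exists A, set0; split=> //; rewrite setDv setU0. Qed.

Lemma FW_sigma t : salg (FW t).
Proof.
split.
- by apply: sW_FW; case: (sW_sigma t).
- move=> A [G [N [sG mN PN h]]]; exists (~` G), N; split=> //; first exact: (sigma_setC (sW_sigma t)).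
  by rewrite setTD => w /= hw; apply: h; case: hw => -[h1 h2]; [right|left]; split=> //; apply: contrapT.
- move=> F hF; have /choice[x hx] : forall n, exists x : set Omega * set Omega,
     [/\ sigmaW W t x.1, measurable x.2, P x.2 = 0%E & (F n `\` x.1) `|` (x.1 `\` F n) `<=` x.2].
    by move=> n; have [G [N h]] := hF n; exists (G, N).
  exists (\bigcup_n (x n).1), (\bigcup_n (x n).2); split.
  + by apply: (sigma_bigcup (sW_sigma t)) => n; case: (hx n).
  + by apply: bigcup_measurable => n _; case: (hx n).
  + apply/negligibleP; first by apply: bigcup_measurable => n _; case: (hx n).
    by apply: negligible_bigcup => n; apply/negligibleP; case: (hx n).
  + move=> w [[[n _ Fn] nG]|[[n _ Gn] nF]]; exists n => //; have [_ _ _ h] := hx n; apply: h.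
      by left; split=> // hG; apply: nG; exists n.
    by right; split=> // hG; apply: nF; exists n.
Qed.

Lemma FW_mono s t : s <= t -> FW s `<=` FW t.
Proof. by move=> st A [G [N [sG mN PN h]]]; exists G, N; split=> //; exact: sW_mono st _ sG. Qed.

Lemma pr_ae A G E : measurable A -> measurable G -> measurable E -> pr (A `\` G) = 0 -> pr (G `\` A) = 0 ->
  pr (A `&` E) = pr (G `&` E).
Proof.
move=> mA mG' mE h1 h2.
have half A' G' : measurable A' -> measurable G' -> pr (A' `\` G') = 0 -> pr (A' `&` E) <= pr (G' `&` E).
  move=> mA' mG'' h; have mAE := measurableI _ _ mA' mE.
  have h0 : pr (A' `&` E `\` G') = 0.
    apply: (pr0 (B := A' `\` G') _ _ _ h); [exact: measurableD|exact: measurableD|].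
    by move=> w [[]].
  rewrite (pr_split _ mAE mG'') h0 addr0.
  by apply: pr_mono; [exact: measurableI|exact: measurableI|move=> w [[]]].
by apply: le_anti; rewrite !half.
Qed.

Section Dyadic.
Variables (a c : R).
Hypotheses (a0 : 0 <= a) (ac : a < c).

(** Dyadic points of [[a, c]]: each grid refines the previous one, so the sigma-algebras of its
    increments grow with [n]. *)
Definition gr (n i : nat) : R := a + (c - a) * (i%:R / 2 ^+ n).

Definition Dl n i w := W (gr n i.+1) w - W (gr n i) w.

Definition cyl n k (C : nat -> set R) := \bigcap_(i < k) (Dl n i @^-1` C i).

Let p2 n : 0 < 2 ^+ n :> R. Proof. by rewrite exprn_gt0. Qed.

Lemma gr_lt n i j : (i < j)%N -> gr n i < gr n j.
Proof.
move=> ij; rewrite /gr ltrD2l ltr_pM2l ?subr_gt0 //.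
by rewrite ltr_pM2r ?invr_gt0 // ltr_nat.
Qed.

Lemma gr0 n : gr n 0 = a. Proof. by rewrite /gr mul0r mulr0 addr0. Qed.

Lemma gr_ge n i : a <= gr n i.
Proof. by case: i => [|i]; [rewrite gr0|rewrite -{1}(gr0 n) ltW // gr_lt]. Qed.

Lemma gr_top n : gr n (2 ^ n) = c.
Proof. by rewrite /gr natrX divff; [rewrite mulr1 addrC subrK|rewrite gt_eqF]. Qed.

Lemma gr_double n i : gr n.+1 i.*2 = gr n i.
Proof.
rewrite /gr exprS -muln2 natrM; congr (_ + _ * _).
by rewrite [_ * 2]mulrC -mulf_div divff ?mul1r // pnatr_eq0.
Qed.

Lemma gr_ge0 n i : 0 <= gr n i. Proof. exact: le_trans a0 (gr_ge n i). Qed.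

Lemma Dl_meas n i (C : set R) : measurable C -> measurable (Dl n i @^-1` C).
Proof. by move=> mC; apply: inc_meas => //; exact: gr_ge0. Qed.

Lemma cyl_meas n k C : (forall i, measurable (C i)) -> measurable (cyl n k C).
Proof. by move=> mC; apply: bigcap_measurableType => i _; exact: Dl_meas. Qed.

Lemma cylS n k C : cyl n k.+1 C = cyl n k C `&` Dl n k @^-1` C k.
Proof. by rewrite /cyl !bigcap_mkord big_ord_recr. Qed.

Let Pn n := [set B | exists2 C : nat -> set R, (forall i, measurable (C i)) & B = cyl n (2 ^ n) C].

Let Sn n : set (set Omega) := <<s Pn n >>.

Let Sn_sigma n : salg (Sn n). Proof. exact: smallest_sigma_algebra. Qed.

Lemma mG_Dl n i : (i < 2 ^ n)%N -> mG (Sn n) (Dl n i).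
Proof.
move=> ni; apply/(mGP _ (Sn_sigma n)) => B mB; apply: sub_sigma_algebra.
exists (fun j => if j == i then B else setT) => [j|]; first by case: ifP.
apply/seteqP; split=> w /=.
  by move=> Bw j _ /=; case: eqP => // ->.
by move=> /(_ i ni) /=; rewrite eqxx.
Qed.

Lemma Sn_step n : Sn n `<=` Sn n.+1.
Proof.
apply: smallest_sub; first exact: Sn_sigma.
move=> _ [C mC ->]; rewrite /cyl bigcap_mkcond; apply: (sigma_bigcap (Sn_sigma _)) => i.
case: ifPn => [/set_mem /= ni|_]; last exact: (sigma_setT (Sn_sigma _)).
have lt1 : (i.*2.+1 < 2 ^ n.+1)%N by rewrite expnS mul2n -doubleS leq_double.
have : mG (Sn n.+1) (Dl n i).
  rewrite (_ : Dl n i = fun w => Dl n.+1 i.*2.+1 w + Dl n.+1 i.*2 w).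
    by apply: mGD; apply: mG_Dl => //; exact: ltnW.
  by apply/funext => w; rewrite /Dl -doubleS !gr_double addrA subrK.
by move/(mGP _ (Sn_sigma _)); apply.
Qed.

Lemma Sn_mono n m : (n <= m)%N -> Sn n `<=` Sn m.
Proof.
move/subnK <-; elim: (m - n)%N => // k IH A /IH; rewrite addSn; exact: Sn_step.
Qed.

Let Gi : set (set Omega) := [set B | exists n, Sn n B].

Lemma mG_dyadic u : a <= u -> u <= c -> mG <<s Gi >> (fun w => W u w - W a w).
Proof.
move=> au uc; have ca0 : 0 < c - a by rewrite subr_gt0.
pose x := (u - a) / (c - a).
have x0 : 0 <= x by rewrite divr_ge0 // ?subr_ge0 // ltW.
have x1 : x <= 1 by rewrite ler_pdivrMr // mul1r lerD2r.
pose k n := Num.trunc (2 ^+ n * x).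
have kx n : (k n)%:R <= 2 ^+ n * x < (k n).+1%:R by apply: truncn_itv; rewrite mulr_ge0 // ltW.
have kn n : (k n <= 2 ^ n)%N.
  rewrite -(ler_nat R) natrX; have /andP[h _] := kx n; apply: (le_trans h).
  by rewrite ler_piMr // ltW.
have ux : u = a + (c - a) * x by rewrite /x mulrC divfK ?gt_eqF // addrC subrK.
have near n : `|gr n (k n) - u| <= (c - a) / 2 ^+ n.
  rewrite ux /gr opprD addrACA subrr add0r -mulrBr normrM gtr0_norm // ler_pM2l //.
  have /andP[h1 h2] := kx n; rewrite ler0_norm; last first.
    by rewrite subr_le0 ler_pdivrMr // mulrC.
  rewrite opprB lerBlDr -{1}[2 ^- n]mul1r -mulrDl [1 + _]addrC natr1 ler_pdivlMr //.
  by rewrite mulrC ltW.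
apply: (mG_lim (F := fun n w => W (gr n (k n)) w - W a w)) => [n|w].
  have : mG (Sn n) (fun w => W (gr n (k n)) w - W a w).
    rewrite (_ : (fun w => _) = fun w => \sum_(0 <= i < k n) Dl n i w); last first.
      by apply/funext => w; rewrite /Dl (telescope_sumr (fun i => W (gr n i) w)) // gr0.
    elim: (k n) (kn n) => [|m IH] mn.
      by under eq_fun do rewrite big_geq //; exact: mG_cst.
    under eq_fun do rewrite big_nat_recr //=.
    by apply: mGD; [apply: IH; exact: ltnW|exact: mG_Dl].
  apply: mG_sub; [exact: Sn_sigma|exact: smallest_sigma_algebra|].
  by move=> B hB; apply: sub_sigma_algebra; exists n.
apply: cvgB; last exact: cvg_cst.
apply/cvgrPdist_lt => e e0; have [h h0 hh] := W_dist w (le_trans a0 au) e0.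
have [N hN] := hf_small (divr_gt0 h0 ca0).
exists N => // n Nn /=; rewrite distrC; apply: hh; first exact: gr_ge0.
apply: le_lt_trans (near n) _; have := hN n Nn; rewrite /hf exprVn ltr_pdivlMr //.
by rewrite mulrC.
Qed.

(** It suffices to test cylinders over one dyadic grid at a time: they are stable under
    intersection, the sigma-algebras [Sn n] increase, and continuity of the paths recovers
    increments between arbitrary times. *)
Lemma dyadic_indep A : measurable A ->
  (forall n C, (forall i, measurable (C i)) ->
     pr (A `&` cyl n (2 ^ n) C) = pr A * pr (cyl n (2 ^ n) C)) ->
  forall B, <<s [set B | exists u (C : set R), [/\ a <= u, u <= c, measurable C &
      B = (fun w => W u w - W a w) @^-1` C]] >> B ->
    measurable B /\ pr (A `&` B) = pr A * pr B.
Proof.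
move=> mA hA.
have hS n B : Sn n B -> measurable B /\ pr (A `&` B) = pr A * pr B.
  apply: indep_pi => //.
  - move=> _ _ [C mC ->] [C' mC' ->]; exists (fun i => C i `&` C' i).
      by move=> i; exact: measurableI.
    by rewrite /cyl -bigcapI.
  - by move=> _ [C mC ->]; exact: cyl_meas.
  - by move=> _ [C mC ->]; exact: hA.
have hG B : <<s Gi >> B -> measurable B /\ pr (A `&` B) = pr A * pr B.
  apply: indep_pi => //.
  - move=> B1 B2 [n1 h1] [n2 h2]; exists (maxn n1 n2); apply: (sigma_setI (Sn_sigma _)).
      exact: (Sn_mono (leq_maxl _ _)).
    exact: (Sn_mono (leq_maxr _ _)).
  - by move=> B1 [n /hS[]].
  - by move=> B1 [n /hS[]].
move=> B sB; apply: hG; move: B sB; apply: smallest_sub; first exact: smallest_sigma_algebra.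
move=> _ [u [C [au uc mC ->]]].
by have /(mGP _ (smallest_sigma_algebra _ _)) := mG_dyadic au uc; apply.
Qed.

End Dyadic.

Lemma pr_cyl a c n k (C : nat -> set R) : 0 <= a -> a < c -> (forall i, measurable (C i)) ->
  pr (cyl a c n k C) = \prod_(i < k) pr (Dl a c n i @^-1` C i).
Proof.
move=> a0 ac mC; apply: (inc_indep (tt := gr a c n)) => //; first by rewrite gr0.
by move=> i _; exact: gr_lt.
Qed.

(** Appending [v] as one more point to a dyadic grid of [[0, t]] reduces the claim to the
    independence of consecutive increments. *)
Lemma inc_past t v A (C : set R) : 0 <= t -> t < v -> measurable C -> FW t A ->
  pr (A `&` (fun w => W v w - W t w) @^-1` C) = pr A * pr ((fun w => W v w - W t w) @^-1` C).
Proof.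
move=> t0 tv mC FA; set E := _ @^-1` C.
have v0 := le_trans t0 (ltW tv).
have mE : measurable E by exact: inc_meas.
suff hG G : sigmaW W t G -> pr (E `&` G) = pr E * pr G.
  have mA := FW_meas FA.
  have [_ [G [sG h1 h2]]] := proj1 (FWP t A) FA; have mG' := sW_meas sG.
  rewrite (pr_ae mA mG' mE h1 h2) setIC hG // mulrC; congr (_ * _).
  by have := pr_ae mA mG' measurableT h1 h2; rewrite !setIT.
(* The interval has no dyadic grid when [t = 0]; there [W 0 = 0] makes the sigma-algebra trivial. *)
have [t00|tpos] := eqVneq t 0.
  suff : G = set0 \/ G = setT -> pr (E `&` G) = pr E * pr G.
    move=> h sG; apply: h; move: G sG; rewrite t00; apply: smallest_sub.
      split; first by left.
        by move=> A' [->|->]; [right; rewrite setD0|left; rewrite setDv].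
      move=> F hF; have [[n Fn]|nF] := pselect (exists n, F n = setT).
        by right; apply/seteqP; split=> // w _; exists n => //; rewrite Fn.
      left; apply/seteqP; split=> // w [n _]; have [->//|Fn] := hF n.
      by exfalso; apply: nF; exists n.
    move=> _ [u [B [u0 u1 mB ->]]]; have -> : u = 0 by apply: le_anti; rewrite u0 u1.
    have [B0|nB] := pselect (B 0); [right|left]; apply/seteqP; split=> // w /=; by rewrite W0.
  by move=> [->|->]; rewrite ?setI0 ?setIT ?pr_set0 ?prT ?mulr0 ?mulr1.
have tgt : 0 < t by rewrite lt_def tpos t0.
have hcyl n (C' : nat -> set R) : (forall i, measurable (C' i)) ->
    pr (E `&` cyl 0 t n (2 ^ n) C') = pr E * pr (cyl 0 t n (2 ^ n) C').
  move=> mC'; rewrite pr_cyl // setIC.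
  pose tt i := if (i <= 2 ^ n)%N then gr 0 t n i else v.
  pose B i := if (i < 2 ^ n)%N then C' i else C.
  have ttE i : (i <= 2 ^ n)%N -> tt i = gr 0 t n i by rewrite /tt => ->.
  have ttV : tt (2 ^ n).+1 = v by rewrite /tt ltnn.
  have ttT : tt (2 ^ n)%N = t by rewrite ttE // gr_top.
  have tt0 : 0 <= tt 0%N by rewrite ttE // gr0.
  have ttlt i : (i < (2 ^ n).+1)%N -> tt i < tt i.+1.
    rewrite ltnS leq_eqVlt => /orP[/eqP ->|ilt]; first by rewrite ttV ttT.
    by rewrite !ttE //; [exact: gr_lt|exact: ltnW].
  have mB i : measurable (B i) by rewrite /B; case: ifP.
  have := inc_indep tt0 ttlt mB.
  rewrite bigcap_mkord !big_ord_recr /= ttV ttT -[B (2 ^ n)%N]/(if (2 ^ n < 2 ^ n)%N then _ else C) ltnn -/E.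
  rewrite (_ : \big[setI/setT]_(i < 2 ^ n) _ = cyl 0 t n (2 ^ n) C'); last first.
    rewrite /cyl bigcap_mkord; apply: eq_bigr => i _.
    by rewrite !ttE ?(ltnW (ltn_ord i)) // /B ltn_ord.
  move=> ->; rewrite mulrC; congr (_ * _); apply: eq_bigr => i _.
  by rewrite !ttE ?(ltnW (ltn_ord i)) // /B ltn_ord.
move=> sG.
suff sG' : <<s [set B | exists u (C : set R), [/\ 0 <= u, u <= t, measurable C &
      B = (fun w => W u w - W 0 w) @^-1` C]] >> G by have [] := dyadic_indep (lexx 0) tgt mE hcyl sG'.
move: G sG; apply: sub_smallest2r; first exact: smallest_sigma_algebra.
move=> _ [u [B [u0 ut mB ->]]]; exists u, B; split=> //.
by apply/seteqP; split=> w /=; rewrite W0 subr0.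
Qed.

(** [A] is known at every [tn n > t], so it is independent of [W v - W (tn n)]. The limit in [n] is
    taken for the continuous functions [f c m] of the increment; afterwards these tend to the
    indicator of [D w <= c] as [m] grows. *)
Lemma inc_germ t v A (C : set R) : 0 <= t -> t < v -> measurable C -> (forall u, t < u -> FW u A) ->
  pr (A `&` (fun w => W v w - W t w) @^-1` C) = pr A * pr ((fun w => W v w - W t w) @^-1` C).
Proof.
move=> t0 tv mC FA; pose D w := W v w - W t w.
have v0 := le_trans t0 (ltW tv).
have mD : mfun D by apply: measurable_funB; exact: W_meas.
have mA : measurable A by exact: (FW_meas (FA v tv)).
have mU : mfun (fun w => \1_A w - pr A) by apply: measurable_funB => //; exact: measurable_indic.
pose f c (m : nat) (x : R) := ramp (1 - m%:R * (x - c)).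
have mf c m : mfun (f c m).
  apply: (measurableT_comp (f := ramp)); first exact: measurable_ramp.
  by apply: measurable_funB => //; apply: measurable_funM => //; exact: measurable_funB.
pose tn (n : nat) := t + (v - t) / n.+2%:R.
have vt0 : 0 < v - t by rewrite subr_gt0.
have n2 (n : nat) : 0 < n.+2%:R :> R by rewrite ltr0n.
have tn1 n : t < tn n by rewrite ltrDl divr_gt0.
have tn2 n : tn n < v.
  by rewrite /tn -ltrBrDl ltr_pdivrMr // ltr_pMr // ltr1n.
have tnl : tn @ \oo --> t.
  apply/cvgrPdist_lt => e e0; have [N hN] := inv_lt (divr_gt0 e0 vt0).
  exists N => // n Nn /=; rewrite /tn opprD addrA subrr add0r normrN gtr0_norm ?divr_gt0 //.
  by have := hN n.+1 (leqW Nn); rewrite ltr_pdivlMr // mulrC.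
have Dn w : (fun n => W v w - W (tn n) w) @ \oo --> D w.
  apply: cvgB; first exact: cvg_cst.
  apply/cvgrPdist_lt => e e0; have [h h0 hh] := W_dist w t0 e0.
  have /cvgrPdist_lt /(_ h h0) [N _ hN] := tnl.
  exists N => // n Nn /=; rewrite distrC; apply: hh; last by rewrite distrC; exact: hN.
  exact: le_trans t0 (ltW (tn1 n)).
have E1 c m : Ex (fun w => f c m (D w) * (\1_A w - pr A)) = 0.
  have h0 n : Ex (fun w => f c m (W v w - W (tn n) w) * (\1_A w - pr A)) = 0.
    have tn0 := le_trans t0 (ltW (tn1 n)).
    have mDn : mfun (fun w => W v w - W (tn n) w) by apply: measurable_funB; exact: W_meas.
    apply: (indep_fun mA mDn _ (mf c m)) => [C' mC'|x|].
    - by apply: inc_past => //; exact: FA.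
    - exact: ramp_ge0.
    - by apply: (Ib_le _ (Ib_cst P 1)) => [|w]; [exact: (measurableT_comp (mf c m))|exact: ramp_bd].
  have [||||_ /=] := @Ex_dct _ _ _ P (fun n w => f c m (W v w - W (tn n) w) * (\1_A w - pr A))
    (fun w => f c m (D w) * (\1_A w - pr A)) (fun=> 1).
  - move=> n; apply: measurable_funM => //; apply: (measurableT_comp (mf c m)).
    by apply: measurable_funB; apply: W_meas => //; exact: le_trans t0 (ltW (tn1 n)).
  - exact: Ib_cst.
  - by move=> n w; rewrite normrM -[leRHS]mulr1 ler_pM ?ramp_bd ?indic_pr.
  - move=> w; apply: cvgMl; apply: ramp_cvg; apply: cvgB; first exact: cvg_cst.
    by apply: cvgMr; apply: cvgB; [exact: Dn|exact: cvg_cst].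
  under eq_fun do rewrite h0.
  by move=> h; exact: cvg_unique h (cvg_cst _).
have E2 c : pr (A `&` [set w | D w <= c]) = pr A * pr [set w | D w <= c].
  set Bc := [set w | D w <= c].
  have mB : measurable Bc by rewrite -[Bc]setTI; exact: measurable_fun_le.
  suff : Ex (fun w => \1_Bc w * (\1_A w - pr A)) = 0.
    by rewrite Ex_indic_pr // setIC mulrC => /eqP; rewrite subr_eq0 => /eqP.
  have [||||_ /=] := @Ex_dct _ _ _ P (fun n w => f c n (D w) * (\1_A w - pr A))
    (fun w => \1_Bc w * (\1_A w - pr A)) (fun=> 1).
  - by move=> n; apply: measurable_funM => //; exact: (measurableT_comp (mf c n)).
  - exact: Ib_cst.
  - by move=> n w; rewrite normrM -[leRHS]mulr1 ler_pM ?ramp_bd ?indic_pr.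
  - move=> w; apply: cvgMl; rewrite indicE; have [Dc|cD] := leP (D w) c.
      rewrite mem_set //=; apply: cvg_near_cst; exists 0%N => // n _ /=; apply: ramp_ge1.
      by rewrite lerDl -mulrN mulr_ge0 // opprB subr_ge0.
    rewrite memNset /=; last by rewrite /Bc /= leNgt cD.
    have d0 : 0 < D w - c by rewrite subr_gt0.
    have [N hN] := inv_lt d0; apply: cvg_near_cst; exists N.+1 => // n Nn /=; apply: ramp_le0.
    case: n Nn => // n Nn; rewrite subr_le0 mulrC -ler_pdivrMr ?ltr0n // div1r ltW //.
    exact: hN.
  under eq_fun do rewrite E1.
  by move=> h; exact: cvg_unique h (cvg_cst _).
pose G := [set B | exists c, B = [set w | D w <= c]].
have sG : <<s G >> (D @^-1` C).
  suff /(mGP _ (smallest_sigma_algebra _ _)) : mG <<s G >> D by apply.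
  apply: mG_ray; first exact: smallest_sigma_algebra.
  by move=> c; apply: sub_sigma_algebra; exists c.
have [|||_ ->//] := indep_pi (P := P) (A := A) (G := G) mA _ _ _ sG.
- move=> _ _ [c1 ->] [c2 ->]; exists (Num.min c1 c2).
  by apply/seteqP; split=> w /=; rewrite le_min; [move=> [-> ->]|move=> /andP[]].
- by move=> _ [c ->]; rewrite -[X in measurable X]setTI; exact: measurable_fun_le.
- by move=> _ [c ->]; exact: E2.
Qed.

(** The first increment of a dyadic grid is covered by [inc_germ]; each further one starts strictly
    after [t] and is independent of all that is known at its left end, including [A]. *)
Lemma germ_indep t c A : 0 <= t -> t < c -> (forall u, t < u -> FW u A) ->
  forall B, <<s [set B | exists u (C : set R), [/\ t <= u, u <= c, measurable C &
      B = (fun w => W u w - W t w) @^-1` C]] >> B ->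
    measurable B /\ pr (A `&` B) = pr A * pr B.
Proof.
move=> t0 tc FA; have mA : measurable A by exact: (FW_meas (FA c tc)).
apply: (dyadic_indep t0 tc mA) => n C mC; rewrite pr_cyl //.
elim: (2 ^ n)%N => [|k IH]; first by rewrite big_ord0 /cyl bigcap_mkord big_ord0 setIT mulr1.
rewrite cylS setIA big_ord_recr /= mulrA -IH.
have tk : gr t c n k < gr t c n k.+1 by exact: gr_lt.
case: k IH tk => [|k] IH tk.
  rewrite {1}/cyl bigcap_mkord big_ord0 setIT {1}/cyl bigcap_mkord big_ord0 setIT.
  by rewrite /Dl gr0; apply: inc_germ => //; rewrite -{1}(gr0 t c n).
apply: inc_past => //; first exact: gr_ge0.
have tg : t < gr t c n k.+1 by rewrite -{1}(gr0 t c n); exact: gr_lt.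
have sF := FW_sigma (gr t c n k.+1).
apply: (sigma_setI sF); first exact: FA.
rewrite /cyl bigcap_mkcond; apply: (sigma_bigcap sF) => i.
case: ifPn => [/set_mem /= ik|_]; last exact: (sigma_setT sF).
apply: sW_FW.
have gle j : (j <= k.+1)%N -> gr t c n j <= gr t c n k.+1.
  by rewrite leq_eqVlt => /orP[/eqP -> //|h]; apply/ltW/gr_lt.
suff /(mGP _ (sW_sigma _)) : mG (sigmaW W (gr t c n k.+1)) (Dl t c n i) by apply.
by apply: mGB; apply: mG_W; [exact: gr_ge0|exact: gle|exact: gr_ge0|apply: gle; exact: ltnW].
Qed.

(** Up to a null set [A] belongs to the sigma-algebra of [W] up to [t + 1], which lies in the one
    generated by the past up to [t] and the increments [J] after [t]. As the germ at [t] is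
    independent of [J], [indep_germ] places [A] in the past, again up to a null set. *)
Lemma FW_rc t A : 0 <= t -> (forall u, t < u -> FW u A) -> FW t A.
Proof.
move=> t0 FA; have t1 : t < t + 1 by rewrite ltrDl.
pose A0 : set (set Omega) := [set B | forall u, t < u -> FW u B].
pose J := <<s [set B | exists u (C : set R), [/\ t <= u, u <= t + 1, measurable C &
      B = (fun w => W u w - W t w) @^-1` C]] >>.
have sJ : salg J by exact: smallest_sigma_algebra.
have sA : salg A0.
  split.
  - by move=> u tu; case: (FW_sigma u).
  - by move=> B hB u tu; have [_ h _] := FW_sigma u; apply: h; exact: hB.
  - by move=> F hF u tu; have [_ _ h] := FW_sigma u; apply: h => n; exact: hF.
have mA0 : A0 `<=` measurable by move=> B /(_ _ t1); exact: FW_meas.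
have mJ : J `<=` measurable by move=> B /(germ_indep t0 t1 FA)[].
have BA : sigmaW W t `<=` A0 by move=> B sB u tu; apply: sW_FW; exact: (sW_mono (ltW tu)).
have ind B C : A0 B -> J C -> pr (B `&` C) = pr B * pr C by move=> hB hC; have [] := germ_indep t0 t1 hB hC.
have [mA [G [sG h1 h2]]] := proj1 (FWP (t + 1) A) (FA _ t1).
have mG' := sW_meas sG.
have A0G : A0 G.
  move=> u tu; have [_ [G' [sG' h1' h2']]] := proj1 (FWP u A) (FA u tu).
  have mG'' := sW_meas sG'.
  apply/FWP; split=> //; exists G'; split=> //.
    exact: ae_trans mG' mA mG'' h2 h1'.
  exact: ae_trans mG'' mA mG' h2' h1.
have sGU : <<s sigmaW W t `|` J >> G.
  move: G sG {mG' A0G h1 h2}; apply: smallest_sub; first exact: smallest_sigma_algebra.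
  move=> _ [u [B [u0 ut mB ->]]].
  have sU : salg <<s sigmaW W t `|` J >> by exact: smallest_sigma_algebra.
  suff /(mGP _ sU) : mG <<s sigmaW W t `|` J >> (W u) by apply.
  have s1 : sigmaW W t `<=` <<s sigmaW W t `|` J >> by move=> D hD; apply: sub_sigma_algebra; left.
  have s2 : J `<=` <<s sigmaW W t `|` J >> by move=> D hD; apply: sub_sigma_algebra; right.
  have [ut'|tu] := leP u t.
    by apply: (mG_sub (sW_sigma t) sU s1); exact: mG_W.
  rewrite (_ : W u = fun w => (W u w - W t w) + W t w); last by apply/funext => w; rewrite subrK.
  apply: mGD; last by apply: (mG_sub (sW_sigma t) sU s1); exact: mG_W.
  apply: (mG_sub sJ sU s2); apply/(mGP _ sJ) => C mC; apply: sub_sigma_algebra.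
  by exists u, C; split=> //; exact: ltW.
have [B sB [h3 h4]] := indep_germ (sW_sigma t) sA sJ mA0 mJ BA ind A0G sGU.
have mB := sW_meas sB.
apply/FWP; split=> //; exists B; split=> //.
  exact: ae_trans mA mG' mB h1 h3.
exact: ae_trans mB mG' mA h4 h2.
Qed.

(** * Exponential martingales, domination and optional stopping *)

Lemma inc_mgf c t v : 0 <= t -> t < v -> Ib (fun w => expR (c * (W v w - W t w))) /\
  Ex (fun w => expR (c * (W v w - W t w))) = expR (c ^+ 2 * (v - t) / 2).
Proof.
move=> t0 tv; have v0 := le_trans t0 (ltW tv).
have vt : 0 < v - t by rewrite subr_gt0.
pose X w := W v w - W t w.
have mX : mfun X by apply: measurable_funB; exact: W_meas.
have mf : mfun (fun x : R => (expR (c * x))%:E).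
  by apply/measurable_EFinP; apply: measurableT_comp => //; exact: measurable_funM.
have s0 : Num.sqrt (v - t) != 0 by rewrite gt_eqF // sqrtr_gt0.
have E : (\int[P]_w (expR (c * X w))%:E = (expR (c ^+ 2 * (v - t) / 2))%:E)%E.
  have mX' : mfun (X : Omega -> measurableTypeR R) by move=> mT B mB; exact: (mX mT B mB).
  have mf' : mfun (fun x : measurableTypeR R => (expR (c * x))%:E).
    by move=> mT B mB; exact: (mf mT B mB).
  pose X' : {mfun Omega >-> measurableTypeR R} := HB.pack X (isMeasurableFun.Build _ _ _ _ _ mX').
  have := @ge0_integral_pushforward _ _ _ _ _ _ mX' P setT (fun x => (expR (c * x))%:E) measurableT mf' _.
  rewrite preimage_setT => <-; last by move=> x _; rewrite lee_fin expR_ge0.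
  transitivity (\int[normal_prob 0 (Num.sqrt (v - t))]_x (expR (c * x))%:E)%E; last first.
    by rewrite normal_mgf // sqr_sqrtr // ltW.
  apply: (@eq_measure_integral _ _ _ setT (normal_prob 0 (Num.sqrt (v - t))) (pushforward P X')) => A mA _.
  by have [_ [_ [_ [h _]]]] := BM; exact: (h t v t0 tv A mA).
split; last by rewrite /Ex /Rintegral -/(X _) E.
apply/integrableP; split.
  apply/measurable_EFinP; apply: measurableT_comp => //; apply: measurable_funM => //.
under eq_integral => w _ do rewrite /= ger0_norm ?expR_ge0 //.
by rewrite E ltry.
Qed.

Lemma Ib_expW c t : 0 <= t -> Ib (fun w => expR (c * W t w)).
Proof.
rewrite le_eqVlt => /orP[/eqP <-|t0].
  have := Ib_cst P 1; apply: eq_integrable => // w _ /=.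
  by rewrite W0 mulr0 expR0.
have [+ _] := inc_mgf c (lexx 0) t0; apply: eq_integrable => // w _ /=.
by rewrite W0 subr0.
Qed.

Lemma exp_mart c t v A : 0 <= t -> t <= v -> FW t A ->
  Ex (fun w => \1_A w * expR (c * W v w)) =
  expR (c ^+ 2 * (v - t) / 2) * Ex (fun w => \1_A w * expR (c * W t w)).
Proof.
move=> t0; rewrite le_eqVlt => /orP[/eqP <-|tv] FA.
  by rewrite subrr mulr0 mul0r expR0 mul1r.
have v0 := le_trans t0 (ltW tv); have mA := FW_meas FA.
have [ID ED] := inc_mgf c t0 tv; set q := expR (_ / 2) in ED *.
pose D w := W v w - W t w.
have mD : mfun D by apply: measurable_funB; exact: W_meas.
pose U w := expR (c * D w) - q.
have IU : Ib U by apply: IbB => //; exact: Ib_cst.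
have EU B : FW t B -> Ex (fun w => \1_B w * U w) = 0.
  move=> FB; have mB := FW_meas FB.
  have e1 : Ex (fun w => expR (c * D w) * (\1_B w - pr B)) = 0.
    apply: (indep_fun (X := D) (f := fun x => expR (c * x)) mB mD) => // [C mC|].
    - exact: inc_past.
    - by apply: measurableT_comp => //; exact: measurable_funM.
  have I1 : Ib (fun w => expR (c * D w) * (\1_B w - pr B)).
    have := Ib_mult (Ib_measurable (Ib_indic_pr P mB)) (fun w => indic_pr P w mB) ID.
    by apply: eq_integrable => // w _ /=; rewrite mulrC.
  have I2 := IbZ (pr B) ID; have I3 := IbZ q (Ib_ind P mB).
  rewrite (_ : Ex _ = Ex (fun w => expR (c * D w) * (\1_B w - pr B) +
      (pr B * expR (c * D w) - q * \1_B w))).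
    by rewrite (ExD I1 (IbB I2 I3)) (ExB I2 I3) e1 (ExZ _ ID) ED (ExZ q (Ib_ind P mB)) -/(pr B) (mulrC q) subrr addr0.
  apply: eq_Ex => w; rewrite /U; set y := expR _; set y' := pr B; set y2 := \1_B w.
  by clear -y y' y2; ring.
have sF := FW_sigma t; have IWt := Ib_expW c t0; have IWv := Ib_expW c v0.
have EW w : expR (c * W t w) * expR (c * D w) = expR (c * W v w).
  by rewrite -expRD -mulrDr /D addrC subrK.
have IZ : Ib (fun w => expR (c * W v w) + q * expR (c * W t w)) by apply: IbD => //; exact: IbZ.
have e1 : Ex (fun w => (\1_A w * expR (c * W t w)) * U w) = 0.
  apply: (Ex_mult_ge0 sF (@FW_meas t) _ _ IU IZ _ EU) => [|w|w].
  - apply: mGM; first exact: mG_indic.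
    apply: (mG_comp (f := fun x => expR (c * x))).
      by apply: measurableT_comp => //; exact: measurable_funM.
    by apply: (mG_sub (sW_sigma t) sF); [exact: sW_FW|exact: mG_W].
  - by rewrite mulr_ge0 ?expR_ge0 // indicE.
  apply: (@le_trans _ _ (expR (c * W t w) * (expR (c * D w) + q))); last by rewrite mulrDr EW [q * _]mulrC.
  rewrite normrM; apply: ler_pM => //.
    by rewrite indicE ger0_norm; case: (w \in A); rewrite ?mul1r ?mul0r ?expR_ge0.
  by apply: le_trans (ler_normB _ _) _; rewrite !ger0_norm ?expR_ge0.
have I1 : Ib (fun w => \1_A w * expR (c * W v w)) by exact: Ib_indic.
have I2 : Ib (fun w => \1_A w * expR (c * W t w)) by exact: Ib_indic.
rewrite -(ExZ q I2); apply/eqP; rewrite -subr_eq0; apply/eqP.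
rewrite -ExB; [|exact: I1|exact: IbZ].
rewrite -[RHS]e1; apply: eq_Ex => w; rewrite /U -(EW w).
set y := expR _; set y' := expR _; set y2 := \1_A w.
by clear -y y' y2; ring.
Qed.

(** The exponential martingale. Both the density of the market and its product with the price are of
    this form, up to a constant factor. *)
Definition Nm c t w := expR (c * W t w - c ^+ 2 * t / 2).

Lemma NmE c t w : Nm c t w = expR (- (c ^+ 2 * t / 2)) * expR (c * W t w).
Proof. by rewrite -expRD addrC. Qed.

Lemma Ib_Nm c t : 0 <= t -> Ib (Nm c t).
Proof.
move=> t0; have := IbZ (expR (- (c ^+ 2 * t / 2))) (Ib_expW c t0).
by apply: eq_integrable => // w _ /=; rewrite NmE.
Qed.

Lemma Nm_mart c t v A : 0 <= t -> t <= v -> FW t A ->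
  Ex (fun w => \1_A w * Nm c v w) = Ex (fun w => \1_A w * Nm c t w).
Proof.
move=> t0 tv FA; have mA := FW_meas FA; have v0 := le_trans t0 tv.
have IA u : 0 <= u -> Ib (fun w => \1_A w * expR (c * W u w)) by move=> u0; apply: Ib_indic => //; exact: Ib_expW.
have e u : 0 <= u -> Ex (fun w => \1_A w * Nm c u w) =
    expR (- (c ^+ 2 * u / 2)) * Ex (fun w => \1_A w * expR (c * W u w)).
  by move=> u0; rewrite -ExZ; [apply: eq_Ex => w; rewrite NmE mulrCA|exact: IA].
rewrite (e v v0) (e t t0) (exp_mart c t0 tv FA) mulrA -expRD.
by have -> : - (c ^+ 2 * v / 2) + c ^+ 2 * (v - t) / 2 = - (c ^+ 2 * t / 2) by field.
Qed.

(** Doob's maximal inequality by induction on the number of times: on the paths that reach the level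
    first at [tt m.+1] the martingale is at least [x], and the martingale property carries along the
    paths that reached it before. *)
Lemma Nm_maximal c (tt : nat -> R) (x : R) k : 0 <= tt 0%N -> (forall i, tt i <= tt i.+1) -> 0 <= x ->
  x * pr [set w | exists2 i, (i <= k)%N & x <= Nm c (tt i) w] <= 1.
Proof.
move=> t0 ht x0; have tp i : 0 <= tt i by elim: i => // i IH; exact: le_trans (ht i).
have tmon i j : (i <= j)%N -> tt i <= tt j.
  by move/subnK <-; elim: (j - i)%N => // m IH; rewrite addSn; exact: le_trans (ht _).
pose F k := [set w | exists2 i, (i <= k)%N & x <= Nm c (tt i) w].
have mNm i j : (i <= j)%N -> mG (FW (tt j)) (Nm c (tt i)).
  move=> ij; apply: (mG_comp (f := fun y => expR (c * y - c ^+ 2 * tt i / 2))).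
    by apply: measurableT_comp => //; apply: measurable_funB => //; exact: measurable_funM.
  apply: (mG_sub (sW_sigma _) (FW_sigma _)); first exact: sW_FW.
  by apply: mG_W => //; exact: tmon.
have FS m : F m.+1 = F m `|` [set w | x <= Nm c (tt m.+1) w].
  apply/seteqP; split=> w /=.
    move=> [i]; rewrite leq_eqVlt => /orP[/eqP ->|im] h; [by right|by left; exists i].
  by move=> [[i im h]|h]; [exists i => //; exact: leqW|exists m.+1].
have FF m : FW (tt m) (F m).
  elim: m => [|m IH].
    have -> : F 0%N = [set w | x <= Nm c (tt 0%N) w].
      by apply/seteqP; split=> w /=; [move=> [i]; rewrite leqn0 => /eqP ->|exists 0%N].
    by apply: (mG_le (FW_sigma _)); [exact: mG_cst|exact: mNm].
  rewrite FS; apply: (sigma_setU (FW_sigma _)); first exact: (FW_mono (ht m)).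
  by apply: (mG_le (FW_sigma _)); [exact: mG_cst|exact: mNm].
have Nm0 i w : 0 <= Nm c i w by exact: expR_ge0.
have key m : x * pr (F m) <= Ex (fun w => \1_(F m) w * Nm c (tt m) w).
  elim: m => [|m IH].
    have mF := FW_meas (FF 0%N).
    rewrite -ExZ; last exact: Ib_ind.
    apply: Ex_le; [apply: IbZ; exact: Ib_ind|apply: Ib_indic => //; exact: Ib_Nm|].
    move=> w; rewrite indicE; case: (boolP (w \in _)) => [/set_mem[i]|_]; last by rewrite mulr0 mul0r.
    by rewrite leqn0 => /eqP -> h; rewrite mulr1 mul1r.
  have mF := FW_meas (FF m); have mF1 := FW_meas (FF m.+1).
  have sub : F m `<=` F m.+1 by rewrite FS => w; left.
  have mD : measurable (F m.+1 `\` F m) by exact: measurableD.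
  have IN := Ib_Nm c (tp m.+1).
  rewrite (pr_split P mF1 mF) (setIidr sub) mulrDr.
  rewrite (_ : Ex _ = Ex (fun w => \1_(F m) w * Nm c (tt m.+1) w) +
      Ex (fun w => \1_(F m.+1 `\` F m) w * Nm c (tt m.+1) w)); last first.
    rewrite -ExD; [|exact: Ib_indic|exact: Ib_indic].
    apply: eq_Ex => w; rewrite -mulrDl; congr (_ * _); rewrite !indicE in_setD.
    case: (boolP (w \in F m)) => [/set_mem/sub/mem_set -> /=|_]; first by rewrite addr0.
    by rewrite /= andbT add0r.
  apply: lerD; first by rewrite (Nm_mart c (tp m) (ht m) (FF m)).
  rewrite -ExZ; last exact: Ib_ind.
  apply: Ex_le; [by apply: IbZ; exact: Ib_ind|exact: Ib_indic|].
  move=> w; rewrite indicE; case: (boolP (w \in _)) => [/set_mem|_]; last by rewrite mulr0 mul0r.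
  by rewrite FS => -[[h|h] nF]; [exfalso|rewrite mulr1 mul1r].
apply: le_trans (key k) _.
have -> : (1 : R) = Ex (Nm c (tt k)).
  have := Nm_mart c (lexx 0) (tp k) (sigma_setT (FW_sigma 0)).
  rewrite (_ : Ex _ = Ex (Nm c (tt k))); last by apply: eq_Ex => w; rewrite indicT mul1r.
  move=> ->; rewrite -(Ex_cst P 1); apply: eq_Ex => w; rewrite indicT mul1r /Nm W0.
  by rewrite !mulr0 mul0r subr0 expR0.
apply: Ex_le; [apply: Ib_indic; [exact: (FW_meas (FF k))|exact: Ib_Nm]|exact: Ib_Nm|].
by move=> w; rewrite indicE; case: (w \in _); rewrite ?mul1r ?mul0r.
Qed.

Section Stopped.
Variable T : R.
Hypothesis T0 : 0 < T.

(** The filtration is kept constant outside [[0, T]], because [market] asks for one indexed by all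
    real times. *)
Definition Fc u := FW (cl T u).

Lemma Fc_sigma u : salg (Fc u). Proof. exact: FW_sigma. Qed.

Lemma Fc_mono u v : u <= v -> Fc u `<=` Fc v.
Proof. by move=> uv; apply: FW_mono; exact: cl_mono. Qed.

Lemma Fc_meas u : Fc u `<=` measurable. Proof. exact: FW_meas. Qed.

Lemma Fc_rc u A : (forall v, u < v -> Fc v A) -> Fc u A.
Proof.
move=> h; have [Tu|uT] := leP T u.
  have := h (u + 1); rewrite /Fc ltrDl ltr01 => /(_ isT).
  have e v : T <= v -> cl T v = T by move=> Tv; rewrite /cl (min_idPr Tv) (max_idPr (ltW T0)).
  by rewrite !e // (le_trans Tu) // lerDl.
apply: FW_rc; first exact: cl_ge0.
move=> v cv; have [vT|Tv] := leP v T; last first.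
  by apply: (FW_mono (ltW Tv)); have := h T uT; rewrite /Fc cl_id // ltW.
have v0 : 0 <= v := le_trans (cl_ge0 T u) (ltW cv).
have uv : u < v.
  rewrite ltNge; apply/negP => vu; move: cv; rewrite ltNge => /negP[].
  by rewrite -{1}(cl_id v0 vT) cl_mono.
by have := h v uv; rewrite /Fc cl_id.
Qed.

Lemma geom_sum_le (r : R) m : 0 <= r -> r < 1 -> \sum_(k < m) r ^+ k <= (1 - r)^-1.
Proof.
move=> r0 r1; have d0 : 0 < 1 - r by rewrite subr_gt0.
rewrite -[leRHS]mul1r ler_pdivlMr // mulrC -opprB mulNr -subrX1 opprB.
by rewrite gerBl exprn_ge0.
Qed.

Lemma W_bounded w : exists2 C : R, 0 < C & forall u, 0 <= u -> u <= T -> `|W u w| <= C.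
Proof.
have cW : continuous (fun u => W (Num.max 0 u) w).
  move=> u; apply/cvgrPdist_lt => e e0.
  have m0 : 0 <= Num.max 0 u by rewrite le_maxL.
  have [h h0 hh] := W_dist w m0 e0.
  near=> v; rewrite distrC; apply: hh; first by rewrite le_maxL.
  apply: (@le_lt_trans _ _ `|v - u|); last by rewrite distrC; near: v; exact: cvgr_dist_lt.
  have := ler_norm (u - v); have := ler_norm (v - u); rewrite [`|u - v|]distrC.
  have := normr_ge0 (v - u); set n := `|v - u|; move=> n0 h1 h2.
  have [u0|u0] := leP 0 u; have [v0|v0] := leP 0 v; rewrite ler_norml; apply/andP; split; lra.
have [C C0 hC] := bounded_itv (ltW T0) cW; exists C => // u u0 uT.
by have := hC u u0 uT; rewrite (max_idPr u0).
Unshelve. all: by end_near. Qed.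

(** The maximal inequality with [c = 2 * a], for both signs, bounds the probability that [|W|]
    reaches [k] at a dyadic time by a multiple of [expR (- 2 * a * k)]. Weighted with
    [expR (a * (k + 1))] these probabilities form a geometric series with ratio [expR (- a)]; its
    sum of indicators is the dominating variable. *)
Lemma W_exp_dom a : 0 < a -> exists2 Z : Omega -> R, Ib Z &
  forall w u, 0 <= u -> u <= T -> expR (a * `|W u w|) <= Z w.
Proof.
move=> a0; pose c := 2 * a.
pose F (k n : nat) := [set w | exists2 i, (i <= 2 ^ n)%N & k%:R <= `|W (gr 0 T n i) w|].
pose x (k : nat) : R := expR (c * k%:R - c ^+ 2 * T / 2).
have g0 n i : 0 <= gr 0 T n i by exact: gr_ge0.
have gT n i : (i <= 2 ^ n)%N -> gr 0 T n i <= T.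
  rewrite leq_eqVlt => /orP[/eqP ->|h]; first by rewrite gr_top.
  by rewrite -{2}(gr_top 0 T n); apply/ltW/gr_lt.
have gS n i : gr 0 T n i <= gr 0 T n i.+1 by apply/ltW/gr_lt.
have mset (p : Omega -> R) (y : R) : mfun p -> measurable [set w | y <= p w].
  by move=> mp; rewrite -[X in measurable X]setTI; exact: measurable_fun_le.
have mex n (Q : nat -> set Omega) : (forall i, measurable (Q i)) -> measurable [set w | exists2 i, (i <= n)%N & Q i w].
  move=> mQ; rewrite (_ : [set _ | _] = \bigcup_(i in `I_n.+1) Q i); first exact: bigcup_measurable.
  by apply/seteqP; split=> w /= [i h1 h2]; exists i.
have mF k n : measurable (F k n).
  by apply: mex => i; apply: mset; apply: measurableT_comp => //; exact: W_meas.
have mNm (e : R) n i : mfun (Nm e (gr 0 T n i)) by apply: Ib_measurable; exact: Ib_Nm.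
pose E e k n := [set w | exists2 i, (i <= 2 ^ n)%N & x k <= Nm e (gr 0 T n i) w].
have mE e k n : measurable (E e k n) by apply: mex => i; apply: mset.
have x0 k : 0 < x k by exact: expR_gt0.
have pE e k n : pr (E e k n) <= (x k)^-1.
  rewrite -[leRHS]mul1r ler_pdivlMr // mulrC.
  exact: (Nm_maximal e (tt := gr 0 T n) (2 ^ n) (g0 n 0%N) (gS n) (ltW (x0 k))).
have pF k n : pr (F k n) <= 2 * (x k)^-1.
  have mU : measurable (E c k n `|` E (- c) k n) by exact: measurableU.
  apply: (@le_trans _ _ (pr (E c k n `|` E (- c) k n))).
    apply: pr_mono => // w [i i2 h].
    have gi := gT n i i2.
    have cT : c ^+ 2 * gr 0 T n i / 2 <= c ^+ 2 * T / 2.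
      by rewrite ler_wpM2r ?invr_ge0 // ler_wpM2l // sqr_ge0.
    have ck : c * k%:R <= c * `|W (gr 0 T n i) w| by rewrite ler_wpM2l // mulr_ge0 // ltW.
    have [W0'|W0'] := leP 0 (W (gr 0 T n i) w).
      left; exists i => //; rewrite /x /Nm ler_expR; move: ck; rewrite ger0_norm //; lra.
    right; exists i => //; rewrite /x /Nm ler_expR sqrrN mulNr; move: ck; rewrite ltr0_norm //; lra.
  rewrite (pr_split P mU (mE c k n)) setUK.
  rewrite [leRHS]mulr_natl mulr2n lerD //.
  apply: le_trans (pE (- c) k n); apply: pr_mono => //; first exact: measurableD.
  by move=> w [[]].
have Fnd k : {homo F k : n m / (n <= m)%N >-> (n <= m)%O}.
  move=> n m; move/subnK <-; elim: (m - n)%N => [|j IH]; first by rewrite add0n.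
  apply: le_trans IH _; rewrite addSn; apply/subsetPset => w [i i2 h]; exists i.*2.
    by rewrite expnS mul2n leq_double.
  by rewrite gr_double.
pose Fi k := \bigcup_n F k n.
have mFi k : measurable (Fi k) by exact: bigcup_measurable.
have pFi k : pr (Fi k) <= 2 * (x k)^-1.
  have cv := pr_nd (P := P) (mF k) (Fnd k).
  rewrite -(cvg_lim _ cv) //; apply: limr_le; first by apply/cvg_ex; exists (pr (Fi k)).
  by apply: nearW => n; exact: pF.
pose H m w := \sum_(k < m) expR (a * k.+1%:R) * \1_(Fi k) w.
have IH' k : Ib (fun w => expR (a * k.+1%:R) * \1_(Fi k) w) by apply: IbZ; exact: Ib_ind.
have IH m : Ib (H m).
  elim: m => [|m IH]; first by rewrite /H; under eq_fun do rewrite big_ord0; exact: Ib_cst.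
  by rewrite /H; under eq_fun do rewrite big_ord_recr /=; apply: IbD.
pose r := expR (- a).
have r0 : 0 <= r by exact: expR_ge0.
have r1 : r < 1 by rewrite /r expR_lt1 oppr_lt0.
pose q := 2 * expR (a + c ^+ 2 * T / 2).
have q0 : 0 <= q by rewrite mulr_ge0 // expR_ge0.
have EH m : Ex (H m) <= q * \sum_(k < m) r ^+ k.
  elim: m => [|m IHm].
    have -> : H 0%N = fun=> 0 by apply/funext => w; rewrite /H big_ord0.
    by rewrite big_ord0 mulr0 Ex_cst.
  rewrite (_ : Ex _ = Ex (H m) + Ex (fun w => expR (a * m.+1%:R) * \1_(Fi m) w)); last first.
    by rewrite -(ExD (IH m) (IH' m)); apply: eq_Ex => w; rewrite /H big_ord_recr.
  rewrite big_ord_recr /= mulrDr lerD // (ExZ _ (Ib_ind P (mFi m))) -/(pr (Fi m)).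
  apply: le_trans (ler_wpM2l (expR_ge0 _) (pFi m)) _.
  rewrite /q /r -expRM_natr -mulrA -expRD mulrCA ler_wpM2l // /x -expRN -expRD ler_expR.
  by rewrite -natr1 /c; lra.
have H0 m w : 0 <= H m w by apply: sumr_ge0 => k _; rewrite mulr_ge0 ?expR_ge0 // indicE.
have /choice[K hK] : forall w, exists K : nat, forall k, (K <= k)%N -> ~ Fi k w.
  move=> w; have [C C0 hC] := W_bounded w; exists (Num.trunc C).+1 => k Kk [n _ [i i2 h]].
  have := le_trans h (hC _ (g0 n i) (gT n i i2)); rewrite leNgt => /negP[].
  by apply: lt_le_trans (truncnS_gt C) _; rewrite ler_nat.
have Hc w m : (K w <= m)%N -> H m w = H (K w) w.
  move/subnK <-; elim: (m - K w)%N => // j IHj; rewrite addSn /H big_ord_recr /= -/(H _ w) IHj.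
  by rewrite indicE memNset ?mulr0 ?addr0 //; apply: hK; rewrite leq_addl.
have [||||IZ _] := @Ib_fatou _ _ _ P H (fun w => H (K w) w) (q * (1 - r)^-1).
- exact: IH.
- exact: H0.
- by move=> m; apply: le_trans (EH m) _; rewrite ler_wpM2l // geom_sum_le.
- by move=> w; apply: cvg_near_cst; exists (K w) => // m Km /=; exact: Hc.
exists (fun w => H (K w) w) => // w.
have grid n i : (i <= 2 ^ n)%N -> expR (a * `|W (gr 0 T n i) w|) <= H (K w) w.
  move=> i2; pose y : R := `|W (gr 0 T n i) w|; pose k := Num.trunc y.
  have /andP[k1 k2] : k%:R <= y < k.+1%:R by apply: truncn_itv; exact: normr_ge0.
  rewrite -/y.
  have Fk : Fi k w by exists n => //; exists i.
  have kK : (k < maxn (K w) k.+1)%N by rewrite leq_maxr.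
  rewrite -(Hc w (maxn (K w) k.+1) (leq_maxl _ _)) /H (bigD1 (Ordinal kK)) //=.
  rewrite indicE mem_set // mulr1; apply: ler_wpDr.
    by apply: sumr_ge0 => i' _; rewrite mulr_ge0 ?expR_ge0 // indicE.
  by rewrite ler_expR ler_wpM2l // ltW.
move=> u u0 uT.
pose k n := Num.trunc (2 ^+ n * (u / T)).
have p2 n : 0 < 2 ^+ n :> R by rewrite exprn_gt0.
have uT1 : u / T <= 1 by rewrite ler_pdivrMr // mul1r.
have uT0 : 0 <= u / T by rewrite divr_ge0 // ltW.
have kx n : (k n)%:R <= 2 ^+ n * (u / T) < (k n).+1%:R by apply: truncn_itv; rewrite mulr_ge0 // ltW.
have kn n : (k n <= 2 ^ n)%N.
  rewrite -(ler_nat R) natrX; have /andP[h _] := kx n; apply: (le_trans h).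
  by rewrite ler_piMr // ltW.
have cv : (fun n => expR (a * `|W (gr 0 T n (k n)) w|)) @ \oo --> expR (a * `|W u w|).
  apply: continuous_cvg; first exact: continuous_expR.
  apply: cvgMr; apply: cvg_norm; apply/cvgrPdist_lt => e e0.
  have [h h0 hh] := W_dist w u0 e0.
  have [N hN] := hf_small (divr_gt0 h0 T0).
  exists N => // n Nn /=; rewrite distrC; apply: hh => //.
  have e1 : u - gr 0 T n (k n) = T * (u / T - (k n)%:R / 2 ^+ n).
    by rewrite /gr add0r subr0 mulrBr [T * (u / T)]mulrC divfK // gt_eqF.
  have /andP[k1 k2] := kx n.
  have d1 : (k n)%:R / 2 ^+ n <= u / T by rewrite ler_pdivrMr // mulrC.
  have d2 : u / T - (k n)%:R / 2 ^+ n <= 2 ^- n.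
    rewrite lerBlDr -{1}[2 ^- n]mul1r -mulrDl [1 + _]addrC natr1 ler_pdivlMr //.
    by rewrite mulrC ltW.
  rewrite distrC ger0_norm e1; last by rewrite mulr_ge0 ?subr_ge0 // ltW.
  apply: le_lt_trans (ler_wpM2l (ltW T0) d2) _.
  by have := hN n Nn; rewrite /hf exprVn ltr_pdivlMr // mulrC.
rewrite -(cvg_lim _ cv) //; apply: limr_le; first by apply/cvg_ex; eexists; exact: cv.
by apply: nearW => n; exact: grid.
Qed.

Lemma Nm_dom c : exists2 Z : Omega -> R, Ib Z & forall w u, 0 <= u -> u <= T -> `|Nm c u w| <= Z w.
Proof.
have [|Z IZ hZ] := @W_exp_dom (`|c| + 1); first by rewrite ltr_wpDl.
exists Z => // w u u0 uT; rewrite ger0_norm ?expR_ge0 //; apply: le_trans (hZ w u u0 uT).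
rewrite /Nm ler_expR; apply: (@le_trans _ _ (`|c| * `|W u w|)).
  apply: (@le_trans _ _ (c * W u w)); last by rewrite -normrM ler_norm.
  by rewrite gerBl divr_ge0 // mulr_ge0 // sqr_ge0.
by rewrite ler_wpM2r // lerDl.
Qed.

Lemma Nm_ost c tau A : stopt T Fc tau -> Fat Fc tau A ->
  Ib (fun w => \1_A w * Nm c (tau w) w) /\
  Ex (fun w => \1_A w * Nm c (tau w) w) = Ex (fun w => \1_A w * Nm c T w).
Proof.
move=> st FA; have mA : measurable A by apply: (@Fc_meas T); exact: (Fat_setT st FA).
have [Z IZ hZ] := Nm_dom c.
have t0 w : 0 <= tau w by exact: stopt_ge0 st.
have tT w : tau w <= T by exact: stopt_leT st.
have p2 n : 0 < 2 ^+ n :> R by rewrite exprn_gt0.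
pose j n w := Num.trunc (2 ^+ n * (tau w / T)).
have jx n w : (j n w)%:R <= 2 ^+ n * (tau w / T) < (j n w).+1%:R.
  by apply: truncn_itv; rewrite mulr_ge0 // ?divr_ge0 // ltW.
pose tn n w := Num.min (gr 0 T n (j n w).+1) T.
have g0 n i : 0 <= gr 0 T n i by exact: gr_ge0.
have gT n i : (i <= 2 ^ n)%N -> gr 0 T n i <= T.
  rewrite leq_eqVlt => /orP[/eqP ->|h]; first by rewrite gr_top.
  by rewrite -{2}(gr_top 0 T n); apply/ltW/gr_lt.
have tn0 n w : 0 <= tn n w by rewrite le_min g0 ltW.
have tnT n w : tn n w <= T by rewrite min_leR.
have grx n i w : (gr 0 T n i <= tau w) = (i%:R <= 2 ^+ n * (tau w / T)).
  rewrite /gr add0r subr0 [T * _]mulrC -ler_pdivlMr // ler_pdivrMr //.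
  by rewrite [in RHS]mulrC.
have near n w : tau w <= tn n w /\ tn n w - tau w <= T / 2 ^+ n.
  have /andP[j1 j2] := jx n w; split.
    by rewrite le_min tT andbT leNgt; apply/negP => /ltW; rewrite grx leNgt j2.
  apply: (@le_trans _ _ (gr 0 T n (j n w).+1 - tau w)); first by rewrite lerD2r min_leL.
  rewrite -grx in j1; rewrite lerBlDl; apply: le_trans (lerD j1 (lexx _)).
  by rewrite /gr !add0r subr0 -natr1 mulrDl mul1r mulrDr.
have NT : Ib (Nm c T) by apply: Ib_Nm; exact: ltW.
have tau_lt u : measurable (A `&` [set w | tau w < u]).
  exact: (Fc_meas (Fat_lt Fc_sigma Fc_mono u st FA)).
pose OK n B := Ib (fun w => \1_B w * Nm c (tn n w) w) /\
  Ex (fun w => \1_B w * Nm c (tn n w) w) = Ex (fun w => \1_B w * Nm c T w).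
have glue n B B' : B `<=` B' -> measurable B -> measurable B' -> OK n B -> OK n (B' `\` B) ->
    OK n B'.
  move=> sub mB mB' [I1 E1] [I2 E2].
  have split' (f : Omega -> R) :
      (fun w => \1_B' w * f w) = fun w => \1_B w * f w + \1_(B' `\` B) w * f w.
    apply/funext => w; rewrite -mulrDl; congr (_ * _); rewrite !indicE in_setD.
    case: (boolP (w \in B)) => [/set_mem/sub/mem_set -> /=|_]; first by rewrite addr0.
    by rewrite /= andbT add0r.
  rewrite /OK !split'; split; first exact: IbD.
  rewrite !ExD ?E1 ?E2 //; apply: Ib_indic => //; exact: measurableD.
have C n k : (k <= 2 ^ n)%N -> OK n (A `&` [set w | tau w < gr 0 T n k]).
  elim: k => [|k IHk] kn.
    have z (f : Omega -> R) : (fun w => \1_(A `&` [set w | tau w < gr 0 T n 0]) w * f w) = fun=> 0.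
      apply/funext => w; rewrite indicE memNset ?mul0r // => -[_ /=].
      by rewrite gr0 ltNge t0.
    by rewrite /OK !z; split=> //; exact: Ib_cst.
  have kk : gr 0 T n k <= gr 0 T n k.+1 by apply/ltW/gr_lt.
  apply: (glue _ _ _ _ (tau_lt _) (tau_lt _) (IHk (ltnW kn))) => [w [Aw h]|].
    by split=> //; exact: lt_le_trans h kk.
  set D := _ `\` _.
  have FD : FW (gr 0 T n k.+1) D.
    have h i : (i <= k.+1)%N -> FW (gr 0 T n k.+1) (A `&` [set w | tau w < gr 0 T n i]).
      move=> ik; have := Fat_lt Fc_sigma Fc_mono (gr 0 T n i) st FA.
      rewrite /Fc cl_id ?gT //; last exact: leq_trans kn.
      by apply: FW_mono; move: ik; rewrite leq_eqVlt => /orP[/eqP ->|] // /gr_lt/ltW; apply.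
    by apply: (sigma_setD (FW_sigma _)); exact: h.
  have eD : (fun w => \1_D w * Nm c (tn n w) w) = fun w => \1_D w * Nm c (gr 0 T n k.+1) w.
    apply/funext => w; rewrite indicE.
    case: (boolP (w \in D)) => [/set_mem[[Aw /= lt1] nB]|_]; last by rewrite !mul0r.
    have ge1 : gr 0 T n k <= tau w by rewrite leNgt; apply/negP => h; apply: nB.
    have ej : j n w = k.
      apply: truncn_def; rewrite -grx ge1 /=; rewrite ltNge -grx -ltNge; exact: lt1.
    by rewrite /tn ej (min_idPl (gT _ _ kn)).
  rewrite /OK eD; split; first by apply: Ib_indic; [exact: measurableD|exact: Ib_Nm].
  by rewrite (Nm_mart c (g0 n k.+1) (gT _ _ kn) FD).
have Etn n : OK n A.
  have := C n (2 ^ n)%N (leqnn _); rewrite gr_top => h.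
  apply: (glue _ _ _ (@subIsetl _ _ _) (tau_lt _) mA h); set D := _ `\` _.
  have eD : (fun w => \1_D w * Nm c (tn n w) w) = fun w => \1_D w * Nm c T w.
    apply/funext => w; rewrite indicE.
    case: (boolP (w \in D)) => [/set_mem[Aw nB]|_]; last by rewrite !mul0r.
    have [h1 _] := near n w; rewrite (_ : tn n w = T) //; apply: le_anti; rewrite tnT /=.
    by apply: le_trans h1; rewrite leNgt; apply/negP => h2; apply: nB.
  by rewrite /OK eD; split=> //; apply: Ib_indic => //; exact: measurableD.
have [||||I0 /=] := @Ex_dct _ _ _ P (fun n w => \1_A w * Nm c (tn n w) w)
   (fun w => \1_A w * Nm c (tau w) w) Z.
- by move=> n; have [h _] := Etn n; exact: Ib_measurable h.
- exact: IZ.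
- move=> n w; rewrite indicE; case: (w \in A); rewrite ?mul1r ?mul0r ?normr0; first exact: hZ.
  exact: le_trans (normr_ge0 _) (hZ w 0 (lexx 0) (ltW T0)).
- move=> w; apply: cvgMr.
  have ctn : (fun n => tn n w) @ \oo --> tau w.
    apply/cvgrPdist_lt => e e0; have [N hN] := hf_small (divr_gt0 e0 T0).
    exists N => // n Nn /=; have [h1 h2] := near n w; rewrite distrC ger0_norm ?subr_ge0 //.
    apply: le_lt_trans h2 _.
    by have := hN n Nn; rewrite /hf exprVn ltr_pdivlMr // mulrC.
  apply: continuous_cvg; first exact: continuous_expR.
  apply: cvgB; last by apply: cvgMl; apply: cvgMr.
  apply: cvgMr; apply/cvgrPdist_lt => e e0.
  have [h h0 hh] := W_dist w (t0 w) e0.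
  have /cvgrPdist_lt /(_ h h0) [N _ hN] := ctn.
  by exists N => // n Nn /=; rewrite distrC; apply: hh => //; rewrite distrC; exact: hN.
under eq_fun do rewrite (proj2 (Etn _)).
by move=> h; split=> //; exact: cvg_unique h (cvg_cst _).
Qed.

End Stopped.

(** * The Black-Scholes market *)

Section BlackScholes.
Variables (T kappa theta delta mu : R) (F G : (R -> R) -> (R -> R)) (s : R).
Hypotheses (T0 : 0 < T) (kap0 : 0 < kappa) (dl0 : 0 < delta) (mu0 : 0 < mu) (mu1 : mu < 1).
Hypothesis FG : game_payoffs T F G.
Hypothesis s0 : 0 < s.
Local Notation cl := (cl T).
Local Notation Fc := (Fc T).

Definition path w t := stock s kappa theta W t w.

Lemma Wcl_cont w : continuous (fun t => W (cl t) w).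
Proof.
move=> x; apply/cvgrPdist_lt => e e0.
have [h h0 hh] := W_dist w (cl_ge0 T x) e0.
near=> v; rewrite distrC; apply: hh; first exact: cl_ge0.
apply: le_lt_trans (cl_dist _ _ (ltW T0)) _.
by rewrite distrC; near: v; exact: cvgr_dist_lt.
Unshelve. all: by end_near. Qed.

Lemma expW_cont (a b : R) w : continuous (fun t => expR (a * W (cl t) w + b * cl t)).
Proof.
move=> x; have h : (a * W (cl t) w + b * cl t) @[t --> x] --> a * W (cl x) w + b * cl x.
  by apply: cvgD; apply: cvgMr; [exact: Wcl_cont|exact: (cl_cont (f := idfun) (ltW T0) (fun=> cvg_id))].
by apply: (cvg_comp _ _ h); exact: continuous_expR.
Qed.

Lemma path_cont w : continuous (fun t => path w (cl t)).
Proof. by move=> x; apply: cvgMr; exact: expW_cont. Qed.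

Arguments path_cont : clear implicits.

Lemma path_C w : Cspace T (path w).
Proof.
apply/subspace_continuousP => x; rewrite /= in_itv /= => /andP[x0 xT].
apply/cvgrPdist_lt => e e0.
have [h h0 hh] := continuous_dist x (path_cont w) e0.
exists h => //= v; rewrite /= distrC => vx; rewrite in_itv /= => /andP[v0 vT].
by have := hh v vx; rewrite !cl_id // distrC.
Qed.

Arguments path_C : clear implicits.

Lemma mG_expW (a b : R) t : 0 <= t -> mG (FW t) (fun w => expR (a * W t w + b * t)).
Proof.
move=> t0; apply: (mG_comp (f := fun y => expR (a * y + b * t))).
  by apply: measurableT_comp => //; apply: measurable_funD => //; exact: measurable_funM.
apply: (mG_sub (sW_sigma t) (FW_sigma t)); first exact: sW_FW.
exact: mG_W.
Qed.

Lemma mG_path t u : 0 <= t -> t <= u -> mG (FW u) (fun w => path w t).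
Proof.
move=> t0 tu; apply: (mG_sub (FW_sigma t) (FW_sigma u) (FW_mono tu)).
by apply: mGM; [exact: mG_cst|exact: mG_expW].
Qed.

Lemma payoff_ad (H : (R -> R) -> R -> R) t : payoff_functional T H -> mG (Fc t) (fun w => H (path w) (cl t)).
Proof.
move=> pH; apply: (@mG_functional _ T H (fun v w => path w v) _ (FW_sigma _) T0 pH path_C).
- exact: cl_ge0.
- exact/cl_leT/ltW.
- by move=> v v0 vu; exact: mG_path.
Qed.

Lemma payoff_cont (H : (R -> R) -> R -> R) w : payoff_functional T H -> continuous (fun t => H (path w) (cl t)).
Proof.
move=> [hC _]; apply: (@Cspace_stop T) => //; [exact: (hC _ (path_C w))|exact: ltW].
Qed.

(** The price path is at most a constant times the exponential of [kappa * |W|]; after polynomial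
    growth of order [p], [W_exp_dom] with exponent [kappa * p] dominates it. *)
Lemma payoff_bound : exists2 Z : Omega -> R, Ib Z & forall w t, 0 <= t -> t <= T ->
  `|G (path w) t| <= Z w /\ `|F (path w) t| <= Z w.
Proof.
have [pF [pG [_ [C [p [C0 p0 bd]]]]]] := FG.
pose b := theta - kappa ^+ 2 / 2; pose K := s * expR (`|b| * T).
have K0 : 0 <= K by rewrite mulr_ge0 ?expR_ge0 // ltW.
have pk : 0 < kappa * p by rewrite mulr_gt0.
have [Z IZ hZ] := W_exp_dom T0 pk.
exists (fun w => C * (1 + K `^ p * Z w)).
  by apply: IbZ; apply: IbD; [exact: Ib_cst|exact: IbZ].
move=> w t t0 tT.
have Z0 : 0 <= Z w by apply: le_trans (expR_ge0 _) (hZ w 0 (lexx 0) (ltW T0)).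
have Sp : supnorm T (path w) `^ p <= K `^ p * Z w.
  have -> : K `^ p * Z w = (K * Z w `^ p^-1) `^ p.
    by rewrite powRM ?powR_ge0 // -powRrM mulVf ?gt_eqF // powRr1.
  apply: ge0_ler_powR; rewrite ?nnegrE ?(ltW p0) //.
  - exact: (supnorm_ge0 (ltW T0) (path_C w)).
  - by rewrite mulr_ge0 // powR_ge0.
  apply: (supnorm_le (ltW T0)) => v v0 vT; rewrite ger0_norm; last by rewrite mulr_ge0 ?expR_ge0 // ltW.
  rewrite /path /stock /K -mulrA ler_pM2l // expRD mulrC; apply: ler_pM; rewrite ?expR_ge0 //.
    rewrite ler_expR; apply: (@le_trans _ _ (`|b| * v)); first by rewrite ler_wpM2r // ler_norm.
    by rewrite ler_wpM2l.
  have -> : expR (kappa * W v w) = expR (kappa * p * W v w) `^ p^-1.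
    by rewrite -expRM; congr expR; rewrite mulrAC mulrK // unitfE gt_eqF.
  apply: ge0_ler_powR; rewrite ?nnegrE ?expR_ge0 ?invr_ge0 ?(ltW p0) //.
  apply: le_trans (hZ w v v0 vT); rewrite ler_expR; exact: (ler_wpM2l (ltW pk) (ler_norm _)).
have h := bd _ (path_C w).
have hF := supnorm_ge (ltW T0) (proj1 pF _ (path_C w)) t0 tT.
have hG := supnorm_ge (ltW T0) (proj1 pG _ (path_C w)) t0 tT.
have B : C * (1 + supnorm T (path w) `^ p) <= C * (1 + K `^ p * Z w) by rewrite ler_pM2l // lerD2l.
have F0 := le_trans (normr_ge0 _) hF; have G0 := le_trans (normr_ge0 _) hG.
split; apply: le_trans B; apply: le_trans h.
  by apply: (le_trans hG); rewrite lerDr.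
by apply: (le_trans hF); rewrite lerDl.
Qed.

(** The market price of risk: [Nm (- lam)] is the Girsanov density under which the price has no
    drift. *)
Let lam := theta / kappa.

Lemma density_stock t w : 0 <= t -> t <= T ->
  Nm (- lam) (cl t) w * path w (cl t) = s * Nm (kappa - lam) t w.
Proof.
move=> t0 tT; rewrite cl_id // /Nm /path /stock mulrCA -expRD; congr (_ * expR _).
by rewrite /lam; field; rewrite gt_eqF.
Qed.

Lemma density_int tau : stopt T Fc tau -> Ib (fun w => Nm (- lam) (cl (tau w)) w) /\
  Ib (fun w => Nm (- lam) (cl (tau w)) w * path w (cl (tau w))).
Proof.
move=> st; have FT : Fat Fc tau setT by apply: (sigma_setT (Fat_sigma (Fc_sigma T) st)).
have t0 w := stopt_ge0 w st; have tT w := stopt_leT w st.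
split.
  have [I1 _] := Nm_ost T0 (- lam) st FT; move: I1; apply: eq_integrable => // w _ /=.
  by rewrite indicT mul1r cl_id.
have [I1 _] := Nm_ost T0 (kappa - lam) st FT; have := IbZ s I1; apply: eq_integrable => // w _ /=.
by rewrite indicT mul1r density_stock.
Qed.

Lemma density_mart tau A : stopt T Fc tau -> Fat Fc tau A ->
  Ex (fun w => \1_A w * Nm (- lam) (cl (tau w)) w) = Ex (fun w => \1_A w * Nm (- lam) (cl T) w) /\
  Ex (fun w => \1_A w * (Nm (- lam) (cl (tau w)) w * path w (cl (tau w)))) =
  Ex (fun w => \1_A w * (Nm (- lam) (cl T) w * path w (cl T))).
Proof.
move=> st FA; have t0 w := stopt_ge0 w st; have tT w := stopt_leT w st.
have mA : measurable A by apply: (@Fc_meas T T); exact: (Fat_setT st FA).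
have TT := ltW T0.
split.
  have [_ E1] := Nm_ost T0 (- lam) st FA.
  rewrite (_ : Ex _ = Ex (fun w => \1_A w * Nm (- lam) (tau w) w)); last by apply: eq_Ex => w; rewrite cl_id.
  by rewrite E1; apply: eq_Ex => w; rewrite cl_id.
have [I1 E1] := Nm_ost T0 (kappa - lam) st FA.
rewrite (_ : Ex _ = Ex (fun w => s * (\1_A w * Nm (kappa - lam) (tau w) w))); last first.
  by apply: eq_Ex => w; rewrite density_stock // mulrCA.
rewrite (ExZ s I1) E1 -(ExZ s (Ib_indic mA (Ib_Nm (kappa - lam) TT))).
by apply: eq_Ex => w; rewrite density_stock // mulrCA.
Qed.

Lemma path_gt0 w t : 0 < path w t. Proof. by rewrite mulr_gt0 // expR_gt0. Qed.

Lemma payoffs_le t w : F (path w) (cl t) <= G (path w) (cl t).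
Proof. by have [_ [_ [h _]]] := FG; apply: h; [exact: path_C|exact: cl_ge0|exact/cl_leT/ltW]. Qed.

Lemma Nm_cont c w : continuous (fun t => Nm c (cl t) w).
Proof.
rewrite (_ : (fun t => _) = fun t => expR (c * W (cl t) w + (- (c ^+ 2 / 2)) * cl t)).
  exact: expW_cont.
by apply/funext => t; rewrite /Nm; congr expR; rewrite mulNr mulrAC.
Qed.

Lemma Nm_ad c t : mG (Fc t) (Nm c (cl t)).
Proof.
rewrite (_ : Nm c (cl t) = fun w => expR (c * W (cl t) w + (- (c ^+ 2 / 2)) * cl t)).
  by apply: mG_expW; exact: cl_ge0.
by apply/funext => w; rewrite /Nm; congr expR; rewrite mulNr mulrAC.
Qed.

Lemma bs_market : exists M : market R Omega,
  [/\ mP M = P, mT M = T, mFi M = Fc, mdl M = delta & mmu M = mu] /\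
  [/\ forall t w, mS M t w = path w (cl t), forall t w, mX M t w = G (path w) (cl t) &
      forall t w, mY M t w = F (path w) (cl t)].
Proof.
have [pF [pG _]] := FG; have [Z IZ hZ] := payoff_bound.
have hX t w : `|G (path w) (cl t)| <= Z w by have [] := hZ w (cl t) (cl_ge0 T t) (cl_leT t (ltW T0)).
have hY t w : `|F (path w) (cl t)| <= Z w by have [] := hZ w (cl t) (cl_ge0 T t) (cl_leT t (ltW T0)).
by exists (@Market R d Omega P T Fc delta mu (fun t w => path w (cl t)) (fun t w => G (path w) (cl t))
  (fun t w => F (path w) (cl t)) (fun t w => Nm (- lam) (cl t) w) Z T0 (Fc_sigma T)
  (fun u v uv => @Fc_mono T u v uv) (@Fc_meas T)
  (fun u A => @Fc_rc T T0 u A)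
  dl0 mu0 mu1 path_cont (fun w => payoff_cont (w := w) pG) (fun w => payoff_cont (w := w) pF) (fun w => Nm_cont (c := - lam) (w := w))
  (fun t => mG_path (cl_ge0 T t) (lexx _)) (fun t => payoff_ad t pG) (fun t => payoff_ad t pF) (Nm_ad (- lam))
  (fun t w => path_gt0 w (cl t)) (fun t w => expR_gt0 _) payoffs_le hX hY IZ density_int density_mart).
Qed.

End BlackScholes.

End Brownian.

Lemma cvg_maxr (u : nat -> R) (a x : R) : u @ \oo --> x ->
  (fun n => Num.max a (u n)) @ \oo --> Num.max a x.
Proof.
move=> ux; have e (v : R) : Num.max a v = (a + v + `|a - v|) / 2.
  by rewrite maxr_absE.
rewrite e (_ : (fun n => _) = fun n => (a + u n + `|a - u n|) / 2); last by apply/funext => n; rewrite e.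
apply: cvgMl; apply: cvgD; first by apply: cvgD => //; exact: cvg_cst.
by apply: cvg_norm; apply: cvgB => //; exact: cvg_cst.
Qed.

Lemma sum_diff1 n (f g : 'I_n -> R) j : (forall k, k != j -> f k = g k) ->
  \sum_(k < n) f k - \sum_(k < n) g k = f j - g j.
Proof.
move=> e; rewrite -sumrB (bigD1 j) //= big1 ?addr0 // => k /e ->.
exact: subrr.
Qed.

Lemma legal_price (T delta mu : R) (S S' : R -> R) n t k b K B : legal T delta mu S n t k b K B ->
  (forall u, t <= u -> u < T -> S' u = S u) -> legal T delta mu S' n t k b K B.
Proof.
elim=> {n t k b K B} [n t k b K B hc _|n t k b v k' b' K B tv vT hc tr leg IH e].
  exact: legal_hold.
apply: (legal_jump (s := v) tv vT hc (k' := k') (b' := b')); first by rewrite e.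
by apply: IH => u vu; apply: e; exact: le_trans vu.
Qed.

(** * From trading strategies to paths of cash and shares *)

Section StepPaths.
Variables (T delta mu : R).
Hypotheses (T0 : 0 < T) (delta0 : 0 < delta) (mu0 : 0 < mu).
Variables (S f : R -> R) (s z y : R).
Hypothesis S0 : forall u, 0 <= S u.
Hypotheses (Ss : S 0 = s) (fy : f 0 = y).
Local Notation legal := (legal T delta mu S).
Local Notation tc := (tcost delta mu).
Implicit Types (u v : R) (K B : R -> R).

Lemma step_inc n (tau : nat -> R) i j : (forall k, (k < n)%N -> tau k < tau k.+1) ->
  (i <= j)%N -> (j <= n)%N -> tau i <= tau j.
Proof.
move=> ti ij; rewrite -(subnK ij); elim: (j - i)%N => // q IH.
rewrite addSn => qn; apply: le_trans (ltW (ti _ qn)); apply: IH; exact: ltnW.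
Qed.

Lemma legal_steps n t k b K B : legal n t k b K B -> t <= T -> exists m (tau : nat -> R) (c : nat -> R),
  [/\ tau 0%N = t, tau m = T, (forall k, (k < m)%N -> tau k < tau k.+1) &
      (forall k u, (k < m)%N -> tau k < u -> u <= tau k.+1 -> B u = c k)].
Proof.
have cons t' v b' B' m (tau c : nat -> R) : t' < v -> (forall u, t' < u -> u <= v -> B' u = b') ->
    [/\ tau 0%N = v, tau m = T, (forall k, (k < m)%N -> tau k < tau k.+1) &
      (forall k u, (k < m)%N -> tau k < u -> u <= tau k.+1 -> B' u = c k)] ->
    exists m (tau : nat -> R) (c : nat -> R),
    [/\ tau 0%N = t', tau m = T, (forall k, (k < m)%N -> tau k < tau k.+1) &
      (forall k u, (k < m)%N -> tau k < u -> u <= tau k.+1 -> B' u = c k)].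
  move=> tv hc [t0 tm ti tB].
  exists m.+1, (fun i => if i is j.+1 then tau j else t'), (fun i => if i is j.+1 then c j else b').
  split=> // [[|i]|[|i] u] //=; rewrite ?t0 ?ltnS //; first exact: ti.
  - by move=> _; exact: hc.
  - exact: tB.
elim=> {n t k b K B} [n t k b K B hc tT|n t k b v k' b' K B tv vT hc tr leg IH tT].
  have [tT'|Tt] := ltP t T; last first.
    have e : t = T by apply: le_anti; rewrite tT Tt.
    by exists 0%N, (fun=> T), (fun=> 0); split.
  apply: (@cons t T b B 0%N (fun=> T) (fun=> 0)) => // u tu uT.
  by case: (hc u tu uT).
have [m [tau [c h]]] := IH (ltW vT).
have [tv'|vt] := ltP t v.
  have hb u : t < u -> u <= v -> B u = b by move=> tu uv; case: (hc u tu uv).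
  exact: (cons t v b B m tau c tv' hb h).
have e : v = t by apply: le_anti; rewrite tv vt.
by exists m, tau, c; rewrite -e.
Qed.

(** Solves the definition of [value] for the cash account, so that [value] becomes the liquidation
    value of this cash and [f u] shares. *)
Definition cash u := value T delta mu s z y S f u + tc (f u) (S u) - f u * S u.

Hypothesis sp : step_path T f.

(** [step_integral] and [step_costs] use a decomposition obtained by choice. It is fixed here once
    for both and turned into a recursion along its intervals. *)
Lemma cash_steps : exists n (tau : nat -> R) (c : nat -> R), [/\ step_data T f (n, tau, c),
  cash 0 = z + tc y s - y * s &
  forall j u, (j < n)%N -> tau j < u -> u <= tau j.+1 ->
  cash u = cash (tau j) - (c j - f (tau j)) * S (tau j) - tc (c j - f (tau j)) (S (tau j))].
Proof.
pose I (n : nat) (tau c : nat -> R) u : R :=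
  \sum_(k < n) c k * (S (Num.min (tau k.+1) u) - S (Num.min (tau k) u)).
pose Q (n : nat) (tau c : nat -> R) u : R :=
  \sum_(k < n | tau k < u) tc (c k - f (tau k)) (S (tau k)).
have [n [tau [c [D EI EQ]]]] : exists n tau c, [/\ step_data T f (n, tau, c),
    forall u, step_integral T f S u = I n tau c u & forall u, step_costs T delta mu f S u = Q n tau c u].
  rewrite /step_integral /step_costs; case: pselect => // h.
  case: (cid h) => -[[n tau] c] D /=.
  by exists n, tau, c.
have [t0 tn ti tB] := D.
have tinc i j : (i <= j)%N -> (j <= n)%N -> tau i <= tau j := step_inc ti (i := i) (j := j).
have tge j : (j <= n)%N -> 0 <= tau j by move=> jn; rewrite -t0; exact: tinc.
have eC u : cash u = z + tc y s + I n tau c u - Q n tau c u - f u * S u.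
  by rewrite /cash /value EI EQ; ring.
exists n, tau, c; split=> //.
  rewrite eC fy Ss.
  have -> : I n tau c 0 = 0.
    rewrite /I big1 // => k _; rewrite !(min_idPr _) ?subrr ?mulr0 //; apply: tge => //.
    exact: ltnW.
  have -> : Q n tau c 0 = 0.
    by rewrite /Q big1 // => k; rewrite ltNge tge // ltnW.
  by rewrite addr0 subr0.
move=> j u jn ju uj; rewrite !eC (tB j u jn ju uj).
have -> : I n tau c u = I n tau c (tau j) + c j * (S u - S (tau j)).
  have := @sum_diff1 n (fun k => c k * (S (Num.min (tau k.+1) u) - S (Num.min (tau k) u)))
    (fun k => c k * (S (Num.min (tau k.+1) (tau j)) - S (Num.min (tau k) (tau j)))) (Ordinal jn).
  rewrite -/(I n tau c u) -/(I n tau c (tau j)) /= => e; apply/eqP; rewrite addrC -subr_eq; apply/eqP.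
  rewrite e; last first.
    move=> k; rewrite -val_eqE /= neq_ltn => /orP[kj|jk].
      have h1 := tinc k.+1 j kj (ltnW jn); have h2 := tinc k j (ltnW kj) (ltnW jn).
      by rewrite !(min_idPl _) // ?(le_trans _ (ltW ju)).
    have h1 := tinc j.+1 k jk (ltnW (ltn_ord k)).
    have h2 := tinc j.+1 k.+1 (ltnW jk) (ltn_ord k).
    by rewrite !(min_idPr _) ?subrr //; apply: le_trans uj _ || apply: le_trans (le_trans (ltW ju) uj) _.
  rewrite (min_idPr uj) (min_idPl (ltW ju)) (min_idPr (tinc j j.+1 (leqnSn j) jn)) minxx; ring.
have -> : Q n tau c u = Q n tau c (tau j) + tc (c j - f (tau j)) (S (tau j)).
  have := @sum_diff1 n (fun k => if tau k < u then tc (c k - f (tau k)) (S (tau k)) else 0)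
    (fun k => if tau k < tau j then tc (c k - f (tau k)) (S (tau k)) else 0) (Ordinal jn).
  rewrite /= -!big_mkcond -/(Q n tau c u) -/(Q n tau c (tau j)) => e; apply/eqP; rewrite addrC -subr_eq; apply/eqP.
  rewrite e; last first.
    move=> k; rewrite -val_eqE /= neq_ltn => /orP[kj|jk].
      have h1 : tau k < tau j by apply: lt_le_trans (ti k (ltn_ord k)) (tinc _ _ kj (ltnW jn)).
      by rewrite h1 (lt_trans h1 ju).
    have h1 : u <= tau k by apply: le_trans uj (tinc _ _ jk (ltnW (ltn_ord k))).
    by rewrite !ltNge h1 (le_trans (ltW ju) h1).
  by rewrite ju ltxx subr0.
ring.
Qed.

(** A decomposition may contain points without a jump; these are not counted as actions, since an
    action would cost [delta]. *)
Lemma cash_legal : exists n, legal n 0 (z + tc y s - y * s) y cash f.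
Proof.
have [n [tau [c [[t0 tn ti tB] C0 CS]]]] := cash_steps.
suff H i : (i <= n)%N -> exists m, legal m (tau (n - i)%N) (cash (tau (n - i)%N)) (f (tau (n - i)%N)) cash f.
  by have := H n (leqnn n); rewrite subnn t0 C0 fy.
elim: i => [_|i IH lin].
  by exists 0%N; rewrite subn0 tn; apply: legal_hold => u Tu; rewrite leNgt Tu.
have [m] := IH (ltnW lin); set j := (n - i.+1)%N.
have jn : (j < n)%N by rewrite /j ltn_subrL; case: (n) lin.
have -> : (n - i)%N = j.+1 by rewrite /j subnS prednK // subn_gt0.
have jj := ti j jn.
have e1 := tB j _ jn jj (lexx _); have e2 := CS j _ jn jj (lexx _) => leg.
have hc u : tau j < u -> u <= tau j.+1 -> cash u = cash (tau j.+1) /\ f u = f (tau j.+1).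
  by move=> u1 u2; rewrite (CS j u) // e2 (tB j u) // e1.
have leg' := legal_extend leg (ltW jj) hc.
have [e|ne] := eqVneq (c j) (f (tau j)).
  by exists m; move: leg'; rewrite e2 e1 e subrr mul0r tcost0 !subr0.
have jT : tau j < T.
  by rewrite -tn; apply: lt_le_trans jj _; exact: (step_inc ti).
exists m.+1; apply: (legal_jump (lexx _) jT _ _ leg').
  by move=> u u1 u2; move: (lt_le_trans u1 u2); rewrite ltxx.
by rewrite /trade e2 e1 tcost_neq0 // subr_eq0.
Qed.

(** The shares are constant on each interval of the decomposition, so [legal_cash_le] bounds the
    cash by that of a single trade at its left end: a legal path can only waste money. *)
Lemma cash_le n K : legal n 0 (z + tc y s - y * s) y K f ->
  forall u, 0 < u -> u <= T -> K u <= cash u.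
Proof.
have [m [tau [c [[t0 tn ti tB] C0 CS]]]] := cash_steps => leg.
suff H j : (j <= m)%N -> forall u, 0 < u -> u <= tau j -> u <= T -> K u <= cash u.
  by move=> u u0 uT; apply: (H m) => //; rewrite tn.
elim: j => [_ u u0|j IH jm u u0 uj uT].
  by rewrite t0 leNgt u0.
have [h|ju] := leP u (tau j); first exact: IH (ltnW jm) u u0 h uT.
rewrite (CS j u) //.
have tj : 0 <= tau j.
  by rewrite -t0; apply: (step_inc ti) => //; exact: ltnW.
have hc v : tau j < v -> v <= u -> f v = c j by move=> v1 v2; apply: tB => //; exact: le_trans v2 uj.
move: tj; rewrite le_eqVlt => /orP[/eqP e|tj].
  have := @legal_cash_le R T delta mu delta0 mu0 S n 0 _ _ K f u (c j) S0 leg u0 uT.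
  rewrite -e fy C0; apply=> v v0; apply: hc; by rewrite -e.
have [q leg'] := legal_at leg tj (ltW (lt_le_trans ju uT)).
have h := @legal_cash_le R T delta mu delta0 mu0 S q _ _ _ K f u (c j) S0 leg' ju uT hc.
apply: (le_trans h); rewrite !lerD2r; apply: (IH (ltnW jm)) => //.
exact: ltW (lt_le_trans ju uT).
Qed.

Let grid N (i : nat) : R := i%:R * (T / N.+1%:R).

(** The jump times in [cash_steps] are chosen path by path, without measurability. This sum uses
    deterministic times only; it converges to the cash and thereby shows that the cash is
    adapted. *)
Definition grid_cash N u : R := (z + tc y s - y * s) - \sum_(i < N.+1)
  ((f (Num.min (grid N i.+1) u) - f (Num.min (grid N i) u)) * S (Num.min (grid N i) u) +
   tc (f (Num.min (grid N i.+1) u) - f (Num.min (grid N i) u)) (S (Num.min (grid N i) u))).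

Hypothesis Sc : forall (v : nat -> R) u, (forall n, 0 <= v n <= T) -> 0 <= u <= T ->
  v @ \oo --> u -> (fun n => S (v n)) @ \oo --> S u.

(* Passing from [tau j] to a later time before [tau j.+1] changes a single term of the
   grid sum, the one whose interval contains [tau j]. *)
Lemma grid_cash_cvg u : 0 <= u -> u <= T -> grid_cash ^~ u @ \oo --> cash u.
Proof.
have [m [tau [c [[t0 tn ti tB] C0 CS]]]] := cash_steps.
have g0 N i : 0 <= grid N i by rewrite mulr_ge0 // divr_ge0 // ltW.
have gm N i j : (i <= j)%N -> grid N i <= grid N j.
  by move=> ij; rewrite ler_wpM2r ?ler_nat // divr_ge0 // ltW.
suff H j : (j <= m)%N -> forall u, 0 <= u -> u <= tau j -> u <= T -> grid_cash ^~ u @ \oo --> cash u.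
  by move=> v0 vT; apply: (H m) => //; rewrite tn.
elim: j => [_ v v0|j IH jm v v0 vj vT].
  rewrite t0 => v0' _; have -> : v = 0 by apply: le_anti; rewrite v0 v0'.
  rewrite (_ : grid_cash ^~ 0 = fun=> cash 0); first exact: cvg_cst.
  apply/funext => N; rewrite /grid_cash big1 ?subr0 // => i _.
  by rewrite !(min_idPr _) // subrr mul0r tcost0 addr0.
have [h|jv] := leP v (tau j); first exact: IH (ltnW jm) v v0 h vT.
have tj : 0 <= tau j by rewrite -t0; apply: (step_inc ti) => //; exact: ltnW.
have tjT : tau j < T by exact: lt_le_trans jv vT.
pose ix N : nat := Num.trunc (tau j / (T / N.+1%:R)).
have h0 N : 0 < T / N.+1%:R by rewrite divr_gt0.
have ixP N : grid N (ix N) <= tau j < grid N (ix N).+1.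
  have := truncn_itv (divr_ge0 tj (ltW (h0 N))).
  by rewrite ler_pdivlMr // ltr_pdivrMr.
have ixN N : (ix N < N.+1)%N.
  have /andP[+ _] := ixP N; rewrite -(ltr_nat R) => h.
  have : (ix N)%:R * (T / N.+1%:R) < N.+1%:R * (T / N.+1%:R).
    by rewrite [ltRHS]mulrC divfK // ?pnatr_eq0 //; exact: le_lt_trans h tjT.
  by rewrite ltr_pM2r.
rewrite (CS j v) //; set bj := c j - f (tau j).
have fv w : tau j < w -> w <= v -> f w = c j by move=> w1 w2; apply: tB => //; exact: le_trans vj.
pose E N : R := bj * S (grid N (ix N)) + tc bj (S (grid N (ix N))).
have gx : (fun N => grid N (ix N)) @ \oo --> tau j.
  apply/cvgrPdist_lt => e e0; have [N0 hN] := inv_lt (divr_gt0 e0 T0).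
  exists N0 => // N /= /hN hN'; have /andP[h1 h2] := ixP N.
  rewrite ger0_norm ?subr_ge0 //; move: h2; rewrite /grid -natr1 mulrDl mul1r -/(grid _ _).
  have h3 : T / N.+1%:R < e by rewrite mulrC -ltr_pdivlMr.
  by move=> h4; rewrite ltrBlDl; apply: lt_trans h4 _; rewrite ltrD2l.
have near : \forall N \near \oo, f (grid N (ix N)) = f (tau j).
  move: tj; rewrite le_eqVlt => /orP[/eqP e|tj'].
    apply: nearW => N; congr f; apply: le_anti; rewrite -{2}e g0 andbT.
    by case/andP: (ixP N).
  have [i ei] : exists i, j = i.+1 by case: (j) tj' => [|i _]; [rewrite t0 ltxx|exists i].
  have im : (i < m)%N by apply: ltn_trans jm; rewrite ei.
  have ii : tau i < tau j by rewrite ei; exact: ti.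
  have ij : tau j <= tau i.+1 by rewrite ei.
  have /cvgrPdist_lt /(_ (tau j - tau i)) := gx.
  rewrite subr_gt0 => /(_ ii) [N0 _ hN]; exists N0 => // N /= /hN; have /andP[h1 _] := ixP N.
  rewrite ger0_norm ?subr_ge0 // ltrD2l ltrN2 => h2.
  by rewrite (tB i (tau j)) // (tB i) //; exact: le_trans h1 ij.
have step : \forall N \near \oo, grid_cash N (tau j) - E N = grid_cash N v.
  apply: filterS near => N nf; rewrite /grid_cash.
  pose F w (i : 'I_N.+1) := (f (Num.min (grid N i.+1) w) - f (Num.min (grid N i) w)) * S (Num.min (grid N i) w) +
     tc (f (Num.min (grid N i.+1) w) - f (Num.min (grid N i) w)) (S (Num.min (grid N i) w)).
  have /andP[i1 i2] := ixP N.
  have e1 : F v (Ordinal (ixN N)) = E N.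
    rewrite /F /= (min_idPl (le_trans i1 (ltW jv))) nf.
    by rewrite (fv (Num.min _ v)); [|by rewrite lt_min i2|by rewrite min_leR].
  have e2 : F (tau j) (Ordinal (ixN N)) = 0.
    by rewrite /F /= (min_idPr (ltW i2)) (min_idPl i1) nf subrr mul0r tcost0 addr0.
  have := @sum_diff1 N.+1 (F v) (F (tau j)) (Ordinal (ixN N)).
  rewrite e1 e2 subr0 -/(E N) => <-; first by rewrite /F; ring.
  move=> i; rewrite -val_eqE /= neq_ltn => /orP[ik|ki].
    have h1 : grid N i.+1 <= tau j := le_trans (gm N _ _ ik) i1.
    have h2 : grid N i <= tau j := le_trans (gm N _ _ (ltnW ik)) i1.
    by rewrite /F !(min_idPl _) // ?(le_trans _ (ltW jv)).
  have h1 : tau j < grid N i := lt_le_trans i2 (gm N _ _ ki).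
  have h2 : tau j < grid N i.+1 := lt_le_trans h1 (gm N _ _ (leqnSn i)).
  rewrite /F (min_idPr (ltW h1)) (min_idPr (ltW h2)).
  have e3 : f (Num.min (grid N i.+1) v) = c j by apply: fv; rewrite ?lt_min ?h2 // min_leR.
  have e4 : f (Num.min (grid N i) v) = c j by apply: fv; rewrite ?lt_min ?h1 // min_leR.
  by rewrite e3 e4 !subrr !mul0r !tcost0.
have cE : E @ \oo --> bj * S (tau j) + tc bj (S (tau j)).
  have cS : (fun N => S (grid N (ix N))) @ \oo --> S (tau j).
    have hv N : 0 <= grid N (ix N) <= T.
      by have /andP[h1 _] := ixP N; rewrite g0 (le_trans h1 (ltW tjT)).
    have ht : 0 <= tau j <= T by rewrite tj ltW.
    exact: (Sc hv ht gx).
  apply: cvgD; first exact: cvgMr.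
  rewrite /tcost; case: eqP => _; first exact: cvg_cst.
  by apply: cvg_maxr; exact: cvgMr.
apply: (cvg_trans (near_eq_cvg step)).
rewrite -addrA -opprD; apply: cvgB => //; apply: (IH (ltnW jm)) => //.
exact: ltW.
Qed.

End StepPaths.

(** * Transfer of the optimum to trading strategies *)

Section Conversion.
Variables (M : market R Omega) (W : R -> Omega -> R).
Variables (kappa theta : R) (F G : (R -> R) -> (R -> R)) (s z y : R).
Local Notation P := (mP M).
Local Notation T := (mT M).
Local Notation dl := (mdl M).
Local Notation mu := (mmu M).
Local Notation FW := (FW P W).
Local Notation cl := (cl T).
Local Notation Fc := (Fc P W T).
Local Notation path := (path W kappa theta s).
Local Notation stopt := (stopt T (mFi M)).
Local Notation isH := (isH M).
Local Notation rho := (rho M).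
Local Notation cost := (cost M).
Local Notation V := (V W T kappa theta dl mu s z y).
Local Notation k0 := (z + tcost dl mu y s - y * s).
Hypotheses (HC : measure_is_complete P) (BM : standard_BM P W) (s0 : 0 < s) (z0 : 0 <= z).
Hypothesis eF : mFi M = Fc.
Hypothesis eS : forall t w, mS M t w = path w (cl t).
Hypothesis eX : forall t w, mX M t w = G (path w) (cl t).
Hypothesis eY : forall t w, mY M t w = F (path w) (cl t).
Implicit Types (A N : set Omega) (t u v : R) (w : Omega) (gam : R -> Omega -> R) (tau sig : Omega -> R).

Let T0 := mT0 M.

Lemma stopping_stopt tau : stopping_time P W T tau <-> stopt tau.
Proof.
rewrite eF; split=> -[h0 h]; split=> // t; last by move=> t0 tT; have := h t; rewrite /Fc cl_id.
have [t0|t0] := ltP t 0.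
  have -> : [set w | tau w <= t] = set0.
    by apply/seteqP; split=> w //= tw; have /andP[w0 _] := h0 w; move: (le_lt_trans tw t0); rewrite ltNge w0.
  by case: (Fc_sigma P W T t).
have [tT|Tt] := leP t T; first by rewrite /Fc cl_id //; exact: h.
have -> : [set w | tau w <= t] = setT.
  by apply/seteqP; split=> // w _ /=; have /andP[_ wT] := h0 w; exact: le_trans wT (ltW Tt).
exact: (sigma_setT (Fc_sigma P W T t)).
Qed.

Lemma path0 w : path w 0 = s.
Proof. by rewrite /path /stock (W0 BM) !mulr0 addr0 expR0 mulr1. Qed.

Lemma V_cash gam t w : V gam t w =
  liq dl mu (cash T dl mu (path w) (gam ^~ w) s z y t) (gam t w) (path w t).
Proof. by rewrite /liq /cash /V; ring. Qed.

(** The problem prescribes the initial liquidation value [z], not the cash: [k0] adds the closing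
    cost of the initial position and subtracts the price of its shares. *)
Lemma init_liq : liq dl mu k0 y s = z.
Proof. by rewrite /liq; ring. Qed.

Lemma mG_sum n (H : set (set Omega)) (f : 'I_n -> Omega -> R) : (forall i, mG H (f i)) ->
  mG H (fun w => \sum_(i < n) f i w).
Proof.
move=> mf; elim: n f mf => [f _|n IH f mf].
  by rewrite (_ : (fun w => _) = fun=> 0); [exact: mG_cst|apply/funext => w; rewrite big_ord0].
rewrite (_ : (fun w => _) = fun w => \sum_(i < n) f (widen_ord (leqnSn n) i) w + f ord_max w); last first.
  by apply/funext => w; rewrite big_ord_recr.
by apply: mGD => //; exact: IH.
Qed.

Lemma null_FW N t : measurable N -> P N = 0%E -> FW t N.
Proof.
move=> mN PN; exists set0, N; split=> //; last by rewrite setD0 set0D setU0.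
by case: (sW_sigma W t).
Qed.

Lemma measurable_off_null N (f g : Omega -> R) : measurable N -> P N = 0%E -> mfun g ->
  (forall w, ~ N w -> f w = g w) -> mfun f.
Proof.
move=> mN PN mg e _ B mB; rewrite setTI.
have -> : f @^-1` B = (g @^-1` B `\` N) `|` (f @^-1` B `&` N).
  apply/seteqP; split=> w /=.
    by have [h|h] := pselect (N w); [right|left; rewrite -e].
  by case=> [[h nN]|[]//]; rewrite e.
apply: measurableU; first by apply: measurableD => //; rewrite -[X in measurable X]setTI; exact: mg.
by apply: (null_meas HC mN PN) => w [].
Qed.

Section CashHedge.
Variables (gam : R -> Omega -> R) (sig : Omega -> R) (N : set Omega).
Hypotheses (ad : adapted P W T gam) (g0 : forall w, gam 0 w = y) (ss : stopping_time P W T sig).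
Hypotheses (mN : measurable N) (PN : P N = 0%E).
Hypothesis gsp : forall w, ~ N w -> step_path T (gam ^~ w).
Hypothesis gadm : forall w, ~ N w -> forall t, 0 <= t -> t <= T -> 0 <= V gam t w.

Let C w u := cash T dl mu (path w) (gam ^~ w) s z y u.

Lemma mG_gam t : 0 <= t -> t <= T -> mG (FW t) (gam t).
Proof. by move=> t0 tT; apply/(mGP _ (FW_sigma P W t)); exact: ad. Qed.

Lemma mG_cash (c : Omega -> R) t : 0 <= t -> t <= T -> mG (FW t) c ->
  mG (FW t) (fun w => if w \in N then c w else C w t).
Proof.
move=> t0 tT mc; have sF := FW_sigma P W t; have FN := null_FW t mN PN.
have gT n i : 0 <= i%:R * (T / n.+1%:R) by rewrite mulr_ge0 // divr_ge0 // ltW.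
apply: (mG_lim (F := fun n w => if w \in N then c w else
    grid_cash T dl mu (path w) (gam ^~ w) s z y n t)) => [n|w].
  apply: mG_if => //; apply: mGB; first exact: mG_cst.
  apply: mG_sum => i.
  have mg j : mG (FW t) (gam (Num.min (j%:R * (T / n.+1%:R)) t)).
    have h : Num.min (j%:R * (T / n.+1%:R)) t <= t by rewrite min_leR.
    apply: (mG_sub (FW_sigma P W _) sF (FW_mono h)); apply: mG_gam; last exact: le_trans h tT.
    by rewrite le_min gT.
  have mp j : mG (FW t) (fun w => path w (Num.min (j%:R * (T / n.+1%:R)) t)).
    by apply: (mG_path P W kappa theta s); rewrite ?le_min ?gT // min_leR.
  apply: mGD; first by apply: mGM => //; exact: mGB.
  by apply: mG_tcost => //; exact: mGB.
case: ifPn => [_|]; first exact: cvg_cst.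
rewrite notin_setE => nN.
apply: (@grid_cash_cvg T dl mu T0 (path w) (gam ^~ w) s z y (path0 w) (g0 w) (gsp nN)) => //.
move=> v u hv /andP[u0 uT] vu.
rewrite (_ : (fun n => _) = fun n => path w (cl (v n))); last first.
  by apply/funext => n; have /andP[v0 vT] := hv n; rewrite cl_id.
rewrite -[X in path w X](cl_id u0 uT).
exact: (cvg_comp _ _ vu (@path_cont P W BM T kappa theta s T0 w u)).
Qed.

(** On the null set [N], where the strategy may be insolvent or have no step path, it is replaced by
    [liqd], so that all conditions of [isH] hold on every path. By completeness this does not
    disturb adaptedness. *)
Definition cash_hedge : hedge R Omega :=
  let l := liqd M (fun=> 0) (fun=> k0) (fun=> y) sig in
  Hedge (fun u w => if w \in N then hK l u w else C w (cl u))
        (fun u w => if w \in N then hB l u w else gam (cl u) w) sig.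

Lemma cash_hedge_isH : isH (fun=> 0) (fun=> k0) (fun=> y) cash_hedge.
Proof.
have st0 : stopt (fun=> 0) by apply: (stopt_cst (mFs M)); rewrite lexx ltW.
have sg : stopt sig by exact/stopping_stopt.
have sg0 w := stopt_ge0 w sg.
have hl : isH (fun=> 0) (fun=> k0) (fun=> y) (liqd M (fun=> 0) (fun=> k0) (fun=> y) sig).
  apply: (isH_liqd st0 (mG_cst _ _) (mG_cst _ _) _ sg sg0).
  by move=> w; rewrite eS cl_id ?(ltW T0) // path0 init_liq.
have cT u : cl u <= T by exact/cl_leT/ltW.
have cge u : 0 <= cl u by exact: cl_ge0.
have eC w u : 0 < u -> u <= T -> cl u = u by move=> u0 uT; rewrite cl_id // ltW.
have C0 w : ~ N w -> C w 0 = k0.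
  by move=> nN; rewrite /C; have [n [tau [c [_ -> _]]]] := cash_steps dl mu z (path0 w) (g0 w) (gsp nN).
split=> //; try exact: mG_cst.
- move=> u; rewrite eF /=; case: (ltP 0 u) => [u0|_]; last exact: mG_cst.
  apply: mG_cash => //; have := isH_Kad hl u; rewrite eF /= u0; exact.
- move=> u; rewrite eF /=; case: (ltP 0 u) => [u0|_]; last exact: mG_cst.
  apply: mG_if; [exact: FW_sigma|exact: null_FW| |exact: mG_gam].
  by have := isH_Bad hl u; rewrite eF /= u0.
- move=> w u u0 /=; case: ifPn => [_|].
    exact: (isH_pre hl (w := w) u0).
  rewrite notin_setE => nN.
  by rewrite cl_le0 // C0 // g0.
- move=> w; have [nN|nN] := pselect (N w).
    have [n leg] := isH_leg hl w; exists n; apply: legal_ext leg _ => u u0 uT.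
    by rewrite /= mem_set.
  have [n leg] := cash_legal dl mu z (path0 w) (g0 w) (gsp nN).
  exists n; apply: (@legal_ext _ _ _ _ _ _ _ _ _ (C w) (gam ^~ w)).
    by apply: legal_price leg _ => u u0 uT; rewrite eS cl_id // ltW.
  by move=> u u0 uT; rewrite /= memNset // cl_id // ltW.
- move=> w u /= u0 uT; have [nN|nN] := pselect (N w).
    by have := isH_adm hl u0 uT (w := w); rewrite /Vh /= mem_set.
  by rewrite /Vh /= memNset // cl_id // eS cl_id // -V_cash; exact: gadm.
Qed.

Lemma cash_hedge_cost tau w : stopt tau -> ~ N w -> cost cash_hedge tau w =
  Num.max ((if sig w < tau w then Xpay W kappa theta G s (sig w) w else Ypay W kappa theta F s (tau w) w)
                       - V gam (Num.min (sig w) (tau w)) w) 0.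
Proof.
move=> st nN; have sg : stopt sig by exact/stopping_stopt.
have /andP[t0 tT] := st.1 w; have /andP[a0 aT] := sg.1 w.
have eV u : 0 <= u -> u <= T -> Vh M cash_hedge u w = V gam u w.
  by move=> u0 uT; rewrite /Vh /= memNset // cl_id // eS cl_id // -V_cash.
rewrite /cost /=; case: ltP => h; rewrite eV // ?eX ?eY cl_id //.
Qed.

Lemma cash_hedge_given tau : stopping_time P W T tau ->
  shortfall_given P W T kappa theta dl mu F G s z y (gam, sig) tau = (J M setT cash_hedge tau)%:E.
Proof.
move=> /stopping_stopt st.
have I := Ib_cost cash_hedge_isH st (fun w => stopt_ge0 w st).
have -> : J M setT cash_hedge tau = Ex P (cost cash_hedge tau).
  by apply: eq_Ex => w; rewrite indicT mul1r.
rewrite /Ex /Rintegral fineK; last exact: (integrable_fin_num measurableT I).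
apply: ae_eq_integral => //.
- apply/measurable_EFinP; apply: (measurable_off_null mN PN (Ib_measurable I)) => w nN.
  by rewrite cash_hedge_cost.
- exact: measurable_int I.
exists N; split=> // w /= h; apply: contrapT => nN; apply: h => _ /=.
by rewrite cash_hedge_cost.
Qed.

Lemma cash_hedge_risk :
  shortfall_risk P W T kappa theta dl mu F G s z y (gam, sig) = (rho (fun=> 0) setT cash_hedge)%:E.
Proof.
have hh := cash_hedge_isH.
apply: le_anti; apply/andP; split.
  apply: ge_ereal_sup => _ [tau stau <-]; rewrite cash_hedge_given // lee_fin.
  have st := iffLR (stopping_stopt tau) stau.
  exact: (J_rho measurableT hh st (fun w => stopt_ge0 w st)).
apply/lee_addgt0Pr => e e0.
have [tau [st _ h]] := rho_near measurableT hh e0.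
have stau := iffRL (stopping_stopt tau) st.
apply: (@le_trans _ _ ((J M setT cash_hedge tau)%:E + e%:E)%E).
  by rewrite -EFinD lee_fin -lerBlDr ltW.
rewrite leeD2r // -cash_hedge_given //; apply: ereal_sup_ubound.
by exists tau.
Qed.

End CashHedge.

Local Notation isH0 := (isH (fun=> 0) (fun=> k0) (fun=> y)).
Local Notation rho0 := (rho (fun=> 0) setT).
Local Notation hedges := (hedges P W T kappa theta dl mu s z y).
Local Notation risk := (shortfall_risk P W T kappa theta dl mu F G s z y).

Lemma hedge_to_isH h : hedges h -> exists2 g, isH0 g & risk h = (rho0 g)%:E.
Proof.
case: h => gam sig [[/= ad g0 sp] adm ss].
have [N [mN PN sub]] := filterI sp adm.
have nN w : ~ N w -> step_path T (gam ^~ w) /\ forall t, 0 <= t -> t <= T -> 0 <= V gam t w.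
  by move=> h; apply: contrapT => h'; apply: h; exact: sub.
exists (cash_hedge gam sig N).
  exact: (cash_hedge_isH ad g0 ss mN PN (fun w h => (nN w h).1) (fun w h => (nN w h).2)).
exact: (cash_hedge_risk ad g0 ss mN PN (fun w h => (nN w h).1) (fun w h => (nN w h).2)).
Qed.

(** Only an inequality: [V] neither charges actions that move no shares nor loses discarded cash, so
    the strategy may be worth more than the hedge it comes from. *)
Lemma isH_to_hedge h : isH0 h -> exists2 g, hedges g & (risk g <= (rho0 h)%:E)%E.
Proof.
move=> hh.
have g0 w : hB h 0 w = y by have [_] := isH_pre hh (w := w) (lexx 0).
have ad : adapted P W T (hB h).
  move=> t t0 tT; apply/(mGP _ (FW_sigma P W t)); move: t0; rewrite le_eqVlt => /orP[/eqP <-|t0].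
    by rewrite (_ : hB h 0 = fun=> y); [exact: mG_cst|apply/funext => w].
  by have := isH_Bad hh t; rewrite eF /Fc cl_id ?(ltW t0) //= t0.
have leg w : exists n, legal T dl mu (path w) n 0 k0 y (hK h ^~ w) (hB h ^~ w).
  have [n l] := isH_leg hh w; exists n; apply: legal_price l _ => u u0 uT.
  by rewrite eS cl_id // ltW.
have sp w : step_path T (hB h ^~ w).
  have [n l] := leg w; have [m [tau [c st]]] := legal_steps l (ltW T0).
  by exists (m, tau, c).
have path_ge0 w u : 0 <= path w u by apply/ltW/path_gt0.
have ss : stopping_time P W T (hs h) by apply/stopping_stopt => //; exact: isH_s hh.
have VV u w : 0 <= u -> u <= T -> Vh M h u w <= V (hB h) u w.
  move=> u0 uT; rewrite V_cash /Vh eS cl_id //.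
  rewrite /liq !lerD2r; move: u0; rewrite le_eqVlt => /orP[/eqP <-|u0].
    have [-> _] := isH_pre hh (w := w) (lexx 0).
    by have [n [tau [c [_ -> _]]]] := cash_steps dl mu z (path0 w) (g0 w) (sp w).
  have [n l] := leg w.
  exact: (cash_le (mdl0 M) (mmu0 M) (path_ge0 w) (path0 w) (g0 w) (sp w) l u0 uT).
have adm w t : 0 <= t -> t <= T -> 0 <= V (hB h) t w.
  by move=> t0 tT; apply: le_trans (VV t w t0 tT); exact: isH_adm hh _ _ _ _.
exists (hB h, hs h).
  by split=> //=; [split=> //; exact: aeW|apply: aeW => w t; exact: adm].
have E := cash_hedge_risk ad g0 ss measurable0 (measure0 P) (fun w _ => sp w) (fun w _ => adm w).
have hc := cash_hedge_isH ad g0 ss measurable0 (measure0 P) (fun w _ => sp w) (fun w _ => adm w).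
rewrite E lee_fin; apply: (rho_le measurableT hc) => tau st tt.
apply: le_trans (J_rho measurableT hh st tt).
apply: Ex_le; [exact: (Ib_Jc measurableT hc st tt)|exact: (Ib_Jc measurableT hh st tt)|] => w.
rewrite indicT !mul1r cash_hedge_cost //.
have /andP[t0 tT] := st.1 w; have /andP[a0 aT] := (isH_s hh).1 w.
rewrite /cost; case: ltP => h1; rewrite ?eX ?eY cl_id // ge_max !le_max lexx orbT andbT;
  apply/orP; left; rewrite lerD2l lerN2; exact: VV.
Qed.

Lemma optimal_trading : exists2 h, hedges h & risk h = min_risk P W T kappa theta dl mu F G s z y.
Proof.
have st : stopt (fun=> 0) by apply: (stopt_cst (mFs M)); rewrite lexx ltW.
have l0 w : 0 <= liq dl mu k0 y (mS M 0 w).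
  by rewrite eS cl_id ?(ltW T0) // path0 init_liq.
have [h hh ho] := optimal_hedge st (mG_cst _ k0) (mG_cst _ y) l0.
have [g hg gh] := isH_to_hedge hh; exists g => //.
apply: le_anti; apply/andP; split; last by apply: ereal_inf_lbound; exists g.
apply: le_ereal_inf_tmp => _ [g' /hedge_to_isH[h' hh' ->] <-].
by apply: (le_trans gh); rewrite lee_fin; exact: ho.
Qed.

End Conversion.

End BlackScholesMarket.

Theorem theorem2p1 (R : realType) (d : measure_display) (Omega : measurableType d)
    (P : probability Omega R) (W : R -> Omega -> R)
    (T kappa theta delta mu : R) (F G : (R -> R) -> (R -> R)) (s z y : R) :
  measure_is_complete P ->
  standard_BM P W ->
  0 < T -> 0 < kappa -> 0 < delta -> 0 < mu -> mu < 1 ->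
  game_payoffs T F G ->
  0 < s -> 0 <= z ->
  exists2 h, hedges P W T kappa theta delta mu s z y h &
    shortfall_risk P W T kappa theta delta mu F G s z y h =
    min_risk P W T kappa theta delta mu F G s z y.
Proof.
move=> HC BM T0 ka0 dl0 mu0 mu1 FG s0 z0.
have [M [[eP eT eF ed em] [eS eX eY]]] := bs_market HC BM theta T0 ka0 dl0 mu0 mu1 FG s0.
by subst P T delta mu; exact: optimal_trading.
Qed.
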